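(* Let $d\geq 2$ and let $K_1$ and $K_2$ be two strictly convex and compact subsets of $\mathbb{R}^d$ with smooth boundary. Suppose that $\mathfrak{p}(\partial K_1)$ is oriented by the outgoing normal vector to $K_1$ and that $\mathfrak{p}(\partial K_2)$ is oriented by the ingoing normal vector to $K_2$. Let $$\zeta_{\operatorname{Conv}}(K_1,K_2,s)=\sum_{\gamma\in\mathcal{P}_{K_1,K_2}}\frac{1}{\ell(\gamma)^s},\qquad \operatorname{Re}(s)>d.$$ Then the function $$s\mapsto \zeta_{\operatorname{Conv}}(K_1,K_2,s)-\frac{1}{(2\pi)^d}\sum_{\ell=1}^d\frac{\pi^{\frac{\ell}{2}}\,\ell}{\Gamma\left(\frac{\ell}{2}+1\right)}\,\frac{V_{d-\ell}\left(K_1-K_2\right)}{s-\ell}$$ extends holomorphically from $\{\operatorname{Re}(s)>d\}$ to $\mathbb{C}$, where $V_j(K_1-K_2)$ denotes the $j$-th intrinsic volume of the convex set $K_1-K_2=\{x-y: x\in K_1,\ y\in K_2\}$.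
   Context: Strictly convex compact set with smooth boundary: a subset $K\subset\mathbb{R}^d$ which is either a single point or a compact convex set with nonempty interior whose boundary $\partial K$ is smooth and has all its sectional curvatures positive (equivalently, the second fundamental form of $\partial K$ with respect to the inward normal is positive definite; for $d=2$ this means that the boundary curve has positive curvature). Torus: $\mathbb{T}^d=\mathbb{R}^d/2\pi\mathbb{Z}^d$ carries the flat metric, $\mathfrak{p}:\mathbb{R}^d\to\mathbb{T}^d$ is the canonical projection, and $S\mathbb{T}^d=\mathbb{T}^d\times\mathbb{S}^{d-1}$. Normal bundles: $N(K_1)\subset S\mathbb{T}^d$ is the set of all $(\mathfrak{p}(x),\theta)$ with $x\in\partial K_1$ and $\theta$ the outgoing unit normal to $K_1$ at $x$; $N(K_2)\subset S\mathbb{T}^d$ is the set of all $(\mathfrak{p}(x),\theta)$ with $x\in\partial K_2$ and $\theta$ the ingoing unit normal to $K_2$ at $x$. If $K_i=\{x_i\}$ is a point, then $N(K_i)=\{\mathfrak{p}(x_i)\}\times\mathbb{S}^{d-1}$. Orthogeodesics: $\mathcal{P}_{K_1,K_2}$ is the set of unit speed geodesic curves $\gamma:[0,\ell]\to\mathbb{T}^d$, with $\ell=\ell(\gamma)>0$ the length of $\gamma$, that are directly orthogonal to $K_1$ and $K_2$, i.e. $(\gamma(0),\gamma'(0))\in N(K_1)$ and $(\gamma(\ell),\gamma'(\ell))\in N(K_2)$. Unit speed geodesics are the curves $t\mapsto x+t\theta$ with $(x,\theta)\in S\mathbb{T}^d$. The series defining $\zeta_{\operatorname{Conv}}$ is absolutely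 convergent and holomorphic in $\{\operatorname{Re}(s)>d\}$. Intrinsic volumes: for a compact convex subset $K\subset\mathbb{R}^d$, with $B_d$ the closed unit ball of $\mathbb{R}^d$, the function $t\mapsto\operatorname{Vol}_{\mathbb{R}^d}(K+tB_d)$ is a polynomial of degree $d$ with nonnegative coefficients (Steiner's formula), and the intrinsic volumes $V_0(K),\ldots,V_d(K)\geq 0$ are defined by $$\operatorname{Vol}_{\mathbb{R}^d}(K+tB_d)=\sum_{\ell=0}^d V_{d-\ell}(K)\frac{\pi^{\frac{\ell}{2}}}{\Gamma\left(\frac{\ell}{2}+1\right)}\,t^\ell\qquad\text{for all } t>0.$$ *)

(* Defs.v *)
From mathcomp Require Import all_boot all_order all_algebra.
From mathcomp Require Import generic_quotient complex.
From mathcomp Require Import all_classical all_reals all_analysis.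
From mathcomp Require summability.
From HB Require Import structures.

Set Implicit Arguments.
Unset Strict Implicit.
Unset Printing Implicit Defensive.

Import Order.TTheory GRing.Theory Num.Theory.
Import numFieldNormedType.Exports.

Local Open Scope classical_set_scope.
Local Open Scope ring_scope.

Section Euclidean.
Variables (R : realType) (d : nat).
Implicit Types (u v x : 'rV[R]_d) (K L : set 'rV[R]_d).

(* The library norm on 'rV[R]_d is the sup norm: it gives the usual topology,
   but the unit sphere, the unit ball and unit vectors need the following. *)
Definition dotp u v : R := \sum_(i < d) u 0 i * v 0 i.

Definition enorm u : R := Num.sqrt (dotp u u).

Definition unit_ball : set 'rV[R]_d := [set u | enorm u <= 1].

Definition boundary K : set 'rV[R]_d := closure K `\` interior K.

(* K + t L *)
Definition minkowski (t : R) K L : set 'rV[R]_d :=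
  [set z | exists x y, [/\ K x, L y & z = x + t *: y]].

Definition minkowski_diff K L : set 'rV[R]_d :=
  [set z | exists x y, [/\ K x, L y & z = x - y]].

End Euclidean.

Arguments unit_ball {R d}.

Section Smoothness.
Variables (R : realType) (V W : normedModType R).

(* On an open set U, f is of class C^k iff all its iterated directional
   derivatives of order at most k exist and are continuous on U. *)
Fixpoint Ck (k : nat) (U : set V) (f : V -> W) : Prop :=
  (forall x, U x -> {for x, continuous f}) /\
  match k with
  | 0%N => True
  | j.+1 => forall v : V,
      (forall x, U x -> derivable f x v) /\ Ck j U ('D_v f)
  end.

Definition smooth_on (U : set V) (f : V -> W) : Prop := forall k, Ck k U f.

End Smoothness.

Section ConvexBodies.
Variables (R : realType) (d : nat).
Implicit Types (K U : set 'rV[R]_d) (f : 'rV[R]_d -> R) (x v w : 'rV[R]_d).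

Definition gradient f x : 'rV[R]_d := \row_i 'D_(delta_mx 0 i) f x.

(* Near its boundary point x, K is the sublevel set {f <= 0} of a smooth
   function without critical points, so that the boundary of K is the regular
   level set {f = 0}. *)
Definition local_defining K x U f : Prop :=
  [/\ open U, U x, smooth_on U f,
      (forall y, U y -> gradient f y != 0) &
      (forall y, U y -> (K y <-> f y <= 0))].

Definition smooth_boundary K : Prop :=
  forall x, boundary K x -> exists U f, local_defining K x U f.

(* At a boundary point this is the outgoing unit normal, since f <= 0 on K. *)
Definition outer_normal f x : 'rV[R]_d :=
  (enorm (gradient f x))^-1 *: gradient f x.

(* Second fundamental form of {f = 0} with respect to the inward unit normal
   field n := - outer_normal f, i.e. II(v, w) = - <D_v n, w>. *)
Definition second_fundamental_form f x v w : R :=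
  - dotp ('D_v (fun y => - outer_normal f y) x) w.

Definition positively_curved K : Prop :=
  forall x U f, boundary K x -> local_defining K x U f ->
  forall v, dotp (gradient f x) v = 0 -> v != 0 ->
    0 < second_fundamental_form f x v v.

Definition strictly_convex_smooth K : Prop :=
  (exists x, K = [set x]) \/
  [/\ compact K, convex_set (K : set (convex_lmodType 'rV[R]_d)),
      interior K !=set0, smooth_boundary K & positively_curved K].

(* For K a point every unit vector is an outgoing (and an ingoing) normal. *)
Definition outgoing_unit_normal K x : set 'rV[R]_d :=
  [set theta | enorm theta = 1 /\
    (K = [set x] \/
     exists U f, local_defining K x U f /\ theta = outer_normal f x)].

Definition ingoing_unit_normal K x : set 'rV[R]_d :=
  [set theta | outgoing_unit_normal K x (- theta)].

End ConvexBodies.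

Section Torus.
Variables (R : realType) (d : nat).

Definition lattice_rel (x y : 'rV[R]_d) : bool :=
  `[< exists k : 'rV[int]_d, x - y = (2 * pi) *: map_mx intr k >].

Lemma lattice_rel_refl : reflexive lattice_rel.
Proof.
move=> x; apply/asboolP; exists 0; rewrite subrr; apply/rowP => i.
by rewrite !mxE mulr0z mulr0.
Qed.

Lemma lattice_rel_sym : symmetric lattice_rel.
Proof.
suff h x y : lattice_rel x y -> lattice_rel y x.
  by move=> x y; apply/idP/idP; exact: h.
move=> /asboolP[k xyk]; apply/asboolP; exists (- k).
rewrite -opprB xyk; apply/rowP => i.
by rewrite !mxE mulrNz mulrN.
Qed.

Lemma lattice_rel_trans : transitive lattice_rel.
Proof.
move=> y x z /asboolP[k xyk] /asboolP[l yzl]; apply/asboolP; exists (k + l).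
rewrite -(subrK y x) -addrA xyk yzl; apply/rowP => i.
by rewrite !mxE intrD [RHS]mulrDr.
Qed.

Definition lattice_equiv :=
  EquivRel lattice_rel lattice_rel_refl lattice_rel_sym lattice_rel_trans.

Definition torus := {eq_quot lattice_equiv}%qT.

HB.instance Definition _ := Choice.on torus.
HB.instance Definition _ := EqQuotient.on torus.

Definition torus_proj (x : 'rV[R]_d) : torus := \pi_torus%qT x.

HB.instance Definition _ := isPointed.Build torus (torus_proj 0).

(* The tangent bundle of the torus is trivial: points of the unit tangent
   bundle are pairs (x, theta) with theta a unit vector. *)
Definition normal_bundle_out (K : set 'rV[R]_d) : set (torus * 'rV[R]_d) :=
  [set z | exists x, [/\ boundary K x, z.1 = torus_proj x &
                         outgoing_unit_normal K x z.2]].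

Definition normal_bundle_in (K : set 'rV[R]_d) : set (torus * 'rV[R]_d) :=
  [set z | exists x, [/\ boundary K x, z.1 = torus_proj x &
                         ingoing_unit_normal K x z.2]].

(* A curve [0, l] -> torus is the pair of its length l and of a function on R
   taking the constant default value outside [0, l], so that equality of pairs
   is equality of curves. *)
Definition curve : Type := (R * (R -> torus))%type.

HB.instance Definition _ := Choice.on curve.

Definition geodesic (l : R) (x theta : 'rV[R]_d) : curve :=
  (l, (fun t : R => torus_proj (x + t *: theta)) \_ `[0, l]).

(* The velocity of geodesic l x theta is theta at all times. *)
Definition orthogeodesics (K1 K2 : set 'rV[R]_d) : set curve :=
  [set g | exists l x theta,
    [/\ 0 < l, enorm theta = 1, g = geodesic l x theta,
        normal_bundle_out K1 (g.2 0, theta) &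
        normal_bundle_in K2 (g.2 l, theta)]].

End Torus.

Section Zeta.
Variables (R : realType).

(* x ^ s for x > 0 *)
Definition cpower (x : R) (s : R[i]) : R[i] :=
  (expR (complex.Re s * ln x))%:C%C *
  (cos (complex.Im s * ln x) +i* sin (complex.Im s * ln x))%C.

Definition zeta_term d (s : R[i]) (g : curve R d) : R[i] := 1 / cpower g.1 s.

(* Unordered sum, i.e. limit over the net of finite sets of curves. *)
Definition zeta_Conv d (K1 K2 : set 'rV[R]_d) (s : R[i]) : R[i] :=
  summability.sum (fun g : curve R d =>
    (if g \in orthogeodesics K1 K2 then zeta_term s g else 0) : R[i]^o).

Definition zeta_Conv_abs_convergent d (K1 K2 : set 'rV[R]_d) (s : R[i]) :=
  summable (orthogeodesics K1 K2)
    (fun g : curve R d => (complex.Re `|zeta_term s g|)%:E).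

Definition entire (F : R[i] -> R[i]) : Prop :=
  forall s, derivable (F : R[i]^o -> R[i]^o) s 1.

End Zeta.

Section IntrinsicVolumes.
Variable R : realType.
Local Notation mu := (@lebesgue_measure R).

(* d-fold product of the Lebesgue measure on R; the library product measure of
   m1 and m2 maps A to the m1-integral of the m2-measures of the sections
   of A. *)
Fixpoint Vol (d : nat) : set 'rV[R]_d -> \bar R :=
  match d with
  | 0%N => fun A => (\1_A 0)%:E
  | n.+1 => fun A =>
      (\int[mu]_x @Vol n [set y | A (row_mx (x%:M : 'rV[R]_1) y)])%E
  end.

Definition Gamma (x : R) : R :=
  \int[mu]_(t in `]0, +oo[) (t `^ (x - 1) * expR (- t)).

(* pi^(l/2) / Gamma(l/2 + 1) *)
Definition ball_volume (l : nat) : R :=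
  pi `^ (l%:R / 2) / Gamma (l%:R / 2 + 1).

Definition steiner d (K : set 'rV[R]_d) (V : nat -> R) : Prop :=
  (forall t, 0 < t -> Vol (minkowski t K unit_ball) =
     (\sum_(0 <= l < d.+1) V (d - l)%N * ball_volume l * t ^+ l)%:E) /\
  (forall j, (d < j)%N -> V j = 0).

(* The sequence V_0(K), ..., V_d(K), 0, 0, ... determined by Steiner's formula;
   the default value is irrelevant for K nonempty, convex and compact. *)
Definition intrinsic_volume d (K : set 'rV[R]_d) : nat -> R :=
  xget (fun=> 0) [set V | steiner K V].

End IntrinsicVolumes.

(* Main.v *)
Require Import Defs.
From HB Require Import structures.
From mathcomp Require Import all_boot all_order all_algebra.
From mathcomp Require Import complex.
From mathcomp Require Import all_classical all_reals all_analysis.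
From mathcomp Require Import perm measurable_realfun ring lra zify.
From mathcomp Require summability.
Import Order.TTheory GRing.Theory Num.Theory.
Import numFieldNormedType.Exports.
Local Open Scope classical_set_scope.
Local Open Scope ring_scope.
Set Implicit Arguments.
Unset Strict Implicit.
Unset Printing Implicit Defensive.

(* Let K := K1 - K2, a strictly convex body. An orthogeodesic of length l and
   direction u joins the support points X1 u of K1 and X2 (- u) of K2, so that
   its end points lift to X1 u + l u = X2 (- u) + 2 pi k: this says that
   dist(2 pi k, K) = l, the nearest point of K being X1 u - X2 (- u). Hence zeta
   is the sum of dist(y, K)^-s over the lattice points y outside K.

   Let y' be the lattice corner of the cell of y, and compare the values of
   g = dist(., K)^-s, cut off near K, at the points y' + j (y - y'),
   0 <= j <= N. For j >= 1 the map y |-> y' + j (y - y') preserves the Lebesgue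
   measure, so g contributes its integral; for j = 0 one gets the lattice sum.
   The N-th difference in j is thus, up to sign, the lattice sum minus the
   integral of g. As p = y - proj y depends smoothly on y and its inverse
   p |-> p + X p is governed by the homogeneous support map X, g is a symbol of
   order -s and the N-th difference is O(|y|^(-Re s - N)). Its integral thus
   converges and is holomorphic for Re s > d - N; the functions obtained for
   different N agree, as one sees by damping g to a summable function.

   It remains to integrate g. By the divergence theorem and homogeneity, the
   image of the Lebesgue measure under ln dist has a density
   \sum_k c_k exp (k L), which is integrated at sight. The constants c_k are
   recovered from the volumes of the tubes {dist <= t}, i.e. from Steiner's
   formula. *)

(** * Smooth functions on row vectors *)

(** Complex exponents enter only through the real profiles [ec] and [es], and holomorphy is obtained
    without differentiating under an integral. The functional [lfun] is linear and bounded uniformly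
    on every family of profiles satisfying [Wf]. The second order Taylor remainder of exp (- z L) in
    z, divided by the square of the increment, is such a family at the cost of one order; hence
    [lfun] has a quadratic remainder in z. Symbols blow up at the origin, so estimates are asked
    only where dist > 1. The finitely many lattice points with 0 < dist <= 1 contribute a finite sum
    of entire functions. The constants c_k come from the Jacobian determinant of p |-> p + X p. It
    is a sum of parts of degree k - d, the part k = 0 vanishing because p lies in the kernel of the
    derivative of X; this is why there is no pole at 0. Divided by |p|^k, each part is a weight G of
    degree - d, for which G dp is invariant under dilations, so that its image under ln |p| is a
    multiple of the Lebesgue measure. The divergence theorem proves this invariance and takes the
    place of a change of variables. *)

Section Calculus.
Variables (R : realType) (m : nat).
Local Notation V := 'rV[R]_m.
Implicit Types (x v : V) (F : V -> R).

Definition ev (i : 'I_m) : V := delta_mx 0 i.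
Definition pd (i : 'I_m) F : V -> R := fun x => 'D_(ev i) F x.

Lemma row_ev v : v = \sum_i v 0 i *: ev i.
Proof. exact: row_sum_delta. Qed.

Lemma norm_coord_le v i : `|v 0 i| <= `|v|.
Proof.
by rewrite [leRHS](_ : _ = mx_norm v) // mx_normrE; apply/bigmax_geP; right => /=; exists (0, i).
Qed.

Lemma norm_le_coord v (r : R) : 0 <= r -> (forall i, `|v 0 i| <= r) -> `|v| <= r.
Proof.
move=> r0 h; rewrite [leLHS](_ : _ = mx_norm v) // mx_normrE; apply/bigmax_leP; split=> //.
by move=> [i j] _ /=; rewrite (ord1 i).
Qed.

Lemma derive_row F x v : differentiable F x ->
  'D_v F x = \sum_i v 0 i * pd i F x.
Proof.
move=> dF; rewrite deriveE // {1}(row_ev v) linear_sum; apply: eq_bigr => i _.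
by rewrite linearZ /= /pd deriveE.
Qed.

Lemma is_derive_line F (z v : V) (t : R) : derivable F (z + t *: v) v ->
  is_derive t (1 : R) (fun t => F (z + t *: v)) ('D_v F (z + t *: v)).
Proof.
move=> dF.
have E : (fun h : R => h^-1 *: (((fun s => F (z + s *: v)) \o shift t) (h *: (1:R)) - F (z + t *: v)))
   = (fun h => h^-1 *: ((F \o shift (z + t *: v)) (h *: v) - F (z + t *: v))).
  apply/funext => h /=; congr (_ *: (F _ - _)).
  by rewrite [h *: (1:R)]mulr1 scalerDl addrCA.
by apply: DeriveDef; rewrite /derivable /derive E.
Qed.

Lemma MVT_line F (z v : V) (a b : R) : a <= b ->
  (forall t, a <= t <= b -> derivable F (z + t *: v) v) ->
  exists2 t, a <= t <= b &
    F (z + b *: v) - F (z + a *: v) = 'D_v F (z + t *: v) * (b - a).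
Proof.
move=> ab dF.
have [|//|t tI ->] := @MVT_segment R (fun t => F (z + t *: v)) (fun t => 'D_v F (z + t *: v)) a b ab.
- move=> t; rewrite in_itv /= => /andP[at_ tb].
  by apply: is_derive_line; apply: dF; rewrite !ltW.
- apply: derivable_within_continuous => t; rewrite in_itv /= => tI.
  by case: (is_derive_line (dF t tI)).
by exists t => //; move: tI; rewrite in_itv.
Qed.

Lemma MVT_line0 F (z v : V) (b : R) :
  (forall t, `|t| <= `|b| -> derivable F (z + t *: v) v) ->
  exists2 t, `|t| <= `|b| & F (z + b *: v) - F z = 'D_v F (z + t *: v) * b.
Proof.
move=> dF; have [b0|b0] := leP 0 b.
  have [|t /andP[t0 tb]] := @MVT_line F z v 0 b b0.
    by move=> t /andP[t0 tb]; apply: dF; rewrite !ger0_norm.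
  by rewrite scale0r addr0 subr0 => ->; exists t => //; rewrite !ger0_norm.
have [|t /andP[t0 tb]] := @MVT_line F z v b 0 (ltW b0).
  by move=> t /andP[t0 tb]; apply: dF; rewrite !ler0_norm ?lerN2 // ltW.
rewrite scale0r addr0 sub0r => E; exists t; last by rewrite -opprB E mulrN opprK.
by rewrite !ler0_norm ?lerN2 // ltW.
Qed.

Lemma differentiable_epsP (W : normedModType R) (f : V -> W) x (L : {linear V -> W}) :
  continuous L ->
  (forall e, 0 < e -> \forall v \near (0 : V), `|f (v + x) - (f x + L v)| <= e * `|v|) ->
  differentiable f x /\ 'd f x = L :> (V -> W).
Proof.
move=> cL h.
have dL : 'd f x = L :> (V -> W).
  by apply: diff_unique => //; apply/eqaddoP => e e0; exact: (h e e0).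
split=> //; apply/diff_locallyP; rewrite dL; split=> //.
by apply/eqaddoP => e e0; exact: (h e e0).
Qed.

Lemma differentiable_eps (W : normedModType R) (f : V -> W) x : differentiable f x ->
  forall e, 0 < e -> \forall v \near (0 : V), `|f (v + x) - (f x + 'd f x v)| <= e * `|v|.
Proof.
move=> /diff_locally E e e0.
by move: E => /eqaddoP /(_ e e0).
Qed.

End Calculus.

Arguments ev {R m}.

Section ContinuityTools.
Variables (R : realType).

Lemma continuous_bigsum (T : topologicalType) (I : Type) (r : seq I)
    (f : I -> T -> R) (x : T) :
  (forall i, {for x, continuous (f i)}) ->
  {for x, continuous (fun y => \sum_(i <- r) f i y)}.
Proof.
move=> h; elim: r => [|i r IH].
  rewrite (_ : (fun y => _) = cst 0); first exact: cst_continuous.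
  by apply/funext => y; rewrite big_nil.
rewrite (_ : (fun y => _) = (fun y => f i y + \sum_(j <- r) f j y)).
  by apply: continuousD => //; exact: h.
by apply/funext => y; rewrite big_cons.
Qed.

End ContinuityTools.

Section LinForm.
Variables (R : realType) (m : nat).
Local Notation V := 'rV[R]_m.

Definition lform (g : V) (v : V) : R := dotp v g.

Lemma lform_is_linear g : linear (lform g).
Proof.
move=> a u v; rewrite /lform /dotp scaler_sumr -big_split /=.
by apply: eq_bigr => i _; rewrite !mxE mulrDl [_ *: _]mulrA.
Qed.

HB.instance Definition _ g := GRing.isLinear.Build R V R _ (lform g) (lform_is_linear g).

Lemma lform_continuous g : continuous (lform g).
Proof.
move=> x; apply: continuous_bigsum => i; apply: continuousM.
  exact: coord_continuous.
exact: cst_continuous.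
Qed.

(** The increment is split into steps along the coordinate axes and the mean value theorem is
    applied to each; continuity of the partial derivatives replaces the intermediate points by x. *)
Lemma C1_differentiable (F : V -> R) (U : set V) (x : V) : open U -> U x ->
  (forall y, U y -> forall i, derivable F y (ev i)) ->
  (forall i, {for x, continuous (pd i F)}) -> differentiable F x.
Proof.
move=> oU Ux dF cF.
suff: differentiable F x /\ 'd F x = lform (\row_i pd i F x) :> (V -> R) by case.
apply: differentiable_epsP; first exact: lform_continuous.
move=> e e0.
(* Each of the m coordinate steps costs e'. Dividing by m + 1 makes sense in dimension 0 as well. *)
pose e' := e / m.+1%:R.
have e'0 : 0 < e' by rewrite divr_gt0 // ltr0n.
have : \forall y \near x, U y /\ forall i, `|pd i F x - pd i F y| <= e'.
  apply: filterI; first exact: open_nbhs_nbhs.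
  apply: (filter_forall (F := nbhs x) (f := fun i y => `|pd i F x - pd i F y| <= e')) => i.
  by move/cvgrPdist_le : (cF i) => /(_ _ e'0).
move=> /nbhs_ballP[r /= r0 hr].
apply/nbhs_ballP; exists r => //= v; rewrite -ball_normE /= sub0r normrN => vr.
have {}hr w : `|w| <= `|v| -> U (x + w) /\ forall i, `|pd i F x - pd i F (x + w)| <= e'.
  move=> wv; apply: hr; rewrite -ball_normE /= opprD addNKr normrN.
  exact: le_lt_trans vr.
(* Consecutive truncations of v differ along a single axis. *)
pose tr k : V := \row_i (if (i < k)%N then v 0 i else 0).
have trS (k : 'I_m) : tr k.+1 = tr k + v 0 k *: ev k.
  apply/rowP => i; rewrite !mxE eqxx /= ltnS leq_eqVlt val_eqE.
  by have [->|] := eqVneq i k; rewrite /= ?ltnn ?mulr1 ?mulr0 ?add0r ?addr0.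
have trle (k : 'I_m) t : `|t| <= `|v 0 k| -> `|tr k + t *: ev k| <= `|v|.
  move=> tv; apply: norm_le_coord => // i; rewrite !mxE eqxx /=.
  have [->|_] := eqVneq i k.
    by rewrite ltnn mulr1 add0r (le_trans tv) // norm_coord_le.
  by rewrite mulr0 addr0; case: ifP => _; rewrite ?normr0 ?norm_coord_le.
have -> : F (v + x) - (F x + lform (\row_i pd i F x) v) =
    \sum_(k < m) (F (x + tr k.+1) - F (x + tr k) - v 0 k * pd k F x).
  rewrite sumrB -(big_mkord xpredT (fun k => F (x + tr k.+1) - F (x + tr k))).
  rewrite telescope_sumr // opprD addrA; congr (F _ - F _ - _).
  - rewrite addrC; congr (_ + _); apply/rowP => i; by rewrite mxE ltn_ord.
  - rewrite (_ : tr 0%N = 0) ?addr0 //; by apply/rowP => i; rewrite !mxE.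
  - by apply: eq_bigr => i _; rewrite mxE.
apply: (le_trans (ler_norm_sum _ _ _)).
apply: (@le_trans _ _ (\sum_(k < m) e' * `|v|)).
  apply: ler_sum => k _; rewrite trS addrA.
  have [|t tv ->] := @MVT_line0 R m F (x + tr k) (ev k) (v 0 k).
    by move=> t tv; rewrite -addrA; apply: dF; apply: (hr _ (trle _ _ tv)).1.
  rewrite -/(pd k F _) [v 0 k * _]mulrC -mulrBl normrM distrC.
  apply: ler_pM => //; last exact: norm_coord_le.
  by rewrite -addrA; apply: (hr _ (trle _ _ tv)).2.
rewrite sumr_const card_ord -mulr_natr mulrAC ler_wpM2r // /e'.
rewrite mulrAC -mulrA ger_pMr // ler_pdivrMr ?ltr0n // mul1r ler_nat.
exact: leqnSn.
Qed.

End LinForm.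

Section Smooth.
Variables (R : realType) (m : nat).
Local Notation V := 'rV[R]_m.
Implicit Types (x v : V) (F G : V -> R) (U W : set V).

Lemma near_eq_differentiable F G x :
  {near x, F =1 G} -> differentiable F x -> differentiable G x.
Proof.
move=> FG dF; suff: differentiable G x /\ 'd G x = 'd F x :> (V -> R) by case.
apply: differentiable_epsP => [|e e0]; first exact: diff_continuous.
have := differentiable_eps dF e0.
have FGx : F x = G x by exact: nbhs_singleton FG.
have : \forall v \near (0 : V), F (v + x) = G (v + x).
  have c : (v + x) @[v --> (0 : V)] --> x.
    rewrite -{2}(add0r x); apply: (@cvgD _ _ _ (nbhs (0:V))); [exact: cvg_id|exact: cvg_cst].
  exact: (c _ FG).
by apply: filterS2 => v /= -> ; rewrite FGx.
Qed.

Lemma near_eq_continuous F G x :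
  {near x, F =1 G} -> {for x, continuous F} -> {for x, continuous G}.
Proof.
move=> FG cF; rewrite /prop_for /continuous_at.
rewrite -(nbhs_singleton FG); exact: cvg_trans (near_eq_cvg FG) cF.
Qed.

Lemma near_eq_pd F G x i : {near x, F =1 G} -> pd i F x = pd i G x.
Proof. by move=> FG; apply: near_eq_derive. Qed.

(* C^k by iterated partial derivatives. Unlike [Ck] it asks for Frechet
   differentiability, which makes it stable under composition. *)
Fixpoint Dn (k : nat) U F : Prop :=
  match k with
  | 0%N => forall x, U x -> {for x, continuous F}
  | j.+1 => (forall x, U x -> differentiable F x) /\ forall i, Dn j U (pd i F)
  end.

Lemma DnS k U F : Dn k.+1 U F ->
  (forall x, U x -> differentiable F x) /\ forall i, Dn k U (pd i F).
Proof. by []. Qed.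

Definition smooth U F := forall k, Dn k U F.

Lemma Dn_continuous k U F x : Dn k U F -> U x -> {for x, continuous F}.
Proof.
case: k => [|k] /= h Ux; first exact: h.
by apply: differentiable_continuous; apply: h.1.
Qed.

Lemma Dn_pred k U F : Dn k.+1 U F -> Dn k U F.
Proof.
elim: k F => [|k IH] F [dF pF]; first by move=> x Ux; apply: differentiable_continuous; exact: dF.
by split=> // i; exact: IH.
Qed.

Lemma Dn_sub k U W F : W `<=` U -> Dn k U F -> Dn k W F.
Proof.
move=> WU; elim: k F => [|k IH] F /=; first by move=> h x /WU; exact: h.
by move=> /DnS[dF pF]; split=> [x xW|i]; [exact/dF/WU|exact: IH].
Qed.

Lemma open_near_eq U F G x : open U -> U x -> (forall y, U y -> F y = G y) ->
  {near x, F =1 G}.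
Proof. by move=> oU Ux FG; near=> y; apply: FG; near: y; exact: open_nbhs_nbhs. Unshelve. all: by end_near. Qed.

Lemma Dn_ext k U F G : open U -> (forall y, U y -> F y = G y) -> Dn k U F -> Dn k U G.
Proof.
move=> oU; elim: k F G => [|k IH] F G FG /=.
  by move=> cF x Ux; apply: near_eq_continuous (cF x Ux); exact: open_near_eq FG.
move=> /DnS[dF pF]; split=> [x Ux|i].
  by apply: near_eq_differentiable (dF x Ux); exact: open_near_eq FG.
apply: IH (pF i) => y Uy; apply: near_eq_pd; exact: open_near_eq FG.
Qed.

Lemma Dn_local k U F :
  (forall x, U x -> exists W, [/\ open W, W x & Dn k W F]) -> Dn k U F.
Proof.
elim: k F => [|k IH] F h /=.
  by move=> x /h[W [oW Wx]]; apply.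
split; first by move=> x /h[W [oW Wx [dF _]]]; exact: dF.
by move=> i; apply: IH => x /h[W [oW Wx /DnS[_ pF]]]; exists W.
Qed.

Lemma Dn_cst k U (c : R) : Dn k U (fun=> c).
Proof.
elim: k c => [|k IH] c /=; first by move=> x _; exact: cst_continuous.
split=> [x _|i]; first exact: differentiable_cst.
rewrite (_ : pd i _ = fun=> 0); first exact: IH.
by apply/funext => x; exact: derive_cst.
Qed.

Lemma pd_coord i j x : pd i (fun y : V => y 0 j) x = (i == j)%:R.
Proof.
rewrite /pd deriveE; last exact: differentiable_coord.
rewrite (_ : 'd _ x = (fun y : V => y 0 j) :> (V -> R)).
  by rewrite mxE eqxx eq_sym.
have -> : (fun y : V => y 0 j) = lform (ev j).
  apply/funext => y; rewrite /lform /dotp (bigD1 j) //= big1 => [|l lj].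
    by rewrite mxE !eqxx mulr1 addr0.
  by rewrite mxE eqxx (negbTE lj) mulr0.
by apply: diff_lin; exact: lform_continuous.
Qed.

Lemma Dn_coord k U j : Dn k U (fun y : V => y 0 j).
Proof.
case: k => [|k] /=; first by move=> x _; exact: coord_continuous.
split=> [x _|i]; first exact: differentiable_coord.
rewrite (_ : pd i _ = fun=> (i == j)%:R); first exact: Dn_cst.
by apply/funext => x; exact: pd_coord.
Qed.

Lemma pdD i F G x : differentiable F x -> differentiable G x ->
  pd i (fun y => F y + G y) x = pd i F x + pd i G x.
Proof. by move=> dF dG; rewrite /pd [LHS]deriveD //; exact: diff_derivable. Qed.

Lemma pdM i F G x : differentiable F x -> differentiable G x ->
  pd i (fun y => F y * G y) x = F x * pd i G x + G x * pd i F x.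
Proof. by move=> dF dG; rewrite /pd [LHS]deriveM //; exact: diff_derivable. Qed.

Lemma pdN i F x : differentiable F x -> pd i (fun y => - F y) x = - pd i F x.
Proof. by move=> dF; rewrite /pd [LHS]deriveN //; exact: diff_derivable. Qed.

Lemma derD v F G x : derivable F x v -> derivable G x v ->
  'D_v (fun y => F y + G y) x = 'D_v F x + 'D_v G x.
Proof. exact: deriveD. Qed.

Lemma derM v F G x : derivable F x v -> derivable G x v ->
  'D_v (fun y => F y * G y) x = F x * 'D_v G x + G x * 'D_v F x.
Proof. exact: deriveM. Qed.

Lemma DnD k U F G : open U -> Dn k U F -> Dn k U G -> Dn k U (fun x => F x + G x).
Proof.
move=> oU; elim: k F G => [|k IH] F G /=.
  by move=> cF cG x Ux; apply: continuousD; [exact: cF|exact: cG].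
move=> /DnS[dF pF] /DnS[dG pG]; split=> [x Ux|i].
  by apply: differentiableD; [exact: dF|exact: dG].
apply: (@Dn_ext _ _ (fun x => pd i F x + pd i G x)) => // [x Ux|]; last exact: IH.
by rewrite pdD //; [exact: dF|exact: dG].
Qed.

Lemma DnN k U F : open U -> Dn k U F -> Dn k U (fun x => - F x).
Proof.
move=> oU; elim: k F => [|k IH] F /=.
  by move=> cF x Ux; apply: continuousN; exact: cF.
move=> /DnS[dF pF]; split=> [x Ux|i]; first by apply: differentiableN; exact: dF.
apply: (@Dn_ext _ _ (fun x => - pd i F x)) => // [x Ux|]; last exact: IH.
by rewrite pdN //; exact: dF.
Qed.

Lemma DnM k U F G : open U -> Dn k U F -> Dn k U G -> Dn k U (fun x => F x * G x).
Proof.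
move=> oU; elim: k F G => [|k IH] F G /=.
  by move=> cF cG x Ux; apply: continuousM; [exact: cF|exact: cG].
move=> hF hG; have [[dF pF] [dG pG]] := (DnS hF, DnS hG); split=> [x Ux|i].
  by apply: differentiableM; [exact: dF|exact: dG].
apply: (@Dn_ext _ _ (fun x => F x * pd i G x + G x * pd i F x)) => // [x Ux|].
  by rewrite pdM //; [exact: dF|exact: dG].
by apply: DnD => //; apply: IH => //; exact: Dn_pred.
Qed.

Lemma Dn_sum k U (I : Type) (r : seq I) (F : I -> V -> R) : open U ->
  (forall i, Dn k U (F i)) -> Dn k U (fun x => \sum_(i <- r) F i x).
Proof.
move=> oU h; elim: r => [|i r IH].
  by apply: (@Dn_ext _ _ (fun=> 0)) => // [x _|]; [rewrite big_nil|exact: Dn_cst].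
apply: (@Dn_ext _ _ (fun x => F i x + \sum_(j <- r) F j x)) => // [x _|].
  by rewrite big_cons.
exact: DnD.
Qed.

Lemma Dn_prod k U (I : Type) (r : seq I) (F : I -> V -> R) : open U ->
  (forall i, Dn k U (F i)) -> Dn k U (fun x => \prod_(i <- r) F i x).
Proof.
move=> oU h; elim: r => [|i r IH].
  by apply: (@Dn_ext _ _ (fun=> 1)) => // [x _|]; [rewrite big_nil|exact: Dn_cst].
apply: (@Dn_ext _ _ (fun x => F i x * \prod_(j <- r) F j x)) => // [x _|].
  by rewrite big_cons.
exact: DnM.
Qed.

(** Smoothness is asked of the composite of g' with F, one order lower. For the inverse and the
    square root, g' is expressed by g itself, so these functions follow by induction on k. *)
Lemma Dn_comp1 k U F (g g' : R -> R) : open U ->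
  (forall x, U x -> is_derive (F x) (1 : R) g (g' (F x))) ->
  Dn k U (fun x => g' (F x)) -> Dn k.+1 U F -> Dn k.+1 U (fun x => g (F x)).
Proof.
move=> oU dg hg' hF; have [dF pF] := DnS hF.
have dgd x : U x -> differentiable g (F x).
  by move=> Ux; apply/derivable1_diffP; case: (dg x Ux).
split=> [x Ux|i].
  by apply: (@differentiable_comp _ _ _ _ F g); [exact: dF|exact: dgd].
apply: (@Dn_ext _ _ (fun x => g' (F x) * pd i F x)) => // [x Ux|]; last exact: DnM.
rewrite /pd [RHS]deriveE; last first.
  by apply: (@differentiable_comp _ _ _ _ F g); [exact: dF|exact: dgd].
rewrite (@diff_comp _ _ _ _ F g); [|exact: dF|exact: dgd].
rewrite /= -(deriveE _ (dF x Ux)).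
rewrite -[X in 'd g (F x) X]mulr1 linearZ /= -deriveE; last exact: dgd.
by have [_ ->] := dg x Ux; rewrite mulrC.
Qed.

Lemma DnV k U F : open U -> (forall x, U x -> F x != 0) -> Dn k U F ->
  Dn k U (fun x => (F x)^-1).
Proof.
move=> oU F0; elim: k => [|k IH] hF.
  by move=> x Ux; apply: continuousV; [exact: F0|exact: hF].
apply: (@Dn_comp1 _ _ _ (fun t => t^-1) (fun t => - (t^-1 * t^-1))) => //.
- move=> x Ux; apply: is_derive_eq; first exact: is_deriveV (F0 x Ux) (is_derive_id _ _).
  by rewrite /= [_ *: _]mulr1 expr2 invfM.
- by apply: DnN => //; apply: DnM => //; apply: IH; exact: Dn_pred.
Qed.

Lemma Dn_sqrt k U F : open U -> (forall x, U x -> 0 < F x) -> Dn k U F ->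
  Dn k U (fun x => Num.sqrt (F x)).
Proof.
move=> oU F0; elim: k => [|k IH] hF.
  move=> x Ux; apply: (@continuous_comp _ _ _ F (@Num.sqrt R)); first exact: hF.
  exact: sqrt_continuous.
apply: (@Dn_comp1 _ _ _ (@Num.sqrt R) (fun t => (2 * Num.sqrt t)^-1)) => //.
- by move=> x Ux; apply: is_derive1_sqrt; exact: F0.
- apply: DnV => // [x Ux|]; first by rewrite mulf_neq0 ?pnatr_eq0 // gt_eqF // sqrtr_gt0 F0.
  by apply: DnM => //; [exact: Dn_cst|apply: IH; exact: Dn_pred].
Qed.

End Smooth.

Section SmoothMaps.
Variables (R : realType) (m : nat).
Local Notation V := 'rV[R]_m.
Implicit Types (X : V -> V) (G : V -> R) (U W : set V).

Lemma differentiable_rowP (X : V -> V) x :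
  (forall i, differentiable (fun y => X y 0 i) x) -> differentiable X x.
Proof.
move=> dX.
have -> : X = \sum_i (fun y => X y 0 i *: ev i).
  by apply/funext => y; rewrite {1}(row_ev (X y)) fct_sumE.
by apply: differentiable_sum => i; apply: differentiableZl; exact: dX.
Qed.

Lemma derive_row_coord X x v i : derivable X x v ->
  'D_v X x 0 i = 'D_v (fun y => X y 0 i) x.
Proof. by move=> dX; rewrite derive_mx // mxE. Qed.

Lemma differentiable_row_coord X x i : differentiable X x ->
  differentiable (fun y => X y 0 i) x.
Proof.
move=> dX; apply: (@differentiable_comp _ _ _ _ X (fun z : V => z 0 i)) => //.
exact: differentiable_coord.
Qed.

Lemma derive_comp_row X G x v :
  differentiable X x -> differentiable G (X x) ->
  'D_v (fun y => G (X y)) x = \sum_i pd i G (X x) * 'D_v (fun y => X y 0 i) x.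
Proof.
move=> dX dG; rewrite deriveE; last exact: (@differentiable_comp _ _ _ _ X G).
rewrite (@diff_comp _ _ _ _ X G) //= -(deriveE _ dX) -(deriveE _ dG) derive_row //.
apply: eq_bigr => i _; rewrite mulrC derive_row_coord //; exact: diff_derivable.
Qed.

Lemma continuous_rowP (T : topologicalType) (X : T -> V) x :
  (forall i, {for x, continuous (fun y => X y 0 i)}) -> {for x, continuous X}.
Proof.
move=> cX; apply/cvgrPdist_le => e e0.
have : \forall y \near x, forall i, `|X x 0 i - X y 0 i| <= e.
  apply: (filter_forall (F := nbhs x) (f := fun i y => `|X x 0 i - X y 0 i| <= e)) => i.
  by move/cvgrPdist_le : (cX i) => /(_ _ e0).
apply: filterS => y h; apply: norm_le_coord; first exact: ltW.
by move=> i; rewrite !mxE.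
Qed.

Lemma Dn_comp k U W X G : open U -> (forall x, U x -> W (X x)) ->
  (forall i, Dn k U (fun x => X x 0 i)) -> Dn k W G ->
  Dn k U (fun x => G (X x)).
Proof.
move=> oU UW; elim: k G => [|k IH] G hX.
  move=> cG x Ux; apply: (@continuous_comp _ _ _ X G); last by apply: cG; exact: UW.
  by apply: continuous_rowP => i; exact: hX.
move=> /DnS[dG pG].
have dX x : U x -> differentiable X x.
  by move=> Ux; apply: differentiable_rowP => i; apply: (hX i).1.
split=> [x Ux|j].
  by apply: (@differentiable_comp _ _ _ _ X G); [exact: dX|apply: dG; exact: UW].
apply: (@Dn_ext _ _ _ _ (fun x => \sum_i pd i G (X x) * pd j (fun y => X y 0 i) x)) => //.
  by move=> x Ux; rewrite /pd derive_comp_row //; [exact: dX|apply: dG; exact: UW].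
apply: Dn_sum => // i; apply: DnM => //; last exact: (hX i).2.
by apply: IH => // l; apply: Dn_pred; exact: hX.
Qed.

(** The next layer of [Ck] contains the continuity of the partial derivatives, from which
    [C1_differentiable] obtains Frechet differentiability. *)
Lemma Dn_Ck k U G : open U -> Ck k U G -> Dn k U G.
Proof.
move=> oU; elim: k G => [|k IH] G [cG h] //.
split=> [x Ux|i]; last exact: IH (h (ev i)).2.
apply: (C1_differentiable oU Ux) => [y Uy i|i]; first exact: (h (ev i)).1.
by have := (h (ev i)).2; case: {IH h} k => [|k] /= [+ _]; apply.
Qed.

End SmoothMaps.

Section Euclid.
Variables (R : realType) (m : nat).
Local Notation V := 'rV[R]_m.
Implicit Types (u v w : V) (a : R).

Lemma dotpC u v : dotp u v = dotp v u.
Proof. by apply: eq_bigr => i _; rewrite mulrC. Qed.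

Lemma dotpDl u v w : dotp (u + v) w = dotp u w + dotp v w.
Proof. exact: (linearD (lform w)). Qed.

Lemma dotpZl a u w : dotp (a *: u) w = a * dotp u w.
Proof. exact: (linearZ_LR (lform w)). Qed.

Lemma dotpNl u w : dotp (- u) w = - dotp u w.
Proof. exact: (linearN (lform w)). Qed.

Lemma dotpBl u v w : dotp (u - v) w = dotp u w - dotp v w.
Proof. exact: (linearB (lform w)). Qed.

Lemma dotp0l w : dotp 0 w = 0.
Proof. exact: (linear0 (lform w)). Qed.

Lemma dotpDr u v w : dotp w (u + v) = dotp w u + dotp w v.
Proof. by rewrite !(dotpC w) dotpDl. Qed.

Lemma dotpZr a u w : dotp w (a *: u) = a * dotp w u.
Proof. by rewrite !(dotpC w) dotpZl. Qed.

Lemma dotpNr u w : dotp w (- u) = - dotp w u.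
Proof. by rewrite !(dotpC w) dotpNl. Qed.

Lemma dotpBr u v w : dotp w (u - v) = dotp w u - dotp w v.
Proof. by rewrite !(dotpC w) dotpBl. Qed.

Lemma dotp0r w : dotp w 0 = 0.
Proof. by rewrite dotpC dotp0l. Qed.

Lemma dotp_ev u i : dotp u (ev i) = u 0 i.
Proof.
rewrite /dotp (bigD1 i) //= big1 => [|j ji]; first by rewrite mxE !eqxx mulr1 addr0.
by rewrite mxE eqxx (negbTE ji) mulr0.
Qed.

Lemma dotp_ge0 u : 0 <= dotp u u.
Proof. by apply: sumr_ge0 => i _; rewrite -expr2 sqr_ge0. Qed.

Lemma dotp_eq0 u : dotp u u = 0 -> u = 0.
Proof.
move=> /eqP; rewrite psumr_eq0 => [/allP h|i _]; last by rewrite -expr2 sqr_ge0.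
apply/rowP => i; rewrite mxE; have /h : i \in index_enum 'I_m by rewrite mem_index_enum.
by rewrite /= mulf_eq0 orbb => /eqP.
Qed.

Lemma dotp_gt0 u : u != 0 -> 0 < dotp u u.
Proof.
move=> u0; rewrite lt_neqAle dotp_ge0 andbT eq_sym.
by apply: contra u0 => /eqP/dotp_eq0/eqP.
Qed.

Lemma enorm_ge0 u : 0 <= enorm u. Proof. exact: sqrtr_ge0. Qed.

Lemma enormE u : enorm u ^+ 2 = dotp u u.
Proof. by rewrite sqr_sqrtr // dotp_ge0. Qed.

Lemma enorm_eq0 u : (enorm u == 0) = (u == 0).
Proof.
apply/eqP/eqP => [e0|->]; last by rewrite /enorm dotp0l sqrtr0.
by apply: dotp_eq0; rewrite -enormE e0 expr0n.
Qed.

Lemma enorm_gt0 u : (0 < enorm u) = (u != 0).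
Proof. by rewrite lt_neqAle enorm_ge0 andbT eq_sym enorm_eq0. Qed.

Lemma enorm0 : enorm (0 : V) = 0. Proof. by apply/eqP; rewrite enorm_eq0. Qed.

Lemma enormZ a u : enorm (a *: u) = `|a| * enorm u.
Proof.
by rewrite /enorm dotpZl dotpZr mulrA -expr2 sqrtrM ?sqr_ge0 // sqrtr_sqr.
Qed.

Lemma enormN u : enorm (- u) = enorm u.
Proof. by rewrite -scaleN1r enormZ normrN1 mul1r. Qed.

Lemma CauchySchwarz u v : dotp u v <= enorm u * enorm v.
Proof.
have [->|v0] := eqVneq v 0; first by rewrite dotp0r enorm0 mulr0.
have v0' : 0 < enorm v by rewrite enorm_gt0.
have := dotp_ge0 (enorm v *: u - (dotp u v / enorm v) *: v).
rewrite !(dotpBl,dotpBr,dotpZl,dotpZr) -!enormE (dotpC v u) => h.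
have h2 : (dotp u v) ^+ 2 <= (enorm u * enorm v) ^+ 2.
  rewrite -subr_ge0; move: h; congr (_ <= _); field; exact: lt0r_neq0.
have [|h3] := leP (dotp u v) 0; first by move/le_trans; apply; rewrite mulr_ge0 ?enorm_ge0.
by rewrite -(@ler_pXn2r _ 2) // nnegrE ?(ltW h3) ?mulr_ge0 ?enorm_ge0.
Qed.

Lemma enormD u v : enorm (u + v) <= enorm u + enorm v.
Proof.
rewrite -(@ler_pXn2r _ 2) ?nnegrE ?addr_ge0 ?enorm_ge0 //.
rewrite enormE dotpDl !dotpDr -!enormE (dotpC v u).
by have := CauchySchwarz u v; nra.
Qed.

Lemma enormB u v : enorm (u - v) = enorm (v - u).
Proof. by rewrite -enormN opprB. Qed.

Lemma enorm_dist u v : `|enorm u - enorm v| <= enorm (u - v).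
Proof.
rewrite ler_norml; apply/andP; split.
  rewrite lerNl opprB lerBlDr enormB -[X in enorm X <= _](subrK u v).
  exact: enormD.
by rewrite lerBlDr -[X in enorm X <= _](subrK v u); exact: enormD.
Qed.

Lemma norm_le_enorm u : `|u| <= enorm u.
Proof.
apply: norm_le_coord => [|i]; first exact: enorm_ge0.
rewrite -sqrtr_sqr ler_wsqrtr // /dotp (bigD1 i) //= expr2 lerDl.
by apply: sumr_ge0 => j _; rewrite -expr2 sqr_ge0.
Qed.

Lemma enorm_le_norm u : enorm u <= m%:R * `|u|.
Proof.
rewrite {1}(row_ev u).
apply: (@le_trans _ _ (\sum_(i < m) `|u|)); last by rewrite sumr_const card_ord mulr_natl.
elim/big_ind2 : _ => [|x1 x2 y1 y2 h1 h2|i _]; first by rewrite enorm0.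
  by apply: (le_trans (enormD _ _)); exact: lerD.
rewrite enormZ -[leRHS]mulr1 ler_pM ?enorm_ge0 // ?norm_coord_le //.
by rewrite /enorm dotp_ev mxE !eqxx sqrtr1.
Qed.

(** The geometry uses [enorm] while the topology comes from the sup norm; the factor [m%:R] in the
    proof pays for the comparison. *)
Lemma lip_continuous (f : V -> V) (x : V) (C : R) :
  (forall y, enorm (f y - f x) <= C * enorm (y - x)) -> {for x, continuous f}.
Proof.
move=> h; apply/(@cvgrPdist_le _ _ V (nbhs x)) => e e0.
have C1 : 0 < `|C| * m%:R + 1 by rewrite ltr_wpDl // mulr_ge0.
apply/nbhs_ballP; exists (e / (`|C| * m%:R + 1)) => /= [|y]; first by rewrite divr_gt0.
rewrite -ball_normE /= => /ltW yx.
rewrite (le_trans (norm_le_enorm _)) // enormB (le_trans (h y)) //.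
apply: (@le_trans _ _ ((`|C| * m%:R + 1) * `|x - y|)).
  apply: (@le_trans _ _ (`|C| * (m%:R * `|x - y|))).
    apply: (@le_trans _ _ (`|C| * enorm (y - x))).
      by rewrite ler_wpM2r ?enorm_ge0 // ler_norm.
    by rewrite ler_wpM2l // distrC enorm_le_norm.
  by rewrite mulrA ler_wpM2r // lerDl.
by rewrite mulrC -ler_pdivlMr.
Qed.

Lemma enorm_continuous : continuous (@enorm R m).
Proof.
move=> x; apply: (@continuous_comp _ _ _ (fun u => dotp u u) (@Num.sqrt R)).
  by apply: continuous_bigsum => i; apply: (@continuousM R V); exact: coord_continuous.
exact: sqrt_continuous.
Qed.

Lemma dotp_continuousl w : continuous (fun u => dotp u w).
Proof. exact: lform_continuous. Qed.

End Euclid.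

(** * Support maps *)

Section InverseMaps.
Variables (R : realType) (m : nat).
Local Notation V := 'rV[R]_m.

Lemma mulmx_norm_le (v : V) (N : 'M[R]_m) :
  `|v *m N| <= (\sum_i \sum_j `|N i j|) * `|v|.
Proof.
apply: norm_le_coord => [|j].
  by rewrite mulr_ge0 // sumr_ge0 // => i _; rewrite sumr_ge0.
rewrite mxE (le_trans (ler_norm_sum _ _ _)) // mulr_suml ler_sum // => i _.
rewrite normrM mulrC ler_pM // ?norm_coord_le //.
by rewrite (bigD1 j) //= lerDl sumr_ge0.
Qed.

Lemma mulmxr_continuous (N : 'M[R]_m) : continuous (fun v : V => v *m N).
Proof.
move=> x; apply: continuous_rowP => i.
rewrite (_ : (fun y : V => _) = fun y : V => \sum_j y 0 j * N j i).
  apply: continuous_bigsum => j; apply: (@continuousM R V); last exact: cst_continuous.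
  exact: coord_continuous.
by apply/funext => y; rewrite mxE.
Qed.

(** The differentiability half of the inverse function theorem, for a map X already known to be
    continuous. Expanding F (X p) = n p at p0 and multiplying by N solves for the increment of X up
    to small errors; this first gives a Lipschitz bound at p0, and then, fed back into the errors,
    the derivative. *)
Lemma inverse_differentiable (F X n : V -> V) (p0 : V) (M N : 'M[R]_m) :
  differentiable F (X p0) -> (forall v, 'd F (X p0) v = v *m M) -> M *m N = 1%:M ->
  {for p0, continuous X} -> differentiable n p0 ->
  (\forall p \near p0, F (X p) = n p) ->
  differentiable X p0 /\ forall v, 'd X p0 v = 'd n p0 v *m N.
Proof.
move=> dF dFE MN cX dn Fn.
pose L v : V := 'd n p0 v *m N.
pose LL : {linear V -> V} := mulmxr N \o 'd n p0.
have LLE v : LL v = L v by [].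
suff [dX E] : differentiable X p0 /\ 'd X p0 = LL :> (V -> V).
  split; first exact: dX.
  move=> v; transitivity (LL v); last exact: (LLE v).
  exact: (congr1 (fun g : V -> V => g v) E).
clearbody LL; apply: differentiable_epsP.
  rewrite (_ : (LL : V -> V) = L); last by apply/funext => v; exact: LLE.
  move=> x; apply: (@continuous_comp _ _ _ ('d n p0) (fun w : V => w *m N)).
    exact: diff_continuous.
  exact: mulmxr_continuous.
move=> e e0.
pose c := (\sum_i \sum_j `|N i j|) + 1.
have c0 : 0 < c by rewrite ltr_wpDl // sumr_ge0 // => i _; rewrite sumr_ge0.
have cle (w : V) : `|w *m N| <= c * `|w|.
  by rewrite (le_trans (mulmx_norm_le _ _)) // ler_wpM2r // lerDl.
have [k k0 kle] : exists2 k, 0 < k & forall v, `|'d n p0 v| <= k * `|v|.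
  have [k k0 hk] := linear_lipschitz (diff_continuous dn).
  by exists k.
(* h = X(p0+v) - X p0 satisfies h = L v + (o(v) - o(h)) N *)
pose e1 := Num.min (2 * c)^-1 (e / (2 * c * (2 * c * (k + 1)))).
have k1 : 0 < k + 1 by rewrite ltr_wpDl // ltW.
have e10 : 0 < e1 by rewrite lt_min invr_gt0 mulr_gt0 //= divr_gt0 // !mulr_gt0.
pose e2 := Num.min 1 (e / (2 * c)).
have e20 : 0 < e2 by rewrite lt_min ltr01 divr_gt0 // mulr_gt0.
have tr : (v + p0) @[v --> (0 : V)] --> p0.
  rewrite -{2}(add0r p0); apply: (@cvgD _ _ _ (nbhs (0:V))); [exact: cvg_id|exact: cvg_cst].
have cXt : X (v + p0) @[v --> (0 : V)] --> X p0 by exact: cvg_comp tr cX.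
have H1 : \forall v \near (0 : V), F (X (v + p0)) = n (v + p0) by exact: (tr _ Fn).
have H2 := differentiable_eps dn e20.
have H3 : \forall v \near (0 : V),
    `|F (X (v + p0)) - (F (X p0) + 'd F (X p0) (X (v + p0) - X p0))| <= e1 * `|X (v + p0) - X p0|.
  have /nbhs_ballP[r /= r0 hr] := differentiable_eps dF e10.
  have /(@cvgrPdist_lt _ _ V (nbhs (0 : V)))/(_ r r0) := cXt.
  apply: filterS => v vr; have := hr (X (v + p0) - X p0).
  by rewrite -ball_normE /= sub0r opprB subrK => /(_ vr).
have Fn0 := nbhs_singleton Fn.
move: H1 H2; apply: filterS3 H3 => v /= H3 H1 H2.
rewrite [v + p0]addrC in H1 H2 H3 *; rewrite LLE.
set h := X (p0 + v) - X p0 in H3 *.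
rewrite opprD addrA -/h.
rewrite H1 Fn0 dFE in H3.
pose r := n (p0 + v) - (n p0 + h *m M).
pose q := n (p0 + v) - (n p0 + 'd n p0 v).
have hE : h - L v = (q - r) *m N.
  have aux (a b c' e' : V) : (a - (b + c')) - (a - (b + e')) = e' - c'.
    by apply/rowP => i; rewrite !mxE; ring.
  by rewrite /q /r aux mulmxBl -mulmxA MN mulmx1.
have h_le : `|h| <= 2 * c * (k + 1) * `|v|.
  have : `|h| <= c * (k * `|v|) + c * (e2 * `|v| + e1 * `|h|).
    have : `|h| <= `|L v| + `|h - L v|.
      by have := ler_normD (L v) (h - L v); rewrite addrC subrK.
    move=> /le_trans; apply; apply: lerD.
      by rewrite (le_trans (cle _)) // ler_wpM2l ?(ltW c0) // kle.
    rewrite [X in `|X|]hE (le_trans (cle _)) // ler_wpM2l ?(ltW c0) //.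
    by rewrite (le_trans (ler_normB _ _)) // lerD.
  have h1 : c * (e1 * `|h|) <= 2^-1 * `|h|.
    rewrite mulrA ler_wpM2r // (@le_trans _ _ (c * (2 * c)^-1)) //.
      by rewrite ler_wpM2l ?(ltW c0) // /e1 ge_min lexx.
    by rewrite invfM mulrCA mulfV ?mulr1 // gt_eqF.
  have h2 : c * (e2 * `|v|) <= c * `|v|.
    rewrite ler_wpM2l ?(ltW c0) // -[leRHS]mul1r ler_wpM2r // /e2.
    by rewrite ge_min lexx.
  by move=> h3; lra.
rewrite hE (le_trans (cle _)) //.
have : c * `|q - r| <= c * (e2 * `|v| + e1 * `|h|).
  by rewrite ler_wpM2l ?(ltW c0) // (le_trans (ler_normB _ _)) // lerD.
move=> /le_trans; apply.
have h1 : c * (e2 * `|v|) <= e / 2 * `|v|.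
  rewrite mulrA ler_wpM2r // (@le_trans _ _ (c * (e / (2 * c)))) //.
    by rewrite ler_wpM2l ?(ltW c0) // /e2 ge_min lexx orbT.
  by rewrite le_eqVlt; apply/orP; left; apply/eqP; field; exact: lt0r_neq0.
have h2 : c * (e1 * `|h|) <= e / 2 * `|v|.
  apply: (@le_trans _ _ (c * (e / (2 * c * (2 * c * (k + 1))) * (2 * c * (k + 1) * `|v|)))).
    rewrite ler_wpM2l ?(ltW c0) // ler_pM ?(ltW e10) //.
    by rewrite /e1 ge_min lexx orbT.
  rewrite le_eqVlt; apply/orP; left; apply/eqP; field.
  by rewrite !lt0r_neq0.
by rewrite mulrDr; lra.
Qed.

Lemma Dn_det k (U : set V) (n : nat) (A : V -> 'M[R]_n) : open U ->
  (forall i j, Dn k U (fun x => A x i j)) -> Dn k U (fun x => \det (A x)).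
Proof.
move=> oU h; rewrite /determinant; apply: Dn_sum => // s; apply: DnM => //.
  exact: Dn_cst.
by apply: Dn_prod.
Qed.

Lemma Dn_invmx k (U : set V) (n : nat) (A : V -> 'M[R]_n) : open U ->
  (forall x, U x -> A x \in unitmx) ->
  (forall i j, Dn k U (fun x => A x i j)) ->
  forall i j, Dn k U (fun x => invmx (A x) i j).
Proof.
move=> oU uA h i j.
apply: (@Dn_ext _ _ _ _ (fun x => (\det (A x))^-1 * ((-1) ^+ (j + i) * \det (row' j (col' i (A x)))))) => //.
  by move=> x Ux; rewrite /invmx uA // !mxE.
apply: DnM => //.
  by apply: DnV => // [x Ux|]; [have := uA x Ux; rewrite unitmxE unitfE|exact: Dn_det].
apply: DnM => //; first exact: Dn_cst.
apply: Dn_det => // a b; apply: (@Dn_ext _ _ _ _ (fun x => A x (lift j a) (lift i b))) => //.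
by move=> x _; rewrite !mxE.
Qed.

End InverseMaps.

(** * Boundary points of a convex body: normals, maximizers and curvature *)

Section ConvexLocal.
Variables (R : realType) (m : nat).
Local Notation V := 'rV[R]_m.
Implicit Types (K U : set V) (f : V -> R) (x v : V).

Definition segment_convex K := forall x y (t : R), K x -> K y -> 0 <= t <= 1 ->
  K (x + t *: (y - x)).

Lemma convex_set_segment K :
  convex_set (K : set (convex_lmodType V)) -> segment_convex K.
Proof.
move=> cK x y t Kx Ky /andP[t0 t1].
have := cK y x (Itv01 t0 t1); rewrite !inE => /(_ Ky Kx).
suff -> : x + t *: (y - x) = (t *: y + (1 - t) *: x) by [].
by rewrite scalerBl scale1r scalerBr addrCA.
Qed.

Lemma dotp_gradient f x v : differentiable f x -> 'D_v f x = dotp (gradient f x) v.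
Proof.
by move=> df; rewrite derive_row //; apply: eq_bigr => i _; rewrite mxE mulrC.
Qed.

Lemma descent f x v : differentiable f x -> 'D_v f x < 0 ->
  exists2 r : R, 0 < r & forall h, 0 < h < r -> f (x + h *: v) < f x.
Proof.
move=> df Dneg; have dv : derivable f x v by exact: diff_derivable.
have : \forall h \near (0 : R), h != 0 ->
    h^-1 *: ((f \o shift x) (h *: v) - f x) < 0.
  exact: (@cvgr_lt _ _ _ _ _ _ dv 0 Dneg).
move=> /nbhs_ballP[r /= r0 hr]; exists r => // h /andP[h0 hr'].
have := hr h; rewrite -ball_normE /= sub0r normrN gtr0_norm // => /(_ hr').
rewrite gt_eqF // => /(_ isT).
move=> H; have {}H : h^-1 * (f (h *: v + x) - f x) < 0 by exact: H.
by move: H; rewrite pmulr_rlt0 ?invr_gt0 // subr_lt0 addrC.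
Qed.

Lemma ascent f x v : differentiable f x -> 0 < 'D_v f x ->
  exists2 r : R, 0 < r & forall h, 0 < h < r -> f x < f (x + h *: v).
Proof.
move=> df Dp; have [||r r0 hr] := @descent (fun y => - f y) x v.
- exact: differentiableN.
- by rewrite [X in X < _]deriveN ?oppr_lt0 //; exact: diff_derivable.
by exists r => // h /hr; rewrite ltrN2.
Qed.

Lemma open_segment U x v : open U -> U x ->
  exists2 r : R, 0 < r & forall h, `|h| < r -> U (x + h *: v).
Proof.
move=> oU Ux; have /nbhs_ballP[r /= r0 hr] : nbhs x U by exact: open_nbhs_nbhs.
exists (r / (`|v| + 1)) => [|h hh]; first by rewrite divr_gt0 // ltr_wpDl.
apply: hr; rewrite -ball_normE /= opprD addNKr normrN normrZ.
apply: (@le_lt_trans _ _ (`|h| * (`|v| + 1))); first by rewrite ler_wpM2l // lerDl.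
by rewrite -ltr_pdivlMr // ltr_wpDl.
Qed.

Section LocalDefining.
Variables (K : set V) (x : V) (U : set V) (f : V -> R).
Hypothesis ldK : local_defining K x U f.

Lemma ld_Dn k : Dn k U f.
Proof. by case: ldK => oU _ sf _ _; exact: Dn_Ck. Qed.

Lemma ld_differentiable y : U y -> differentiable f y.
Proof. exact: (DnS (ld_Dn 1)).1. Qed.

Lemma ld_move y : U y -> local_defining K y U f.
Proof. by case: ldK => oU _ sf gf Kf Uy. Qed.

Lemma ld_zero : closed K -> boundary K x -> f x = 0.
Proof.
case: ldK => oU Ux _ _ Kf cK [clx nix].
have Kx : K x by rewrite (closure_id K).1.
apply/eqP; rewrite eq_le (Kf x Ux).1 //= leNgt; apply/negP => fx0; apply: nix.
have cf : {for x, continuous f} by apply: differentiable_continuous; exact: ld_differentiable.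
have := @cvgr_lt _ _ (nbhs x) (nbhs_filter x) _ _ cf 0 fx0; rewrite /interior /= => h.
have Un : nbhs x U by exact: open_nbhs_nbhs.
suff : nbhs x K by [].
have UI : nbhs x (U `&` [set y | f y < 0]) by exact: (filterI Un h).
by move: UI; apply: filterS => y [Uy fy]; apply/Kf => //; exact: ltW.
Qed.

(** If f increased from x towards z, it would become positive on the segment from x to z, which
    convexity keeps inside K. *)
Lemma ld_outer z : closed K -> segment_convex K -> boundary K x -> K z ->
  dotp (z - x) (gradient f x) <= 0.
Proof.
move=> cK sK bx Kz; have f0 := ld_zero cK bx; case: ldK => oU Ux _ _ Kf.
have Kx : K x by apply/Kf => //; rewrite f0.
have df := ld_differentiable Ux.
rewrite leNgt dotpC -dotp_gradient //; apply/negP => /(ascent df)[r r0 hr].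
have [r' r'0 hr'] := open_segment (z - x) oU Ux.
(* Half the smallest of three bounds: staying on the segment, in the range of the ascent and in
   U. *)
pose h := Num.min 1 (Num.min r r') / 2.
have h0 : 0 < h by rewrite divr_gt0 // !lt_min ltr01 r0.
have hlt (s : R) : Num.min 1 (Num.min r r') <= s -> h < s.
  by move=> hs; rewrite /h; move: h0; rewrite /h => h0; lra.
have h1 : h < 1 by apply: hlt; rewrite ge_min lexx.
have h2 : h < r by apply: hlt; rewrite !ge_min lexx orbT.
have h3 : h < r' by apply: hlt; rewrite !ge_min lexx !orbT.
have Uh : U (x + h *: (z - x)) by apply: hr'; rewrite gtr0_norm.
have := hr h; rewrite h0 h2 => /(_ isT); rewrite f0 ltNge => /negP; apply.
by apply/(Kf _ Uh); apply: sK => //; rewrite !ltW.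
Qed.

(** Lagrange multipliers for one inequality constraint: every direction that decreases f leads into
    K, hence cannot increase the product with p. This forces the part w of p orthogonal to the
    gradient to vanish and the remaining factor to be positive. *)
Lemma ld_maximizer p : closed K -> boundary K x -> p != 0 ->
  (forall z, K z -> dotp z p <= dotp x p) ->
  exists2 l : R, 0 < l & p = l *: gradient f x.
Proof.
move=> cK bx p0 mx; have f0 := ld_zero cK bx; case: ldK => oU Ux _ gf Kf.
have df := ld_differentiable Ux.
set g := gradient f x; have g0 : g != 0 by exact: gf.
have half v : dotp g v < 0 -> dotp v p <= 0.
  rewrite /g -dotp_gradient // => /(descent df)[r r0 hr].
  have [r' r'0 hr'] := open_segment v oU Ux.
  pose h := Num.min r r' / 2.
  have h0 : 0 < h by rewrite divr_gt0 // lt_min r0.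
  have hlt (s : R) : Num.min r r' <= s -> h < s.
    by move=> hs; rewrite /h; move: h0; rewrite /h => h0; lra.
  have Kh : K (x + h *: v).
    apply/Kf; first by apply: hr'; rewrite gtr0_norm // hlt // ge_min lexx orbT.
    by rewrite -f0 ltW // hr // h0 hlt // ge_min lexx.
  by have := mx _ Kh; rewrite dotpDl gerDl dotpZl pmulr_rle0.
have gg : 0 < dotp g g by exact: dotp_gt0.
pose c := dotp p g / dotp g g.
have c0 : 0 <= c.
  rewrite divr_ge0 ?dotp_ge0 //; have := half (- g).
  by rewrite dotpNr oppr_lt0 dotpNl oppr_le0 dotpC => /(_ gg).
pose w := p - c *: g.
have gw : dotp g w = 0.
  by rewrite /w dotpBr dotpZr /c dotpC divfK ?subrr // gt_eqF.
have wp : dotp w p = dotp w w.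
  by rewrite -{1}[p](subrK (c *: g)) dotpDr dotpZr (dotpC w g) gw mulr0 addr0.
have w0 : w = 0.
  apply: dotp_eq0; apply/eqP; rewrite eq_le dotp_ge0 andbT leNgt; apply/negP => ww.
  (* perturb w slightly into the open half space *)
  pose e := dotp w w / (2 * (`|dotp g p| + 1)).
  have D0 : 0 < `|dotp g p| + 1 by rewrite ltr_wpDl.
  have e0 : 0 < e by rewrite divr_gt0 // mulr_gt0.
  have := half (w - e *: g); rewrite dotpBr gw dotpZr sub0r oppr_lt0 mulr_gt0 // => /(_ isT).
  rewrite dotpBl wp dotpZl leNgt => /negP; apply; rewrite subr_gt0.
  apply: (@le_lt_trans _ _ (e * (`|dotp g p| + 1))).
    by rewrite ler_wpM2l ?(ltW e0) // (le_trans (ler_norm _)) // lerDl.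
  rewrite /e invfM mulrA divfK ?gt_eqF //; lra.
have pE : p = c *: g by apply/eqP; rewrite -subr_eq0 -/w w0.
exists c => //; rewrite lt_neqAle c0 andbT eq_sym; apply: contra p0 => /eqP c0'.
by rewrite pE c0' scale0r.
Qed.

End LocalDefining.

Lemma maximizer_boundary K x p : p != 0 -> K x ->
  (forall z, K z -> dotp z p <= dotp x p) -> boundary K x.
Proof.
move=> p0 Kx mx; split; first exact: subset_closure.
move=> ix; have [r r0 hr] := open_segment p (open_interior K) ix.
have /interior_subset/mx : K° (x + (r / 2) *: p).
  by apply: hr; rewrite gtr0_norm ?divr_gt0 //; lra.
rewrite dotpDl dotpZl gerDl leNgt => /negP; apply.
by rewrite mulr_gt0 ?divr_gt0 // dotp_gt0.
Qed.

Definition unit_gradient f y i : R := gradient f y 0 i / enorm (gradient f y).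

Lemma outer_normalE f y i : outer_normal f y 0 i = unit_gradient f y i.
Proof. by rewrite mxE mulrC. Qed.

Lemma ld_normal_Dn K x U f k i : local_defining K x U f ->
  Dn k U (fun y => unit_gradient f y i).
Proof.
move=> ldK; have [oU Ux sf gf Kf] := ldK.
have pf j : Dn k U (fun y => gradient f y 0 j).
  apply: (@Dn_ext _ _ _ _ (pd j f)) => // [y _|]; first by rewrite mxE.
  exact: (DnS (ld_Dn ldK k.+1)).2.
apply: DnM => //; apply: DnV => // [y Uy|]; first by rewrite enorm_eq0 gf.
apply: Dn_sqrt => // [y Uy|]; first by rewrite dotp_gt0 // gf.
by apply: Dn_sum => // j; apply: DnM.
Qed.

Lemma second_fundamental_formE K x U f v w : local_defining K x U f ->
  second_fundamental_form f x v w = \sum_i 'D_v (unit_gradient f ^~ i) x * w 0 i.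
Proof.
move=> ldK; have [oU Ux sf gf Kf] := ldK.
have du i : derivable (unit_gradient f ^~ i) x v.
  by apply: diff_derivable; exact: (DnS (ld_normal_Dn 1 i ldK)).1.
rewrite /second_fundamental_form -dotpNl; apply: eq_bigr => i _; congr (_ * _).
have dn : derivable (fun y => - outer_normal f y) x v.
  apply/derivable_mxP => a b; rewrite (_ : (fun y => _) = fun y => - unit_gradient f y b).
    exact: derivableN.
  by apply/funext => y; rewrite mxE (ord1 a) outer_normalE.
rewrite mxE derive_row_coord // (_ : (fun y => _) = fun y => - unit_gradient f y i).
  by rewrite [X in - X]deriveN // opprK.
by apply/funext => y; rewrite mxE outer_normalE.
Qed.

(** If x and y were distinct maximizers, all points of the segment between them would be maximizers,
    hence boundary points with gradient parallel to p. The unit normal would then stay orthogonal to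
    v = y - x along the segment, and differentiating this relation makes the second fundamental form
    vanish at v. *)
Lemma unique_maximizer K p x y : closed K -> segment_convex K ->
  smooth_boundary K -> positively_curved K -> p != 0 -> K x -> K y ->
  (forall z, K z -> dotp z p <= dotp x p) -> dotp y p = dotp x p -> x = y.
Proof.
move=> cK sK sbK pcK p0 Kx Ky mx yx.
apply/eqP; rewrite eq_sym -subr_eq0; apply/negP => /negP v0; set v := y - x in v0.
have vp : dotp v p = 0 by rewrite dotpBl yx subrr.
(* At the midpoint the segment extends in both directions, so the function [g] below vanishes on a
   neighbourhood of 0. *)
pose z := x + 2^-1 *: v.
have hz (h : R) : `|h| < 2^-1 -> K (z + h *: v) /\ dotp (z + h *: v) p = dotp x p.
  rewrite ltr_norml => /andP[h1 h2]; rewrite /z -addrA -scalerDl; split.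
    by apply: sK => //; lra.
  by rewrite dotpDl dotpZl vp mulr0 addr0.
have [Kz zp] : K z /\ dotp z p = dotp x p.
  by have := hz 0; rewrite normr0 scale0r addr0 invr_gt0 ltr0n => /(_ isT).
have bz : boundary K z by apply: (maximizer_boundary p0) => // w Kw; rewrite zp mx.
have [U [f ldK]] := sbK _ bz; have [oU Uz sf gf Kf] := ldK.
have gv (w : V) : U w -> K w -> dotp w p = dotp x p -> dotp (gradient f w) v = 0.
  move=> Uw Kw wp.
  have mw z' : K z' -> dotp z' p <= dotp w p by rewrite wp; exact: mx.
  have bw : boundary K w by exact: (maximizer_boundary p0).
  have [l l0 pE] := ld_maximizer (ld_move ldK Uw) cK bw p0 mw.
  by move: vp; rewrite pE dotpZr dotpC => /eqP; rewrite mulf_eq0 gt_eqF //= => /eqP.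
have := pcK z U f bz ldK v (gv z Uz Kz zp) v0.
rewrite (second_fundamental_formE _ _ ldK).
have du i : derivable (unit_gradient f ^~ i) z v.
  by apply: diff_derivable; exact: (DnS (ld_normal_Dn 1 i ldK)).1.
have [r r0 hr] := open_segment v oU Uz.
pose g (h : R) := \sum_i unit_gradient f (z + h *: v) i * v 0 i.
have g0 : {near (0 : R), g =1 cst 0}.
  apply/nbhs_ballP; exists (Num.min r 2^-1) => /=; first by rewrite lt_min r0 invr_gt0 ltr0n.
  move=> h; rewrite -ball_normE /= sub0r normrN lt_min => /andP[h1 h2].
  have [Kh hp] := hz h h2.
  have := gv _ (hr h h1) Kh hp; rewrite /g /unit_gradient => E.
  transitivity ((enorm (gradient f (z + h *: v)))^-1 * dotp (gradient f (z + h *: v)) v).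
    by rewrite /dotp mulr_sumr; apply: eq_bigr => i _; rewrite mulrCA mulrA.
  by rewrite E mulr0.
suff -> : \sum_i 'D_v (unit_gradient f ^~ i) z * v 0 i = 0 by rewrite ltxx.
have dg : is_derive (0 : R) (1 : R) g (\sum_i 'D_v (unit_gradient f ^~ i) z * v 0 i).
  rewrite /g; have E : z = z + 0 *: v by rewrite scale0r addr0.
  pose gi i (h : R) : R := unit_gradient f (z + h *: v) i * v 0 i.
  have -> : (fun h : R => \sum_i unit_gradient f (z + h *: v) i * v 0 i) = \sum_i gi i.
    by apply/funext => h; rewrite fct_sumE.
  apply: is_derive_sum => i; rewrite /gi.
  have := @is_derive_line R m (unit_gradient f ^~ i) z v 0; rewrite -E => /(_ (du i)) d1.
  have d2 := is_deriveM d1 (is_derive_cst (v 0 i) (0:R) (1:R)).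
  apply: (is_derive_eq d2); rewrite /= scaler0 add0r [_ *: _]mulrC //.
transitivity ('D_1 g (0 : R)); first by case: dg.
by rewrite (near_eq_derive (1 : R) g0) derive_cst.
Qed.

End ConvexLocal.

Lemma open_preimage_nbhs (T S : topologicalType) (X : T -> S) (p : T) (U : set S) :
  {for p, continuous X} -> open U -> U (X p) -> nbhs p [set q | U (X q)].
Proof. by move=> c oU Up; exact: (c _ (open_nbhs_nbhs (conj oU Up))). Qed.

Section SupportMap.
Variables (R : realType) (m : nat).
Local Notation V := 'rV[R]_m.
Implicit Types (K : set V) (f : V -> R) (p z : V) (X : V -> V).

Definition nonzero : set V := [set p | p != 0].

Lemma open_nonzero : open nonzero.
Proof.
rewrite (_ : nonzero = ~` [set 0]); last by apply/seteqP; split=> p /= /eqP.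
by apply: closed_openC; apply: accessible_closed_set1; exact/hausdorff_accessible/norm_hausdorff.
Qed.

(** X is the inverse Gauss map, extended from the sphere to all nonzero p by homogeneity of degree
    0. Formulated by maximization it also makes sense for a point, where X is constant. *)
Record support_map K X : Prop := SupportMap {
  sm_in : forall p, p != 0 -> K (X p);
  sm_max : forall p z, p != 0 -> K z -> dotp z p <= dotp (X p) p;
  sm_uniq : forall p z, p != 0 -> K z -> dotp z p = dotp (X p) p -> z = X p;
  sm_smooth : forall i, smooth nonzero (fun p => X p 0 i) }.

Definition normalize p : V := (enorm p)^-1 *: p.

Lemma normalize_Dn k i : Dn k nonzero (fun p => normalize p 0 i).
Proof.
apply: (@Dn_ext _ _ _ _ (fun p => (enorm p)^-1 * p 0 i)).
- exact: open_nonzero.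
- by move=> p _; rewrite mxE.
apply: DnM; [exact: open_nonzero| |exact: Dn_coord].
apply: DnV; [exact: open_nonzero|by move=> p /= p0; rewrite enorm_eq0|].
apply: Dn_sqrt; [exact: open_nonzero|by move=> p /= p0; exact: dotp_gt0|].
apply: Dn_sum; first exact: open_nonzero.
by move=> j; apply: DnM; [exact: open_nonzero|exact: Dn_coord|exact: Dn_coord].
Qed.

Lemma compact_enorm_bound K : compact K -> exists2 B : R, 0 < B & forall z, K z -> enorm z <= B.
Proof.
move=> cK; have [K0|/set0P K0] := eqVneq K set0; first by exists 1 => // z; rewrite K0.
have [|c cK' h] := compact_EVT_max K0 cK (f := @enorm R m).
  by apply: continuous_subspaceT; exact: enorm_continuous.
exists (enorm c + 1) => [|z Kz]; first by rewrite ltr_wpDl // enorm_ge0.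
by rewrite (le_trans (h z _)) ?inE // lerDl.
Qed.

(** On the compact set [C] of the points of K that are at distance at least e from X p0, the product
    with p0 stays below its maximum by a gap D > 0. Since K lies in a ball of radius B, changing p0
    by less than D / (2 B) cannot move the maximizer into [C]. *)
Lemma maximizer_continuous K X p0 : compact K ->
  (forall p, p != 0 -> K (X p)) ->
  (forall p z, p != 0 -> K z -> dotp z p <= dotp (X p) p) ->
  (forall p z, p != 0 -> K z -> dotp z p = dotp (X p) p -> z = X p) ->
  p0 != 0 -> {for p0, continuous X}.
Proof.
move=> cK XK mX uX p00; apply/(@cvgrPdist_lt _ _ V (nbhs p0)) => e e0.
have [B B0 KB] := compact_enorm_bound cK.
pose C := K `&` [set z | e <= `|X p0 - z|].
have [C0|/set0P C0] := eqVneq C set0.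
  near=> p; rewrite ltNge; apply/negP => h.
  have : C (X p) by split=> //; apply: XK; near: p; apply: open_nbhs_nbhs; split; [exact: open_nonzero|].
  by rewrite C0.
have cC : compact C.
  apply: (@subclosed_compact _ _ K) => //; last by move=> z [].
  apply: closedI; first exact: compact_closed.
  rewrite (_ : [set _ | _] = (fun z => `|X p0 - z|) @^-1` [set r | e <= r]) //.
  apply: closed_comp; last exact: closed_ge.
  move=> z _; apply: (@continuous_comp _ _ _ (fun z : V => X p0 - z) (fun z => `|z|)).
    by apply: continuousB; [exact: cst_continuous|exact: cvg_id].
  exact: norm_continuous.
have [|c] := compact_EVT_max C0 cC (f := fun z => dotp z p0).
  by apply: continuous_subspaceT; exact: dotp_continuousl.
rewrite inE => -[Kc ec] mc.
pose D := dotp (X p0) p0 - dotp c p0.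
have D0 : 0 < D.
  rewrite subr_gt0 lt_neqAle mX // andbT; apply/eqP => /(uX _ _ p00 Kc) cX.
  by move: ec; rewrite /= cX subrr normr0 leNgt e0.
have hnear : \forall p \near p0, enorm (p0 - p) < D / (B + B).
  have c1 : {for p0, continuous (fun p => enorm (p0 - p))}.
    apply: (@continuous_comp _ _ _ (fun z : V => p0 - z) (@enorm R m)).
      by apply: continuousB; [exact: cst_continuous|exact: cvg_id].
    exact: enorm_continuous.
  apply: (@cvgr_lt _ _ (nbhs p0) (nbhs_filter p0) _ _ c1).
  by rewrite subrr enorm0 divr_gt0 // addr_gt0.
near=> p; rewrite ltNge; apply/negP => h.
have p1 : p != 0 by near: p; apply: open_nbhs_nbhs; split; [exact: open_nonzero|].
have Cp : C (X p) by split=> //; exact: XK.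
have h1 := mc (X p); rewrite inE in h1; have {}h1 := h1 Cp.
have h2 := mX p (X p0) p1 (XK _ p00).
have h3 : D <= dotp (X p0 - X p) (p0 - p).
  by rewrite dotpBr !dotpBl /D; lra.
have h4 : D <= (B + B) * enorm (p0 - p).
  rewrite (le_trans h3) // (le_trans (CauchySchwarz _ _)) // ler_wpM2r ?enorm_ge0 //.
  rewrite (le_trans (enormD _ _)) // enormN lerD // KB //; exact: XK.
have h5 : (B + B) * enorm (p0 - p) < D.
  rewrite mulrC -ltr_pdivlMr ?addr_gt0 //; near: p.
  exact: hnear.
by move: h4; rewrite leNgt h5.
Unshelve. all: by end_near. Qed.

Section BodySmooth.
Variables (K : set V) (X : V -> V).
Hypotheses (cK : compact K) (sbK : smooth_boundary K) (pcK : positively_curved K).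
Hypothesis XK : forall p, p != 0 -> K (X p).
Hypothesis mX : forall p z, p != 0 -> K z -> dotp z p <= dotp (X p) p.
Hypothesis uX : forall p z, p != 0 -> K z -> dotp z p = dotp (X p) p -> z = X p.

Let clK : closed K. Proof. exact: compact_closed. Qed.

Let bX p : p != 0 -> boundary K (X p).
Proof. by move=> p0; apply: (maximizer_boundary p0) => [|z]; [exact: XK|exact: mX]. Qed.

Let cX p : p != 0 -> {for p, continuous X}.
Proof. by move=> p0; exact: (maximizer_continuous cK XK mX uX p0). Qed.

(* The gauge [Phi = (1 + f) nu] inverts X: on the boundary f = 0 and nu is the
   Gauss map, and its differential is invertible by positive curvature. *)
Let Phi f y : V := \row_i ((1 + f y) * unit_gradient f y i).
Let M f y : 'M[R]_m := \matrix_(i, j) pd i (fun y => (1 + f y) * unit_gradient f y j) y.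

Let Phi_Dn x U f k j : local_defining K x U f ->
  Dn k U (fun y => (1 + f y) * unit_gradient f y j).
Proof.
move=> ldK; have [oU Ux _ _ _] := ldK.
apply: DnM => //; last exact: ld_normal_Dn ldK.
by apply: DnD => //; [exact: Dn_cst|exact: ld_Dn ldK k].
Qed.

Let Phi_diff x U f y : local_defining K x U f -> U y ->
  differentiable (Phi f) y /\ forall v, 'd (Phi f) y v = v *m M f y.
Proof.
move=> ldK Uy.
have d1 j : differentiable (fun y => (1 + f y) * unit_gradient f y j) y.
  exact: (DnS (Phi_Dn 1 j ldK)).1.
have E j : (fun y => Phi f y 0 j) = (fun y => (1 + f y) * unit_gradient f y j).
  by apply/funext => z; rewrite mxE.
have dP : differentiable (Phi f) y by apply: differentiable_rowP => j; rewrite E.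
split=> // v; rewrite -deriveE //; apply/rowP => j.
rewrite derive_row_coord; last exact: diff_derivable.
by rewrite E derive_row // mxE; apply: eq_bigr => i _; rewrite mxE.
Qed.

Let Phi_X x U f p : local_defining K x U f -> p != 0 -> U (X p) ->
  Phi f (X p) = normalize p.
Proof.
move=> ldK p0 Up; have ldK' := ld_move ldK Up.
have f0 : f (X p) = 0 by exact: (ld_zero ldK' clK (bX p0)).
have [l l0 pE] := ld_maximizer ldK' clK (bX p0) p0 (fun z => mX p0).
apply/rowP => i; rewrite !mxE f0 addr0 mul1r /unit_gradient.
set g := gradient f (X p) in pE *; rewrite pE enormZ gtr0_norm // !mxE.
have g0 : enorm g != 0 by rewrite enorm_eq0; case: ldK => _ _ _ gf _; exact: gf.
by rewrite -/(pd i f (X p)) (_ : pd i f (X p) = g 0 i) ?mxE //; field; rewrite g0 gt_eqF.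
Qed.

(** For v in the kernel, (D_v f) nu + D_v nu = 0 at x, where f = 0. As nu is a unit field, D_v nu is
    orthogonal to nu, so both terms vanish: v is tangent and the second fundamental form vanishes at
    v, whence v = 0. *)
Let M_unit x U f : local_defining K x U f -> boundary K x -> M f x \in unitmx.
Proof.
move=> ldK bx; have [oU Ux _ gf _] := ldK.
rewrite -row_free_unit -kermx_eq0; apply/eqP/row_matrixP => i.
set v := row i (kermx (M f x)); rewrite row0.
have vM : v *m M f x = 0 by rewrite /v -row_mul mulmx_ker row0.
have f0 := ld_zero ldK clK bx.
have df := ld_differentiable ldK Ux.
have du j : differentiable (unit_gradient f ^~ j) x.
  exact: (DnS (ld_normal_Dn 1 j ldK)).1.
pose D j := 'D_v (unit_gradient f ^~ j) x.
have E j : dotp (gradient f x) v * unit_gradient f x j + D j = 0.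
  have : (v *m M f x) 0 j = 0 by rewrite vM mxE.
  rewrite -(Phi_diff ldK Ux).2 -deriveE; last exact: (Phi_diff ldK Ux).1.
  rewrite derive_row_coord; last by apply: diff_derivable; exact: (Phi_diff ldK Ux).1.
  rewrite (_ : (fun y => _) = (fun y => (1 + f y) * unit_gradient f y j)); last first.
    by apply/funext => z; rewrite mxE.
  have d1 : derivable (fun y => 1 + f y) x v.
    by apply: derivableD; [exact: derivable_cst|exact: diff_derivable].
  have d2 : derivable (unit_gradient f ^~ j) x v by exact: diff_derivable.
  rewrite (derM d1 d2).
  rewrite derD; [|exact: derivable_cst|exact: diff_derivable].
  rewrite derive_cst add0r f0 addr0 (dotp_gradient v df) mul1r -/(D j) => <-.
  by rewrite addrC mulrC.
have g0 : enorm (gradient f x) != 0 by rewrite enorm_eq0; exact: gf.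
have unit1 y : U y -> \sum_j unit_gradient f y j * unit_gradient f y j = 1.
  move=> Uy; have gy : enorm (gradient f y) != 0 by rewrite enorm_eq0; exact: gf.
  transitivity ((enorm (gradient f y)) ^- 2 * dotp (gradient f y) (gradient f y)).
    rewrite /dotp mulr_sumr; apply: eq_bigr => j _; rewrite /unit_gradient.
    by field.
  by rewrite -enormE mulVf // expf_neq0.
have orth : \sum_j unit_gradient f x j * D j = 0.
  have : 'D_v (fun y => \sum_j unit_gradient f y j * unit_gradient f y j) x = 0.
    rewrite -[RHS](derive_cst (1:R) x v); apply: near_eq_derive.
    by near=> y; apply: unit1; near: y; exact: open_nbhs_nbhs.
  pose uu j y := unit_gradient f y j * unit_gradient f y j.
  rewrite (_ : (fun y => _) = \sum_j uu j); last by apply/funext => y; rewrite fct_sumE.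
  rewrite derive_sum; last by move=> j; apply: derivableM; exact: diff_derivable.
  move=> h; suff /eqP : 2 * (\sum_j unit_gradient f x j * D j) = 0.
    by rewrite mulf_eq0 pnatr_eq0 /= => /eqP.
  rewrite -[RHS]h mulr_sumr; apply: eq_bigr => j _.
  rewrite deriveM; [|exact: diff_derivable|exact: diff_derivable].
  by rewrite -/(D j) [_ *: _]mulrC -[in RHS]mulr2n mulr_natl mulrC.
have gv : dotp (gradient f x) v = 0.
  have : \sum_j unit_gradient f x j * (dotp (gradient f x) v * unit_gradient f x j + D j) = 0.
    by rewrite big1 // => j _; rewrite E mulr0.
  under eq_bigr do rewrite mulrDr mulrCA.
  by rewrite big_split /= orth addr0 -mulr_sumr unit1 // mulr1.
apply/eqP; apply: contraT => v0.
have := pcK bx ldK gv v0; rewrite (second_fundamental_formE _ _ ldK) big1 ?ltxx // => j _.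
by have := E j; rewrite gv mul0r add0r /D => ->; rewrite mul0r.
Unshelve. all: by end_near. Qed.

Lemma body_smooth i : smooth nonzero (fun p => X p 0 i).
Proof.
move=> k; apply: Dn_local => p0 p00.
have [U [f ldK]] := sbK (bX p00); have [oU Ux _ gf _] := ldK.
have M_Dn k' a b : Dn k' U (fun y => M f y a b).
  apply: (@Dn_ext _ _ _ _ (pd a (fun y => (1 + f y) * unit_gradient f y b))) => //.
    by move=> y _; rewrite mxE.
  exact: (DnS (Phi_Dn k'.+1 b ldK)).2.
pose U' := U `&` [set y | M f y \in unitmx].
have oU' : open U'.
  rewrite openE => y [Uy My].
  have cdet : {for y, continuous (fun y => \det (M f y))} by exact: (Dn_det oU (M_Dn 0)).
  have d0 : \det (M f y) != 0 by move: My; rewrite /= unitmxE unitfE.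
  have h : \forall z \near y, \det (M f z) != 0.
    have := cdet _ (open_nbhs_nbhs (conj (@open_neq R 0) _)) => /(_ d0).
    by [].
  have Un : nbhs y U by exact: open_nbhs_nbhs.
  have : nbhs y (U `&` [set z | \det (M f z) != 0]) by exact: (filterI Un h).
  by apply: filterS => z [Uz hz]; split; [exact: Uz|rewrite /= unitmxE unitfE].
pose W := [set p | p != 0 /\ U' (X p)].
have oW : open W.
  rewrite openE => p [p1 Up].
  have h := open_preimage_nbhs (cX p1) oU' Up.
  have n0 : nbhs p nonzero by apply: open_nbhs_nbhs; split; [exact: open_nonzero|].
  have : nbhs p (nonzero `&` [set q | U' (X q)]) by exact: (filterI n0 h).
  by apply: filterS => q [].
exists W; split=> //.
  by split=> //; split=> //; exact: M_unit ldK (bX p00).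
have key p : W p -> differentiable X p /\
    forall v, 'd X p v = 'd normalize p v *m invmx (M f (X p)).
  move=> [p1 [Up Mp]].
  have [dPhi PhiE] := Phi_diff ldK Up.
  apply: (inverse_differentiable dPhi PhiE) => //.
  - exact: mulmxV.
  - exact: cX.
  - by apply: differentiable_rowP => j; exact: (DnS (normalize_Dn 1 j)).1.
  - near=> q; have [q0 [Uq _]] : W q by near: q; exact: open_nbhs_nbhs.
    exact: Phi_X ldK q0 Uq.
(* Bootstrap: by [key] the derivative of X is that of [normalize] times the inverse of M at X p, so
   it is as smooth as X itself, which gains one order. *)
elim: k i => [|k IH] i.
  move=> p [p1 _]; apply: (@continuous_comp _ _ _ X (fun z : V => z 0 i)); first exact: cX.
  exact: coord_continuous.
split=> [p Wp|j]; first by apply: differentiable_row_coord; exact: (key p Wp).1.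
apply: (@Dn_ext _ _ _ _ (fun p => \sum_l pd j (fun q => normalize q 0 l) p * invmx (M f (X p)) l i)) => //.
  move=> p Wp; have [dX XE] := key p Wp; have [p1 _] := Wp.
  have dn : differentiable normalize p.
    by apply: differentiable_rowP => l; exact: (DnS (normalize_Dn 1 l)).1.
  rewrite /pd -derive_row_coord; last exact: diff_derivable.
  rewrite deriveE // XE mxE; apply: eq_bigr => l _; congr (_ * _).
  by rewrite -deriveE // derive_row_coord //; exact: diff_derivable.
apply: Dn_sum => // l; apply: DnM => //.
  by apply: (Dn_sub _ ((DnS (normalize_Dn k.+1 l)).2 j)) => q [].
apply: (@Dn_comp _ _ _ _ U' X (fun y => invmx (M f y) l i)) => // [q []//|].
apply: Dn_invmx => // [y []//|a b].
by apply: (Dn_sub _ (M_Dn k a b)) => y [].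
Unshelve. all: by end_near. Qed.

End BodySmooth.

Lemma exists_support_map K : strictly_convex_smooth K -> exists X, support_map K X.
Proof.
move=> [[x ->]|[cK cvK iK sbK pcK]].
  exists (fun=> x); split=> //=; first by move=> p z _ ->.
  by move=> i k; apply: Dn_cst.
have sK := convex_set_segment cvK.
have K0 : K !=set0 by case: iK => x /interior_subset; exists x.
have /choice[X hX] : forall p, exists x, K x /\ forall z, K z -> dotp z p <= dotp x p.
  move=> p; have [|c] := compact_EVT_max K0 cK (f := fun z => dotp z p).
    by apply: continuous_subspaceT; exact: dotp_continuousl.
  by rewrite inE => Kc mc; exists c; split=> // z Kz; apply: mc; rewrite inE.
have uX p z : p != 0 -> K z -> dotp z p = dotp (X p) p -> z = X p.
  move=> p0 Kz E; apply/esym.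
  by apply: (unique_maximizer (compact_closed _ cK) sK sbK pcK p0 (hX p).1 Kz (hX p).2 E).
exists X; split=> // [p _|p z _|i].
- exact: (hX p).1.
- exact: (hX p).2.
- by apply: (body_smooth cK sbK pcK _ _ uX) => [p _|p z _]; [exact: (hX p).1|exact: (hX p).2].
Qed.

End SupportMap.

Lemma dotp_sqrD (R : realType) (m : nat) (u v : 'rV[R]_m) :
  dotp (u + v) (u + v) = dotp u u + 2 * dotp u v + dotp v v.
Proof. by rewrite dotpDl !(dotpDr _ _ _) (dotpC v u); ring. Qed.

Section Difference.
Variables (R : realType) (m : nat).
Local Notation V := 'rV[R]_m.
Implicit Types (K : set V) (p x z : V) (X : V -> V).

(** What is kept of a strictly convex body with smooth boundary. In this form it passes to
    differences directly, without a study of the boundary of K1 - K2. *)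
Record body K X : Prop := Body {
  body_compact : compact K;
  body_convex : segment_convex K;
  body_support : support_map K X }.

Lemma exists_body K : strictly_convex_smooth K -> exists X, body K X.
Proof.
move=> sK; have [X hX] := exists_support_map sK; exists X; split=> //.
  by case: sK => [[x ->]|[]//]; exact: compact_set1.
case: sK => [[x ->]|[_ cvK _ _ _]]; last exact: convex_set_segment.
by move=> _ _ t -> -> _ /=; rewrite subrr scaler0 addr0.
Qed.

(** Maximizing <x - y, p> amounts to maximizing <x, p> over K1 and <y, - p> over K2 separately.
    Equality for the difference forces equality in both, which gives uniqueness. *)
Lemma body_diff K1 K2 X1 X2 : body K1 X1 -> body K2 X2 ->
  body (minkowski_diff K1 K2) (fun p => X1 p - X2 (- p)).
Proof.
move=> [cK1 sK1 hX1] [cK2 sK2 hX2]; split.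
- rewrite (_ : minkowski_diff _ _ = (fun z : V * V => z.1 - z.2) @` (K1 `*` K2)).
    apply: continuous_compact; last exact: compact_setX.
    apply: continuous_subspaceT => z; apply: (@cvgB R V _ (nbhs z)).
      exact: cvg_fst.
    exact: cvg_snd.
  apply/seteqP; split=> [_ [x [y [Kx Ky ->]]]|_ [[x y] [Kx Ky] <-]].
    by exists (x, y).
  by exists x, y.
- move=> _ _ t [x [y [Kx Ky ->]]] [x' [y' [Kx' Ky' ->]]] t01.
  exists (x + t *: (x' - x)), (y + t *: (y' - y)); split.
  + exact: sK1.
  + exact: sK2.
  + by apply/rowP => i; rewrite !mxE; ring.
- have mx p z : p != 0 -> minkowski_diff K1 K2 z ->
      dotp z p <= dotp (X1 p - X2 (- p)) p /\ (dotp z p = dotp (X1 p - X2 (- p)) p ->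
      z = X1 p - X2 (- p)).
    move=> p0 [x [y [Kx Ky ->]]]; have p0' : - p != 0 by rewrite oppr_eq0.
    have h1 := sm_max hX1 p0 Kx; have h2 := sm_max hX2 p0' Ky.
    rewrite !dotpNr in h2; rewrite !dotpBl; split; first by lra.
    move=> E; rewrite -(sm_uniq hX1 p0 Kx); last by lra.
    by rewrite -(sm_uniq hX2 p0' Ky) // !dotpNr; lra.
  split=> [p p0|p z p0 Kz|p z p0 Kz|i k].
  + exists (X1 p), (X2 (- p)); split=> //; first exact: (sm_in hX1).
    by apply: (sm_in hX2); rewrite oppr_eq0.
  + exact: (mx p z p0 Kz).1.
  + exact: (mx p z p0 Kz).2.
  + have on := @open_nonzero R m.
    apply: (@Dn_ext _ _ _ _ (fun p => X1 p 0 i + - X2 (- p) 0 i)) => //.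
      by move=> p _; rewrite !mxE.
    apply: DnD => //; first exact: (sm_smooth hX1).
    apply: DnN => //.
    apply: (@Dn_comp _ _ _ _ (@nonzero R m) (fun p : V => - p) (fun p => X2 p 0 i)) => //.
    * by move=> p; rewrite /nonzero /= oppr_eq0.
    * move=> j; apply: (@Dn_ext _ _ _ _ (fun p : V => - (p 0 j))) => //.
        by move=> p _; rewrite mxE.
      by apply: DnN => //; exact: Dn_coord.
    * exact: (sm_smooth hX2).
Qed.

End Difference.

(** * Distance to a convex body *)

Section Projection.
Variables (R : realType) (m : nat).
Local Notation V := 'rV[R]_m.
Variables (K : set V) (X : V -> V).
Hypotheses (bK : body K X) (K0 : K !=set0).
Implicit Types (p q y z v : V).

Lemma nearest_exists y : exists c, K c /\ forall z, K z -> enorm (y - c) <= enorm (y - z).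
Proof.
have [|c] := compact_EVT_min K0 (body_compact bK) (f := fun z => enorm (y - z)).
  apply: continuous_subspaceT => z.
  apply: (@continuous_comp _ _ _ (fun z : V => y - z) (@enorm R m)).
    by apply: continuousB; [exact: cst_continuous|exact: cvg_id].
  exact: enorm_continuous.
by rewrite inE => Kc h; exists c; split=> // z Kz; apply: h; rewrite inE.
Qed.

Definition proj y : V := sval (cid (nearest_exists y)).
Definition pvec y : V := y - proj y.
Definition dist y : R := enorm (pvec y).

Lemma projK y : K (proj y).
Proof. by rewrite /proj; case: cid => c []. Qed.

Lemma dist_le y z : K z -> dist y <= enorm (y - z).
Proof. by rewrite /dist /pvec /proj; case: cid => c [Kc h] /=; exact: h. Qed.

(** Moving [proj y] by the fraction t towards z does not decrease the distance to y; expanding the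
    squares gives 2 <p, w> <= t <w, w> for all t in ]0, 1]. *)
Lemma proj_variational y z : K z -> dotp (pvec y) (z - proj y) <= 0.
Proof.
move=> Kz; set w := z - proj y; set p := pvec y.
have h t : 0 < t <= 1 -> 2 * dotp p w <= t * dotp w w.
  move=> /andP[t0 t1].
  have := dist_le y (body_convex bK (projK y) Kz (_ : 0 <= t <= 1)).
  rewrite (ltW t0) t1 => /(_ isT).
  rewrite -/w (_ : y - (proj y + t *: w) = p - t *: w); last by rewrite opprD addrA.
  rewrite /dist -/p -(@ler_pXn2r _ 2) ?nnegrE ?enorm_ge0 // !enormE.
  rewrite (dotp_sqrD p (- (t *: w))) !dotpNr dotpNl dotpZl !dotpZr => h1.
  by rewrite -(ler_pM2l t0); nra.
rewrite leNgt; apply/negP => p0.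
have w0 := dotp_ge0 w.
(* This t gives t <w, w> <= <p, w>, which contradicts the inequality [h] if <p, w> > 0. *)
pose t := Num.min 1 (dotp p w / (dotp w w + 1)).
have t0 : 0 < t by rewrite lt_min ltr01 divr_gt0 // ltr_wpDl.
have := h t; rewrite t0 ge_min lexx => /(_ isT).
have t1 : t * (dotp w w + 1) <= dotp p w.
  by rewrite -ler_pdivlMr ?ltr_wpDl // ge_min lexx orbT.
by move=> h2; nra.
Qed.

(** y - y' is the sum of the increments of [pvec] and of [proj], whose product is nonnegative by the
    variational inequalities at y and y'. *)
Lemma pvec_lip y y' : enorm (pvec y - pvec y') <= enorm (y - y').
Proof.
rewrite -(@ler_pXn2r _ 2) ?nnegrE ?enorm_ge0 // !enormE.
have h1 := proj_variational y (projK y').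
have h2 := proj_variational y' (projK y).
have -> : y - y' = (pvec y - pvec y') + (proj y - proj y').
  by rewrite /pvec; apply/rowP => i; rewrite !mxE; ring.
set a := pvec y in h1 h2 *; set b := pvec y' in h1 h2 *.
set c := proj y - proj y'.
have h3 : 0 <= dotp (a - b) c by move: h1 h2; rewrite /c !dotpBl !dotpBr; lra.
by rewrite (dotp_sqrD (a - b) c); have := dotp_ge0 c; move: h3; lra.
Qed.

Lemma pvec_continuous : continuous pvec.
Proof. by move=> y; apply: (@lip_continuous _ _ _ _ 1) => y'; rewrite mul1r pvec_lip. Qed.

Lemma dist_continuous : continuous dist.
Proof.
move=> y; apply: (@continuous_comp _ _ _ pvec (@enorm R m)); first exact: pvec_continuous.
exact: enorm_continuous.
Qed.

Lemma dist_lip y y' : `|dist y - dist y'| <= enorm (y - y').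
Proof. exact: le_trans (enorm_dist _ _) (pvec_lip _ _). Qed.

Lemma pvec_eq0 y : (pvec y == 0) <-> K y.
Proof.
split=> [|Ky]; first by rewrite subr_eq0 => /eqP ->; exact: projK.
have := dist_le y Ky; rewrite subrr enorm0 => h.
by rewrite -enorm_eq0 eq_le h enorm_ge0.
Qed.

Lemma dist_gt0 y : (0 < dist y) <-> ~ K y.
Proof.
rewrite /dist enorm_gt0; split=> [/negP h /pvec_eq0//|h].
by apply/negP => /pvec_eq0.
Qed.

Lemma proj_support y : ~ K y -> proj y = X (pvec y).
Proof.
move=> nK; have p0 : pvec y != 0 by apply/negP => /pvec_eq0.
apply: (sm_uniq (body_support bK) p0 (projK y)).
apply/eqP; rewrite eq_le (sm_max (body_support bK) p0 (projK y)) /=.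
have := proj_variational y (sm_in (body_support bK) p0).
by rewrite dotpC dotpBl subr_le0.
Qed.

Lemma pvecE y : ~ K y -> pvec y + X (pvec y) = y.
Proof. by move=> nK; rewrite -proj_support // subrK. Qed.

Lemma support_monotone p q : p != 0 -> q != 0 -> 0 <= dotp (X p - X q) (p - q).
Proof.
move=> p0 q0.
have h1 := sm_max (body_support bK) p0 (sm_in (body_support bK) q0).
have h2 := sm_max (body_support bK) q0 (sm_in (body_support bK) p0).
by rewrite dotpBl !dotpBr; lra.
Qed.

Lemma outside p : p != 0 -> ~ K (p + X p).
Proof.
move=> p0 /(sm_max (body_support bK) p0); rewrite dotpDl gerDr leNgt => /negP; apply.
exact: dotp_gt0.
Qed.

(** If p + X p = q + X q, then <X p - X q, p - q> = - |p - q|^2, while support maps are monotone;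
    hence p = q. *)
Lemma pvecK p : p != 0 -> pvec (p + X p) = p.
Proof.
move=> p0; set y := p + X p; have nK : ~ K y by exact: outside.
have q0 : pvec y != 0 by apply/negP => /pvec_eq0.
have := support_monotone p0 q0.
have -> : X p - X (pvec y) = - (p - pvec y).
  have := pvecE nK; rewrite {3}/y => E; apply/rowP => i.
  by have := congr1 (fun w : V => w 0 i) E; rewrite !mxE; lra.
rewrite dotpNl oppr_ge0 => h; apply/esym/eqP; rewrite -subr_eq0; apply/eqP/dotp_eq0.
by apply/eqP; rewrite eq_le h dotp_ge0.
Qed.

Lemma support_homog p (t : R) : p != 0 -> 0 < t -> X (t *: p) = X p.
Proof.
move=> p0 t0; have hX := body_support bK.
have tp0 : t *: p != 0 by rewrite scaler_eq0 negb_or gt_eqF.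
apply: (sm_uniq hX p0 (sm_in hX tp0)); apply/eqP.
rewrite eq_le (sm_max hX p0 (sm_in hX tp0)) /= -(ler_pM2l t0) -!dotpZr.
exact: (sm_max hX tp0 (sm_in hX p0)).
Qed.

(** Row convention: [v *m DX p] is the derivative of X in the direction v. Then [Jm] is the Jacobian
    matrix of p |-> p + X p, the inverse of [pvec]. *)
Definition DX p : 'M[R]_m := \matrix_(i, j) pd i (fun q => X q 0 j) p.
Definition Jm p : 'M[R]_m := 1%:M + DX p.
Definition Mi p : 'M[R]_m := invmx (Jm p).

Lemma X_differentiable p j : p != 0 -> differentiable (fun q => X q 0 j) p.
Proof. exact: (DnS (sm_smooth (body_support bK) j 1)).1. Qed.

Lemma DXE p v j : p != 0 -> (v *m DX p) 0 j = 'D_v (fun q => X q 0 j) p.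
Proof.
move=> p0; rewrite derive_row; last exact: X_differentiable.
by rewrite mxE; apply: eq_bigr => i _; rewrite mxE.
Qed.

(** The infinitesimal form of [support_monotone]. *)
Lemma DX_psd p v : p != 0 -> 0 <= dotp (v *m DX p) v.
Proof.
move=> p0; pose f q := dotp (X q) v.
have df : differentiable f p.
  rewrite (_ : f = \sum_j (fun q => X q 0 j * v 0 j)); last by apply/funext => q; rewrite fct_sumE.
  apply: differentiable_sum => j; apply: differentiableM; first exact: X_differentiable.
  exact: differentiable_cst.
have E : 'D_v f p = dotp (v *m DX p) v.
  rewrite (_ : f = \sum_j (fun q => X q 0 j * v 0 j)); last by apply/funext => q; rewrite fct_sumE.
  rewrite derive_sum => [|j]; last first.
    by apply: derivableM; [exact/diff_derivable/X_differentiable|exact: derivable_cst].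
  apply: eq_bigr => j _; rewrite derM; [|exact/diff_derivable/X_differentiable|exact: derivable_cst].
  by rewrite derive_cst mulr0 add0r DXE // mulrC.
rewrite -E leNgt; apply/negP => /(descent df)[r r0 hr].
have [r' r'0 hr'] := open_segment v (@open_nonzero R m) p0.
pose h := Num.min r r' / 2.
have h0 : 0 < h by rewrite divr_gt0 // lt_min r0.
have hlt (s : R) : Num.min r r' <= s -> h < s.
  by move=> hs; rewrite /h; move: h0; rewrite /h => h0; lra.
have q0 : p + h *: v != 0 by apply: hr'; rewrite gtr0_norm // hlt // ge_min lexx orbT.
have := support_monotone q0 p0; rewrite [p + _]addrC addrK dotpZr dotpBl.
rewrite pmulr_rge0 // subr_ge0 leNgt addrC -/(f p) -/(f (p + h *: v)) hr // h0 hlt //.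
by rewrite ge_min lexx.
Qed.

Lemma Jm_coercive p v : p != 0 -> dotp v v <= dotp (v *m Jm p) v.
Proof. by move=> p0; rewrite mulmxDr mulmx1 dotpDl lerDl DX_psd. Qed.

Lemma Jm_unit p : p != 0 -> Jm p \in unitmx.
Proof.
move=> p0; rewrite -row_free_unit -kermx_eq0; apply/eqP/row_matrixP => i.
set v := row i (kermx _); rewrite row0; apply: dotp_eq0; apply/eqP.
rewrite eq_le dotp_ge0 andbT (le_trans (Jm_coercive v p0)) //.
by rewrite /v -row_mul mulmx_ker row0 dotp0l.
Qed.

(** Coercivity at w = v *m Mi p reads |w|^2 <= <v, w>. The bound is uniform in p, which makes [Mi] a
    symbol of order 0. *)
Lemma Mi_contract p v : p != 0 -> enorm (v *m Mi p) <= enorm v.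
Proof.
move=> p0; set w := v *m Mi p.
have [->|w0] := eqVneq w 0; first by rewrite enorm0 enorm_ge0.
have := Jm_coercive w p0; rewrite /w -mulmxA mulVmx ?Jm_unit // mulmx1 -/w -enormE.
move=> /le_trans/(_ (CauchySchwarz _ _)); rewrite expr2 ler_pM2r // ?enorm_gt0 //.
Qed.

Lemma Mi_le1 p i j : p != 0 -> `|Mi p i j| <= 1.
Proof.
move=> p0; have -> : Mi p i j = (ev i *m Mi p) 0 j.
  by rewrite -rowE mxE.
rewrite (le_trans (norm_coord_le _ _)) // (le_trans (norm_le_enorm _)) //.
rewrite (le_trans (Mi_contract _ p0)) // /enorm dotp_ev mxE !eqxx sqrtr1 //.
Qed.

Lemma open_outside : open (~` K).
Proof. by apply: closed_openC; apply: compact_closed => //; case: bK. Qed.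

(** [inverse_differentiable] for p |-> p + X p, of which [pvec] is a continuous right inverse
    outside K. *)
Lemma pvec_differentiable y : ~ K y ->
  differentiable pvec y /\ forall v, 'd pvec y v = v *m Mi (pvec y).
Proof.
move=> nK; have p0 : pvec y != 0 by apply/negP => /pvec_eq0.
pose F p := p + X p.
have Fj j : (fun p => F p 0 j) = (fun p : V => p 0 j + X p 0 j).
  by apply/funext => p; rewrite mxE.
have dF : differentiable F (pvec y).
  apply: differentiable_rowP => j; rewrite Fj; apply: differentiableD.
    exact: differentiable_coord.
  exact: X_differentiable.
have FE v : 'd F (pvec y) v = v *m Jm (pvec y).
  rewrite -deriveE //; apply/rowP => j; rewrite derive_row_coord; last exact: diff_derivable.
  rewrite Fj derD; [|exact/diff_derivable/differentiable_coord|exact/diff_derivable/X_differentiable].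
  rewrite mulmxDr mulmx1 mxE DXE //; congr (_ + _).
  rewrite derive_row; last exact: differentiable_coord.
  rewrite (bigD1 j) //= pd_coord eqxx mulr1 big1 ?addr0 // => i ij.
  by rewrite pd_coord (negbTE ij) mulr0.
have [||||dX XE] := inverse_differentiable dF FE (N := Mi (pvec y)) (X := pvec) (n := id).
- exact/mulmxV/Jm_unit.
- exact: pvec_continuous.
- exact: ex_diff.
- have : nbhs y (~` K) by apply: open_nbhs_nbhs; split; [exact: open_outside|].
  by apply: filterS => z nKz; exact: pvecE.
split; first exact: dX.
by move=> v; rewrite XE diff_val.
Qed.

End Projection.

(** * Symbols and finite differences *)

Section Weight.
Variable R : realType.
Implicit Types (r s x y : R).

(* x^-r for x > 0 *)
Definition wgt r x : R := expR (- (r * ln x)).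

Lemma wgt_gt0 r x : 0 < wgt r x. Proof. exact: expR_gt0. Qed.
Lemma wgt_ge0 r x : 0 <= wgt r x. Proof. exact: expR_ge0. Qed.
Lemma wgtD r s x : wgt (r + s) x = wgt r x * wgt s x.
Proof. by rewrite /wgt mulrDl opprD expRD. Qed.
Lemma wgt0 x : wgt 0 x = 1. Proof. by rewrite /wgt mul0r oppr0 expR0. Qed.
Lemma wgtM r x y : 0 < x -> 0 < y -> wgt r (x * y) = wgt r x * wgt r y.
Proof. by move=> x0 y0; rewrite /wgt lnM ?posrE // mulrDr opprD expRD. Qed.
Lemma wgt1 r : wgt r 1 = 1. Proof. by rewrite /wgt ln1 mulr0 oppr0 expR0. Qed.
Lemma wgt_le r s x : 1 <= x -> s <= r -> wgt r x <= wgt s x.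
Proof. by move=> x1 sr; rewrite ler_expR lerN2 ler_wpM2r // ln_ge0. Qed.
Lemma wgt1r x : 0 < x -> wgt 1 x = x^-1.
Proof. by move=> x0; rewrite /wgt mul1r expRN lnK. Qed.
End Weight.

Section Symbols.
Variables (R : realType) (m : nat) (Par : Type).
Local Notation V := 'rV[R]_m.
Implicit Types (F G : Par -> V -> R) (r s : R) (p : V).

Definition far : set V := [set p | 1 < enorm p].

Lemma open_far : open far.
Proof.
rewrite (_ : far = (@enorm R m) @^-1` [set x | 1 < x]) //.
apply: open_comp; last exact: open_gt.
by move=> x _; exact: enorm_continuous.
Qed.

Lemma far_nonzero p : far p -> p != 0.
Proof. by rewrite -enorm_gt0; apply: lt_trans. Qed.

Definition sym_bound r F := exists2 C : R, 0 <= C &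
  forall a p, far p -> `|F a p| <= C * wgt r (enorm p).

(* Symbols of order -r outside the unit ball: the derivatives of order k <= N
   are O(|p|^(-r-k)), uniformly in the parameter. *)
Fixpoint Sym (N : nat) r F : Prop :=
  match N with
  | 0%N => sym_bound r F
  | N'.+1 => [/\ sym_bound r F, (forall a p, far p -> differentiable (F a) p) &
                 forall i, Sym N' (r + 1) (fun a => pd i (F a))]
  end.

Lemma SymS N r F : Sym N.+1 r F ->
  [/\ sym_bound r F, (forall a p, far p -> differentiable (F a) p) &
      forall i, Sym N (r + 1) (fun a => pd i (F a))].
Proof. by []. Qed.

Lemma Sym_sym_bound N r F : Sym N r F -> sym_bound r F.
Proof. by case: N => [|N] // [].  Qed.

Lemma Sym_pred N r F : Sym N.+1 r F -> Sym N r F.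
Proof.
elim: N r F => [|N IH] r F; first by case.
by move=> /SymS[bF dF pF]; split=> // i; exact: IH.
Qed.

Lemma Sym_weaken N r s F : s <= r -> Sym N r F -> Sym N s F.
Proof.
have wb r' s' G : s' <= r' -> sym_bound r' G -> sym_bound s' G.
  move=> sr [C C0 h]; exists C => // a p pf; rewrite (le_trans (h a p pf)) //.
  by rewrite ler_wpM2l // wgt_le // ltW.
elim: N r s F => [|N IH] r s F sr; first exact: wb.
move=> /SymS[bF dF pF]; split=> //; first exact: wb bF.
by move=> i; apply: IH (pF i); rewrite lerD2r.
Qed.

Lemma Sym_ext N r F G : (forall a p, far p -> F a p = G a p) -> Sym N r F -> Sym N r G.
Proof.
elim: N r F G => [|N IH] r F G FG.
  by move=> [C C0 h]; exists C => // a p pf; rewrite -FG //; exact: h.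
move=> /SymS[[C C0 h] dF pF]; split.
- by exists C => // a p pf; rewrite -FG //; exact: h.
- move=> a p pf; apply: near_eq_differentiable (dF a p pf).
  by apply: (open_near_eq open_far pf) => q; exact: FG.
- move=> i; apply: IH (pF i) => a p pf; apply: near_eq_pd.
  by apply: (open_near_eq open_far pf) => q; exact: FG.
Qed.

Lemma SymD N r F G : Sym N r F -> Sym N r G -> Sym N r (fun a p => F a p + G a p).
Proof.
have bD r' F' G' : sym_bound r' F' -> sym_bound r' G' -> sym_bound r' (fun a p => F' a p + G' a p).
  move=> [C C0 h] [D D0 k]; exists (C + D); first exact: addr_ge0.
  move=> a p pf; rewrite (le_trans (ler_normD _ _)) // mulrDl lerD //; [exact: h|exact: k].
elim: N r F G => [|N IH] r F G; first exact: bD.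
move=> /SymS[bF dF pF] /SymS[bG dG pG]; split.
- exact: bD.
- by move=> a p pf; apply: differentiableD; [exact: dF|exact: dG].
- move=> i; apply: Sym_ext (IH _ _ _ (pF i) (pG i)) => a p pf.
  by rewrite pdD //; [exact: dF|exact: dG].
Qed.

Lemma SymN N r F : Sym N r F -> Sym N r (fun a p => - F a p).
Proof.
elim: N r F => [|N IH] r F.
  by move=> [C C0 h]; exists C => // a p pf; rewrite normrN; exact: h.
move=> /SymS[[C C0 h] dF pF]; split.
- by exists C => // a p pf; rewrite normrN; exact: h.
- by move=> a p pf; apply: differentiableN; exact: dF.
- move=> i; apply: Sym_ext (IH _ _ (pF i)) => a p pf.
  by rewrite pdN //; exact: dF.
Qed.

Lemma SymM N r s F G : Sym N r F -> Sym N s G -> Sym N (r + s) (fun a p => F a p * G a p).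
Proof.
have bM r' s' F' G' : sym_bound r' F' -> sym_bound s' G' ->
    sym_bound (r' + s') (fun a p => F' a p * G' a p).
  move=> [C C0 h] [D D0 k]; exists (C * D); first exact: mulr_ge0.
  by move=> a p pf; rewrite normrM wgtD mulrACA ler_pM //; [exact: h|exact: k].
elim: N r s F G => [|N IH] r s F G; first exact: bM.
move=> hF hG; have [bF dF pF] := SymS hF; have [bG dG pG] := SymS hG; split.
- exact: bM.
- by move=> a p pf; apply: differentiableM; [exact: dF|exact: dG].
- move=> i.
  have h1 := IH _ _ _ _ (Sym_pred hF) (pG i).
  have h2 := IH _ _ _ _ (Sym_pred hG) (pF i).
  rewrite addrA in h1; rewrite addrA [s + r]addrC in h2.
  apply: Sym_ext (SymD h1 h2) => a p pf.
  by rewrite pdM //; [exact: dF|exact: dG].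
Qed.

Lemma Sym_zero N r : Sym N r (fun (_ : Par) (_ : V) => 0 : R).
Proof.
have b0 r' : sym_bound r' (fun (_ : Par) (_ : V) => 0 : R).
  by exists 0 => // a p _; rewrite normr0 mul0r.
elim: N r => [|n IH] r; first exact: b0.
split; first exact: b0.
  by move=> a p _; exact: differentiable_cst.
by move=> i; apply: Sym_ext (IH _) => a p _; rewrite /pd derive_cst.
Qed.

Lemma Sym_cst N (c : Par -> R) (C : R) : (forall a, `|c a| <= C) ->
  Sym N 0 (fun a (_ : V) => c a).
Proof.
move=> cC; have bc : sym_bound 0 (fun a (_ : V) => c a).
  by exists `|C| => // a p _; rewrite wgt0 mulr1 (le_trans (cC a)) // ler_norm.
case: N => [|N]; first exact: bc.
split; first exact: bc.
  by move=> a p _; exact: differentiable_cst.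
by move=> i; apply: Sym_ext (Sym_zero _ _) => a p _; rewrite /pd derive_cst.
Qed.

Lemma Sym_sum N r (I : Type) (l : seq I) (F : I -> Par -> V -> R) :
  (forall i, Sym N r (F i)) -> Sym N r (fun a p => \sum_(i <- l) F i a p).
Proof.
move=> h; elim: l => [|i l IH].
  by apply: Sym_ext (Sym_zero _ _) => a p _; rewrite big_nil.
by apply: Sym_ext (SymD (h i) IH) => a p _; rewrite big_cons.
Qed.

(** Homogeneity of degree - r: the sign follows [wgt], so that r measures decay. *)
Definition homog r (G : V -> R) :=
  forall p (t : R), p != 0 -> 0 < t -> G (t *: p) = wgt r t * G p.

Lemma homog_pd r (G : V -> R) i : (forall p, p != 0 -> differentiable G p) ->
  homog r G -> homog (r + 1) (pd i G).
Proof.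
move=> dG hG p t p0 t0.
have tp0 : t *: p != 0 by rewrite scaler_eq0 negb_or gt_eqF.
have dt j : differentiable (fun q : V => (t *: q) 0 j) p.
  rewrite (_ : (fun q => _) = fun q : V => t * q 0 j).
    apply: differentiableM; [exact: differentiable_cst|exact: differentiable_coord].
  by apply/funext => q; rewrite mxE.
have dj j : 'D_(ev i) (fun q : V => (t *: q) 0 j) p = t * (i == j)%:R.
  rewrite (_ : (fun q => _) = fun q : V => t * q 0 j); last by apply/funext => q; rewrite mxE.
  rewrite derM; [|exact: derivable_cst|exact/diff_derivable/differentiable_coord].
  by rewrite derive_cst mulr0 addr0 -/(pd i _ _) pd_coord.
have E1 : pd i (fun q => G (t *: q)) p = t * pd i G (t *: p).
  have dX : differentiable (fun q : V => t *: q) p by exact: differentiable_rowP.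
  rewrite /pd (derive_comp_row (ev i) dX (dG _ tp0)).
  rewrite (bigD1 i) //= dj eqxx mulr1 big1 ?addr0 => [|j ji]; first by rewrite mulrC.
  by rewrite dj eq_sym (negbTE ji) !mulr0.
have E2 : pd i (fun q => G (t *: q)) p = wgt r t * pd i G p.
  rewrite (near_eq_pd (G := fun q => wgt r t * G q)).
    rewrite /pd derM; [|exact: derivable_cst|exact/diff_derivable/dG].
    by rewrite derive_cst mulr0 addr0.
  by apply: (open_near_eq (@open_nonzero R m) p0) => q q0; exact: hG.
apply: (@mulfI _ t); first by rewrite gt_eqF.
by rewrite -E1 E2 wgtD wgt1r // mulrA mulrCA mulfV ?mulr1 // gt_eqF.
Qed.

(** The maximum over the compact unit sphere bounds G everywhere by homogeneity, and each derivative
    is again homogeneous, of one degree less. *)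
Lemma homog_Sym N r (G : V -> R) : smooth (@nonzero R m) G -> homog r G ->
  Sym N r (fun _ : Par => G).
Proof.
have hb r' (H : V -> R) : Dn 0 (@nonzero R m) H -> homog r' H -> sym_bound r' (fun _ : Par => H).
  move=> cH hH; pose S := [set p : V | enorm p = 1].
  have S_n0 p : S p -> p != 0 by move=> /= p1; rewrite -enorm_eq0 p1 oner_eq0.
  have cS : compact S.
    apply: bounded_closed_compact.
      exists 1; split; first exact: num_real.
      by move=> x x1 p /= p1; rewrite (le_trans (norm_le_enorm _)) // p1 ltW.
    rewrite (_ : S = (@enorm R m) @^-1` [set 1]) //.
    apply: closed_comp; first by move=> p _; exact: enorm_continuous.
    by apply: accessible_closed_set1; exact/hausdorff_accessible/norm_hausdorff.
  (* The sphere is empty in dimension 0. *)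
  have [S0|/set0P S0] := eqVneq S set0.
    exists 0 => // _ p /far_nonzero p0; exfalso.
    have : S (normalize p) by rewrite /S /= /normalize enormZ gtr0_norm ?invr_gt0 ?enorm_gt0 // mulVf // enorm_eq0.
    by rewrite S0.
  have [|c _ hc] := compact_EVT_max S0 cS (f := fun p => `|H p|).
    rewrite continuous_subspace_in => p; rewrite inE => Sp.
    apply: continuous_subspaceT_for => //.
    apply: (@continuous_comp _ _ _ H (fun x => `|x|)); first exact/cH/S_n0.
    exact: norm_continuous.
  exists `|H c| => // _ p pf; have p0 := far_nonzero pf.
  have pE : p = enorm p *: normalize p.
    by rewrite /normalize scalerA mulfV ?scale1r // enorm_eq0.
  have Sn : S (normalize p) by rewrite /S /= /normalize enormZ gtr0_norm ?invr_gt0 ?enorm_gt0 // mulVf // enorm_eq0.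
  rewrite {1}pE hH ?enorm_gt0 //; last exact: S_n0.
  rewrite normrM (gtr0_norm (wgt_gt0 _ _)) mulrC ler_wpM2r ?wgt_ge0 //.
  by apply: hc; rewrite inE.
elim: N r G => [|N IH] r G sG hG; first by apply: hb => //; exact: sG.
have dG p : p != 0 -> differentiable G p by move=> p0; exact: (DnS (sG 1)).1.
split; first by apply: hb => //; exact: sG.
  by move=> _ p /far_nonzero; exact: dG.
move=> i; apply: IH; last exact: homog_pd.
by move=> k; exact: (DnS (sG k.+1)).2.
Qed.

(* Profiles whose derivatives of order at most N are O(exp (- r L)), so that
   b (ln |p|) is a symbol of order -r (Wf_Sym). *)
Fixpoint Wf (N : nat) r (b : Par -> R -> R) : Prop :=
  (exists2 C : R, 0 <= C & forall a (L : R), 0 < L -> `|b a L| <= C * expR (- (r * L))) /\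
  match N with
  | 0%N => True
  | N'.+1 => exists2 b', (forall a (L : R), 0 < L -> is_derive L (1 : R) (b a) (b' a L)) &
             Wf N' r b'
  end.

(** These functions are the components of the gradient of ln |p|. *)
Lemma coord_over_sqr j : smooth (@nonzero R m) (fun p => p 0 j * (dotp p p)^-1) /\
  homog 1 (fun p : V => p 0 j * (dotp p p)^-1).
Proof.
split=> [k|p t p0 t0].
  have on := @open_nonzero R m.
  apply: DnM => //; first exact: Dn_coord.
  apply: DnV => // [p p0|]; first by rewrite gt_eqF // dotp_gt0.
  by apply: Dn_sum => // i; apply: DnM => //; exact: Dn_coord.
rewrite mxE dotpZl dotpZr wgt1r //; have := dotp_gt0 p0; set s := dotp p p => s0.
by field; rewrite !gt_eqF.
Qed.

Lemma pd_ln_enorm j p : p != 0 ->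
  differentiable (fun q : V => ln (enorm q)) p /\
  pd j (fun q : V => ln (enorm q)) p = p 0 j * (dotp p p)^-1.
Proof.
move=> p0; have e0 : 0 < enorm p by rewrite enorm_gt0.
have dd : differentiable (fun q : V => dotp q q) p.
  rewrite (_ : (fun q => _) = \sum_i (fun q : V => q 0 i * q 0 i)).
    by apply: differentiable_sum => i; apply: differentiableM; exact: differentiable_coord.
  by apply/funext => q; rewrite fct_sumE.
have Ed : pd j (fun q : V => dotp q q) p = 2 * p 0 j.
  rewrite (_ : (fun q => _) = \sum_i (fun q : V => q 0 i * q 0 i)); last first.
    by apply/funext => q; rewrite fct_sumE.
  rewrite /pd derive_sum; last first.
    by move=> i; apply: derivableM; exact/diff_derivable/differentiable_coord.
  rewrite (bigD1 j) //= big1 => [|i ij].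
    rewrite derM; [|exact/diff_derivable/differentiable_coord|exact/diff_derivable/differentiable_coord].
    by rewrite -/(pd j _ _) pd_coord eqxx mulr1 addr0; ring.
  rewrite derM; [|exact/diff_derivable/differentiable_coord|exact/diff_derivable/differentiable_coord].
  by rewrite -/(pd j _ _) pd_coord eq_sym (negbTE ij) mulr0 addr0.
pose g (x : R) := ln (Num.sqrt x).
have d0 : 0 < dotp p p by exact: dotp_gt0.
have dg : is_derive (dotp p p) (1:R) g (2 * dotp p p)^-1.
  have d1 := is_derive1_sqrt d0.
  have d2 : is_derive (Num.sqrt (dotp p p)) (1:R) (@ln R) (Num.sqrt (dotp p p))^-1.
    by apply: is_derive1_ln; rewrite sqrtr_gt0.
  have d3 := is_derive1_comp d2 d1.
  apply: (is_derive_eq d3); rewrite -[in RHS](sqr_sqrtr (ltW d0)).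
  have s0 : Num.sqrt (dotp p p) != 0 by rewrite gt_eqF // sqrtr_gt0.
  by field.
have dgd : differentiable g (dotp p p) by apply/derivable1_diffP; case: dg.
have dl : differentiable (fun q : V => ln (enorm q)) p.
  exact: (@differentiable_comp _ _ _ _ (fun q : V => dotp q q) g).
split=> //; rewrite /pd deriveE //.
rewrite (@diff_comp _ _ _ _ (fun q : V => dotp q q) g) //= -(deriveE _ dd) -/(pd j _ _) Ed.
rewrite -[X in 'd g _ X]mulr1 linearZ /= -deriveE //.
have [_ ->] := dg; rewrite [_ *: _](_ : _ = 2 * p 0 j * (2 * dotp p p)^-1) //.
by field; rewrite gt_eqF.
Qed.

(** Differentiating b (ln |p|) keeps the decay of the profile and multiplies by the gradient of ln
    |p|, a symbol of order - 1: this is where each derivative gains a power of |p|. *)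
Lemma Wf_Sym N r (b : Par -> R -> R) : Wf N r b -> Sym N r (fun a p => b a (ln (enorm p))).
Proof.
have lnp p : far p -> 0 < ln (enorm p) by move=> pf; rewrite ln_gt0.
have bb r' b' : (exists2 C : R, 0 <= C & forall a (L : R), 0 < L -> `|b' a L| <= C * expR (- (r' * L))) ->
    sym_bound r' (fun (a : Par) p => b' a (ln (enorm p))).
  by move=> [C C0 h]; exists C => // a p pf; apply: h; exact: lnp.
elim: N r b => [|N IH] r b; first by move=> [hb _]; exact: bb.
move=> [hb [b' db' hb']].
have d1 a p : far p -> differentiable (b a) (ln (enorm p)).
  by move=> pf; apply/derivable1_diffP; case: (db' a _ (lnp p pf)).
have d2 p : far p -> differentiable (fun q : V => ln (enorm q)) p.
  move=> /far_nonzero p0; suff [j _] : exists j, p 0 j != 0 by exact: (pd_ln_enorm j p0).1.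
  apply: contrapT => h; move/eqP: p0; apply; apply/rowP => i; rewrite mxE.
  by apply: contrapT => /eqP hi; apply: h; exists i.
split; first exact: bb.
  move=> a p pf; apply: (@differentiable_comp _ _ _ _ (fun q : V => ln (enorm q)) (b a)).
    exact: d2.
  exact: d1.
move=> j; have [s1 h1] := coord_over_sqr j.
apply: Sym_ext (SymM (IH _ _ hb') (homog_Sym N s1 h1)) => a p pf.
have [dl El] := pd_ln_enorm j (far_nonzero pf).
rewrite /pd deriveE; last first.
  by apply: (@differentiable_comp _ _ _ _ (fun q : V => ln (enorm q)) (b a)) => //; exact: d1.
rewrite (@diff_comp _ _ _ _ (fun q : V => ln (enorm q)) (b a)) //=; last exact: d1.
rewrite -(deriveE _ dl) -/(pd j _ _) El.
rewrite -[X in 'd (b a) _ X]mulr1 linearZ /= -deriveE; last exact: d1.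
have [_ ->] := db' a _ (lnp p pf).
by rewrite mulrC.
Qed.

End Symbols.

(** * Finite differences *)

Section Differences.
Variable R : realType.

Fixpoint diffn (n : nat) (g : nat -> R) : R :=
  match n with
  | 0%N => g 0%N
  | n'.+1 => diffn n' (fun j => g j.+1) - diffn n' g
  end.

Lemma eq_diffn n (g h : nat -> R) : (forall j, (j <= n)%N -> g j = h j) -> diffn n g = diffn n h.
Proof.
elim: n g h => [|n IH] g h gh /=; first exact: gh.
by rewrite (IH _ (fun j => h j.+1)) ?(IH g h) // => j jn; apply: gh => //; exact: ltnW.
Qed.

Lemma diffnD n (g h : nat -> R) : diffn n (fun j => g j + h j) = diffn n g + diffn n h.
Proof. by elim: n g h => [|n IH] g h //=; rewrite !IH; ring. Qed.

Lemma diffnZ n (c : R) (g : nat -> R) : diffn n (fun j => c * g j) = c * diffn n g.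
Proof. by elim: n g => [|n IH] g //=; rewrite !IH; ring. Qed.

Lemma diffnB n (g h : nat -> R) : diffn n (fun j => g j - h j) = diffn n g - diffn n h.
Proof. by elim: n g h => [|n IH] g h //=; rewrite !IH; ring. Qed.

Lemma diffn_cst0 n (c : R) : diffn n.+1 (fun=> c) = 0.
Proof. by rewrite /= subrr. Qed.

Lemma diffn_step n (s c : R) : diffn n.+1 (fun j => if j is 0%N then s else c) = (-1) ^+ n.+1 * (s - c).
Proof.
have z0 k : diffn k (fun=> 0) = 0 by elim: k => //= k ->; rewrite subrr.
have E k : diffn k (fun j => if j is 0%N then s - c else 0) = (-1) ^+ k * (s - c).
  by elim: k => [|k IH] /=; rewrite ?expr0 ?mul1r // z0 IH exprS; ring.
rewrite -E -[RHS]addr0 -[X in _ = _ + X](diffn_cst0 n c) -diffnD.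
by apply: eq_diffn => -[|j] _ /=; rewrite ?subrK ?add0r.
Qed.

Lemma diffn_bound n (g : nat -> R) (C : R) : (forall j, (j <= n)%N -> `|g j| <= C) ->
  `|diffn n g| <= 2 ^+ n * C.
Proof.
elim: n g => [|n IH] g h /=; first by rewrite expr0 mul1r; exact: h.
rewrite (le_trans (ler_normB _ _)) // exprS -mulrA mulr_natl mulr2n lerD //.
  by apply: IH => j jn; exact: h.
by apply: IH => j jn; apply: h; exact: leqW.
Qed.

(** Induction on n applied to psi i t = phi i (t + 1) - phi i t: by the mean value theorem psi n t
    is a value of phi n.+1 on an interval of length 1. *)
Lemma diffn_MVT n (phi : nat -> R -> R) (a M : R) :
  (forall i t, (i < n)%N -> a <= t <= a + n%:R -> is_derive t (1:R) (phi i) (phi i.+1 t)) ->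
  (forall t, a <= t <= a + n%:R -> `|phi n t| <= M) ->
  `|diffn n (fun j => phi 0%N (a + j%:R))| <= M.
Proof.
elim: n phi => [|n IH] phi hd hM /=; first by apply: hM; rewrite addr0 lexx.
have n1 : n.+1%:R = n%:R + 1 :> R by rewrite -natr1.
rewrite -diffnB.
pose psi i t := phi i (t + 1) - phi i t.
rewrite (@eq_diffn _ _ (fun j => psi 0%N (a + j%:R))); last first.
  by move=> j _; rewrite /psi -addrA natr1.
apply: IH => [i t iN /andP[t1 t2]|t /andP[t1 t2]].
  have h1 : is_derive (t + 1) (1 : R) (phi i) (phi i.+1 (t + 1)).
    by apply: hd; [exact: ltnW|rewrite n1; lra].
  have h2 : is_derive t (1 : R) (phi i) (phi i.+1 t).
    by apply: hd; [exact: ltnW|rewrite n1; lra].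
  have h3 : is_derive t (1 : R) (fun t => t + 1) 1.
    by have := is_deriveD (is_derive_id t (1:R)) (is_derive_cst (1:R) t (1:R)); rewrite addr0.
  have h4 := is_derive1_comp (f := phi i) (g := fun t : R => t + 1) h1 h3.
  by apply: (is_derive_eq (is_deriveB h4 h2)); rewrite mulr1.
have [|||c] := @MVT_segment R (phi n) (phi n.+1) t (t + 1).
- by rewrite lerDl.
- move=> x; rewrite in_itv /= => /andP[x1 x2]; apply: hd => //.
  by rewrite n1; apply/andP; split; lra.
- apply: derivable_within_continuous => x; rewrite in_itv /= => /andP[x1 x2].
  have : is_derive x (1:R) (phi n) (phi n.+1 x).
    by apply: hd => //; rewrite n1; apply/andP; split; lra.
  by case.
rewrite in_itv /= => /andP[c1 c2] E.
rewrite /psi E [t + 1]addrC addrK mulr1; apply: hM.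
by rewrite n1; apply/andP; split; lra.
Qed.

Lemma wgt_comparable (s x z : R) : 0 < z -> z / 2 <= x -> x <= 2 * z ->
  wgt s x <= expR (`|s| * ln 2) * wgt s z.
Proof.
move=> z0 zx xz; have x0 : 0 < x by rewrite (lt_le_trans _ zx) // divr_gt0.
have l1 : ln x <= ln 2 + ln z by rewrite -lnM ?posrE // ler_ln ?posrE // mulr_gt0.
have l2 : ln z - ln 2 <= ln x.
  by rewrite -ln_div ?posrE // ler_ln ?posrE // divr_gt0.
rewrite /wgt -expRD ler_expR.
have : `|s * (ln x - ln z)| <= `|s| * ln 2.
  by rewrite normrM ler_wpM2l // ler_norml; apply/andP; split; lra.
by rewrite ler_norml => /andP[h1 h2]; rewrite mulrBr in h1 h2; lra.
Qed.

End Differences.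

Section SymbolEstimate.
Variables (R : realType) (m : nat).
Local Notation V := 'rV[R]_m.
Variables (K : set V) (X : V -> V).
Hypotheses (bK : body K X) (K0 : K !=set0).
Variable Par : Type.
Implicit Types (p y : V) (F : Par -> V -> R) (r : R).
Local Notation pv := (pvec bK K0).
Local Notation dst := (dist bK K0).
Local Notation A := (Mi X).

Lemma X_homog j : homog 0 (fun p : V => X p 0 j).
Proof. by move=> p t p0 t0; rewrite (support_homog bK) // wgt0 mul1r. Qed.

Lemma DX_smooth i j : smooth (@nonzero R m) (pd i (fun p : V => X p 0 j)).
Proof. by move=> k; exact: (DnS (sm_smooth (body_support bK) j k.+1)).2. Qed.

Lemma Jm_smooth i j : smooth (@nonzero R m) (fun p => Jm X p i j).
Proof.
move=> k; apply: (@Dn_ext _ _ _ _ (fun p => (i == j)%:R + pd i (fun q => X q 0 j) p)).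
- exact: open_nonzero.
- by move=> p _; rewrite !mxE.
- by apply: DnD; [exact: open_nonzero|exact: Dn_cst|exact: DX_smooth].
Qed.

Lemma Mi_smooth i j : smooth (@nonzero R m) (fun p => A p i j).
Proof.
move=> k; apply: Dn_invmx; first exact: open_nonzero.
  by move=> p p0; exact: (Jm_unit bK).
by move=> a b; exact: Jm_smooth.
Qed.

Lemma pd_Jm k i j p : p != 0 ->
  pd k (fun p => Jm X p i j) p = pd k (pd i (fun q => X q 0 j)) p.
Proof.
move=> p0; rewrite (near_eq_pd (G := fun p => (i == j)%:R + pd i (fun q => X q 0 j) p)).
  rewrite pdD; [|exact: differentiable_cst|exact: (DnS (DX_smooth i j 1)).1].
  by rewrite /pd derive_cst add0r.
by apply: (open_near_eq (@open_nonzero R m) p0) => q _; rewrite !mxE.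
Qed.

(** Differentiating A J = 1 gives dA = - A (dJ) A. *)
Lemma pd_Mi k i j p : p != 0 -> pd k (fun p => A p i j) p =
  - \sum_b (\sum_a A p i a * pd k (pd a (fun q => X q 0 b)) p) * A p b j.
Proof.
move=> p0.
have dA a b : differentiable (fun p => A p a b) p by exact: (DnS (Mi_smooth a b 1)).1.
have dJ a b : differentiable (fun p => Jm X p a b) p by exact: (DnS (Jm_smooth a b 1)).1.
pose dAm : 'M[R]_m := \matrix_(a, b) pd k (fun p => A p a b) p.
pose dJm : 'M[R]_m := \matrix_(a, b) pd k (pd a (fun q => X q 0 b)) p.
have E : dAm *m Jm X p + A p *m dJm = 0.
  apply/matrixP => a b; rewrite !mxE -big_split /=.
  have : pd k (fun p => \sum_c A p a c * Jm X p c b) p = 0.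
    rewrite (near_eq_pd (G := fun=> (a == b)%:R)); first by rewrite /pd derive_cst.
    apply: (open_near_eq (@open_nonzero R m) p0) => q q0.
    have := congr1 (fun M : 'M[R]_m => M a b) (mulVmx (Jm_unit bK q0)).
    by rewrite !mxE.
  pose g c q := A q a c * Jm X q c b.
  rewrite (_ : (fun p => _) = \sum_c g c); last by apply/funext => q; rewrite fct_sumE.
  rewrite /pd derive_sum => [H|c]; last by apply: derivableM; exact: diff_derivable.
  rewrite -[RHS]H.
  apply: eq_bigr => c _; rewrite derM; [|exact: diff_derivable|exact: diff_derivable].
  by rewrite -!/(pd k _ p) pd_Jm // !mxE addrC [in RHS]mulrC; congr (_ + _); rewrite mulrC.
have {}E : dAm = - (A p *m dJm *m A p).
  rewrite -[dAm]mulmx1 -(mulmxV (Jm_unit bK p0)) mulmxA -mulNmx; congr (_ *m _).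
  by apply/eqP; rewrite -addr_eq0 E.
have := congr1 (fun M : 'M[R]_m => M i j) E; rewrite !mxE => ->; congr (- _).
by apply: eq_bigr => b _; rewrite !mxE; congr (_ * _); apply: eq_bigr => a _; rewrite !mxE.
Qed.

Lemma DX_Sym N i j : Sym N 1 (fun _ : Par => pd i (fun p : V => X p 0 j)).
Proof.
apply: homog_Sym; first exact: DX_smooth.
rewrite -[1]add0r; apply: homog_pd; last exact: X_homog.
by move=> p p0; exact: (X_differentiable bK).
Qed.

Lemma D2X_Sym N k i j : Sym N 2 (fun _ : Par => pd k (pd i (fun p : V => X p 0 j))).
Proof. by have [_ _] := SymS (DX_Sym N.+1 i j); move=> /(_ k). Qed.

(** The matrix 1 + DX is not homogeneous, so [homog_Sym] does not apply. The size comes from the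
    contraction bound; a derivative of [Mi] contains a second derivative of X, of order - 2, which
    is more than the order - 1 asked for. *)
Lemma Mi_Sym N i j : Sym N 0 (fun (_ : Par) p => A p i j).
Proof.
have b0 a b : sym_bound 0 (fun (_ : Par) p => A p a b).
  by exists 1 => // _ p /far_nonzero p0; rewrite wgt0 mulr1; exact: (Mi_le1 bK).
elim: N i j => [|N IH] i j; first exact: b0.
split; first exact: b0.
  by move=> _ p /far_nonzero; exact: (DnS (Mi_smooth i j 1)).1.
move=> k; apply: (@Sym_weaken _ _ _ _ 2); first by lra.
apply: (@Sym_ext _ _ _ _ _ (fun (_ : Par) p => - \sum_b (\sum_a A p i a * pd k (pd a (fun q => X q 0 b)) p) * A p b j)).
  by move=> _ p /far_nonzero p0; rewrite pd_Mi.
apply: SymN; apply: Sym_sum => b; rewrite -[2]addr0; apply: SymM; last exact: IH.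
by apply: Sym_sum => a; rewrite -[2]add0r; apply: SymM; [exact: IH|exact: D2X_Sym].
Qed.

Variable u : Par -> V.

(* [Mi X (pvec y)] is the Jacobian matrix of [pvec] at y, so this is the
   derivative of [F a (pvec y)] in the direction [u a]. *)
Definition Top F : Par -> V -> R := fun a p => \sum_i pd i (F a) p * (u a *m A p) 0 i.

Lemma Top_Sym N r F (B : R) : (forall a, enorm (u a) <= B) -> Sym N.+1 r F -> Sym N (r + 1) (Top F).
Proof.
move=> uB /SymS[_ _ pF]; apply: Sym_sum => i; rewrite -[r + 1]addr0; apply: SymM => //.
apply: (@Sym_ext _ _ _ _ _ (fun a p => \sum_j u a 0 j * A p j i)).
  by move=> a p _; rewrite mxE.
apply: Sym_sum => j; rewrite -[0]addr0; apply: SymM; last exact: Mi_Sym.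
apply: (@Sym_cst _ _ _ _ _ B) => a.
by rewrite (le_trans (norm_coord_le _ _)) // (le_trans (norm_le_enorm _)).
Qed.

Lemma iter_Top_Sym N i r F (B : R) : (forall a, enorm (u a) <= B) ->
  Sym (N + i) r F -> Sym N (r + i%:R) (iter i Top F).
Proof.
move=> uB; elim: i N => [|i IH] N; first by rewrite addn0 addr0.
rewrite addnS -addSn => /IH /(Top_Sym uB); rewrite /=.
by rewrite -addrA natr1.
Qed.

Lemma line_Top F a y (t : R) : far (pv (y + t *: u a)) ->
  differentiable (F a) (pv (y + t *: u a)) ->
  is_derive t (1 : R) (fun t => F a (pv (y + t *: u a))) (Top F a (pv (y + t *: u a))).
Proof.
move=> pf dF; set z := y + t *: u a in pf dF *.
have nK : ~ K z.
  apply/(dist_gt0 bK K0); exact: lt_trans pf.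
have [dp pE] := pvec_differentiable bK K0 nK.
have E : 'D_(u a) (fun y => F a (pv y)) z = Top F a (pv z).
  rewrite (derive_comp_row (u a) dp dF); apply: eq_bigr => i _; congr (_ * _).
  rewrite -derive_row_coord; last exact: diff_derivable.
  by rewrite deriveE // pE.
rewrite -E; apply: is_derive_line.
apply: diff_derivable; exact: (@differentiable_comp _ _ _ _ pv (F a)).
Qed.

(** The derivatives of F a (pvec (y + t u)) in t are the iterates of [Top], each of which gains one
    order; [diffn_MVT] concludes. M is any bound for the weight along the segment. *)
Lemma symbol_diff N r F (B : R) : (forall a, enorm (u a) <= B) -> Sym N r F ->
  exists2 C : R, 0 <= C & forall a y M,
    (forall t, 0 <= t <= N%:R -> far (pv (y + t *: u a))) ->
    (forall t, 0 <= t <= N%:R -> wgt (r + N%:R) (dst (y + t *: u a)) <= M) ->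
    `|diffn N (fun j => F a (pv (y + j%:R *: u a)))| <= C * M.
Proof.
move=> uB hF.
have [C C0 hC] : sym_bound (r + N%:R) (iter N Top F).
  by apply: (@Sym_sym_bound _ _ _ 0); exact: iter_Top_Sym uB _.
exists C => // a y M hfar hM.
have := @diffn_MVT R N (fun i t => iter i Top F a (pv (y + t *: u a))) 0 (C * M).
rewrite (@eq_diffn _ _ _ (fun j => F a (pv (y + j%:R *: u a)))); last by move=> j _; rewrite add0r.
apply=> [i t iN|t]; rewrite add0r => tN.
  apply: line_Top; first exact: hfar.
  have : Sym (N - i) (r + i%:R) (iter i Top F).
    by apply: iter_Top_Sym uB _; rewrite subnK // ltnW.
  rewrite -[(N - i)%N]prednK ?subn_gt0 // => /SymS[_ dF _]; apply: dF; exact: hfar.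
rewrite (le_trans (hC _ _ (hfar t tN))) // ler_wpM2l //; exact: hM.
Qed.

(** The threshold ensures that the points y + t u with 0 <= t <= N, which are at most N B away from
    y, have distance between [dst y / 2] and [2 * dst y], and above 1: the weights are comparable
    and the symbol estimates apply. *)
Lemma radial_diff N r (b : Par -> R -> R) (B : R) : 0 <= B ->
  (forall a, enorm (u a) <= B) -> Wf N r b ->
  exists2 C : R, 0 <= C & forall a y, 2 * (N%:R * B + 2) <= dst y ->
    `|diffn N (fun j => b a (ln (dst (y + j%:R *: u a))))| <= C * wgt (r + N%:R) (dst y).
Proof.
move=> B0 uB /(@Wf_Sym _ m) hF; have [C C0 hC] := symbol_diff uB hF.
exists (C * expR (`|r + N%:R| * ln 2)); first by rewrite mulr_ge0 // expR_ge0.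
move=> a y yR; rewrite -mulrA.
have NB : 0 <= N%:R * B by rewrite mulr_ge0.
have near_y t : 0 <= t <= N%:R -> dst y / 2 <= dst (y + t *: u a) <= 2 * dst y.
  move=> /andP[t0 tN]; have := dist_lip bK K0 (y + t *: u a) y.
  rewrite (_ : y + t *: u a - y = t *: u a); last by rewrite addrC addKr.
  rewrite enormZ (ger0_norm t0) => h.
  have : t * enorm (u a) <= N%:R * B by rewrite ler_pM ?enorm_ge0.
  move=> /(le_trans h); rewrite ler_norml => /andP[h1 h2].
  by apply/andP; split; lra.
have dy0 : 0 < dst y by lra.
apply: hC => t tN; have /andP[h1 h2] := near_y t tN.
  by rewrite /far /= -/(dst _); lra.
exact: wgt_comparable.
Qed.

End SymbolEstimate.

(** * Lebesgue measure on row vectors *)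

Definition rv_display : measure_display. Proof. exact: default_measure_display. Qed.

Section RowMeasurable.
Variables (R : realType) (n : nat).
Local Notation V := 'rV[R]_n.

(** The coordinates generate the sigma-algebra, which makes [rowcons] measurable both ways;
    [measurable_open] recovers the open sets. *)
Definition coord_sets : set (set V) :=
  [set A | exists i B, measurable (B : set R) /\ A = (fun x : V => x 0 i) @^-1` B].

Let rv0 : <<s coord_sets >> set0. Proof. exact: sigma_algebra0. Qed.
Let rvC A : <<s coord_sets >> A -> <<s coord_sets >> (~` A). Proof. exact: sigma_algebraC. Qed.
Let rvU (F : (set V)^nat) : (forall i, <<s coord_sets >> (F i)) ->
  <<s coord_sets >> (\bigcup_i (F i)).
Proof. exact: sigma_algebra_bigcup. Qed.

HB.instance Definition _ := @isMeasurable.Build rv_display V <<s coord_sets >> rv0 rvC rvU.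

Lemma measurable_coord i : measurable_fun setT (fun x : V => x 0 i).
Proof.
by move=> _ B mB; rewrite setTI; apply: sub_sigma_algebra; exists i, B.
Qed.

Lemma measurable_rowP d (T : measurableType d) (f : T -> V) :
  (forall i, measurable_fun setT (fun t => f t 0 i)) -> measurable_fun setT f.
Proof.
move=> mf; apply: (@measurability _ _ _ _ setT f coord_sets) => //.
move=> _ [_ [i [B [mB ->]]] <-]; rewrite setTI.
by have := mf i measurableT _ mB; rewrite setTI.
Qed.

Definition ratbox (qk : 'rV[rat]_n * nat) : set V :=
  [set x | forall i, `|x 0 i - ratr (qk.1 0 i)| < qk.2.+1%:R^-1].

Lemma measurable_ratbox qk : measurable (ratbox qk).
Proof.
rewrite (_ : ratbox qk = \bigcap_(i in [set: 'I_n])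
    ((fun x : V => x 0 i) @^-1` [set t | `|t - ratr (qk.1 0 i)| < qk.2.+1%:R^-1])).
  apply: fin_bigcap_measurable => // i _; rewrite -[X in measurable X]setTI.
  apply: measurable_coord => //; apply: open_measurable.
  rewrite (_ : [set _ | _] = ball (ratr (qk.1 0 i) : R) qk.2.+1%:R^-1); first exact: ball_open.
  by apply/seteqP; split=> t /=; rewrite -ball_normE /= distrC.
by apply/seteqP; split=> [x h i _|x h i]; exact: h.
Qed.

(** An open set is the union of the rational boxes that it contains, of which there are countably
    many. *)
Lemma measurable_open (U : set V) : open U -> measurable U.
Proof.
move=> oU.
pose F k : set V := if unpickle k is Some qk then
  (if `[< ratbox qk `<=` U >] then ratbox qk else set0) else set0.
have -> : U = \bigcup_k F k.
  apply/seteqP; split=> [x Ux|x [k _]]; last first.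
    by rewrite /F; case: unpickle => [qk|//]; case: asboolP => // + h; apply.
  have /nbhs_ballP[e /= e0 he] : nbhs x U by exact: open_nbhs_nbhs.
  (* The box around q contains x, so its points are within twice the radius of x; hence the factor
     2. *)
  have [k hk] : exists k : nat, k.+1%:R^-1 < e / 2
    by exists (Num.truncn (e / 2)^-1); rewrite invf_plt ?posrE ?ltr0n ?divr_gt0 // truncnS_gt.
  have k0 : 0 < k.+1%:R^-1 :> R by rewrite invr_gt0 ltr0n.
  have /choice[q hq] : forall i, exists q : rat, `|x 0 i - ratr q| < k.+1%:R^-1.
    move=> i; have [|q] := @rat_in_itvoo R (x 0 i - k.+1%:R^-1) (x 0 i + k.+1%:R^-1).
      by move: k0; set c := k.+1%:R^-1; lra.
    rewrite in_itv /= => /andP[q1 q2]; exists q; rewrite ltr_norml.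
    by move: q1 q2; set c := k.+1%:R^-1 => q1 q2; apply/andP; split; lra.
  pose qk := (\row_i q i, k).
  have xq : ratbox qk x by move=> i; rewrite /= mxE; exact: hq.
  exists (pickle qk) => //; rewrite /F pickleK; case: asboolP => // -[] y hy.
  apply: he; rewrite -ball_normE /=; apply: (@le_lt_trans _ _ (k.+1%:R^-1 + k.+1%:R^-1)).
    apply: norm_le_coord => [|i]; first by rewrite addr_ge0 // ltW.
    rewrite !mxE -[x 0 i](subrK (ratr (qk.1 0 i))) -addrA (le_trans (ler_normD _ _)) //.
    by rewrite lerD ?(ltW (xq i)) // distrC (ltW (hy i)).
  by move: hk; set c := k.+1%:R^-1; lra.
apply: bigcup_measurable => k _; rewrite /F; case: unpickle => [qk|//].
by case: asboolP => // _; exact: measurable_ratbox.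
Qed.

Lemma continuous_measurable_row (f : V -> R) : continuous f -> measurable_fun setT f.
Proof.
move=> cf; apply: (measurability _ (RGenOpens.measurableE R)).
move=> _ [_ [a [b ->]] <-]; rewrite setTI; apply: measurable_open.
by apply: open_comp => //; exact: interval_open.
Qed.

Lemma measurable_closed (U : set V) : closed U -> measurable U.
Proof.
by move=> cU; rewrite -[U]setCK; apply: measurableC; apply: measurable_open; exact: closed_openC.
Qed.

End RowMeasurable.

Lemma prod_sigma_finite d1 d2 (T1 : measurableType d1) (T2 : measurableType d2) (R : realType)
  (m1 : {sigma_finite_measure set T1 -> \bar R}) (m2 : {sigma_finite_measure set T2 -> \bar R}) :
  sigma_finite setT (m1 \x m2)%E.
Proof.
have /sigma_finiteP[F [TF ndF fF]] := sigma_finiteT m1.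
have /sigma_finiteP[G [TG ndG fG]] := sigma_finiteT m2.
exists (fun k => F k `*` G k) => [|k].
  apply/seteqP; split=> // -[x y] _.
  have [i _ Fx] : (\bigcup_k F k) x by rewrite -TF.
  have [j _ Gy] : (\bigcup_k G k) y by rewrite -TG.
  exists (maxn i j) => //; split => /=.
    by move: Fx; apply/subsetPset/ndF/leq_maxl.
  by move: Gy; apply/subsetPset/ndG/leq_maxr.
have [mF lF] := fF k; have [mG lG] := fG k; split; first exact: measurableX.
by rewrite product_measure1E // lte_mul_pinfty // ge0_fin_numE.
Qed.

Section Split.
Variables (R : realType) (n : nat).
Local Notation leb := (@lebesgue_measure R).

Definition rowcons (z : measurableTypeR R * 'rV[R]_n) : 'rV[R]_n.+1 :=
  row_mx (z.1%:M : 'rV[R]_1) z.2.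
Definition rowuncons (x : 'rV[R]_n.+1) : measurableTypeR R * 'rV[R]_n :=
  (x 0 0, \row_i x 0 (lift ord0 i)).

Lemma rowcons0 z : rowcons z 0 0 = z.1.
Proof.
rewrite /rowcons (_ : 0 = lshift n (0 : 'I_1)); last exact: val_inj.
by rewrite (@row_mxEl _ 1 1 n) mxE eqxx mulr1n.
Qed.

Lemma rowconsS z i : rowcons z 0 (lift ord0 i) = z.2 0 i.
Proof.
rewrite /rowcons (_ : lift ord0 i = rshift 1 i); last exact: val_inj.
by rewrite (@row_mxEr _ 1 1 n).
Qed.

Lemma rowconsK : cancel rowcons rowuncons.
Proof.
move=> [a y]; rewrite /rowuncons rowcons0; congr (_, _).
by apply/rowP => i; rewrite mxE rowconsS.
Qed.

Lemma measurable_rowcons : measurable_fun setT rowcons.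
Proof.
apply: measurable_rowP => i; have [j ->|->] := unliftP ord0 i.
  rewrite (_ : (fun t => _) = (fun y : 'rV[R]_n => y 0 j) \o snd); last first.
    by apply/funext => t /=; rewrite rowconsS.
  by apply: measurableT_comp; [exact: measurable_coord|exact: measurable_snd].
rewrite (_ : (fun t => _) = fst); first exact: measurable_fst.
by apply/funext => t /=; rewrite rowcons0.
Qed.

Lemma measurable_rowuncons : measurable_fun setT rowuncons.
Proof.
apply/measurable_fun_pairP; split; first exact: measurable_coord.
apply: measurable_rowP => i; rewrite (_ : (fun t => _) = fun x : 'rV[R]_n.+1 => x 0 (lift ord0 i)).
  exact: measurable_coord.
by apply/funext => t /=; rewrite mxE.
Qed.

Section Extend.
Variable mu : {sigma_finite_measure set 'rV[R]_n -> \bar R}.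

Definition extend : set 'rV[R]_n.+1 -> \bar R :=
  fun A => (leb \x mu)%E (rowcons @^-1` A).

Let ext0 : extend set0 = 0%E. Proof. by rewrite /extend preimage_set0 measure0. Qed.
Let ext_ge0 A : (0 <= extend A)%E. Proof. exact: measure_ge0. Qed.
Let ext_sadd : semi_sigma_additive extend.
Proof.
move=> F mF tF mUF; rewrite /extend preimage_bigcup.
apply: (@measure_semi_sigma_additive _ _ _ (leb \x mu)%E).
- by move=> k; rewrite -[X in measurable X]setTI; exact: measurable_rowcons.
- apply/trivIsetP => /= i j _ _ ij; rewrite -preimage_setI.
  by move/trivIsetP : tF => /(_ _ _ _ _ ij) ->//; rewrite preimage_set0.
- by rewrite -preimage_bigcup -[X in measurable X]setTI; exact: measurable_rowcons.
Qed.

HB.instance Definition _ := isMeasure.Build _ _ _ extend ext0 ext_ge0 ext_sadd.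

Let ext_sf : sigma_finite setT extend.
Proof.
have [G GT hG] := prod_sigma_finite leb mu.
exists (fun k => rowuncons @^-1` (G k)).
  by rewrite -preimage_bigcup -GT preimage_setT.
move=> k; have [mG Gk] := hG k; split.
  by rewrite -[X in measurable X]setTI; exact: measurable_rowuncons.
rewrite /extend -comp_preimage (_ : rowuncons \o rowcons = idfun) //.
by apply/funext => z; exact: rowconsK.
Qed.

HB.instance Definition _ := Measure_isSigmaFinite.Build _ _ _ extend ext_sf.

End Extend.
End Split.

Section Lam.
Variable R : realType.
Local Notation leb := (@lebesgue_measure R).
Local Open Scope ereal_scope.

(** [Vol] as a measure: the recursion is the same, and carrying sigma-finiteness along makes Tonelli
    and Fubini available at each step. *)
Fixpoint lam n : {sigma_finite_measure set 'rV[R]_n -> \bar R} :=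
  match n with
  | 0%N => dirac (0%R : 'rV[R]_0)
  | n'.+1 => extend (lam n')
  end.

Lemma Vol_lam n (A : set 'rV[R]_n) : measurable A -> Vol A = lam n A.
Proof.
elim: n A => [|n IH] A mA /=; first by rewrite /dirac.
rewrite /extend /product_measure1; apply: eq_integral => x _.
rewrite IH /=; last first.
  have m1 : measurable (rowcons (R:=R) (n:=n) @^-1` A).
    by rewrite -[X in measurable X]setTI; exact: measurable_rowcons.
  have := measurable_xsection x m1.
  rewrite (_ : xsection _ x = [set y | A (row_mx (x%:M : 'rV_1) y)]) //.
  by apply/seteqP; split=> y /=; rewrite /xsection /= inE.
congr (lam n _).
by apply/seteqP; split=> y /=; rewrite /xsection /= inE.
Qed.

Lemma lam_tonelli n (f : 'rV[R]_n.+1 -> \bar R) : measurable_fun setT f ->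
  (forall x, 0 <= f x) ->
  \int[lam n.+1]_x f x = \int[leb]_a \int[lam n]_y f (rowcons (a, y)).
Proof.
move=> mf f0 /=.
transitivity (\int[pushforward (leb \x lam n) (@rowcons R n)]_x f x).
  by [].
rewrite (ge0_integral_pushforward (@measurable_rowcons R n)) //.
rewrite preimage_setT (fubini_tonelli1 (f \o @rowcons R n)) //.
  by apply: measurableT_comp => //; exact: measurable_rowcons.
by move=> x; exact: f0.
Qed.

Lemma lam_fubini n (f : 'rV[R]_n.+1 -> \bar R) : (lam n.+1).-integrable setT f ->
  (leb \x lam n).-integrable setT (f \o @rowcons R n) /\
  \int[lam n.+1]_x f x = \int[leb]_a \int[lam n]_y f (rowcons (a, y)).
Proof.
move=> /integrableP[mf fi].
have mfr : measurable_fun setT (f \o @rowcons R n).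
  by apply: measurableT_comp => //; exact: measurable_rowcons.
have i1 : (leb \x lam n).-integrable setT (f \o @rowcons R n).
  apply/integrableP; split=> //.
  have E := ge0_integral_pushforward (@measurable_rowcons R n) (leb \x lam n)
    (D := setT) (f := fun x => `|f x|) measurableT.
  rewrite preimage_setT in E; rewrite -E //.
  by apply: measurableT_comp.
split=> //.
transitivity (\int[pushforward (leb \x lam n) (@rowcons R n)]_x f x).
  by [].
have E := integral_pushforward (@measurable_rowcons R n) (mu := leb \x lam n) (D := setT) mf.
rewrite preimage_setT in E; rewrite (E i1 measurableT).
by rewrite -(integral12_prod_meas1 i1).
Qed.

End Lam.

(** * Countable partitions *)

Section CountablePartition.
Context d (T : measurableType d) (R : realType) (I : countType).
Variable mu : {measure set T -> \bar R}.
Implicit Types F : I -> set T.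
Local Open Scope ereal_scope.

Definition unpickled F (n : nat) : set T := oapp F set0 (unpickle n).

Lemma bigcup_unpickled F : \bigcup_n unpickled F n = \bigcup_i F i.
Proof.
apply/seteqP; split=> x [].
  by move=> n _; rewrite /unpickled; case: unpickle => //= i Fx; exists i.
by move=> i _ Fx; exists (pickle i) => //; rewrite /unpickled pickleK.
Qed.

Lemma measurable_unpickled F n : (forall i, measurable (F i)) -> measurable (unpickled F n).
Proof. by move=> mF; rewrite /unpickled; case: unpickle => //= i. Qed.

Lemma bigcup_countType_measurable F : (forall i, measurable (F i)) ->
  measurable (\bigcup_i F i).
Proof.
by move=> mF; rewrite -bigcup_unpickled; apply: bigcup_measurable => n _; exact: measurable_unpickled.
Qed.

Lemma ge0_integral_countType F (f : T -> \bar R) : (forall i, measurable (F i)) ->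
  (forall i j x, F i x -> F j x -> i = j) -> (\bigcup_i F i = setT) ->
  measurable_fun setT f -> (forall x, 0 <= f x) ->
  \int[mu]_x f x = \esum_(i in setT) \int[mu]_(x in F i) f x.
Proof.
move=> mF tF cF mf f0.
(* Several numbers may decode to the same i; the test keeps one of them, so that the sets [G n] are
   disjoint. *)
pose G n : set T := if unpickle n is Some i then (if pickle i == n then F i else set0) else set0.
have Gp i : G (pickle i) = F i by rewrite /G pickleK eqxx.
have mG n : measurable (G n) by rewrite /G; case: unpickle => // i; case: ifP.
have GU : \bigcup_n G n = setT.
  rewrite -cF; apply/seteqP; split=> x [].
    by move=> n _; rewrite /G; case: unpickle => // i; case: ifP => // _ Fx; exists i.
  by move=> i _ Fx; exists (pickle i) => //; rewrite Gp.
have tG : trivIset setT G.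
  move=> n1 n2 _ _ [x []]; rewrite /G.
  case: (unpickle n1) => [i1|//]; case: eqP => // <-.
  case: (unpickle n2) => [i2|//]; case: eqP => // <- F1 F2.
  by rewrite (tF _ _ _ F1 F2).
have := @ge0_integral_bigcup _ _ _ mu G f mG; rewrite /= GU => -> //.
rewrite nneseries_esumT; last by move=> n; exact: integral_ge0.
rewrite [LHS](_ : _ = \esum_(n in range (@pickle I)) \int[mu]_(x in G n) f x).
  rewrite esum_image; last by apply: in2W; exact: (pcan_inj pickleK).
  by apply: eq_esum => i _; rewrite Gp.
rewrite [RHS]esum_mkcond; apply: eq_esum => n _.
case: ifPn => //; rewrite notin_setE => hn.
rewrite (_ : G n = set0) ?integral_set0 //.
rewrite /G; case: unpickle => // i; case: eqP => // E.
by exfalso; apply: hn; exists i.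
Qed.

Lemma measure_countType F (A : set T) : (forall i, measurable (F i)) ->
  (forall i j x, F i x -> F j x -> i = j) -> (\bigcup_i F i = setT) ->
  measurable A -> mu A = \esum_(i in setT) mu (A `&` F i).
Proof.
move=> mF tF cF mA.
have := ge0_integral_countType (f := fun x => (\1_A x)%:E) mF tF cF.
rewrite integral_indic // setIT => ->.
- by apply: eq_esum => i _; rewrite integral_indic // setIC.
- by apply/measurable_EFinP; exact: measurable_indic.
- by move=> x; rewrite lee_fin.
Qed.

End CountablePartition.

Section PiecewiseMeasurable.
Context d d' (T : measurableType d) (S : measurableType d') (I : countType).

Lemma measurable_piecewise (F : I -> set T) (f : T -> S) (g : I -> T -> S) :
  (forall i, measurable (F i)) -> \bigcup_i F i = setT ->
  (forall i, measurable_fun setT (g i)) -> (forall i x, F i x -> f x = g i x) ->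
  measurable_fun setT f.
Proof.
move=> mF cF mg fg _ B mB; rewrite setTI.
rewrite (_ : f @^-1` B = \bigcup_i (F i `&` g i @^-1` B)).
  apply: bigcup_countType_measurable => i; apply: measurableI => //.
  by rewrite -[X in measurable X]setTI; exact: mg.
apply/seteqP; split=> [x Bx|x [i _ [Fx]]]; last by rewrite /= -(fg i x Fx).
have [i _ Fx] : (\bigcup_i F i) x by rewrite cF.
by exists i => //; split=> //=; rewrite -(fg i x Fx).
Qed.

End PiecewiseMeasurable.

Lemma sume_const_ord (R : realType) (j : nat) (a : \bar R) :
  (\sum_(m < j) a = a * j%:R%:E)%E.
Proof.
rewrite mule_natr; elim: j => [|j IH]; first by rewrite big_ord0.
by rewrite big_ord_recr /= IH; case: j {IH} => [|j] //=; rewrite ?add0e // addeC.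
Qed.

(** * Lattice cells *)

Section OneDim.
Variables (R : realType) (c : R).
Hypothesis c0 : 0 < c.
Local Notation leb := (@lebesgue_measure R).

Definition cell (k : int) : set R := `[c * k%:~R, c * k%:~R + c[%classic.
(* [kap x] is the corner of the cell of x, and [tau j] dilates every cell by the
   factor j from its corner. *)
Definition cellidx (x : R) : int := Num.floor (x / c).
Definition kap (x : measurableTypeR R) : measurableTypeR R := c * (cellidx x)%:~R.
Definition tau (j : nat) (x : measurableTypeR R) : measurableTypeR R := kap x + j%:R * (x - kap x).

Lemma cellP k x : cell k x <-> cellidx x = k.
Proof.
rewrite /cell /= in_itv /= /cellidx; split=> [/andP[h1 h2]|<-].
  apply/eqP; rewrite floor_eq ler_pdivlMr // mulrC h1 /=.
  by rewrite ltr_pdivrMr // intrD mulrDl mul1r mulrC.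
have /andP[h1 h2] := floor_itv (x / c).
rewrite mulrC -ler_pdivlMr // h1 /=.
by move: h2; rewrite ltr_pdivrMr // intrD mulrDl mul1r mulrC.
Qed.

Lemma cell_disj i j x : cell i x -> cell j x -> i = j.
Proof. by move=> /cellP <- /cellP <-. Qed.

Lemma cell_cover : \bigcup_k cell k = setT.
Proof. by apply/seteqP; split=> // x _; exists (cellidx x) => //; apply/cellP. Qed.

Lemma measurable_cell k : measurable (cell k).
Proof. exact: measurable_itv. Qed.

Lemma kap_le x : 0 <= x - kap x < c.
Proof.
have /cellP : cellidx x = cellidx x by [].
rewrite /cell /= in_itv /= -/(kap x) => /andP[h1 h2].
by rewrite subr_ge0 h1 ltrBlDl.
Qed.

Lemma measurable_kap : measurable_fun setT kap.
Proof.
apply: (measurable_piecewise measurable_cell cell_cover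
  (g := fun k (_ : R) => c * k%:~R)) => [k|k x /cellP E].
  exact: measurable_cst.
by rewrite /kap E.
Qed.

Lemma measurable_tau j : measurable_fun setT (tau j).
Proof.
apply: measurable_funD; first exact: measurable_kap.
apply: measurable_funM; first exact: measurable_cst.
apply: measurable_funB; first exact: measurable_id.
exact: measurable_kap.
Qed.

Lemma lebesgue_affine (a b : R) (A : set R) : 0 < a -> measurable A ->
  (leb A = a%:E * leb ((fun x : R => a * x + b)%R @^-1` A))%E.
Proof.
move=> a0 mA.
pose f : measurableTypeR R -> measurableTypeR R := fun x => a * x + b.
have mf : measurable_fun setT f.
  apply: measurable_funD; last exact: measurable_cst.
  by apply: measurable_funM; [exact: measurable_cst|exact: measurable_id].
pose m := pushforward leb f.
pose M : {measure set (measurableTypeR R) -> \bar R} := mscale (NngNum (ltW a0)) (pushforward leb f).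
apply: (@lebesgue_measure_unique R (M mf) _ A mA) => _ [[x y]] _ <-.
rewrite /M /= /mscale /= /pushforward.
rewrite (_ : f @^-1` _ = `](x - b) / a, (y - b) / a]%classic).
  rewrite !lebesgue_measure_itv /= !lte_fin ltr_pM2r ?invr_gt0 // ltrD2r.
  case: ifPn => xy; last by rewrite mule0.
  rewrite -!EFinB -EFinM; congr EFin; field; exact: lt0r_neq0.
apply/seteqP; split=> t; rewrite /f /= !in_itv /= ltr_pdivrMr // ler_pdivlMr // [t * a]mulrC => /andP[h1 h2];
  by apply/andP; split; lra.
Qed.

Lemma cell_union (A : set R) (k : int) (j : nat) : measurable A ->
  (leb (A `&` `[(c * k%:~R)%R, (c * k%:~R + c * j%:R)%R[%classic) =
   \sum_(m < j) leb (A `&` cell (k + m%:Z)))%E.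
Proof.
move=> mA; elim: j => [|j IH].
  rewrite big_ord0 mulr0 addr0 (_ : `[_, _[%classic = set0) ?setI0 ?measure0 //.
  by apply/seteqP; split=> x //=; rewrite in_itv /= => /andP[h1]; rewrite ltNge h1.
rewrite big_ord_recr /= -IH; clear IH.
have cm := mulr_ge0 (ltW c0) (ler0n R j).
have E : `[(c * k%:~R)%R, (c * k%:~R + c * j.+1%:R)%R[%classic =
   `[(c * k%:~R)%R, (c * k%:~R + c * j%:R)%R[%classic `|` cell (k + j%:Z).
  apply/seteqP; split=> x; rewrite /cell /= !in_itv /= intrD -pmulrn -natr1 !mulrDr mulr1.
    move=> /andP[h1 h2]; have [h|h] := ltP x (c * k%:~R + c * j%:R); [left|right];
      by apply/andP; split; lra.
  by have c0' := c0; move=> [/andP[h1 h2]|/andP[h1 h2]]; apply/andP; split; lra.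
rewrite E setIUr measureU //.
- by apply: measurableI => //; exact: measurable_itv.
- by apply: measurableI => //; exact: measurable_cell.
apply/seteqP; split=> x //= [[_ h1] [_ h2]]; move: h1 h2.
rewrite /cell /= !in_itv /= intrD mulrDr -pmulrn => /andP[h1 h2] /andP[h3 h4].
by lra.
Qed.

(* Every point has exactly one preimage under [tau j] in each of the j cells
   that reach it, and each of them contributes with density 1 / j. *)
Lemma lebesgue_tau j (A : set R) : (0 < j)%N -> measurable A -> leb (tau j @^-1` A) = leb A.
Proof.
move=> j0 mA.
have mtA : measurable (tau j @^-1` A).
  by rewrite -[X in measurable X]setTI; exact: measurable_tau.
have jr0 : 0 < j%:R :> R by rewrite ltr0n.
have shift m : (\esum_(k in [set: int]) leb (A `&` cell (k + m%:Z)) = leb A)%E.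
  rewrite [RHS](measure_countType leb measurable_cell cell_disj cell_cover mA).
  apply/esym/(@reindex_esum R int int setT setT (fun k : int => k + m%:Z) (fun k => leb (A `&` cell k))).
  split=> //; first by move=> x y _ _; exact: addIr.
  by move=> x _; exists (x - m%:Z) => //; rewrite subrK.
(* On [cell k] the map [tau j] is affine of slope j, with image the j consecutive cells starting at
   k. *)
have key k : (\sum_(m < j) leb (tau j @^-1` A `&` cell k) = \sum_(m < j) leb (A `&` cell (k + m%:Z)))%E.
  rewrite -cell_union // sume_const_ord.
  set J := `[_, _[%classic.
  have mAJ : measurable (A `&` J) by apply: measurableI => //; exact: measurable_itv.
  rewrite (lebesgue_affine (c * k%:~R * (1 - j%:R)) jr0 mAJ) muleC; congr (_ * _)%E.
  congr (leb _); apply/seteqP; split=> x /= [h1 h2].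
    have xk : kap x = c * k%:~R by move/cellP: h2 => h2; rewrite /kap h2.
    have E : j%:R * x + c * k%:~R * (1 - j%:R) = tau j x by rewrite /tau xk; ring.
    rewrite E; split=> //; rewrite /J /= in_itv /= /tau.
    move: h2; rewrite /cell /= in_itv /= => /andP[h2 h3]; rewrite xk.
    rewrite lerDl mulr_ge0 ?ler0n ?subr_ge0 //= ltrD2l mulrC ltr_pM2r //.
    by rewrite ltrBlDl.
  move: h2; rewrite /J /= in_itv /= => /andP[h2 h3].
  have ck : cell k x.
    rewrite /cell /= in_itv /=; apply/andP; split.
      by rewrite -(ler_pM2l jr0); move: h2; rewrite mulrBr mulr1; lra.
    by rewrite -(ltr_pM2l jr0) mulrDr; move: h3; rewrite mulrBr mulr1; lra.
  have xk : kap x = c * k%:~R by move/cellP: ck => ck; rewrite /kap ck.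
  have E : j%:R * x + c * k%:~R * (1 - j%:R) = tau j x by rewrite /tau xk; ring.
  by rewrite -E.
(* Summed over k, every cell is counted j times on the right of [key]; the common factor j is
   removed at the end. *)
have : (\sum_(m < j) leb (tau j @^-1` A) = \sum_(m < j) leb A)%E.
  transitivity (\sum_(m < j) \esum_(k in [set: int]) leb (tau j @^-1` A `&` cell k))%E.
    apply: eq_bigr => m _.
    by rewrite -(measure_countType leb measurable_cell cell_disj cell_cover mtA).
  rewrite -esum_sum // (eq_esum (b := fun k => \sum_(m < j) leb (A `&` cell (k + m%:Z)))%E) //.
  by rewrite esum_sum //; apply: eq_bigr => m _; exact: shift.
rewrite !sume_const_ord => E.
have := congr1 (fun z => z * (j%:R^-1)%:E)%E E.
by rewrite -!muleA -!EFinM mulfV ?gt_eqF // !mule1.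
Qed.

Lemma integral_tau j (f : measurableTypeR R -> \bar R) : (0 < j)%N -> measurable_fun setT f ->
  (forall x, 0 <= f x)%E -> (\int[leb]_x f (tau j x) = \int[leb]_x f x)%E.
Proof.
move=> j0 mf f0.
have E := ge0_integral_pushforward (measurable_tau j) leb (D := setT) measurableT mf.
rewrite preimage_setT in E.
transitivity (\int[pushforward leb (tau j)]_x f x)%E.
  by rewrite E // => x _; exact: f0.
apply: eq_measure_integral => [|mm]; first exact: measurable_tau.
by move=> A mA _; exact: lebesgue_tau.
Qed.

End OneDim.

Section RowIntegrals.
Variable R : realType.
Local Notation leb := (@lebesgue_measure R).

Definition box n (a b : 'I_n -> R) : set 'rV[R]_n := [set x | forall i, a i <= x 0 i < b i].

Lemma measurable_box n (a b : 'I_n -> R) : measurable (box a b).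
Proof.
rewrite (_ : box a b = \bigcap_(i in [set: 'I_n]) ((fun x : 'rV[R]_n => x 0 i) @^-1` `[a i, b i[)).
  apply: fin_bigcap_measurable => // i _; rewrite -[X in measurable X]setTI.
  by apply: measurable_coord => //; exact: measurable_itv.
by apply/seteqP; split=> [x h i _|x h i]; have := h i; rewrite /= in_itv; [|apply].
Qed.

Lemma rowcons_box n (a b : 'I_n.+1 -> R) :
  @rowcons R n @^-1` box a b = `[a ord0, b ord0[%classic `*` box (a \o lift ord0) (b \o lift ord0).
Proof.
apply/seteqP; split=> -[t y] h.
  split=> [|i]; first by have := h ord0; rewrite rowcons0 /= in_itv.
  by have := h (lift ord0 i); rewrite rowconsS.
move=> i; have [j ->|->] := unliftP ord0 i; rewrite ?rowconsS ?rowcons0.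
  exact: h.2.
by have := h.1; rewrite /= in_itv.
Qed.

Lemma lam_box n (a b : 'I_n -> R) : (forall i, a i <= b i) ->
  lam R n (box a b) = (\prod_i (b i - a i))%:E.
Proof.
elim: n a b => [|n IH] a b ab.
  by rewrite big_ord0 /= /dirac /= indicE mem_set // => -[].
rewrite big_ord_recl /= /extend rowcons_box.
rewrite (product_measure1E leb (lam R n) (measurable_itv _) (measurable_box _ _)).
rewrite IH; last by move=> i; exact: ab.
rewrite EFinM; congr (_ * _)%E.
transitivity (lebesgue_measure (`[a ord0, b ord0[%classic : set R)); first by [].
rewrite lebesgue_measure_itv /= lte_fin.
case: ltP => [//|h]; by rewrite (le_anti (_ : a ord0 <= b ord0 <= a ord0)) ?subrr ?ab.
Qed.

Lemma closed_norm_le n (B : R) : closed [set x : 'rV[R]_n | `|x| <= B].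
Proof.
rewrite (_ : [set _ | _] = (fun x : 'rV[R]_n => `|x|) @^-1` [set t | t <= B]) //.
by apply: closed_comp; [move=> x _; exact: norm_continuous|exact: closed_le].
Qed.

Lemma row_addZ_ev n (u : 'rV[R]_n) t j i : (u + t *: ev j) 0 i = u 0 i + t * (i == j)%:R.
Proof. by rewrite !mxE eqxx. Qed.

Lemma cube_finite n (B : R) : (lam R n [set x : 'rV[R]_n | (`|x| <= B)%R] < +oo)%E.
Proof.
have [B0|B0] := leP 0 B; last first.
  rewrite (_ : [set _ | _] = set0) ?measure0 ?ltry //.
  by apply/seteqP; split=> x //= h; have := le_lt_trans h B0; rewrite normr_lt0.
apply: (@le_lt_trans _ _ (lam R n (box (fun=> - B) (fun=> B + 1)))).
  apply: le_measure; rewrite ?inE.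
  - apply: measurable_closed; exact: closed_norm_le.
  - exact: measurable_box.
  - move=> x /= xB i; have := le_trans (norm_coord_le x i) xB; rewrite ler_norml.
    by move=> /andP[h1 h2]; rewrite h1 /=; lra.
by rewrite lam_box ?ltry // => i; lra.
Qed.

Lemma continuous_support_integrable n (G : 'rV[R]_n -> R) (B : R) : continuous G ->
  (forall x, B < `|x| -> G x = 0) -> (lam R n).-integrable setT (EFin \o G).
Proof.
move=> cG G0; pose D := [set x : 'rV[R]_n | `|x| <= B].
have clD : closed D by exact: closed_norm_le.
have mD : measurable D by exact: measurable_closed.
have cD : compact D.
  apply: bounded_closed_compact => //; exists B; split; first exact: num_real.
  by move=> x Bx y /= yB; rewrite (le_trans yB) // ltW.
have i1 : (lam R n).-integrable D (EFin \o G).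
  apply: measurable_bounded_integrable => //; first exact: cube_finite.
    by apply: measurable_funS (continuous_measurable_row cG).
  have /compact_bounded[M [Mr hM]] : compact (G @` D).
    by apply: continuous_compact => //; exact: continuous_subspaceT.
  by exists M; split=> // r Mr' x Dx; apply: (hM r Mr'); exists x.
move/(integrable_mkcond _ mD): i1; congr (_.-integrable _ _).
apply/funext => x; rewrite patchE; case: ifPn => // /negP xD /=.
by rewrite G0 // ltNge; apply/negP => h; apply: xD; rewrite inE.
Qed.

Lemma FTC_support (F f : R -> R) (B : R) : (forall t, is_derive t (1 : R) F (f t)) ->
  continuous f -> (forall t, B < `|t| -> F t = 0) -> (forall t, B < `|t| -> f t = 0) ->
  (\int[leb]_t (f t)%:E = 0)%E.
Proof.
move=> dF cf F0 f0; pose M := `|B| + 1.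
have M0 : 0 < M by rewrite ltr_wpDl.
have BM : B < M by rewrite (le_lt_trans (ler_norm B)) // ltrDl.
have dcF t : derivable F t 1 by case: (dF t).
have cF : continuous F by move=> t; apply: differentiable_continuous; apply/derivable1_diffP.
transitivity (\int[leb]_(t in `[(- M)%R, M]) (f t)%:E)%E.
  rewrite [RHS]integral_mkcond; apply: eq_integral => t _; rewrite patchE.
  case: ifPn => //; rewrite notin_setE /= in_itv /= => /negP h; rewrite f0 //.
  by rewrite (lt_trans BM) // ltNge ler_norml.
rewrite (@continuous_FTC2 R f F) //.
- by rewrite !F0 ?subee // ?normrN ger0_norm // ltW.
- by lra.
- exact: continuous_subspaceT.
- split=> [t _||]; first exact: dcF.
    by apply: cvg_at_right_filter; exact: cF.
  by apply: cvg_at_left_filter; exact: cF.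
- by move=> t _; rewrite derive1E; case: (dF t).
Qed.

Lemma rowcons_continuous n (a : R) : continuous (fun y : 'rV[R]_n => rowcons (a, y)).
Proof.
move=> y; apply: continuous_rowP => i; have [j ->|->] := unliftP ord0 i.
  rewrite (_ : (fun z => _) = fun z : 'rV[R]_n => z 0 j); first exact: coord_continuous.
  by apply/funext => z; rewrite rowconsS.
rewrite (_ : (fun z => _) = cst a); first exact: cst_continuous.
by apply/funext => z; rewrite rowcons0.
Qed.

Lemma rowcons_shift0 n (a : R) (y : 'rV[R]_n) :
  rowcons (a, y) = rowcons (0, y) + a *: ev (ord0 : 'I_n.+1).
Proof.
apply/rowP => i; rewrite row_addZ_ev; have [j ->|->] := unliftP ord0 i.
  by rewrite !rowconsS mulr0 addr0.
by rewrite !rowcons0 eqxx mulr1 add0r.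
Qed.

Lemma rowcons_shiftS n (a : R) (y : 'rV[R]_n) (t : R) (j : 'I_n) :
  rowcons (a, y + t *: ev j) = rowcons (a, y) + t *: ev (lift ord0 j).
Proof.
apply/rowP => i; rewrite row_addZ_ev; have [k ->|->] := unliftP ord0 i.
  by rewrite !rowconsS row_addZ_ev (inj_eq (@lift_inj _ ord0)).
by rewrite !rowcons0 mulr0 addr0.
Qed.

Lemma norm_rowcons n (a : R) (y : 'rV[R]_n) : `|y| <= `|rowcons (a, y)| /\ `|a| <= `|rowcons (a, y)|.
Proof.
split; last by have := norm_coord_le (rowcons (a, y)) ord0; rewrite rowcons0.
apply: norm_le_coord => // i.
by have := norm_coord_le (rowcons (a, y)) (lift ord0 i); rewrite rowconsS.
Qed.

(* integration by parts against the constant function 1 *)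
Lemma integral_derivative0 n (i : 'I_n) (F G : 'rV[R]_n -> R) (B : R) :
  (forall x, is_derive x (ev i) F (G x)) -> continuous G ->
  (forall x, B < `|x| -> F x = 0) -> (forall x, B < `|x| -> G x = 0) ->
  (\int[lam R n]_x (G x)%:E = 0)%E.
Proof.
elim: n i F G => [[]//|n IH] i F G dF cG F0 G0.
have iG := continuous_support_integrable cG G0.
have [i2 E2] := lam_fubini iG.
rewrite E2; case: (unliftP ord0 i) dF => [j ->|->] dF; last first.
  (* The variable of differentiation is the outer one here, so the order of integration is exchanged
     before the fundamental theorem is applied. *)
  rewrite (Fubini i2) /=; apply: integral0_eq => y _.
  have E a : rowcons (a, y) = rowcons (0, y) + a *: ev ord0 by exact: rowcons_shift0.
  apply: (@FTC_support (fun a => F (rowcons (a, y))) _ B).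
  - move=> a; have dFa := dF (rowcons (a, y)).
    have dFd : derivable F (rowcons (0, y) + a *: ev ord0) (ev ord0) by rewrite -E; case: dFa.
    have := is_derive_line dFd; rewrite -E; have [_ ->] := dFa.
    by under eq_fun do rewrite -E.
  - move=> a; apply: (@continuous_comp _ _ _ (fun a => rowcons (a, y)) G); last exact: cG.
    apply: continuous_rowP => k; have [l ->|->] := unliftP ord0 k.
      rewrite (_ : (fun z => _) = cst (y 0 l)); first exact: cst_continuous.
      by apply/funext => z; rewrite rowconsS.
    rewrite (_ : (fun z => _) = id); first exact: cvg_id.
    by apply/funext => z; rewrite rowcons0.
  - by move=> a Ba; apply: F0; apply: lt_le_trans Ba (norm_rowcons a y).2.
  - by move=> a Ba; apply: G0; apply: lt_le_trans Ba (norm_rowcons a y).2.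
apply: integral0_eq => a _ /=.
apply: (IH j (fun y => F (rowcons (a, y))) (fun y => G (rowcons (a, y)))).
- move=> y; have dFa := dF (rowcons (a, y)).
  have E : (fun h : R => h^-1 *: (((fun y => F (rowcons (a, y))) \o shift y) (h *: ev j) - F (rowcons (a, y)))) =
      (fun h : R => h^-1 *: ((F \o shift (rowcons (a, y))) (h *: ev (lift ord0 j)) - F (rowcons (a, y)))).
    by apply/funext => h /=; congr (_ *: (F _ - _)); rewrite addrC rowcons_shiftS addrC.
  by case: dFa => h1 h2; apply: DeriveDef; rewrite /derivable /derive E.
- move=> y; apply: (@continuous_comp _ _ _ (fun y => rowcons (a, y)) G); last exact: cG.
  exact: rowcons_continuous.
- by move=> y By; apply: F0; apply: lt_le_trans By (norm_rowcons a y).1.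
- by move=> y By; apply: G0; apply: lt_le_trans By (norm_rowcons a y).1.
Qed.

Definition coordwise n (t : R -> R) (x : 'rV[R]_n) : 'rV[R]_n := \row_i t (x 0 i).

Lemma measurable_coordwise n (t : measurableTypeR R -> measurableTypeR R) :
  measurable_fun setT t -> measurable_fun setT (@coordwise n t).
Proof.
move=> mt; apply: measurable_rowP => i.
rewrite (_ : (fun x => _) = t \o (fun x : 'rV[R]_n => x 0 i)); last by apply/funext => x; rewrite mxE.
by apply: measurableT_comp => //; exact: measurable_coord.
Qed.

Lemma coordwise_rowcons n (t : R -> R) a (y : 'rV[R]_n) :
  coordwise t (rowcons (a, y)) = rowcons (t a, coordwise t y).
Proof.
apply/rowP => i; rewrite mxE; have [j ->|->] := unliftP ord0 i.
  by rewrite !rowconsS mxE.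
by rewrite !rowcons0.
Qed.

Lemma integral_coordwise n (t : measurableTypeR R -> measurableTypeR R) (f : 'rV[R]_n -> \bar R) :
  measurable_fun setT t ->
  (forall g : measurableTypeR R -> \bar R, measurable_fun setT g -> (forall x, 0 <= g x)%E ->
    (\int[leb]_x g (t x) = \int[leb]_x g x)%E) ->
  measurable_fun setT f -> (forall x, 0 <= f x)%E ->
  (\int[lam R n]_x f (coordwise t x) = \int[lam R n]_x f x)%E.
Proof.
move=> mt ht; elim: n f => [|n IH] f mf f0.
  by apply: eq_integral => x _; congr f; apply/rowP => -[].
have mft : measurable_fun setT (fun x => f (coordwise t x)).
  by apply: measurableT_comp => //; exact: measurable_coordwise.
rewrite lam_tonelli // [RHS]lam_tonelli //.
have mfr : measurable_fun setT (f \o @rowcons R n).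
  by apply: measurableT_comp => //; exact: measurable_rowcons.
pose g a := (\int[lam R n]_y f (rowcons (a, y)))%E.
transitivity (\int[leb]_a g (t a))%E.
  apply: eq_integral => a _; rewrite /g -[RHS](IH (fun y => f (rowcons (t a, y)))) //; last first.
    apply: measurableT_comp => //; apply: measurableT_comp; first exact: measurable_rowcons.
    by apply/measurable_fun_pairP; split; [exact: measurable_cst|exact: measurable_id].
  by apply: eq_integral => y _; rewrite coordwise_rowcons.
apply: ht; last by move=> a; exact: integral_ge0.
by apply: (measurable_fun_fubini_tonelli_F (f \o @rowcons R n)) => // x; exact: f0.
Qed.

End RowIntegrals.

Section Lattice.
Variables (R : realType) (n : nat) (c : R).
Hypothesis c0 : 0 < c.
Local Open Scope ereal_scope.

Definition latpt (k : 'rV[int]_n) : 'rV[R]_n := \row_i (c * (k 0%R i)%:~R)%R.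
Definition latidx (x : 'rV[R]_n) : 'rV[int]_n := \row_i cellidx c (x 0%R i).
Definition Cell (k : 'rV[int]_n) : set 'rV[R]_n := [set x | latidx x = k].

Lemma CellE k : Cell k = box (fun i => (c * (k 0%R i)%:~R)%R) (fun i => (c * (k 0%R i)%:~R + c)%R).
Proof.
apply/seteqP; split=> x.
  move=> <- i; rewrite mxE.
  have /(cellP c0) : cellidx c (x 0%R i) = cellidx c (x 0%R i) by [].
  by rewrite /cell /= in_itv.
move=> h; apply/rowP => i; rewrite mxE; apply/(cellP c0).
by rewrite /cell /= in_itv; exact: h.
Qed.

Lemma lam_Cell k : lam R n (Cell k) = (c ^+ n)%:E.
Proof.
rewrite CellE lam_box; last by move=> i; rewrite lerDl ltW.
congr EFin; rewrite (eq_bigr (fun=> c)); last by move=> i _; rewrite addrC addKr.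
by rewrite prodr_const card_ord.
Qed.

Lemma coordwise_kap x : coordwise (kap c) x = latpt (latidx x).
Proof. by apply/rowP => i; rewrite !mxE. Qed.

Lemma integral_kap (f : 'rV[R]_n -> \bar R) : measurable_fun setT f -> (forall x, 0 <= f x) ->
  \int[lam R n]_x f (coordwise (kap c) x) =
    \esum_(k in [set: 'rV[int]_n]) (f (latpt k) * (c ^+ n)%:E).
Proof.
move=> mf f0.
have mC k : measurable (Cell k) by rewrite CellE; exact: measurable_box.
rewrite (ge0_integral_countType (lam R n) mC) //.
- apply: eq_esum => k _.
  rewrite (eq_integral (fun=> f (latpt k))).
    by rewrite integral_cst //; congr (_ * _); exact: lam_Cell.
  by move=> x; rewrite inE coordwise_kap => ->.
- by move=> i j x; rewrite /Cell /= => <- <-.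
- by apply/seteqP; split=> // x _; exists (latidx x).
- by apply: measurableT_comp => //; apply: measurable_coordwise; exact: measurable_kap.
Qed.

Lemma integral_coordwise_tau j (f : 'rV[R]_n -> \bar R) : (0 < j)%N ->
  measurable_fun setT f -> (forall x, 0 <= f x) ->
  \int[lam R n]_x f (coordwise (tau c j) x) = \int[lam R n]_x f x.
Proof.
move=> j0 mf f0; apply: integral_coordwise => //; first exact: measurable_tau.
by move=> g mg g0; exact: integral_tau.
Qed.

End Lattice.

(** * The distribution of the distance *)

Section DetDerivative.
Variables (R : realType) (n : nat).

Lemma horner0_deriv_XM (p q : {poly R}) : p.[0] = 0 -> q.[0] = 0 -> (p * q)^`().[0] = 0.
Proof. by move=> p0 q0; rewrite derivM hornerD !hornerM p0 q0 mulr0 mul0r addr0. Qed.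

Lemma horner0_deriv_prod (I : Type) (r : seq I) (D : I -> {poly R}) :
  (forall i, (D i).[0] = 1) ->
  (\prod_(i <- r) D i).[0] = 1 /\
  (\prod_(i <- r) D i)^`().[0] = \sum_(i <- r) (D i)^`().[0].
Proof.
move=> D1; elim: r => [|i r [IH1 IH2]]; first by rewrite !big_nil -polyC1 hornerC derivC horner0.
by rewrite !big_cons hornerM IH1 derivM hornerD !hornerM IH1 IH2 D1 !mulr1 mul1r.
Qed.

Definition detentry (M : 'M[R]_n) i j : {poly R} := (i == j)%:R%:P + 'X * (M i j)%:P.
Definition detpoly (M : 'M[R]_n) : {poly R} := \det (\matrix_(i, j) detentry M i j).

Lemma detpolyE M e : (detpoly M).[e] = \det (1%:M + e *: M).
Proof.
rewrite -horner_evalE -det_map_mx; congr (\det _); apply/matrixP => i j.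
rewrite mxE mxE /= /horner_eval /detentry hornerD hornerM hornerX !hornerC.
by rewrite !mxE.
Qed.

(** A permutation other than the identity moves some a and also s a, and contributes two
    off-diagonal factors vanishing at 0; only the product of the diagonal entries has a term of
    first order. *)
Lemma detpoly_deriv0 M : (detpoly M)^`().[0] = \tr M.
Proof.
rewrite /detpoly /determinant raddf_sum /= horner_sum (bigD1 (1%g : 'S_n)) //= odd_perm1 expr0 mul1r.
rewrite [X in _ + X]big1 ?addr0 => [|s s1]; last first.
  rewrite -[(-1) ^+ s]/((-1) ^+ (s : bool)) derivM hornerD !hornerM.
  have -> : ((-1) ^+ (s : bool) : {poly R})^`() = 0.
    by rewrite -signr_odd; case: (odd _); rewrite ?expr0 ?expr1 ?derivN -?polyC1 derivC ?oppr0.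
  rewrite horner0 mul0r add0r.
  have [a sa] : exists a, s a != a.
    apply: contrapT => h; move/eqP: s1; apply; apply/permP => a; rewrite perm1.
    by apply: contrapT => /eqP sa; apply: h; exists a.
  have z i : s i != i -> ((\matrix_(i, j) detentry M i j) i (s i)).[0] = 0.
    by move=> si; rewrite mxE /detentry !hornerE eq_sym (negbTE si).
  rewrite (bigD1 a) //= (bigD1 (s a)) //= mulrA derivM hornerD !hornerM.
  rewrite horner0_deriv_XM ?z // ?(inj_eq perm_inj) // mul0r mul0r add0r.
  by rewrite mul0r mulr0.
have e0 i : (detentry M i i).[0] = 1.
  by rewrite /detentry eqxx hornerD hornerM hornerX !hornerC mul0r addr0.
have e1 i : (detentry M i i)^`().[0] = M i i.
  rewrite /detentry derivD derivC add0r derivM derivX derivC mulr0 addr0 mul1r.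
  by rewrite hornerC.
rewrite (eq_bigr (fun i => detentry M i i)); last by move=> i _; rewrite perm1 mxE.
by rewrite (horner0_deriv_prod _ e0).2; apply: eq_bigr => i _; exact: e1.
Qed.

Lemma is_derive_det1 (M : 'M[R]_n) :
  is_derive (0 : R) (1 : R) (fun e => \det (1%:M + e *: M)) (\tr M).
Proof.
rewrite (_ : (fun e => _) = horner (detpoly M)); last by apply/funext => e; rewrite detpolyE.
by rewrite -detpoly_deriv0; exact: is_derive_poly.
Qed.

End DetDerivative.

(** * The Jacobian determinant of p + X p *)

Section Jacobian.
Variables (R : realType) (m : nat).
Local Notation V := 'rV[R]_m.
Variables (K : set V) (X : V -> V).
Hypothesis bK : body K X.
Implicit Types (p : V) (r : R).
Local Notation A := (Mi X).

Definition Jac p : R := \det (Jm X p).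

Lemma Euler_homog r (G : V -> R) p : p != 0 -> differentiable G p -> homog r G ->
  'D_p G p = - r * G p.
Proof.
move=> p0 dG hG.
have d1 : derivable G (p + 0 *: p) p by rewrite scale0r addr0; exact: diff_derivable.
have [_ E1] := is_derive_line d1; rewrite scale0r addr0 in E1; rewrite -E1.
have d2 : is_derive (0 : R) (1 : R) (fun t => wgt r (1 + t) * G p) (- r * G p).
  have l1 : is_derive (1 + 0 : R) (1 : R) (@ln R) (1 + 0)^-1.
    by apply: is_derive1_ln; rewrite addr0.
  have l2 : is_derive (0 : R) (1 : R) (fun t : R => 1 + t) 1.
    by have := is_deriveD (is_derive_cst (1:R) (0:R) (1:R)) (is_derive_id (0:R) (1:R)); rewrite add0r.
  have l3 := is_derive1_comp (f := @ln R) (g := fun t : R => 1 + t) l1 l2.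
  have l4 := is_deriveM (is_derive_cst (- r) (0:R) (1:R)) l3.
  have l5 := is_derive1_comp (f := @expR R) (is_derive_expR _) l4.
  have l6 := is_deriveM l5 (is_derive_cst (G p) (0:R) (1:R)).
  have := l6.
  rewrite (_ : (_ * cst (G p)) = (fun t => wgt r (1 + t) * G p)); last first.
    by apply/funext => t; rewrite /wgt -mulNr.
  move/is_derive_eq; apply.
  rewrite /cst /comp !fctE /= addr0 ln1 mulr0 expR0 invr1.
  by rewrite /GRing.scale /= !mulr1 !mulr0 !addr0 !add0r mul1r mulrC.
have [_ <-] := d2; apply: near_eq_derive.
near=> t; have t1 : 0 < 1 + t.
  have : - 1 < t by near: t; apply: (@cvgr_gt _ _ (nbhs (0:R)) (nbhs_filter (0:R)) id _ cvg_id); rewrite oppr_lt0.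
  by lra.
by rewrite -hG // scalerDl scale1r.
Unshelve. all: by end_near. Qed.

(** Euler's relation in degree 0, X being constant on rays. *)
Lemma mulmx_DX p : p != 0 -> p *m DX X p = 0.
Proof.
move=> p0; apply/rowP => j; rewrite (DXE bK) // mxE.
by rewrite (@Euler_homog 0) ?oppr0 ?mul0r //; [exact: (X_differentiable bK)|exact: (X_homog bK)].
Qed.

Lemma mulmx_Mi p : p != 0 -> p *m A p = p.
Proof.
move=> p0; have : p *m Jm X p = p by rewrite mulmxDr mulmx1 mulmx_DX // addr0.
by move=> {1}<-; rewrite -mulmxA mulmxV ?mulmx1 //; exact: (Jm_unit bK).
Qed.

Lemma DX_homog p (t : R) : p != 0 -> 0 < t -> DX X (t *: p) = t^-1 *: DX X p.
Proof.
move=> p0 t0; apply/matrixP => i j; rewrite !mxE -wgt1r //.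
have h : homog (0 + 1) (pd i (fun q => X q 0 j)).
  by apply: homog_pd; [move=> q q0; exact: (X_differentiable bK)|exact: (X_homog bK)].
by rewrite h // add0r.
Qed.

Lemma Jac_smooth : smooth (@nonzero R m) Jac.
Proof.
by move=> k; apply: Dn_det; [exact: open_nonzero|move=> i j; exact: (Jm_smooth bK)].
Qed.

Lemma Jac_neq0 p : p != 0 -> Jac p != 0.
Proof. by move=> p0; have := Jm_unit bK p0; rewrite unitmxE unitfE. Qed.

(** Along e |-> det (1 + e DX p) the value is 1 at e = 0 and, for e > 0, it is the Jacobian at the
    rescaled point p / e, hence nonzero. By the intermediate value theorem the sign does not change
    up to e = 1. *)
Lemma Jac_gt0 p : p != 0 -> 0 < Jac p.
Proof.
move=> p0; pose g e := (detpoly (DX X p)).[e].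
have gE e : g e = \det (1%:M + e *: DX X p) by exact: detpolyE.
have g0 e : 0 <= e -> g e != 0.
  rewrite le_eqVlt => /orP[/eqP <-|e0].
    by rewrite gE scale0r addr0 det1 oner_eq0.
  rewrite gE -[e]invrK -DX_homog ?invr_gt0 //.
  by apply: Jac_neq0; rewrite scaler_eq0 negb_or p0 andbT invr_neq0 // gt_eqF.
have g1 : g 1 = Jac p by rewrite gE scale1r.
rewrite -g1 lt_neqAle eq_sym g0 // leNgt; apply/negP => gneg.
have g00 : g 0 = 1 by rewrite gE scale0r addr0 det1.
have [||e] := @IVT R g 0 1 0 ler01.
- by apply: continuous_subspaceT; exact: continuous_horner.
- rewrite g00 ge_min le_max ler01 (ltW gneg) orbT //.
by rewrite in_itv /= => /andP[e0 _] ge; move: (g0 e e0); rewrite ge eqxx.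
Qed.

(** As DX has degree - 1, Jm ((1 + t) p) is Jm p times 1 + ((1 + t)^-1 - 1) A DX. The determinant of
    the second factor has derivative - tr (A DX) at t = 0, and A DX = 1 - A. *)
Lemma Jac_radial p : p != 0 -> 'D_p Jac p = - Jac p * (m%:R - \tr (A p)).
Proof.
move=> p0; have dJ : differentiable Jac p by exact: (DnS (Jac_smooth 1)).1.
have AD : A p *m DX X p = 1%:M - A p.
  have := mulVmx (Jm_unit bK p0); rewrite mulmxDr mulmx1 -/(A p) => <-.
  by rewrite addrC addKr.
have d1 : derivable Jac (p + 0 *: p) p by rewrite scale0r addr0; exact: diff_derivable.
have [_ E1] := is_derive_line d1; rewrite scale0r addr0 in E1; rewrite -E1.
pose M := A p *m DX X p.
have trM : \tr M = m%:R - \tr (A p) by rewrite /M AD linearB /= mxtrace1.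
have l2 : is_derive (0 : R) (1 : R) (fun t : R => (1 + t)^-1 - 1) (-1).
  have h2 : is_derive (0 : R) (1 : R) (fun t : R => 1 + t) 1.
    by have := is_deriveD (is_derive_cst (1:R) (0:R) (1:R)) (is_derive_id (0:R) (1:R)); rewrite add0r.
  have h0 : (fun t : R => 1 + t) 0 != 0 by rewrite addr0 oner_eq0.
  have := is_deriveB (is_deriveV h0 h2) (is_derive_cst (1:R) (0:R) (1:R)).
  by move/is_derive_eq; apply; rewrite addr0 expr1n invr1 subr0 [_ *: _]mulr1.
have l1 : is_derive ((1 + 0)^-1 - 1 : R) (1 : R) (fun e => \det (1%:M + e *: M)) (\tr M).
  by rewrite addr0 invr1 subrr; exact: is_derive_det1.
have l3 := is_derive1_comp (f := fun e => \det (1%:M + e *: M)) (g := fun t : R => (1 + t)^-1 - 1) l1 l2.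
have l4 := is_deriveM (is_derive_cst (Jac p) (0:R) (1:R)) l3.
have E : - Jac p * (m%:R - \tr (A p)) = Jac p *: (\tr M * -1) + \det (1%:M + ((1 + 0)^-1 - 1) *: M) *: 0.
  by rewrite scaler0 addr0 trM /GRing.scale /= mulrN1 mulrN mulNr.
have EQ (t : R) : 0 < 1 + t -> Jac (p + t *: p) = Jac p * \det (1%:M + ((1 + t)^-1 - 1) *: M).
  move=> t1; have -> : p + t *: p = (1 + t) *: p by rewrite scalerDl scale1r.
  have U := Jm_unit bK p0.
  rewrite /Jac -det_mulmx; congr (\det _).
  rewrite [LHS]/Jm (DX_homog p0 t1) mulmxDr mulmx1 -scalemxAr.
  rewrite /M /Mi mulmxA (mulmxV U) mul1mx.
  by rewrite scalerBl scale1r /Jm addrA addrAC addrK.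
rewrite E; case: l4 => _ <-; apply: near_eq_derive.
near=> t; apply: EQ; rewrite -ltrBlDl sub0r; near: t.
by apply: (@cvgr_gt _ _ (nbhs (0:R)) (nbhs_filter (0:R)) id _ cvg_id); rewrite oppr_lt0.
Unshelve. all: by end_near. Qed.

End Jacobian.

Lemma pd_comp1 (R : realType) (m : nat) i (F : 'rV[R]_m -> R) (g : R -> R) d x :
  differentiable F x -> is_derive (F x) (1 : R) g d ->
  pd i (fun x => g (F x)) x = d * pd i F x.
Proof.
move=> dF dg; have [dgd Eg] := dg; move/derivable1_diffP in dgd.
rewrite /pd deriveE; last exact: (@differentiable_comp _ _ _ _ F g).
rewrite (@diff_comp _ _ _ _ F g) //= -(deriveE _ dF).
by rewrite -[X in 'd g (F x) X]mulr1 linearZ /= -deriveE // Eg mulrC.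
Qed.

(** * The divergence theorem outside the body *)

Section Divergence.
Variables (R : realType) (m : nat).
Local Notation V := 'rV[R]_m.
Variables (K : set V) (X : V -> V).
Hypotheses (bK : body K X) (K0 : K !=set0).
Implicit Types (p v y : V).
Local Notation A := (Mi X).
Local Notation pvec := (pvec bK K0).
Local Notation dist := (dist bK K0).
Local Notation nz := (@nonzero R m).

Lemma pvec_Dn1 j : Dn 1 (~` K) (fun y => pvec y 0 j).
Proof.
split=> [y nK|i].
  by apply: differentiable_row_coord; exact: (pvec_differentiable bK K0 nK).1.
have cA : Dn 0 (~` K) (fun y => A (pvec y) i j).
  apply: (@Dn_comp R m 0 (~` K) nz pvec (fun p => A p i j)).
  - exact: open_outside bK.
  - by move=> y nK; apply/negP => /pvec_eq0.
  - move=> l y nK; apply: (@continuous_comp _ _ _ pvec (fun p : V => p 0 l)).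
      exact: pvec_continuous.
    exact: coord_continuous.
  - exact: (Mi_smooth bK i j 0).
apply: Dn_ext cA; first exact: open_outside bK.
move=> y nK; have [d1 d2] := pvec_differentiable bK K0 nK.
rewrite /pd -derive_row_coord; last exact: diff_derivable.
by rewrite -[RHS]/(('D_(ev i) pvec y) 0 j) deriveE // d2 -rowE mxE.
Qed.

Variables (G : V -> R) (F f : R -> R) (a b : R).
Hypotheses (sG : smooth nz G) (hG : homog m%:R G).
Hypotheses (dF : forall L : R, is_derive L (1 : R) F (f L)) (cf : continuous f).
Hypotheses (Fa : forall L, L <= a -> F L = 0) (Fb : forall L, b <= L -> F L = 0).

(** At p = [pvec y] this is the density, with respect to dy, of the pull-back of G dp by [pvec]. *)
Definition density p : R := G p * (Jac X p)^-1.

Lemma density_smooth : smooth nz density.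
Proof.
move=> k; apply: DnM; [exact: open_nonzero|exact: sG|].
by apply: DnV; [exact: open_nonzero|move=> p p0; exact: (Jac_neq0 bK)|exact: (Jac_smooth bK)].
Qed.

(** The degree - m of G cancels the term m of [Jac_radial]; only the trace survives. *)
Lemma density_radial p : p != 0 -> 'D_p density p = - density p * \tr (A p).
Proof.
move=> p0; have dG : differentiable G p by exact: (DnS (sG 1)).1.
have dJ : differentiable (Jac X) p by exact: (DnS (Jac_smooth bK 1)).1.
have J0 := Jac_neq0 bK p0.
have jJ : derivable (Jac X) p p by exact: diff_derivable.
rewrite /density derM; [|exact: diff_derivable|exact: derivableV].
rewrite deriveV // (Euler_homog p0 dG hG) (Jac_radial bK p0).
rewrite /GRing.scale /=.
move: (\tr _) (G p) (Jac X p) J0 => t g J J0 {jJ dG dJ}.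
by field.
Qed.

Definition vfield j p : R := F (ln (enorm p)) * (density p * p 0 j).

Lemma ln_enorm_Dn1 : Dn 1 nz (fun p => ln (enorm p)).
Proof.
apply: (@Dn_comp1 R m 0 nz (fun p : V => enorm p) (@ln R) (fun x => x^-1)).
- exact: open_nonzero.
- by move=> p p0; apply: is_derive1_ln; rewrite enorm_gt0.
- apply: DnV; [exact: open_nonzero|by move=> p p0; rewrite gt_eqF // enorm_gt0|].
  by move=> p _; exact: enorm_continuous.
- apply: Dn_sqrt; [exact: open_nonzero|by move=> p p0; exact: dotp_gt0|].
  apply: Dn_sum => [|i]; first exact: open_nonzero.
  by apply: DnM; [exact: open_nonzero|exact: Dn_coord|exact: Dn_coord].
Qed.

Lemma cutoff_Dn1 : Dn 1 nz (fun p => F (ln (enorm p))).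
Proof.
apply: (@Dn_comp1 R m 0 nz (fun p : V => ln (enorm p)) F f).
- exact: open_nonzero.
- move=> p p0; apply: (@continuous_comp _ _ _ (fun p : V => ln (enorm p)) f); last exact: cf.
  exact: Dn_continuous ln_enorm_Dn1 p0.
- exact: ln_enorm_Dn1.
Qed.

Lemma vfield_Dn1 j : Dn 1 nz (vfield j).
Proof.
apply: DnM; [exact: open_nonzero|exact: cutoff_Dn1|].
by apply: DnM; [exact: open_nonzero|exact: density_smooth|exact: Dn_coord].
Qed.

Lemma vfield0 j p : enorm p < expR a -> vfield j p = 0.
Proof.
have [->|p0] := eqVneq p 0; first by rewrite /vfield mxE !mulr0.
by move=> pa; rewrite /vfield Fa ?mul0r // -ler_expR lnK ?posrE ?enorm_gt0 // ltW.
Qed.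

Lemma vfield1 j p : expR b <= enorm p -> vfield j p = 0.
Proof.
move=> pb; rewrite /vfield Fb ?mul0r // -ler_expR lnK ?posrE //.
exact: lt_le_trans (expR_gt0 _) pb.
Qed.

Let near_body := [set y | dist y < expR a].

Let open_near_body : open near_body.
Proof. by apply: open_comp (@open_lt R _) => y _; exact: dist_continuous. Qed.

(** Differentiability of [pvec] is known outside K only, but the cutoff F (ln |p|) vanishes wherever
    dist < exp a. *)
Lemma vfield_pvec_Dn1 j : Dn 1 setT (fun y => vfield j (pvec y)).
Proof.
apply: Dn_local => y _; have [Ky|nK] := pselect (K y).
  exists near_body; split=> //.
    by have /eqP p0 := (pvec_eq0 bK K0 y).2 Ky; rewrite /near_body /= /dist p0 enorm0 expR_gt0.
  apply: (@Dn_ext _ _ _ _ (fun=> 0)) (Dn_cst _ _ _) => // z zn.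
  by rewrite vfield0.
exists (~` K); split=> //; first exact: open_outside bK.
apply: (@Dn_comp R m 1 (~` K) nz pvec (vfield j)).
- exact: open_outside bK.
- by move=> z nz; apply/negP => /pvec_eq0.
- exact: pvec_Dn1.
- exact: vfield_Dn1.
Qed.

(** The divergence in y brings in the matrix A. By p A = p all derivatives of the factors become
    radial ones, while the derivative of the factor p contributes F density tr A; [density_radial]
    cancels this trace, and only the radial derivative f of the cutoff remains. *)
Lemma vfield_divergence y :
  \sum_j pd j (fun y => vfield j (pvec y)) y =
  if 0 < dist y then f (ln (dist y)) * density (pvec y) else 0.
Proof.
case: ifPn => [/dist_gt0 nK|]; last first.
  rewrite -leNgt => d0; apply: big1 => j _.
  rewrite (near_eq_pd (G := fun=> 0)); first by rewrite /pd derive_cst.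
  apply: (open_near_eq open_near_body) => [|z zn]; last by rewrite vfield0.
  by rewrite /near_body /= (le_lt_trans d0) ?expR_gt0.
have p0 : pvec y != 0 by apply/negP => /pvec_eq0.
set p := pvec y in p0 *.
have [dp Ep] := pvec_differentiable bK K0 nK.
have E j : pd j (fun y => vfield j (pvec y)) y = \sum_i pd i (vfield j) p * A p j i.
  rewrite /pd derive_comp_row //; last exact: (DnS (vfield_Dn1 j)).1.
  apply: eq_bigr => i _; congr (_ * _).
  rewrite -derive_row_coord; last exact: diff_derivable.
  by rewrite deriveE // Ep -rowE mxE.
rewrite (eq_bigr _ (fun j _ => E j)) exchange_big /=.
have dS : differentiable (fun p => F (ln (enorm p))) p by exact: (DnS cutoff_Dn1).1.
have dq : differentiable density p by exact: (DnS (density_smooth 1)).1.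
have Ei i : \sum_j pd i (vfield j) p * A p j i =
    (pd i (fun p => F (ln (enorm p))) p * density p + F (ln (enorm p)) * pd i density p) * p 0 i
    + F (ln (enorm p)) * density p * A p i i.
  have Eij j : pd i (vfield j) p * A p j i =
      (pd i (fun p => F (ln (enorm p))) p * density p + F (ln (enorm p)) * pd i density p)
        * (p 0 j * A p j i) + F (ln (enorm p)) * density p * ((i == j)%:R * A p j i).
    have dc : differentiable (fun q : V => q 0 j) p by exact: differentiable_coord.
    rewrite /vfield (pdM _ dS (differentiableM dq dc)) (pdM _ dq dc) pd_coord /=.
    rewrite -[(density * _) p]/(density p * p 0 j); move: (_ == _)%:R => e.
    ring.
  rewrite (eq_bigr _ (fun j _ => Eij j)) big_split /= -!mulr_sumr; congr (_ * _ + _ * _).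
    by have /rowP/(_ i) := mulmx_Mi bK p0; rewrite mxE.
  rewrite (bigD1 i) //= eqxx mul1r big1 ?addr0 // => j ji.
  by rewrite eq_sym (negbTE ji) mul0r.
rewrite (eq_bigr _ (fun i _ => Ei i)) big_split /= -mulr_sumr -/(\tr (A p)).
under eq_bigr do rewrite mulrDl.
rewrite big_split /=.
have -> : \sum_i F (ln (enorm p)) * pd i density p * p 0 i =
    F (ln (enorm p)) * (- density p * \tr (A p)).
  rewrite -density_radial // derive_row // mulr_sumr.
  by apply: eq_bigr => i _; rewrite -mulrA [_ * p 0 i]mulrC.
have -> : \sum_i pd i (fun p => F (ln (enorm p))) p * density p * p 0 i =
    density p * f (ln (enorm p)).
  have Ef i : pd i (fun p => F (ln (enorm p))) p = f (ln (enorm p)) * (p 0 i * (dotp p p)^-1).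
    have [dl <-] := pd_ln_enorm i p0.
    exact: (pd_comp1 i dl (dF _)).
  have p2 : dotp p p != 0 by rewrite gt_eqF // dotp_gt0.
  transitivity (\sum_i density p * f (ln (enorm p)) * (dotp p p)^-1 * (p 0 i * p 0 i)).
    by apply: eq_bigr => i _; rewrite Ef; ring.
  by rewrite -mulr_sumr -/(dotp p p) -mulrA mulVf // mulr1.
rewrite -/p /dist -/p; move: (\tr _) => t; ring.
Qed.

Lemma integral_divergence :
  (\int[lam R m]_y (if (0 < dist y)%R then f (ln (dist y)) * density (pvec y) else 0)%:E = 0)%E.
Proof.
have [c Kc] := K0.
have [B hB] : exists B, forall y, B < `|y| -> expR b < dist y.
  have [B _ hB] := compact_enorm_bound (body_compact bK).
  exists (B + expR b) => y yB; have := hB _ (projK bK K0 y).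
  have : enorm y <= dist y + enorm (proj bK K0 y).
    by rewrite -{1}(subrK (proj bK K0 y) y) enormD.
  have := norm_le_enorm y.
  by move: yB; move: `|y| (enorm y) (dist y) (enorm _) => u v w z; lra.
have Fz j y : B < `|y| -> vfield j (pvec y) = 0.
  by move=> /hB yb; rewrite vfield1 // ltW.
have oB : open [set y : V | B < `|y|].
  by apply: open_comp (@open_gt R _) => y _; exact: norm_continuous.
have Gz j y : B < `|y| -> pd j (fun y => vfield j (pvec y)) y = 0.
  move=> yB; rewrite (near_eq_pd (G := fun=> 0)); first by rewrite /pd derive_cst.
  by apply: (open_near_eq oB) => // z; exact: Fz.
have D1 j := DnS (vfield_pvec_Dn1 j).
have cG j : continuous (pd j (fun y => vfield j (pvec y))).
  by move=> y; apply: (D1 j).2.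
have I0 j : (\int[lam R m]_y (pd j (fun y => vfield j (pvec y)) y)%:E = 0)%E.
  apply: (integral_derivative0 (F := fun y => vfield j (pvec y)) (i := j) (B := B)) => //; last exact: Gz.
    move=> y; apply: DeriveDef => //; apply: diff_derivable; exact: (D1 j).1.
  exact: Fz.
under eq_integral do rewrite -vfield_divergence -sumEFin.
rewrite integral_sum //; last first.
  by move=> j; apply: (continuous_support_integrable (cG j) (Gz j)).
by apply: big1 => j _; exact: I0.
Qed.
End Divergence.

Section Density.
Context d (T : measurableType d) (R : realType).
Variables (mu : {measure set T -> \bar R}) (w : T -> R).

Definition mdensity (mw : measurable_fun setT w) (w0 : forall x, 0 <= w x) (A : set T) : \bar R :=
  (\int[mu]_(x in A) (w x)%:E)%E.

Variables (mw : measurable_fun setT w) (w0 : forall x, 0 <= w x).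
Local Notation dens := (mdensity mw w0).

Let mwE D : measurable D -> measurable_fun D (fun x => (w x)%:E).
Proof. by move=> mD; apply: measurable_funTS; exact/measurable_EFinP. Qed.

Let dens0 : dens set0 = 0%E. Proof. by rewrite /mdensity integral_set0. Qed.

Let dens_ge0 A : (0 <= dens A)%E.
Proof. by apply: integral_ge0 => x _; rewrite lee_fin. Qed.

Let dens_additive : semi_sigma_additive dens.
Proof.
move=> F mF tF mU; rewrite /mdensity ge0_integral_bigcup //; last 2 first.
- exact: mwE.
- by move=> x _; rewrite lee_fin.
by apply: is_cvg_ereal_nneg_natsum_cond => n _ _; exact: dens_ge0.
Qed.

HB.instance Definition _ := isMeasure.Build _ _ _ dens dens0 dens_ge0 dens_additive.

Import HBNNSimple.

Lemma ge0_integral_mdensity (f : T -> \bar R) : measurable_fun setT f ->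
  (forall x, 0 <= f x)%E ->
  (\int[dens]_x f x = \int[mu]_x (f x * (w x)%:E))%E.
Proof.
move=> mf f0; pose h := nnsfun_approx measurableT mf.
have hf x : (EFin \o h n) x @[n --> \oo] --> f x by exact: cvg_nnsfun_approx.
have -> : (\int[dens]_x f x = lim (\int[dens]_x (EFin \o h n) x @[n --> \oo]))%E.
  have fE x : f x = lim ((EFin \o h n) x @[n --> \oo]) by apply/esym/cvg_lim.
  under eq_integral do rewrite fE.
  apply: monotone_convergence => //.
  - by move=> n; apply/measurable_EFinP; exact/measurable_funP.
  - by move=> n x _ //=; rewrite lee_fin.
  - by move=> x _ a b ab; rewrite lee_fin; exact/lefP/nd_nnsfun_approx.
have -> : (\int[mu]_x (f x * (w x)%:E) =
    lim (\int[mu]_x ((EFin \o h n) x * (w x)%:E) @[n --> \oo]))%E.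
  have fE x : (f x * (w x)%:E = lim (((EFin \o h n) x * (w x)%:E)%E @[n --> \oo]))%E.
    by apply/esym/cvg_lim => //; apply: cvgeZr.
  under eq_integral do rewrite fE.
  apply: monotone_convergence => //.
  - move=> n; apply: emeasurable_funM; last exact: mwE.
    by apply/measurable_EFinP; exact/measurable_funP.
  - by move=> n x _ /=; rewrite mule_ge0 ?lee_fin.
  - move=> x _ a b ab /=; rewrite lee_wpmul2r ?lee_fin //; exact/lefP/nd_nnsfun_approx.
suff suf n : (\int[mu]_x ((EFin \o h n) x * (w x)%:E) = \int[dens]_x (EFin \o h n) x)%E.
  by under [in RHS]eq_fun do rewrite suf.
transitivity (\int[dens]_x
   (\sum_(y \in range (h n)) (y * \1_(h n @^-1` [set y]) x)%:E))%E; last first.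
  by apply: eq_integral => t tE; rewrite /= fimfunE -fsumEFin.
have indich m r : measurable_fun setT (fun x => (r * \1_(h m @^-1` [set r]) x)%:E).
  by apply/measurable_EFinP; exact: measurable_funM.
rewrite ge0_integral_fsum//; last by move=> m y _; exact: nnfun_muleindic_ge0.
transitivity (\int[mu]_x (\sum_(y \in range (h n))
    ((y * \1_(h n @^-1` [set y]) x)%:E * (w x)%:E)))%E.
  under [RHS]eq_integral => x xE.
    rewrite -ge0_mule_fsuml => [|y]; last exact: nnfun_muleindic_ge0.
    rewrite fsumEFin // -(fimfunE _ x); over.
  by [].
rewrite ge0_integral_fsum//; last 2 first.
- by move=> y; apply: emeasurable_funM => //; exact: mwE.
- by move=> m y _; apply: mule_ge0; [exact: nnfun_muleindic_ge0|rewrite lee_fin].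
apply: eq_fsbigr => r rhn.
under [RHS]eq_integral do rewrite EFinM.
rewrite integralZl_indic_nnsfun => //.
under eq_integral do rewrite EFinM -muleA.
rewrite ge0_integralZl//.
- under eq_integral do rewrite muleC.
  rewrite (eq_integral ((fun x => (w x)%:E) \_ (h n @^-1` [set r]))); last first.
    by move=> x xE; rewrite epatch_indic.
  by rewrite -integral_mkcond integral_indic // setIT.
- by apply: emeasurable_funM; [exact/measurable_EFinP|exact: mwE].
- by move=> t _; rewrite mule_ge0 ?lee_fin.
- by move: rhn; rewrite inE => -[t _ <-]; rewrite lee_fin.
Qed.

End Density.

Section Ramp.
Variable R : realType.
Implicit Types x a b : R.

Definition pos x : R := Num.max x 0.
Definition qpos x : R := pos x ^+ 2 / 2.

Lemma is_derive_qpos x : is_derive x (1 : R) qpos (pos x).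
Proof.
have K h : `|qpos (h + x) - qpos x - h * pos x| <= `|h| ^+ 2.
  rewrite real_normK ?num_real // /qpos /pos ler_norml.
  by case: (leP (h + x) 0) => h1; case: (leP x 0) => h2; apply/andP; split; nra.
have C : h^-1 *: ((qpos \o shift x) (h *: (1 : R)) - qpos x) @[h --> 0^'] --> pos x.
  apply/cvgrPdist_le => e e0; near=> h.
  have h0 : h != 0 by near: h; exact: nbhs_dnbhs_neq.
  rewrite /= [h *: _]mulr1 /GRing.scale /=.
  rewrite (_ : pos x - _ = - (h^-1 * (qpos (h + x) - qpos x - h * pos x))); last by field.
  rewrite normrN normrM normfV ler_pdivrMl ?normr_gt0 // (le_trans (K h)) //.
  rewrite expr2 ler_wpM2l //; near: h; apply: dnbhs0_le => //.
by split; [apply/cvg_ex; exists (pos x)|exact: cvg_lim C].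
Unshelve. all: by end_near. Qed.

Lemma pos_continuous : continuous pos.
Proof. by move=> x; apply: continuous_max; [exact: cvg_id|exact: cvg_cst]. Qed.

Variable n : nat.
Local Notation e := (n.+1%:R^-1 : R).
(** A continuous approximation of the indicator of ]0, +oo[. It comes with the explicit primitive
    [qramp], since the divergence theorem works with the primitive F of the profile f. *)
Definition ramp x : R := n.+1%:R * (pos x - pos (x - e)).
Definition qramp x : R := n.+1%:R * (qpos x - qpos (x - e)).

Lemma e_gt0 : 0 < e. Proof. by rewrite invr_gt0 ltr0n. Qed.

Lemma ramp_le0 x : x <= 0 -> ramp x = 0.
Proof.
have := e_gt0; set d := e => d0 x0; rewrite /ramp /pos -/d.
by case: (leP x 0) => ?; case: (leP (x - d) 0) => ?; rewrite ?subrr ?mulr0 //; lra.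
Qed.

Lemma ramp_ge x : e <= x -> ramp x = 1.
Proof.
have n0 : n.+1%:R != 0 :> R by rewrite pnatr_eq0.
have d0 := e_gt0 => xe; rewrite /ramp /pos.
have -> : Num.max x 0 = x by apply/max_idPl; rewrite (le_trans (ltW d0)).
have -> : Num.max (x - e) 0 = x - e by apply/max_idPl; rewrite subr_ge0.
by rewrite opprB addrC subrK mulfV.
Qed.

Lemma ramp_bound x : 0 <= ramp x <= 1.
Proof.
have n0 : 0 < n.+1%:R :> R by rewrite ltr0n.
have [x0|x0] := leP x 0; first by rewrite ramp_le0 // lexx ler01.
have [xe|xe] := leP e x; first by rewrite ramp_ge // lexx ler01.
rewrite /ramp /pos; have -> : Num.max x 0 = x by apply/max_idPl; exact: ltW.
have -> : Num.max (x - e) 0 = 0 by apply/max_idPr; rewrite subr_le0 ltW.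
by rewrite subr0 mulr_ge0 ?(ltW n0) ?(ltW x0) //= -ler_pdivlMl // mulr1 ltW.
Qed.

Lemma ramp_continuous : continuous ramp.
Proof.
move=> x; apply: cvgM; first exact: cvg_cst.
apply: cvgB; first exact: pos_continuous.
apply: (@continuous_comp _ _ _ (fun x => x - e) pos); last exact: pos_continuous.
by apply: cvgB; [exact: cvg_id|exact: cvg_cst].
Qed.

Lemma is_derive_shift (F : R -> R) (f c x : R) : is_derive (x - c) (1 : R) F f ->
  is_derive x (1 : R) (fun x => F (x - c)) f.
Proof.
move=> dF; have h : is_derive x (1 : R) (fun x => x - c) 1.
  by have := is_deriveB (is_derive_id x (1:R)) (is_derive_cst c x (1:R)); rewrite subr0.
have := is_derive1_comp (f := F) (g := fun x => x - c) dF h.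
by rewrite mulr1.
Qed.

Lemma is_derive_qramp x : is_derive x (1 : R) qramp (ramp x).
Proof.
have := is_deriveB (is_derive_qpos x) (is_derive_shift (is_derive_qpos (x - e))).
by move/(is_deriveZ (n.+1%:R : R)).
Qed.

Lemma qramp_le0 x : x <= 0 -> qramp x = 0.
Proof.
move=> x0; rewrite /qramp /qpos /pos.
have -> : Num.max x 0 = 0 by apply/max_idPr.
have -> : Num.max (x - e) 0 = 0.
  by apply/max_idPr; rewrite subr_le0 (le_trans x0) // ltW // e_gt0.
by rewrite subrr mulr0.
Qed.

Lemma qramp_ge x : e <= x -> qramp x = x - e / 2.
Proof.
have n0 : n.+1%:R != 0 :> R by rewrite pnatr_eq0.
move=> xe; rewrite /qramp /qpos /pos.
have -> : Num.max x 0 = x by apply/max_idPl; rewrite (le_trans (ltW e_gt0)).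
have -> : Num.max (x - e) 0 = x - e by apply/max_idPl; rewrite subr_ge0.
by clear xe; move: n.+1%:R n0 => c c0; field.
Qed.

End Ramp.

Lemma ramp_cvg (R : realType) (x : R) : ramp n x @[n --> \oo] --> (if 0 < x then 1 else 0 : R).
Proof.
case: ifPn => [x0|]; last by rewrite -leNgt => x0; under eq_fun do rewrite ramp_le0 //; exact: cvg_cst.
apply: cvg_near_cst; near=> n; apply: ramp_ge.
near: n; have := @near_infty_natSinv_lt R (PosNum x0).
by apply: filterS => n /= /ltW.
Unshelve. all: by end_near. Qed.

Lemma measurable_continuous_on (R : realType) n (U : set 'rV[R]_n) (f : 'rV[R]_n -> R) :
  open U -> (forall x, U x -> {for x, continuous f}) -> (forall x, ~ U x -> f x = 0) ->
  measurable_fun setT f.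
Proof.
move=> oU cf f0; apply: (measurability _ (RGenOpens.measurableE R)).
move=> _ [_ [a [b ->]] <-]; rewrite setTI; set I := `]a, b[%classic.
rewrite -[_ @^-1` _]setIT -(setUCr U) setIUr; apply: measurableU.
  apply: measurable_open; rewrite openE => x [Ix Ux].
  apply: filterI; last exact: open_nbhs_nbhs.
  by apply: (cf x Ux); apply: open_nbhs_nbhs; split=> //; exact: interval_open.
have mU : measurable (~` U) by apply: measurableC; exact: measurable_open.
have [I0|nI0] := pselect (I 0).
  rewrite (_ : _ `&` _ = ~` U) //; apply/seteqP; split=> [x []//|x Ux]; split=> //.
  by rewrite /= f0.
rewrite (_ : _ `&` _ = set0); first exact: measurable0.
by apply/seteqP; split=> [x [/= + Ux]|//]; rewrite f0.
Qed.

Section Layers.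
Variables (R : realType) (m : nat).
Local Notation V := 'rV[R]_m.
Local Notation leb := (@lebesgue_measure R).
Variables (K : set V) (X : V -> V).
Hypotheses (bK : body K X) (K0 : K !=set0).
Local Notation pvec := (pvec bK K0).
Local Notation dist := (dist bK K0).
Local Notation nz := (@nonzero R m).
Variable G : V -> R.
Hypotheses (sG : smooth nz G) (hG : homog m%:R G).
Local Notation density := (density X G).

Definition layer y : R := if 0 < dist y then density (pvec y) else 0.

Let pvec_nz y : 0 < dist y -> pvec y != 0.
Proof. by move=> d0; rewrite -enorm_gt0. Qed.

Lemma open_dist_gt (c : R) : open [set y | c < dist y].
Proof. by apply: open_comp (@open_gt R _) => y _; exact: dist_continuous. Qed.

Lemma layer_near y : 0 < dist y -> {near y, (fun y => density (pvec y)) =1 layer}.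
Proof.
move=> d0; apply: (@open_near_eq _ _ [set y | 0 < dist y]) => //.
  exact: open_dist_gt.
by move=> z /= z0; rewrite /layer z0.
Qed.

Lemma density_pvec_continuous y : 0 < dist y -> {for y, continuous (fun y => density (pvec y))}.
Proof.
move=> d0; apply: (@continuous_comp _ _ _ pvec density); first exact: pvec_continuous.
have := density_smooth bK sG 0; apply; exact: pvec_nz.
Qed.

Lemma measurable_layer : measurable_fun setT layer.
Proof.
apply: (@measurable_continuous_on _ _ [set y | 0 < dist y]) => [|y /= d0|y /= /negP/negbTE d0].
- exact: open_dist_gt.
- by apply: near_eq_continuous (layer_near d0) _; exact: density_pvec_continuous.
- by rewrite /layer d0.
Qed.

Lemma ln_dist_continuous y : 0 < dist y -> {for y, continuous (fun y => ln (dist y))}.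
Proof.
move=> d0; apply: (@continuous_comp _ _ _ dist (@ln R)); first exact: dist_continuous.
exact: continuous_ln.
Qed.

Lemma layer_continuous (f : R -> R) a : continuous f -> (forall L, L <= a -> f L = 0) ->
  continuous (fun y => f (ln (dist y)) * layer y).
Proof.
move=> cf fa y; have [d0|d0] := ltP 0 (dist y).
  apply: (@near_eq_continuous _ _ (fun y => f (ln (dist y)) * density (pvec y))).
    by apply: filterS (layer_near d0) => z ->.
  apply: continuousM; last exact: density_pvec_continuous.
  apply: (@continuous_comp _ _ _ (fun y => ln (dist y)) f); last exact: cf.
  exact: ln_dist_continuous.
apply: (@near_eq_continuous _ _ (fun=> 0)); last exact: cst_continuous.
have oS : open [set y | dist y < expR a].
  by apply: open_comp (@open_lt R _) => z _; exact: dist_continuous.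
apply: (open_near_eq oS) => [|z /= za]; first by rewrite /= (le_lt_trans d0) // expR_gt0.
rewrite /layer; case: ifPn => z0; last by rewrite mulr0.
by rewrite fa ?mul0r // -ler_expR lnK ?posrE // ltW.
Qed.

Lemma dist_far B : exists C, forall y, C < `|y| -> B < dist y.
Proof.
have [c _ hc] := compact_enorm_bound (body_compact bK).
exists (c + B) => y yB; have := hc _ (projK bK K0 y).
have : enorm y <= dist y + enorm (proj bK K0 y).
  by rewrite -{1}(subrK (proj bK K0 y) y) enormD.
have := norm_le_enorm y.
by move: yB; move: `|y| (enorm y) (dist y) (enorm _) => u v w z; lra.
Qed.

Lemma layer_support (f : R -> R) b : (forall L, b <= L -> f L = 0) ->
  exists C, forall y, C < `|y| -> f (ln (dist y)) * layer y = 0.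
Proof.
move=> fb; have [C hC] := dist_far (expR b); exists C => y /hC yb.
have d0 : 0 < dist y := lt_trans (expR_gt0 _) yb.
by rewrite fb ?mul0r // -ler_expR lnK ?posrE // ltW.
Qed.

Lemma layer_integrable (f : R -> R) a b : continuous f -> (forall L, L <= a -> f L = 0) ->
  (forall L, b <= L -> f L = 0) ->
  (lam R m).-integrable setT (fun y => (f (ln (dist y)) * layer y)%:E).
Proof.
move=> cf fa fb; have [C hC] := layer_support fb.
exact: continuous_support_integrable (layer_continuous cf fa) hC.
Qed.

(* Continuous approximations of the indicator function of ]a, b]. *)
Definition trap a b n (L : R) : R := ramp n (L - a) - ramp n (L - b).

Lemma trap_continuous a b n : continuous (trap a b n).
Proof.
move=> L; apply: cvgB; apply: (@continuous_comp _ _ _ (fun L => L - _) (ramp n));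
  [|exact: ramp_continuous| |exact: ramp_continuous];
  by apply: cvgB; [exact: cvg_id|exact: cvg_cst].
Qed.

Lemma trap_le a b n L : a <= b -> L <= a -> trap a b n L = 0.
Proof. by move=> ab La; rewrite /trap !ramp_le0 ?subrr // subr_le0 // (le_trans La). Qed.

Let en_le1 n : n.+1%:R^-1 <= 1 :> R.
Proof. by rewrite invf_le1 ?ler1n. Qed.

Lemma trap_ge a b n L : a <= b -> b + 1 <= L -> trap a b n L = 0.
Proof.
move=> ab La; rewrite /trap !ramp_ge ?subrr //; have := en_le1 n; set e := _^-1; lra.
Qed.

Lemma trap_bound a b n L : `|trap a b n L| <= 1.
Proof.
rewrite ler_norml /trap; have /andP[h1 h2] := ramp_bound n (L - a).
by have /andP[h3 h4] := ramp_bound n (L - b); apply/andP; split; lra.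
Qed.

Lemma trap_dominated a b n L : a <= b ->
  `|trap a b n L| <= `|trap (a - 1) (b + 1) 0 L|.
Proof.
move=> ab; have [La|aL] := leP L a; first by rewrite trap_le // normr0.
have [bL|Lb] := leP (b + 1) L; first by rewrite trap_ge // normr0.
rewrite (le_trans (trap_bound _ _ _ _)) // /trap ramp_ge ?invr1; last by lra.
by rewrite ramp_le0 ?subr0 ?normr1 //; lra.
Qed.

Lemma trap_integrable a b n : a <= b ->
  (lam R m).-integrable setT (fun y => (trap a b n (ln (dist y)) * layer y)%:E).
Proof.
move=> ab; apply: (@layer_integrable (trap a b n) a (b + 1)); first exact: trap_continuous.
  by move=> L; exact: trap_le.
by move=> L; exact: trap_ge.
Qed.

Definition qtrap a b n (L : R) : R := qramp n (L - a) - qramp n (L - b).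

Lemma is_derive_qtrap a b n L : is_derive L (1 : R) (qtrap a b n) (trap a b n L).
Proof.
exact: is_deriveB (is_derive_shift (is_derive_qramp n _)) (is_derive_shift (is_derive_qramp n _)).
Qed.

Lemma qtrap_le a b n L : a <= b -> L <= a -> qtrap a b n L = 0.
Proof. by move=> ab La; rewrite /qtrap !qramp_le0 ?subrr // subr_le0 // (le_trans La). Qed.

Lemma qtrap_ge a b n L : a <= b -> b + 1 <= L -> qtrap a b n L = b - a.
Proof.
move=> ab La; rewrite /qtrap !qramp_ge; last 2 first.
- by have := en_le1 n; set e := _^-1; lra.
- by have := en_le1 n; set e := _^-1; lra.
by ring.
Qed.

(** Translation invariance: [trap a b n] and (b - a) times [trap 0 1 0] have primitives that agree
    outside a bounded interval, because [qtrap] ends at b - a whatever n is. [integral_divergence]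
    applies to the difference. *)
Lemma integral_trap : exists c, forall a b n, a <= b ->
  (\int[lam R m]_y (trap a b n (ln (dist y)) * layer y)%:E = ((b - a) * c)%:E)%E.
Proof.
pose c := fine (\int[lam R m]_y (trap 0 1 0 (ln (dist y)) * layer y)%:E)%E.
have i0 := trap_integrable 0 (ler01 : (0:R) <= 1).
have c0 : (\int[lam R m]_y (trap 0 1 0 (ln (dist y)) * layer y)%:E = c%:E)%E.
  by rewrite fineK //; exact: integrable_fin_num.
exists c => a b n ab; pose t := b - a.
have dF (L : R) : is_derive L (1 : R) (fun L => qtrap a b n L - t * qtrap 0 1 0 L)
    (trap a b n L - t * trap 0 1 0 L).
  exact: is_deriveB (is_derive_qtrap a b n L) (is_deriveZ t (is_derive_qtrap 0 1 0 L)).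
have cf : continuous (fun L => trap a b n L - t * trap 0 1 0 L).
  move=> L; apply: cvgB; first exact: trap_continuous.
  by apply: cvgM; [exact: cvg_cst|exact: trap_continuous].
have := integral_divergence bK K0 (a := Num.min a 0) (b := Num.max (b + 1) 2) sG hG dF cf.
rewrite (_ : (fun y => _) = (fun y => ((trap a b n (ln (dist y)) * layer y)%:E
    - t%:E * (trap 0 1 0 (ln (dist y)) * layer y)%:E)%E)); last first.
  apply/funext => y; rewrite /layer -EFinM -EFinB; case: ifPn => _; congr EFin; ring.
rewrite integralB //; [|exact: trap_integrable|exact: integrableZl].
rewrite integralZl // c0 -EFinM => h.
have ii := trap_integrable n ab.
rewrite -(fineK (integrable_fin_num _ ii)) // -EFinB in h.
rewrite -(fineK (integrable_fin_num _ ii)) //; congr EFin; apply/eqP; rewrite -subr_eq0.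
apply/eqP; apply: EFin_inj; apply: h => L.
  rewrite le_min => /andP[La L0].
  by rewrite !qtrap_le // mulr0 subrr.
rewrite ge_max => /andP[La L0].
by rewrite !qtrap_ge // subr0 mulr1 subrr.
Qed.

Lemma trap_cvg a b L : a <= b -> trap a b n L @[n --> \oo] --> (\1_(`]a, b]%classic) L : R).
Proof.
move=> ab.
have -> : (\1_(`]a, b]%classic) L : R) = (if 0 < L - a then 1 else 0) - (if 0 < L - b then 1 else 0).
  rewrite indicE; have [bL|Lb] := ltP 0 (L - b).
    have -> : 0 < L - a by lra.
    rewrite memNset ?subrr // /= in_itv /= => /andP[_]; lra.
  rewrite subr0; case: ifPn => La.
    by rewrite mem_set //= in_itv /=; apply/andP; split; lra.
  rewrite memNset //= in_itv /= => /andP[h _].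
  by move: La; rewrite subr_gt0 h.
by apply: cvgB; exact: ramp_cvg.
Qed.

Hypothesis G0 : forall p, p != 0 -> 0 <= G p.

Lemma layer_ge0 y : 0 <= layer y.
Proof.
rewrite /layer; case: ifPn => // d0; rewrite mulr_ge0 ?invr_ge0 //.
  by apply: G0; exact: pvec_nz.
by rewrite ltW // (Jac_gt0 bK) // pvec_nz.
Qed.

Let lnd (y : V) : measurableTypeR R := ln (dist y).

Lemma measurable_ln_dist : measurable_fun setT lnd.
Proof.
apply: (@measurableT_comp _ _ _ _ _ _ (@ln R : measurableTypeR R -> measurableTypeR R)).
  exact: measurable_ln.
by apply: continuous_measurable_row; exact: dist_continuous.
Qed.

Let nu := pushforward (mdensity (lam R m) measurable_layer layer_ge0) lnd.

(** The integrals of the trapezoids do not depend on n, and dominated convergence carries their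
    value over to the indicator. *)
Let nu_itv : exists2 c, 0 <= c & forall a b, a <= b -> nu `]a, b]%classic = ((b - a) * c)%:E.
Proof.
have [c hc] := integral_trap.
have E a b : a <= b -> nu `]a, b]%classic = ((b - a) * c)%:E.
  move=> ab; have mI : measurable (lnd @^-1` `]a, b]%classic).
    by rewrite -[X in measurable X]setTI; exact: measurable_ln_dist.
  transitivity (\int[lam R m]_y (\1_(`]a, b]%classic) (lnd y) * layer y)%:E)%E.
    rewrite /nu /pushforward /mdensity integral_mkcond; apply: eq_integral => y _.
    rewrite /patch indicE; case: ifPn => h.
      by rewrite (_ : (lnd y \in _) = true) ?mul1r //; rewrite inE in h; exact: mem_set.
    rewrite (_ : (lnd y \in _) = false) ?mul0r //; apply/negbTE.
    by move: h; apply: contra; rewrite !inE.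
  have ab' : a - 1 <= b + 1 by lra.
  have iD := integrable_abse (trap_integrable 0 ab').
  pose f_ n y := (trap a b n (lnd y) * layer y)%:E.
  have C : (\int[lam R m]_y f_ n y)%E @[n --> \oo] -->
      (\int[lam R m]_y (\1_(`]a, b]%classic) (lnd y) * layer y)%:E)%E.
    apply: (dominated_cvg measurableT _ _ _ iD) => //=.
    - by move=> n; exact: measurable_int (trap_integrable n ab).
    - move=> y _; apply: cvg_EFin; first exact: nearW.
      by apply: cvgMl; exact: trap_cvg.
    - by move=> n y _; rewrite lee_fin !normrM ler_wpM2r // trap_dominated.
  apply: (@cvg_unique _ _ _ _ _ _ C); first exact: ereal_hausdorff.
  rewrite (_ : (fun n => _) = (fun=> ((b - a) * c)%:E)); last by apply/funext => n; exact: hc.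
  exact: cvg_cst.
exists c => //.
have : (0 <= nu `]0%R, 1%R]%classic)%E.
  by apply: integral_ge0 => y _; rewrite lee_fin layer_ge0.
by rewrite E ?ler01 // subr0 mul1r lee_fin.
Qed.

Lemma integral_layer : exists2 c, 0 <= c & forall f : measurableTypeR R -> \bar R,
  measurable_fun setT f -> (forall L, 0 <= f L)%E ->
  (\int[lam R m]_y (f (ln (dist y)) * (layer y)%:E) = c%:E * \int[leb]_L f L)%E.
Proof.
have [c c0 hc] := nu_itv; exists c => // f mf f0.
have mfl : measurable_fun setT (f \o lnd) by exact: measurableT_comp mf measurable_ln_dist.
rewrite -(ge0_integral_mdensity (lam R m) measurable_layer layer_ge0 mfl) //.
have P := ge0_integral_pushforward measurable_ln_dist (mdensity (lam R m) measurable_layer layer_ge0)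
  measurableT mf (fun y _ => f0 y).
rewrite preimage_setT in P; rewrite -P.
rewrite -(ge0_integral_mscale leb measurableT (NngNum c0)) //.
apply: eq_measure_integral => [|mm]; first exact: measurable_ln_dist.
move=> A mA _.
apply: (@measure_unique _ R (measurableTypeR R) (@ocitv R) (fun k => `](- k%:R), k%:R]%classic) _ _ _ _ _ _ _ _ A mA) => //.
- exact: ocitvI.
- by move=> k; exact: is_ocitv.
- apply/seteqP; split=> // x _.
  exists (Num.truncn `|x|).+1 => //=; rewrite in_itv /=.
  have := truncnS_gt `|x|; rewrite ltr_norml => /andP[h1 h2].
  by rewrite h1 ltW.
- move=> _ [[a b] _ <-] /=; have [ba|ab] := leP a b; last first.
    by rewrite set_itv_ge ?measure0 // -leNgt bnd_simp ltW.
  rewrite -[LHS]/(nu `]a, b]%classic) hc // /mscale /= lebesgue_measure_itv /= lte_fin.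
  case: ltP => [_|ba']; first by rewrite -EFinD -EFinM mulrC.
  by rewrite mule0 (_ : b - a = 0) ?mul0r //; apply/eqP; rewrite subr_eq0 eq_le ba ba'.
- move=> k; rewrite -[X in (X < _)%E]/(nu `](- k%:R), k%:R]%classic) hc ?ltry //.
  by rewrite (le_trans (y := 0)) // oppr_le0.
by move=> y; exact: f0.
Qed.

End Layers.

Lemma poly_eq_pos (R : realType) (p q : {poly R}) : (forall t, 0 < t -> p.[t] = q.[t]) -> p = q.
Proof.
move=> h; apply/eqP; rewrite -subr_eq0; apply/eqP.
pose s := [seq (i.+1)%:R : R | i <- iota 0 (size (p - q))].
apply: (@roots_geq_poly_eq0 _ _ s).
- by apply/allP => _ /mapP[i _ ->]; rewrite rootE hornerD hornerN h ?ltr0n // subrr.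
- by rewrite map_inj_uniq ?iota_uniq // => i j /eqP; rewrite eqr_nat => /eqP[].
- by rewrite size_map size_iota.
Qed.

Lemma wgt_nat (R : realType) k (t : R) : 0 < t -> wgt k%:R t = (t ^+ k)^-1.
Proof. by move=> t0; rewrite /wgt expRN expRM_natl lnK. Qed.

Section CoefSmooth.
Variables (R : realType) (m : nat).
Local Notation V := 'rV[R]_m.
Variable U : set V.
Hypothesis oU : open U.
Variable k : nat.

Definition coef_Dn (P : V -> {poly R}) := forall l, Dn k U (fun p => (P p)`_l).

Lemma coef_Dn_cst q : coef_Dn (fun=> q).
Proof. by move=> l; exact: Dn_cst. Qed.

Lemma coef_DnD P Q : coef_Dn P -> coef_Dn Q -> coef_Dn (fun p => P p + Q p).
Proof.
move=> hP hQ l; apply: (@Dn_ext _ _ _ _ (fun p => (P p)`_l + (Q p)`_l)) => // [p _|].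
  by rewrite coefD.
exact: DnD.
Qed.

Lemma coef_DnM P Q : coef_Dn P -> coef_Dn Q -> coef_Dn (fun p => P p * Q p).
Proof.
move=> hP hQ l.
apply: (@Dn_ext _ _ _ _ (fun p => \sum_(j < l.+1) (P p)`_j * (Q p)`_(l - j))) => // [p _|].
  by rewrite coefM.
by apply: Dn_sum => // j; exact: DnM.
Qed.

Lemma coef_Dn_det n (M : V -> 'M[{poly R}]_n) :
  (forall i j, coef_Dn (fun p => M p i j)) -> coef_Dn (fun p => \det (M p)).
Proof.
move=> hM; rewrite /determinant.
elim: (index_enum _) => [|s r IH].
  by under eq_fun do rewrite big_nil; exact: coef_Dn_cst.
under eq_fun do rewrite big_cons; apply: coef_DnD => //.
apply: coef_DnM; first exact: coef_Dn_cst.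
elim: (index_enum _) => [|i r' IH'].
  by under eq_fun do rewrite big_nil; exact: coef_Dn_cst.
by under eq_fun do rewrite big_cons; exact: coef_DnM.
Qed.

End CoefSmooth.

(** * The Jacobian as a sum of homogeneous parts *)

Section JacExpansion.
Variables (R : realType) (m : nat).
Local Notation V := 'rV[R]_m.
Variables (K : set V) (X : V -> V).
Hypotheses (bK : body K X).
Implicit Types (p : V).
Local Notation nz := (@nonzero R m).

(** The polynomial det (x + DX p), whose value at x = 1 is the Jacobian; its coefficients separate
    the degrees of homogeneity in p. *)
Definition jpoly p : {poly R} := char_poly (- DX X p).

Lemma jpolyE p x : (jpoly p).[x] = \det (x%:M + DX X p).
Proof.
rewrite -horner_evalE -det_map_mx; congr (\det _); apply/matrixP => i j.
by rewrite !mxE /= /horner_eval hornerD hornerN hornerMn hornerX hornerC opprK.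
Qed.

Lemma size_jpoly p : size (jpoly p) = m.+1.
Proof. by rewrite size_char_poly. Qed.

Lemma jpoly_coef0 p : p != 0 -> (jpoly p)`_0 = 0.
Proof.
move=> p0; rewrite -horner_coef0 jpolyE raddf0 add0r.
apply/eqP/det0P; exists p => //; exact: mulmx_DX bK _ p0.
Qed.

Lemma Jac_jpoly p : p != 0 -> Jac X p = \sum_(k < m) (jpoly p)`_k.+1.
Proof.
move=> p0; have := horner_coef_wide 1 (_ : size (jpoly p) <= m.+1)%N.
rewrite size_jpoly => /(_ (leqnn _)); rewrite jpolyE -[X in X = _]/(Jac X p) => ->.
rewrite big_ord_recl jpoly_coef0 // mul0r add0r.
by apply: eq_bigr => k _; rewrite expr1n mulr1.
Qed.

Lemma jpoly_homog k p (t : R) : (k <= m)%N -> p != 0 -> 0 < t ->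
  (jpoly (t *: p))`_k = (t ^+ (m - k))^-1 * (jpoly p)`_k.
Proof.
move=> km p0 t0.
have -> : jpoly (t *: p) = \poly_(i < m.+1) ((t ^+ m)^-1 * (t ^+ i * (jpoly p)`_i)).
  apply: poly_eq_pos => x x0; rewrite horner_poly jpolyE (DX_homog bK p0 t0).
  transitivity ((t ^+ m)^-1 * (jpoly p).[t * x]).
    rewrite jpolyE -exprVn -detZ; congr (\det _).
    by rewrite scalerDr scale_scalar_mx mulrA mulVf ?mul1r // gt_eqF.
  rewrite (@horner_coef_wide _ m.+1) ?size_jpoly // mulr_sumr.
  by apply: eq_bigr => i _; rewrite exprMn; ring.
rewrite coef_poly ltnS km mulrA; congr (_ * _).
rewrite -{1}(subnK km) exprD invfM -mulrA mulVf ?mulr1 //.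
by rewrite expf_neq0 // gt_eqF.
Qed.

Lemma jpoly_smooth k : smooth nz (fun p => (jpoly p)`_k).
Proof.
move=> n; apply: (coef_Dn_det (@open_nonzero R m)) => i j.
under eq_fun do rewrite !mxE polyCN opprK.
apply: coef_DnD; [exact: open_nonzero|exact: coef_Dn_cst|] => l.
apply: (@Dn_ext _ _ _ _ (fun p => pd i (fun q : V => X q 0 j) p * (l == 0%N)%:R)) => [|p _|].
- exact: open_nonzero.
- by rewrite coefC; case: eqP; rewrite ?mulr1 ?mulr0.
- by apply: DnM; [exact: open_nonzero|exact: (DX_smooth bK)|exact: Dn_cst].
Qed.

(** The power of |p| brings the degree k - m of the coefficient to - m, the degree for which the
    dilation-invariant argument works. *)
Definition layer_coef k p : R := (jpoly p)`_k * (enorm p ^+ k)^-1.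

Lemma layer_coef_smooth k : smooth nz (layer_coef k).
Proof.
move=> n; have o := @open_nonzero R m; apply: DnM => //; first exact: jpoly_smooth.
apply: DnV => // [p p0|]; first by rewrite expf_neq0 // gt_eqF // enorm_gt0.
apply: (@Dn_ext _ _ _ _ (fun p => \prod_(i < k) enorm p)) => // [p _|].
  by rewrite prodr_const card_ord.
apply: Dn_prod => // _; apply: Dn_sqrt => // [p p0|]; first exact: dotp_gt0.
by apply: Dn_sum => // i; apply: DnM => //; exact: Dn_coord.
Qed.

Lemma layer_coef_homog k : (k <= m)%N -> homog m%:R (layer_coef k).
Proof.
move=> km p t p0 t0.
have -> : layer_coef k (t *: p) = (t ^+ (m - k))^-1 * (jpoly p)`_k * (enorm (t *: p) ^+ k)^-1.
  by congr (_ * _); exact: jpoly_homog.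
rewrite /layer_coef.
rewrite enormZ (gtr0_norm t0).
rewrite (wgt_nat m t0).
rewrite exprMn.
have -> : t ^+ m = t ^+ (m - k) * t ^+ k by rewrite -exprD subnK.
move: ((jpoly p)`_k) (enorm p ^+ k) (t ^+ k) (t ^+ (m - k)) => a b c d.
rewrite !invfM.
by ring.
Qed.

End JacExpansion.

Lemma homog_bound (R : realType) m (G : 'rV[R]_m -> R) r : smooth (@nonzero R m) G -> homog r G ->
  exists2 C, 0 <= C & forall p, p != 0 -> `|G p| <= C * wgt r (enorm p).
Proof.
move=> sG hG; have [C C0 hC] := @homog_Sym R m unit 0 r G sG hG.
exists C => // p p0; have e0 : 0 < enorm p by rewrite enorm_gt0.
(* Symbol bounds hold for |p| > 1 only; p is rescaled to norm 2 and homogeneity brings the bound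
   back. *)
pose t := enorm p / 2; have t0 : 0 < t by rewrite divr_gt0.
have q2 : enorm (t^-1 *: p) = 2.
  by rewrite enormZ gtr0_norm ?invr_gt0 // /t invf_div divfK // gt_eqF.
have q0 : t^-1 *: p != 0 by rewrite -enorm_gt0 q2.
clearbody t.
have -> : p = t *: (t^-1 *: p) by rewrite scalerA mulfV ?scale1r // gt_eqF.
rewrite hG // normrM gtr0_norm ?wgt_gt0 // enormZ q2 (gtr0_norm t0) (wgtM r t0 (ltr0n _ 2)).
rewrite [leRHS]mulrCA ler_pM2l ?wgt_gt0 // -q2; apply: (hC tt).
by rewrite /far /= q2 ltr1n.
Qed.

Section ShellFormula.
Variables (R : realType) (m : nat).
Local Notation V := 'rV[R]_m.
Local Notation leb := (@lebesgue_measure R).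
Variables (K : set V) (X : V -> V).
Hypotheses (bK : body K X) (K0 : K !=set0).
Local Notation pvec := (pvec bK K0).
Local Notation dist := (dist bK K0).
Local Notation nz := (@nonzero R m).
Local Notation layer := (layer bK K0).
Implicit Types (G : V -> R) (f : measurableTypeR R -> R).

Lemma measurable_comp_ln_dist f : measurable_fun setT f ->
  measurable_fun setT (fun y => f (ln (dist y))).
Proof. by move=> mf; exact: measurableT_comp mf (measurable_ln_dist bK K0). Qed.

Let maxeM (a b : R) : 0 <= b -> (maxe (a * b)%:E 0 = maxe a%:E 0 * b%:E)%E.
Proof.
move=> b0; have [a0|a0] := leP 0 a.
  by rewrite !max_l ?lee_fin ?mulr_ge0.
by rewrite !max_r ?lee_fin ?mul0e ?(ltW a0) // mulr_le0_ge0 // ltW.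
Qed.

Let integral_layer_ge0 G : smooth nz G -> homog m%:R G -> (forall p, p != 0 -> 0 <= G p) ->
  exists c, forall f, measurable_fun setT f -> leb.-integrable setT (EFin \o f) ->
    (lam R m).-integrable setT (fun y => (f (ln (dist y)) * layer G y)%:E) /\
    (\int[lam R m]_y (f (ln (dist y)) * layer G y)%:E = c%:E * \int[leb]_L (f L)%:E)%E.
Proof.
move=> sG hG G0; have [c c0 hc] := integral_layer bK K0 sG hG G0.
have l0 := layer_ge0 bK K0 G0.
exists c => f mf intf.
have mg : measurable_fun setT (fun y => (f (ln (dist y)) * layer G y)%:E).
  apply/measurable_EFinP; apply: measurable_funM; first exact: measurable_comp_ln_dist.
  exact: measurable_layer.
have mE : measurable_fun setT (EFin \o f) by exact/measurable_EFinP.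
split.
  apply/integrableP; split => //.
  under eq_integral do rewrite /= normrM (ger0_norm (l0 _)) EFinM.
  rewrite (hc (fun L => `|f L|%:E)) //; last first.
    by apply/measurable_EFinP; exact: measurableT_comp.
  move/integrableP : intf => [_ h]; rewrite lte_mul_pinfty ?lee_fin //.
rewrite integralE [in RHS]integralE.
have [P N] : (\int[leb]_x (EFin \o f)^\+ x \is a fin_num /\ \int[leb]_x (EFin \o f)^\- x \is a fin_num)%E.
  by split; [exact: integrable_pos_fin_num|exact: integrable_neg_fin_num].
rewrite muleBr //; last by rewrite fin_num_adde_defl // fin_numN.
rewrite -hc; [|exact: measurable_funepos|by move=> L; exact: funepos_ge0].
rewrite -hc; [|exact: measurable_funeneg|by move=> L; exact: funeneg_ge0].
congr (_ - _)%E; apply: eq_integral => y _; first by rewrite !funeposE maxeM.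
by rewrite !funenegE -!EFinN -mulNr maxeM.
Qed.

(** G is the difference of G + C |p|^-m and C |p|^-m, both nonnegative for a suitable C. *)
Lemma integral_layer_signed G : smooth nz G -> homog m%:R G ->
  exists c, forall f, measurable_fun setT f -> leb.-integrable setT (EFin \o f) ->
    (lam R m).-integrable setT (fun y => (f (ln (dist y)) * layer G y)%:E) /\
    (\int[lam R m]_y (f (ln (dist y)) * layer G y)%:E = c%:E * \int[leb]_L (f L)%:E)%E.
Proof.
move=> sG hG; have [C C0 hC] := homog_bound sG hG.
pose G2 (p : V) := C * (enorm p ^+ m)^-1.
have s2 : smooth nz G2.
  move=> n; have o := @open_nonzero R m; apply: DnM => //; first exact: Dn_cst.
  apply: DnV => // [p p0|]; first by rewrite expf_neq0 // gt_eqF // enorm_gt0.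
  apply: (@Dn_ext _ _ _ _ (fun p => \prod_(i < m) enorm p)) => // [p _|].
    by rewrite prodr_const card_ord.
  apply: Dn_prod => // _; apply: Dn_sqrt => // [p p0|]; first exact: dotp_gt0.
  by apply: Dn_sum => // i; apply: DnM => //; exact: Dn_coord.
have h2 : homog m%:R G2.
  move=> p t p0 t0; rewrite /G2 enormZ (gtr0_norm t0) exprMn invfM (wgt_nat m t0).
  by rewrite mulrCA.
have G20 p : p != 0 -> 0 <= G2 p.
  by move=> _; rewrite mulr_ge0 // invr_ge0 exprn_ge0 // enorm_ge0.
have GG2 p : p != 0 -> `|G p| <= G2 p.
  by move=> p0; rewrite (le_trans (hC p p0)) // (wgt_nat m) // enorm_gt0.
pose G1 p := G p + G2 p.
have s1 : smooth nz G1 by move=> n; apply: DnD; [exact: open_nonzero|exact: sG|exact: s2].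
have h1 : homog m%:R G1 by move=> p t p0 t0; rewrite /G1 hG // h2 // mulrDr.
have G10 p : p != 0 -> 0 <= G1 p.
  by move=> /GG2; rewrite /G1 ler_norml -lerBlDr sub0r => /andP[].
have [c1 hc1] := integral_layer_ge0 s1 h1 G10.
have [c2 hc2] := integral_layer_ge0 s2 h2 G20.
exists (c1 - c2) => f mf intf; have [i1 E1] := hc1 f mf intf; have [i2 E2] := hc2 f mf intf.
have E y : ((f (ln (dist y)) * layer G y)%:E =
    (f (ln (dist y)) * layer G1 y)%:E - (f (ln (dist y)) * layer G2 y)%:E)%E.
  rewrite -EFinB; congr EFin; rewrite -mulrBr; congr (_ * _).
  rewrite /layer; case: ifPn => _; last by rewrite subrr.
  by rewrite /density /G1 mulrDl addrK.
rewrite (_ : (fun y => _) = (fun y => (f (ln (dist y)) * layer G1 y)%:E - (f (ln (dist y)) * layer G2 y)%:E)%E); last by apply/funext.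
split; first exact: integrableB.
rewrite integralB // E1 E2 EFinB muleBl //.
by apply: integrable_fin_num.
Qed.

(** With L = ln dist the factor exp (k L) restores |p|^k, and the sum becomes the Jacobian divided
    by itself. Lebesgue measure outside K is thereby resolved into layers. *)
Lemma layer_coef_sum y : 0 < dist y ->
  \sum_(k < m) expR (k.+1%:R * ln (dist y)) * layer (layer_coef X k.+1) y = 1.
Proof.
move=> d0; have p0 : pvec y != 0 by rewrite -enorm_gt0.
transitivity (\sum_(k < m) (jpoly X (pvec y))`_k.+1 * (Jac X (pvec y))^-1).
  apply: eq_bigr => k _; rewrite /layer d0 /density /layer_coef.
  rewrite expRM_natl lnK // -/(dist y) -!mulrA mulrCA; congr (_ * _).
  by rewrite mulrA mulfV ?mul1r // expf_neq0 // gt_eqF.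
by rewrite -mulr_suml -(Jac_jpoly bK p0) mulfV // (Jac_neq0 bK).
Qed.

(* Outside K the distribution of ln dist has the density
   \sum_(k < m) c k * exp (k.+1 L). *)
Definition shell_coefs (c : nat -> R) := forall f, measurable_fun setT f ->
  (forall k, (k < m)%N -> leb.-integrable setT (fun L => (f L * expR (k.+1%:R * L))%:E)) ->
  (lam R m).-integrable setT (fun y => (if 0 < dist y then f (ln (dist y)) else 0)%:E) /\
  (\int[lam R m]_y (if (0 < dist y)%R then f (ln (dist y)) else 0)%:E =
   \sum_(k < m) (c k)%:E * \int[leb]_L (f L * expR (k.+1%:R * L))%:E)%E.

Theorem shell_formula : exists c, shell_coefs c.
Proof.
have /choice[c hc] : forall k, exists c, (k < m)%N -> forall f, measurable_fun setT f ->
    leb.-integrable setT (EFin \o f) ->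
    (lam R m).-integrable setT (fun y => (f (ln (dist y)) * layer (layer_coef X k.+1) y)%:E) /\
    (\int[lam R m]_y (f (ln (dist y)) * layer (layer_coef X k.+1) y)%:E = c%:E * \int[leb]_L (f L)%:E)%E.
  move=> k; have [km|mk] := boolP (k < m)%N; last by exists 0.
  have [c hc] := integral_layer_signed (layer_coef_smooth bK k.+1) (layer_coef_homog bK km).
  by exists c.
exists c => f mf intf.
have mfe k : measurable_fun setT (fun L : measurableTypeR R => f L * expR (k.+1%:R * L)).
  apply: measurable_funM => //; apply: measurableT_comp => //.
have H (k : 'I_m) := hc k (ltn_ord k) _ (mfe k) (intf k (ltn_ord k)).
have E y : ((if 0 < dist y then f (ln (dist y)) else 0)%:E = \sum_(k < m)
    (f (ln (dist y)) * expR (k.+1%:R * ln (dist y)) * layer (layer_coef X k.+1) y)%:E)%E.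
  rewrite sumEFin; congr EFin.
  under eq_bigr do rewrite -mulrA.
  rewrite -mulr_sumr; case: ifPn => d0; first by rewrite layer_coef_sum // mulr1.
  rewrite big1 ?mulr0 // => k _; rewrite /layer (negbTE d0) mulr0 //.
rewrite (_ : (fun y => _) = (fun y => \sum_(k < m)
    (f (ln (dist y)) * expR (k.+1%:R * ln (dist y)) * layer (layer_coef X k.+1) y)%:E)%E); last by apply/funext.
split; first by apply: integrable_sum => // k _; exact: (H k).1.
rewrite integral_sum //; last by move=> k; exact: (H k).1.
by apply: eq_bigr => k _; exact: (H k).2.
Qed.

End ShellFormula.

(** * Intrinsic volumes *)

Section Exponentials.
Variable R : realType.
Local Notation leb := (@lebesgue_measure R).
Implicit Types (a b k : R).

Lemma expRM_continuous k : continuous (fun x : R => expR (k * x)).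
Proof.
move=> x; apply: (@continuous_comp _ _ _ (fun x => k * x) (@expR R)); last exact: continuous_expR.
by apply: cvgM; [exact: cvg_cst|exact: cvg_id].
Qed.

Lemma is_derive_expRM k x : is_derive x (1 : R) (fun x => expR (k * x)) (k * expR (k * x)).
Proof.
have h : is_derive x (1 : R) (fun x => k * x) k.
  by have := is_deriveZ k (is_derive_id x (1:R)); rewrite [k *: 1]mulr1.
by have := is_derive1_comp (f := @expR R) (g := fun x => k * x) (is_derive_expR _) h; rewrite mulrC.
Qed.

Lemma integral_exp_tail k a : 0 < k ->
  (\int[leb]_(x in `[a, +oo[) (expR (- k * x))%:E = (expR (- k * a) / k)%:E)%E.
Proof.
move=> k0; have kn : k != 0 by rewrite gt_eqF.
rewrite (@ge0_continuous_FTC2y _ _ (fun x => - k^-1 * expR (- k * x)) _ 0) => //.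
- by rewrite -EFinB sub0r mulNr opprK mulrC.
- by apply: continuous_subspaceT; exact: expRM_continuous.
- rewrite -(mulr0 (- k^-1)); apply: cvgM; first exact: cvg_cst.
  rewrite (_ : (fun x => expR (- k * x)) = (fun z => expR (- z)) \o (fun z => k * z)); last first.
    by apply: eq_fun => x; rewrite mulNr.
  apply: (@cvg_comp _ _ _ _ _ _ (pinfty_nbhs R)); last exact: cvgr_expR.
  exact: gt0_cvgMry.
- apply: cvgM; first exact: cvg_cst.
  by apply: cvg_at_right_filter; exact: expRM_continuous.
- move=> x _; rewrite derive1E.
  have := is_deriveZ (- k^-1) (is_derive_expRM (- k) x); case=> _ E.
  by rewrite [LHS]E /GRing.scale /= mulrA mulNr mulrN opprK mulVf // mul1r.
Qed.

Lemma integral_exp_head k b : 0 < k ->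
  (\int[leb]_(x in `]-oo, b]) (expR (k * x))%:E = (expR (k * b) / k)%:E)%E.
Proof.
move=> k0; have := @ge0_integration_by_substitutionNy R (fun x => expR (k * x)) (- b).
rewrite opprK => ->.
- under eq_integral do rewrite /= mulrN -mulNr.
  by rewrite integral_exp_tail // mulrNN.
- by apply: continuous_subspaceT; exact: expRM_continuous.
- by move=> x _; exact: expR_ge0.
Qed.

(** Besides a lower bound, taken on [1, 2], finiteness has to be shown: [Gamma] goes through [fine],
    which sends an infinite integral to 0. *)
Lemma Gamma_gt0 (l : nat) : 0 < Gamma (l%:R / 2 + 1 : R).
Proof.
pose a : R := l%:R / 2; have a0 : 0 <= a by rewrite divr_ge0.
rewrite /Gamma addrK -/a; pose g (t : R) : R := t `^ a * expR (- t).
have mg D : measurable_fun D g.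
  apply: measurable_funTS; apply: measurable_funM.
    exact: measurable_powR.
  by apply: measurableT_comp => //; exact: measurableT_comp.
have g0 t : 0 <= g t by rewrite mulr_ge0 ?powR_ge0 ?expR_ge0.
have [C C0 hC] : exists2 C, 0 <= C & forall t, 0 < t -> g t <= C * expR (- (1 / 2) * t).
  have [a00|an] := eqVneq a 0.
    exists 1 => // t t0; rewrite /g a00 powRr0 !mul1r ler_expR; lra.
  have ap : 0 < 2 * a by rewrite mulr_gt0 // lt_neqAle eq_sym an.
  (* The maximum of t^a exp (- t / 2), attained at t = 2 a; the inequality is ln x <= x - 1 at x = t
     / (2 a). *)
  exists (expR (- a + a * ln (2 * a))); first exact: expR_ge0.
  move=> t t0; rewrite /g /powR gt_eqF // -!expRD ler_expR.
  have h : ln (t / (2 * a)) <= t / (2 * a) - 1.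
    have tp : 0 < t / (2 * a) by rewrite divr_gt0.
    have tE : t / (2 * a) = 1 + (t / (2 * a) - 1) by rewrite addrC subrK.
    by rewrite {1}tE; apply: le_ln1Dx; rewrite ltrBrDl subrr.
  rewrite ln_div ?posrE // in h.
  have := ler_wpM2l a0 h; rewrite !mulrBr mulr1.
  have -> : a * (t / (2 * a)) = t / 2 by field; rewrite an.
  move: (a * ln t) (a * ln (2 * a)) => u v; lra.
have fin : (\int[leb]_(t in `]0%R, +oo[) (g t)%:E < +oo)%E.
  have me D : measurable_fun D (fun t : measurableTypeR R => (expR (- (1 / 2) * t))%:E).
    apply: measurable_funTS; apply/measurable_EFinP; apply: measurableT_comp => //.
  have mh D : measurable_fun D (fun t : measurableTypeR R => (C%:E * (expR (- (1 / 2) * t))%:E)%E).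
    by apply: emeasurable_funM => //; exact: me.
  have h0 t : (0 <= C%:E * (expR (- (1 / 2) * t))%:E)%E.
    by rewrite -EFinM lee_fin mulr_ge0 ?expR_ge0.
  apply: (@le_lt_trans _ _ (\int[leb]_(t in `[0%R, +oo[) (C%:E * (expR (- (1 / 2) * t))%:E))%E).
    apply: (@le_trans _ _ (\int[leb]_(t in `]0%R, +oo[) (C%:E * (expR (- (1 / 2) * t))%:E))%E).
      apply: ge0_le_integral => //.
      - by move=> x _; rewrite lee_fin.
      - by apply/measurable_EFinP; exact: mg.
      - by move=> x /=; rewrite in_itv /= andbT => x0; rewrite -EFinM lee_fin hC.
    apply: ge0_subset_integral => //.
    by move=> x /=; rewrite !in_itv /= !andbT => /ltW.
  rewrite ge0_integralZl //.
  by rewrite integral_exp_tail ?divr_gt0 // -EFinM ltry.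
have pos : ((expR (- 2))%:E <= \int[leb]_(t in `]0%R, +oo[) (g t)%:E)%E.
  apply: (@le_trans _ _ (\int[leb]_(t in `[1%R, 2%R]) (g t)%:E)%E); last first.
    apply: ge0_subset_integral => //.
    - by apply/measurable_EFinP; exact: mg.
    - by move=> x _; rewrite lee_fin.
    - by move=> x /=; rewrite !in_itv /= !andbT => /andP[/(lt_le_trans _)->].
  apply: (@le_trans _ _ (\int[leb]_(t in `[1%R, 2%R]) (expR (- 2))%:E)%E).
    have l12 : leb `[1, 2]%classic = 1%E.
      rewrite lebesgue_measure_itv /= lte_fin ltr1n -EFinB; congr EFin.
      by rewrite [LHS]addrC -[X in _ + X]natr1 addKr.
    by rewrite integral_cst // -[X in (_ * X)%E]/(leb `[1, 2]%classic) l12 mule1.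
  apply: ge0_le_integral => //.
  - by apply/measurable_EFinP; exact: mg.
  - move=> x /=; rewrite in_itv /= => /andP[x1 x2]; rewrite lee_fin /g.
    rewrite -[leLHS]mul1r ler_pM ?expR_ge0 // ?ler_expR ?lerN2 //.
    by rewrite -(powRr0 x) ler_powR.
rewrite /Rintegral; apply: fine_gt0; rewrite fin andbT.
by apply: lt_le_trans pos; rewrite lte_fin expR_gt0.
Qed.

Lemma ball_volume_gt0 l : 0 < ball_volume R l.
Proof. by rewrite divr_gt0 ?Gamma_gt0 // powR_gt0 // pi_gt0. Qed.

End Exponentials.

Section Steiner.
Variables (R : realType) (m : nat).
Local Notation V := 'rV[R]_m.
Local Notation leb := (@lebesgue_measure R).
Variables (K : set V) (X : V -> V).
Hypotheses (bK : body K X) (K0 : K !=set0).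
Local Notation dist := (dist bK K0).

Lemma minkowski_ball t : 0 < t -> Defs.minkowski t K unit_ball = [set y | dist y <= t].
Proof.
move=> t0; apply/seteqP; split=> [_ [x [u [Kx u1 ->]]]|y /= yt].
  have := dist_le bK K0 (x + t *: u) Kx => /le_trans; apply.
  by rewrite addrC addKr enormZ gtr0_norm // -[leRHS]mulr1 ler_pM2l.
exists (proj bK K0 y), (t^-1 *: pvec bK K0 y); split; first exact: projK.
  by rewrite /unit_ball /= enormZ gtr0_norm ?invr_gt0 // ler_pdivrMl // mulr1.
by rewrite scalerA mulfV ?scale1r ?gt_eqF // /pvec addrC subrK.
Qed.

Lemma lam_compact : (lam R m K < +oo)%E.
Proof.
have [B B0 hB] := compact_enorm_bound (body_compact bK).
apply: le_lt_trans (cube_finite m B); apply: le_measure; rewrite ?inE.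
- apply: measurable_closed; apply: compact_closed; [exact: norm_hausdorff|exact: body_compact bK].
- by apply: measurable_closed; exact: closed_norm_le.
- by move=> x /hB /= xB; exact: le_trans (norm_le_enorm x) xB.
Qed.

(** The shell formula is applied to the indicator of ]-oo, ln t]; it sees only the outside of K, so
    the volume of K is added as the constant term. *)
Lemma tube_volume (c : nat -> R) : shell_coefs bK K0 c ->
  forall t, 0 < t ->
  lam R m [set y | dist y <= t] =
    (fine (lam R m K) + \sum_(k < m) c k / k.+1%:R * t ^+ k.+1)%:E.
Proof.
move=> hc t t0; pose f (L : measurableTypeR R) : R := \1_(`]-oo, ln t]%classic) L.
have mf : measurable_fun setT f by exact: measurable_indic.
have I (k : nat) : (\int[leb]_L (f L * expR (k.+1%:R * L))%:E = (t ^+ k.+1 / k.+1%:R)%:E)%E.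
  transitivity (\int[leb]_(x in `]-oo, (ln t)]) (expR (k.+1%:R * x))%:E)%E.
    rewrite [RHS]integral_mkcond; apply: eq_integral => x _.
    by rewrite /f indicE patchE; case: ifPn => _; rewrite ?mul1r ?mul0r.
  by rewrite integral_exp_head ?ltr0n // expRM_natl lnK.
have mfe (k : nat) : measurable_fun setT (fun L : measurableTypeR R => f L * expR (k.+1%:R * L)).
  apply: measurable_funM => //; apply: measurableT_comp => //.
have [k _|_ E] := hc f mf.
  apply/integrableP; split; first exact/measurable_EFinP.
  under eq_integral do rewrite gee0_abs ?lee_fin ?mulr_ge0 ?expR_ge0 //.
  by rewrite I ltry.
have mB : measurable [set y | dist y <= t].
  apply: measurable_closed; rewrite (_ : [set _ | _] = dist @^-1` [set z | z <= t]) //.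
  by apply: closed_comp; [move=> x _; exact: dist_continuous|exact: closed_le].
have mK : measurable K.
  by apply: measurable_closed; apply: compact_closed; [exact: norm_hausdorff|exact: body_compact bK].
pose S := [set y | dist y <= t] `\` K.
have mS : measurable S by exact: measurableD.
have KB : K `<=` [set y | dist y <= t].
  by move=> y Ky /=; rewrite leNgt; apply/negP => /(lt_trans t0)/dist_gt0.
rewrite -(setDUK KB) measureU //; last by rewrite setDE setICA setICr setI0.
rewrite EFinD fineK; last by rewrite ge0_fin_numE // lam_compact.
congr (_ + _)%E.
transitivity (\int[lam R m]_y (if (0 < dist y)%R then f (ln (dist y)) else 0)%:E)%E.
  rewrite -[LHS]mul1e -[LHS]integral_cst // integral_mkcond; apply: eq_integral => y _.
  rewrite patchE /f indicE; have [d0|d0] := ltP 0 (dist y); last first.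
    rewrite memNset // => -[_ nK]; by have := (dist_gt0 bK K0 y).2 nK; rewrite ltNge d0.
  have nK : ~ K y := (dist_gt0 bK K0 y).1 d0.
  have [yt|ty] := leP (dist y) t.
    by rewrite !mem_set //= in_itv /= ler_ln ?posrE.
  rewrite !memNset // => [|[/= h _]]; last by rewrite leNgt ty in h.
  by rewrite /= in_itv /= ler_ln ?posrE // leNgt ty.
rewrite E -sumEFin; apply: eq_bigr => k _.
by rewrite I -EFinM mulrCA mulrC -mulrA mulrC.
Qed.

(** [intrinsic_volume] picks some solution of Steiner's formula: the tube polynomial supplies one,
    which rules out the default value, and any two solutions give the same polynomial in t. *)
Lemma steiner_coefficients (c : nat -> R) :
  (forall t, 0 < t -> lam R m [set y | dist y <= t] =
    (fine (lam R m K) + \sum_(k < m) c k / k.+1%:R * t ^+ k.+1)%:E) ->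
  forall k, (k < m)%N ->
  intrinsic_volume K (m - k.+1)%N * ball_volume R k.+1 = c k / k.+1%:R.
Proof.
move=> hc.
pose q : {poly R} := \poly_(i < m.+1) (if i is k.+1 then c k / k.+1%:R else fine (lam R m K)).
have qE t : q.[t] = fine (lam R m K) + \sum_(k < m) c k / k.+1%:R * t ^+ k.+1.
  rewrite horner_poly big_ord_recl expr0 mulr1; congr (_ + _).
have VolE t : 0 < t -> Vol (Defs.minkowski t K unit_ball) = (q.[t])%:E.
  move=> t0; rewrite minkowski_ball // Vol_lam ?hc ?qE //.
  apply: measurable_closed; rewrite (_ : [set _ | _] = dist @^-1` [set z | z <= t]) //.
  by apply: closed_comp; [move=> x _; exact: dist_continuous|exact: closed_le].
pose W j : R := if (j <= m)%N then q`_(m - j) / ball_volume R (m - j) else 0.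
have sW : steiner K W.
  split=> [t t0|j jm]; last by rewrite /W leqNgt jm.
  rewrite VolE // (@horner_coef_wide _ m.+1) ?size_poly // big_mkord; congr EFin.
  apply: eq_bigr => l _; rewrite /W leq_subr subKn -1?ltnS // divfK // gt_eqF //.
  exact: ball_volume_gt0.
have [sV _] : steiner K (intrinsic_volume K) by exact: (xgetPex _ (ex_intro _ W sW)).
pose p : {poly R} := \poly_(l < m.+1) (intrinsic_volume K (m - l)%N * ball_volume R l).
have pE k : (k < m)%N -> intrinsic_volume K (m - k.+1)%N * ball_volume R k.+1 = p`_k.+1.
  by move=> km; rewrite coef_poly ltnS km.
have pq : p = q.
  apply: poly_eq_pos => t t0; apply: EFin_inj; rewrite -VolE // sV // big_mkord.
  by rewrite horner_poly.
by move=> k km; rewrite pE // pq coef_poly ltnS km.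
Qed.

End Steiner.

(** * Functionals with a holomorphic dependence on the exponent *)

Section WfClosure.
Variables (R : realType) (Par : Type).
Implicit Types (b u v f g : Par -> R -> R) (A : Par -> R) (r : R).

Definition bounded_by r b := exists2 C : R, 0 <= C &
  forall a (L : R), 0 < L -> `|b a L| <= C * expR (- (r * L)).

Lemma WfS N r b b' : bounded_by r b ->
  (forall a (L : R), 0 < L -> is_derive L (1 : R) (b a) (b' a L)) -> Wf N r b' -> Wf N.+1 r b.
Proof. by move=> h1 h2 h3; split=> //; exists b'. Qed.

Lemma WfD N r u v : Wf N r u -> Wf N r v -> Wf N r (fun a L => u a L + v a L).
Proof.
have bD : forall u v, bounded_by r u -> bounded_by r v -> bounded_by r (fun a L => u a L + v a L).
  move=> {}u {}v [C C0 hC] [D D0 hD]; exists (C + D); first exact: addr_ge0.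
  by move=> a L L0; rewrite (le_trans (ler_normD _ _)) // mulrDl lerD ?hC ?hD.
elim: N u v => [|N IH] u v [bu hu] [bv hv]; first by split=> //; exact: bD.
case: hu => u' du hu; case: hv => v' dv hv; split; first exact: bD.
exists (fun a L => u' a L + v' a L); last exact: IH.
by move=> a L L0; exact: is_deriveD (du a L L0) (dv a L L0).
Qed.

Lemma WfZ N r A (C : R) u : (forall a, `|A a| <= C) -> Wf N r u -> Wf N r (fun a L => A a * u a L).
Proof.
move=> AC.
have bZ : forall u, bounded_by r u -> bounded_by r (fun a L => A a * u a L).
  move=> {}u [D D0 hD]; exists (`|C| * D); first exact: mulr_ge0.
  move=> a L L0; rewrite normrM -mulrA ler_pM ?hD //.
  by rewrite (le_trans (AC a)) // ler_norm.
elim: N u => [|N IH] u [bu hu]; first by split=> //; exact: bZ.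
case: hu => u' du hu; split; first exact: bZ.
exists (fun a L => A a * u' a L); last exact: IH.
by move=> a L L0; apply: (is_derive_eq (is_deriveZ (A a) (du a L L0))).
Qed.

(** The derivatives of u and v are combinations of u and v with bounded coefficients, up to terms
    already controlled. Size bounds on u and v therefore propagate to all derivatives by
    induction. *)
Lemma Wf_rotation r u v f g A B (C : R) :
  (forall a, `|A a| <= C) -> (forall a, `|B a| <= C) ->
  bounded_by r u -> bounded_by r v ->
  (forall a (L : R), 0 < L -> is_derive L (1 : R) (u a) (A a * u a L + B a * v a L + f a L)) ->
  (forall a (L : R), 0 < L -> is_derive L (1 : R) (v a) (A a * v a L + - B a * u a L + g a L)) ->
  (forall N, Wf N r f) -> (forall N, Wf N r g) ->
  forall N, Wf N r u /\ Wf N r v.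
Proof.
move=> hA hB bu bv du dv hf hg; elim=> [|N [IHu IHv]]; first by [].
have hB' a : `|- B a| <= C by rewrite normrN.
split.
- by apply: WfS bu du _; apply: WfD => //; apply: WfD; [exact: WfZ hA _|exact: WfZ hB _].
- by apply: WfS bv dv _; apply: WfD => //; apply: WfD; [exact: WfZ hA _|exact: WfZ hB' _].
Qed.

End WfClosure.

(** * The exponential family in the exponent *)

Section Exponential.
Variable R : realType.
Implicit Types (s t L a : R).

(** The real part of exp (- (s + i t) L); [es] is minus its imaginary part. *)
Definition ec s t L : R := expR (- s * L) * cos (t * L).
Definition es s t L : R := expR (- s * L) * sin (t * L).

Lemma ec_le s t L : `|ec s t L| <= expR (- s * L).
Proof.
rewrite normrM ger0_norm ?expR_ge0 // -[leRHS]mulr1 ler_wpM2l ?expR_ge0 //.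
by rewrite ler_norml cos_geN1 cos_le1.
Qed.

Lemma es_le s t L : `|es s t L| <= expR (- s * L).
Proof.
rewrite normrM ger0_norm ?expR_ge0 // -[leRHS]mulr1 ler_wpM2l ?expR_ge0 //.
by rewrite ler_norml sin_geN1 sin_le1.
Qed.

(* [ec] and [es] along a path [x |-> (p x, q x)] of exponents, [p] and [q] being
   the values of [- s * L] and [t * L]. *)
Let is_derive_ecs (p q : R -> R) (p' q' x : R) :
  is_derive x (1 : R) p p' -> is_derive x (1 : R) q q' ->
  is_derive x (1 : R) (fun x => expR (p x) * cos (q x))
    (p' * (expR (p x) * cos (q x)) - q' * (expR (p x) * sin (q x))) /\
  is_derive x (1 : R) (fun x => expR (p x) * sin (q x))
    (p' * (expR (p x) * sin (q x)) + q' * (expR (p x) * cos (q x))).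
Proof.
move=> dp dq.
have h1 := is_derive1_comp (f := @expR R) (is_derive_expR (p x)) dp.
have h2 := is_derive1_comp (f := @cos R) (is_derive_cos (q x)) dq.
have h3 := is_derive1_comp (f := @sin R) (is_derive_sin (q x)) dq.
split.
- apply: (is_derive_eq (is_deriveM h1 h2)); rewrite /GRing.scale /=; ring.
- apply: (is_derive_eq (is_deriveM h1 h3)); rewrite /GRing.scale /=; ring.
Qed.

Let is_derive_mulr (k x : R) : is_derive x (1 : R) (fun x => k * x) k.
Proof. by have := is_deriveZ k (is_derive_id x (1:R)); rewrite [k *: 1]mulr1. Qed.

Lemma is_derive_ec s t L : is_derive L (1 : R) (ec s t) (- s * ec s t L + - t * es s t L).
Proof.
have [h _] := is_derive_ecs (is_derive_mulr (- s) L) (is_derive_mulr t L).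
by apply: (is_derive_eq h); rewrite /ec /es; ring.
Qed.

Lemma is_derive_es s t L : is_derive L (1 : R) (es s t) (- s * es s t L + t * ec s t L).
Proof. by have [_ h] := is_derive_ecs (is_derive_mulr (- s) L) (is_derive_mulr t L). Qed.

Let Taylor1 (f0 f1 : R -> R) (M : R) :
  (forall x : R, is_derive x (1 : R) f0 (f1 x)) ->
  (forall x, 0 <= x <= 1 -> `|f1 x| <= M) ->
  forall y, 0 <= y <= 1 -> `|f0 y - f0 0| <= M.
Proof.
move=> d0 h1 y /andP[y0 y1]; have cf : {within `[0, y], continuous f0}.
  by apply: derivable_within_continuous => x _; case: (d0 x).
have [c] := MVT_segment y0 (fun x _ => d0 x) cf.
rewrite in_itv /= => /andP[c0 cy] ->; rewrite subr0 normrM (ger0_norm y0).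
by rewrite -[leRHS]mulr1 ler_pM // h1 // c0 (le_trans cy).
Qed.

Let Taylor2 (f0 f1 f2 : R -> R) (M : R) :
  (forall x : R, is_derive x (1 : R) f0 (f1 x)) -> (forall x : R, is_derive x (1 : R) f1 (f2 x)) ->
  (forall x, 0 <= x <= 1 -> `|f2 x| <= M) -> `|f0 1 - f0 0 - f1 0| <= M.
Proof.
move=> d0 d1 h2.
have d x : is_derive x (1 : R) (fun x => f0 x - x * f1 0) (f1 x - f1 0).
  have dx : is_derive x (1 : R) (fun x => x * f1 0) (f1 0).
    by rewrite (_ : (fun x => _) = (fun x => f1 0 * x)) //; apply/funext => z; rewrite mulrC.
  exact: is_deriveB (d0 x) dx.
have := Taylor1 d (Taylor1 d1 h2) (_ : 0 <= 1 <= 1); rewrite ler01 lexx => /(_ isT).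
by rewrite mul1r mul0r subr0 addrAC.
Qed.

Section Taylor.
Variables (s t a b L : R).
Let pc x := ec (s + x * a) (t + x * b) L.
Let ps x := es (s + x * a) (t + x * b) L.
Let r := `|a| + `|b|.
(** A common bound for |ec| and |es| along the segment of exponents from (s, t) to (s + a, t +
    b). *)
Let E := expR (- s * L + `|a| * `|L|).

Let dp x : is_derive x (1 : R) pc (- L * (a * pc x + b * ps x)) /\
  is_derive x (1 : R) ps (- L * (a * ps x - b * pc x)).
Proof.
have d1 : is_derive x (1 : R) (fun x => - (s + x * a) * L) (- (a * L)).
  rewrite (_ : (fun x => _) = (fun x => - s * L + - (a * L) * x)); last by apply/funext => z; ring.
  by have := is_deriveD (is_derive_cst (- s * L) x (1:R)) (is_derive_mulr (- (a * L)) x); rewrite add0r.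
have d2 : is_derive x (1 : R) (fun x => (t + x * b) * L) (b * L).
  rewrite (_ : (fun x => _) = (fun x => t * L + (b * L) * x)); last by apply/funext => z; ring.
  by have := is_deriveD (is_derive_cst (t * L) x (1:R)) (is_derive_mulr (b * L) x); rewrite add0r.
have [h1 h2] := is_derive_ecs d1 d2.
split; [apply: (is_derive_eq h1)|apply: (is_derive_eq h2)]; rewrite /pc /ps /ec /es; ring.
Qed.

Let pc_le x : 0 <= x <= 1 -> `|pc x| <= E /\ `|ps x| <= E.
Proof.
move=> /andP[x0 x1].
have h : expR (- (s + x * a) * L) <= E.
  rewrite ler_expR mulNr mulrDl opprD -mulNr lerD2l -mulrA -mulrN -normrM.
  have := ler_norm (x * - (a * L)); rewrite [leRHS]normrM normrN (ger0_norm x0) => /le_trans; apply.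
  by rewrite -[leRHS]mul1r ler_wpM2r.
by split; [exact: le_trans (ec_le _ _ _) h|exact: le_trans (es_le _ _ _) h].
Qed.

Let comb (x y A B : R) : `|A| <= E -> `|B| <= E -> `|x * A + y * B| <= (`|x| + `|y|) * E.
Proof.
move=> hA hB; rewrite (le_trans (ler_normD _ _)) // !normrM mulrDl.
by apply: lerD; rewrite ler_wpM2l.
Qed.

Let quad : `|a ^+ 2 - b ^+ 2| + `|2 * a * b| <= r ^+ 2.
Proof.
have := ler_normB (a ^+ 2) (b ^+ 2); rewrite !normrX => h.
have -> : r ^+ 2 = `|a| ^+ 2 + `|b| ^+ 2 + `|2 * a * b|.
  by rewrite !normrM (ger0_norm (ler0n _ 2)) /r; ring.
by rewrite lerD2r.
Qed.

Lemma ec_Taylor1 : `|ec (s + a) (t + b) L - ec s t L| <= r * `|L| * E.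
Proof.
have := Taylor1 (fun x => (dp x).1) _ (_ : 0 <= 1 <= 1).
rewrite /pc !mul1r !mul0r !addr0; apply; last by rewrite ler01 lexx.
move=> x /pc_le[h1 h2]; rewrite normrM normrN mulrAC -[leRHS]mulrC.
by rewrite -/(pc x) -/(ps x) ler_wpM2l // comb.
Qed.

Lemma es_Taylor1 : `|es (s + a) (t + b) L - es s t L| <= r * `|L| * E.
Proof.
have := Taylor1 (fun x => (dp x).2) _ (_ : 0 <= 1 <= 1).
rewrite /ps !mul1r !mul0r !addr0; apply; last by rewrite ler01 lexx.
move=> x /pc_le[h1 h2]; rewrite normrM normrN mulrAC -[leRHS]mulrC.
have := comb a (- b) h2 h1; rewrite normrN mulNr => h.
by rewrite -/(pc x) -/(ps x) ler_wpM2l.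
Qed.

Lemma ec_Taylor2 : `|ec (s + a) (t + b) L - ec s t L + L * (a * ec s t L + b * es s t L)|
  <= r ^+ 2 * L ^+ 2 * E.
Proof.
have d2 x : is_derive x (1 : R) (fun x => - L * (a * pc x + b * ps x))
    (L ^+ 2 * ((a ^+ 2 - b ^+ 2) * pc x + (2 * a * b) * ps x)).
  apply: (is_derive_eq (is_deriveZ (- L) (is_deriveD (is_deriveZ a (dp x).1) (is_deriveZ b (dp x).2)))).
  by rewrite /GRing.scale /=; ring.
have := Taylor2 (fun x => (dp x).1) d2.
rewrite /pc /ps !mul1r !mul0r !addr0 mulNr opprK; apply.
move=> x /pc_le[h1 h2]; rewrite -/(pc x) -/(ps x) normrM (ger0_norm (sqr_ge0 L)).
have -> : r ^+ 2 * L ^+ 2 * E = L ^+ 2 * (r ^+ 2 * E) by ring.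
by rewrite ler_wpM2l ?sqr_ge0 // (le_trans (comb _ _ h1 h2)) // ler_wpM2r ?expR_ge0.
Qed.

Lemma es_Taylor2 : `|es (s + a) (t + b) L - es s t L + L * (a * es s t L - b * ec s t L)|
  <= r ^+ 2 * L ^+ 2 * E.
Proof.
have d2 x : is_derive x (1 : R) (fun x => - L * (a * ps x - b * pc x))
    (L ^+ 2 * ((a ^+ 2 - b ^+ 2) * ps x + (- (2 * a * b)) * pc x)).
  apply: (is_derive_eq (is_deriveZ (- L) (is_deriveB (is_deriveZ a (dp x).2) (is_deriveZ b (dp x).1)))).
  by rewrite /GRing.scale /=; ring.
have := Taylor2 (fun x => (dp x).2) d2.
rewrite /pc /ps !mul1r !mul0r !addr0 mulNr opprK; apply.
move=> x /pc_le[h1 h2]; rewrite -/(pc x) -/(ps x) normrM (ger0_norm (sqr_ge0 L)).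
have -> : r ^+ 2 * L ^+ 2 * E = L ^+ 2 * (r ^+ 2 * E) by ring.
rewrite ler_wpM2l ?sqr_ge0 // (le_trans (comb _ _ h2 h1)) // ler_wpM2r ?expR_ge0 //.
by rewrite normrN.
Qed.

End Taylor.
End Exponential.

Section ExponentialFamilies.
Variables (R : realType) (Par : Type).
Implicit Types (L : R) (N : nat).

Lemma WfC N r (c : R) (b : Par -> R -> R) : Wf N r b -> Wf N r (fun a L => c * b a L).
Proof. by apply: (@WfZ R Par N r (fun=> c) `|c|). Qed.

Lemma Wf0 N r : Wf N r (fun (_ : Par) (_ : R) => 0 : R).
Proof.
have b0 : bounded_by r (fun (_ : Par) (_ : R) => 0 : R) by exists 0 => // a L _; rewrite normr0 mul0r.
elim: N => [|N IH]; first by split.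
by apply: (WfS b0 _ IH) => a L _; exact: is_derive_cst.
Qed.

Section Damped.
Variables (e : Par -> R) (s t : R).
Hypothesis e0 : forall a, 0 < e a.

(* Powers of [damp] make a profile summable; they tend to 1 as e tends to 0. *)
Definition damp a L : R := (1 + e a * expR L)^-1.

Lemma damp_pos a L : 0 < 1 + e a * expR L.
Proof. by rewrite addr_gt0 // mulr_gt0 // expR_gt0. Qed.

Lemma damp_gt0 a L : 0 < damp a L.
Proof. by rewrite invr_gt0 damp_pos. Qed.

Lemma damp_le1 a L : damp a L <= 1.
Proof. by rewrite invf_le1 ?damp_pos // lerDl mulr_ge0 ?expR_ge0 // ltW. Qed.

Lemma damp_le a L : damp a L <= (e a)^-1 * expR (- L).
Proof.
have h : 0 < e a * expR L by rewrite mulr_gt0 // expR_gt0.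
by rewrite expRN -invfM lef_pV2 ?posrE ?damp_pos // lerDr.
Qed.

Lemma is_derive_dampX a q L :
  is_derive L (1 : R) (fun L => damp a L ^+ q) (q%:R * damp a L ^+ q.+1 - q%:R * damp a L ^+ q).
Proof.
have n0 : (fun L => 1 + e a * expR L) L != 0 by rewrite /= gt_eqF // damp_pos.
have d1 : is_derive L (1 : R) (fun L => 1 + e a * expR L) (e a * expR L).
  have := is_deriveD (is_derive_cst (1 : R) L (1:R)) (is_deriveZ (e a) (is_derive_expR L)).
  by rewrite add0r.
have d2 : is_derive L (1 : R) (damp a) (damp a L ^+ 2 - damp a L).
  have d3 := @is_deriveV R (fun L => 1 + e a * expR L) L _ 1 n0 d1; apply: (is_derive_eq (d3 : is_derive L (1:R) (damp a) _)).
  rewrite /damp /GRing.scale /=.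
  by move: n0 => /=; move: (e a * expR L) => z z0; field.
case: q => [|q].
  rewrite (_ : (fun L => _) = cst 1); last by apply/funext => z; rewrite expr0.
  by apply: (is_derive_eq (is_derive_cst (1 : R) L (1:R))); rewrite !mul0r subrr.
rewrite (_ : (fun L => _) = damp a ^+ q.+1); last by apply/funext => z; rewrite exprfctE.
apply: (is_derive_eq (is_deriveX q.+1 d2)); rewrite /GRing.scale /= ?exprfctE.
by rewrite !exprS; move: (damp a L ^+ q) (damp a L) => x y; ring.
Qed.

(** The bounds are uniform in e: powers of [damp] are at most 1, and their derivatives are
    combinations of such powers with coefficients depending on q only. *)
Lemma Wf_damped N q :
  Wf N s (fun a L => ec s t L * damp a L ^+ q) /\ Wf N s (fun a L => es s t L * damp a L ^+ q).
Proof.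
have B (f : R -> R) q' : (forall L, `|f L| <= expR (- s * L)) ->
    bounded_by s (fun a L => f L * damp a L ^+ q').
  move=> hf; exists 1 => // a L L0; rewrite mul1r normrM -mulNr -[leRHS]mulr1.
  by rewrite ler_pM // normrX gtr0_norm ?damp_gt0 // exprn_ile1 ?damp_le1 // ltW // damp_gt0.
elim: N q => [|N IH] q; first by split; split=> //; apply: B => L; [exact: ec_le|exact: es_le].
have [c0 s0] := IH q; have [c1 s1] := IH q.+1.
split.
- apply: (@WfS R Par N s _ (fun a L => (- s - q%:R) * (ec s t L * damp a L ^+ q) +
    ((- t) * (es s t L * damp a L ^+ q) + q%:R * (ec s t L * damp a L ^+ q.+1)))).
  + by apply: B => L; exact: ec_le.
  + move=> a L _; apply: (is_derive_eq (is_deriveM (is_derive_ec s t L) (is_derive_dampX a q L))).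
    by rewrite /GRing.scale /=; ring.
  + by apply: WfD; [exact: WfC|apply: WfD; exact: WfC].
- apply: (@WfS R Par N s _ (fun a L => (- s - q%:R) * (es s t L * damp a L ^+ q) +
    (t * (ec s t L * damp a L ^+ q) + q%:R * (es s t L * damp a L ^+ q.+1)))).
  + by apply: B => L; exact: es_le.
  + move=> a L _; apply: (is_derive_eq (is_deriveM (is_derive_es s t L) (is_derive_dampX a q L))).
    by rewrite /GRing.scale /=; ring.
  + by apply: WfD; [exact: WfC|apply: WfD; exact: WfC].
Qed.

End Damped.

Let L_le L : L <= 4 * expR (L / 4).
Proof.
have := expR_ge1Dx (L / 4); move: (expR _) => x; lra.
Qed.

Lemma Wf_ecs s t N : Wf N s (fun (_ : Par) L => ec s t L) /\ Wf N s (fun (_ : Par) L => es s t L).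
Proof.
apply: (@Wf_rotation R Par s (fun _ => ec s t) (fun _ => es s t) (fun _ _ => 0) (fun _ _ => 0) (fun=> - s) (fun=> - t) (`|s| + `|t|)).
- by move=> _; rewrite normrN lerDl.
- by move=> _; rewrite normrN lerDr.
- by exists 1 => // a L _; rewrite mul1r -mulNr; exact: ec_le.
- by exists 1 => // a L _; rewrite mul1r -mulNr; exact: es_le.
- by move=> a L _; rewrite addr0; exact: is_derive_ec.
- by move=> a L _; rewrite addr0 opprK; exact: is_derive_es.
- by move=> M; exact: Wf0.
- by move=> M; exact: Wf0.
Qed.

Lemma Wf_weaken N r r' (b : Par -> R -> R) : r' <= r -> Wf N r b -> Wf N r' b.
Proof.
move=> rr; have bw : forall b : Par -> R -> R, bounded_by r b -> bounded_by r' b.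
  move=> {}b [C C0 h]; exists C => // a L L0; rewrite (le_trans (h a L L0)) // ler_wpM2l //.
  by rewrite ler_expR lerN2 ler_wpM2r // ltW.
elim: N b => [|N IH] b [hb]; first by split=> //; exact: bw.
by move=> [b' db hb']; split; [exact: bw|exists b' => //; exact: IH].
Qed.

(** The factor L is paid by exp (L / 4), well within the loss of one order; its derivative adds [ec]
    and [es] as inhomogeneous terms. *)
Lemma Wf_Lecs s t N : Wf N (s - 1) (fun (_ : Par) L => L * ec s t L) /\
  Wf N (s - 1) (fun (_ : Par) L => L * es s t L).
Proof.
have B (f : R -> R) : (forall L, `|f L| <= expR (- s * L)) ->
    bounded_by (s - 1) (fun (_ : Par) L => L * f L).
  move=> hf; exists 4 => // _ L L0; rewrite normrM gtr0_norm //.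
  apply: (le_trans (ler_pM (ltW L0) (normr_ge0 _) (L_le L) (hf L))).
  by rewrite -mulrA -expRD ler_wpM2l // ler_expR; lra.
have sw : s - 1 <= s by lra.
apply: (@Wf_rotation R Par (s - 1) (fun _ L => L * ec s t L) (fun _ L => L * es s t L) (fun _ => ec s t) (fun _ => es s t) (fun=> - s) (fun=> - t) (`|s| + `|t|)).
- by move=> _; rewrite normrN lerDl.
- by move=> _; rewrite normrN lerDr.
- by apply: B => L; exact: ec_le.
- by apply: B => L; exact: es_le.
- move=> a L _; apply: (is_derive_eq (is_deriveM (is_derive_id L (1:R)) (is_derive_ec s t L))).
  by rewrite /GRing.scale /=; ring.
- move=> a L _; apply: (is_derive_eq (is_deriveM (is_derive_id L (1:R)) (is_derive_es s t L))).
  by rewrite /GRing.scale /=; ring.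
- by move=> M; apply: Wf_weaken (Wf_ecs s t M).1.
- by move=> M; apply: Wf_weaken (Wf_ecs s t M).2.
Qed.

Section Remainder.
Variables (s t : R) (a b : Par -> R).
Let r p := `|a p| + `|b p|.
Hypotheses (r0 : forall p, 0 < r p) (r1 : forall p, r p <= 1 / 2).

(* Second order Taylor remainders of [ec] and [es] in the exponent. *)
Definition rem_c p L := (r p ^+ 2)^-1 *
  (ec (s + a p) (t + b p) L - ec s t L + L * (a p * ec s t L + b p * es s t L)).
Definition rem_s p L := (r p ^+ 2)^-1 *
  (es (s + a p) (t + b p) L - es s t L + L * (a p * es s t L - b p * ec s t L)).
Let quo_c p L := (r p)^-1 * (ec (s + a p) (t + b p) L - ec s t L).
Let quo_s p L := (r p)^-1 * (es (s + a p) (t + b p) L - es s t L).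

Let a_le p : `|a p| <= 1 / 2.
Proof. by apply: le_trans (r1 p); rewrite lerDl. Qed.

Let b_le p : `|b p| <= 1 / 2.
Proof. by apply: le_trans (r1 p); rewrite lerDr. Qed.

Let rn p : r p != 0. Proof. by rewrite gt_eqF. Qed.

Let ar p : `|- (a p / r p)| <= 1.
Proof. by rewrite normrN normrM normfV (gtr0_norm (r0 p)) ler_pdivrMr // mul1r lerDl. Qed.

Let br p : `|b p / r p| <= 1.
Proof. by rewrite normrM normfV (gtr0_norm (r0 p)) ler_pdivrMr // mul1r lerDr. Qed.

Let E_le p L : 0 < L -> expR (- s * L + `|a p| * `|L|) <= expR (- s * L + L / 2).
Proof.
move=> L0; rewrite ler_expR lerD2l (gtr0_norm L0); have := ler_wpM2r (ltW L0) (a_le p); lra.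
Qed.

Let Wf_p N : Wf N (s - 1) (fun p L => ec (s + a p) (t + b p) L) /\
  Wf N (s - 1) (fun p L => es (s + a p) (t + b p) L).
Proof.
have B (f : Par -> R -> R) : (forall p L, `|f p L| <= expR (- (s + a p) * L)) -> bounded_by (s - 1) f.
  move=> hf; exists 1 => // p L L0; rewrite mul1r (le_trans (hf p L)) // ler_expR.
  rewrite -mulNr ler_wpM2r ?ltW //; have := a_le p; rewrite ler_norml => /andP[h1 h2]; lra.
apply: (@Wf_rotation R Par (s - 1) (fun p => ec (s + a p) (t + b p)) (fun p => es (s + a p) (t + b p)) (fun _ _ => 0) (fun _ _ => 0)
  (fun p => - (s + a p)) (fun p => - (t + b p)) (`|s| + `|t| + 1 / 2)).
- move=> p; rewrite normrN (le_trans (ler_normD _ _)) //; have := a_le p.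
  by have := normr_ge0 t; lra.
- move=> p; rewrite normrN (le_trans (ler_normD _ _)) //; have := b_le p.
  by have := normr_ge0 s; lra.
- by apply: B => p L; exact: ec_le.
- by apply: B => p L; exact: es_le.
- by move=> p L _; rewrite addr0; exact: is_derive_ec.
- by move=> p L _; rewrite addr0 opprK; exact: is_derive_es.
- by move=> M; exact: Wf0.
- by move=> M; exact: Wf0.
Qed.

Let Wf_k N : Wf N (s - 1) quo_c /\ Wf N (s - 1) quo_s.
Proof.
have B (f : Par -> R -> R) :
    (forall p L, `|f p L| <= r p * `|L| * expR (- s * L + `|a p| * `|L|)) ->
    bounded_by (s - 1) (fun p L => (r p)^-1 * f p L).
  move=> hf; exists 4 => // p L L0; rewrite normrM (gtr0_norm (_ : 0 < (r p)^-1)) ?invr_gt0 //.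
  rewrite ler_pdivrMl // (le_trans (hf p L)) // -mulrA ler_pM2l // (gtr0_norm L0).
  have h := E_le p L0; rewrite (gtr0_norm L0) in h.
  apply: (le_trans (ler_pM (ltW L0) (expR_ge0 _) (L_le L) h)).
  by rewrite -mulrA -expRD ler_wpM2l // ler_expR; lra.
apply: (@Wf_rotation R Par (s - 1) quo_c quo_s
  (fun p L => - (a p / r p) * ec (s + a p) (t + b p) L + - (b p / r p) * es (s + a p) (t + b p) L)
  (fun p L => - (a p / r p) * es (s + a p) (t + b p) L + b p / r p * ec (s + a p) (t + b p) L)
  (fun=> - s) (fun=> - t) (`|s| + `|t|)).
- by move=> _; rewrite normrN lerDl.
- by move=> _; rewrite normrN lerDr.
- by apply: B => p L; exact: ec_Taylor1.
- by apply: B => p L; exact: es_Taylor1.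
- move=> p L _; apply: (is_derive_eq (is_deriveZ ((r p)^-1)
    (is_deriveB (is_derive_ec (s + a p) (t + b p) L) (is_derive_ec s t L)))).
  by rewrite /GRing.scale /= /quo_c /quo_s; move: (r p) => x; ring.
- move=> p L _; apply: (is_derive_eq (is_deriveZ ((r p)^-1)
    (is_deriveB (is_derive_es (s + a p) (t + b p) L) (is_derive_es s t L)))).
  by rewrite /GRing.scale /= /quo_c /quo_s; move: (r p) => x; ring.
- move=> M; apply: WfD; first exact: WfZ ar (Wf_p M).1.
  by apply: (WfZ (C := 1)) (Wf_p M).2 => p; rewrite normrN.
- by move=> M; apply: WfD; [exact: WfZ ar (Wf_p M).2|exact: WfZ br (Wf_p M).1].
Qed.

(** A ladder in three steps: the derivative in L of the remainder is a combination of remainders and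
    first order quotients, that of the quotients involves [ec] and [es] at the shifted exponent, and
    the coefficients a / r and b / r are at most 1 in size. *)
Lemma Wf_remainder N : Wf N (s - 1) rem_c /\ Wf N (s - 1) rem_s.
Proof.
have B (f : Par -> R -> R) :
    (forall p L, `|f p L| <= r p ^+ 2 * L ^+ 2 * expR (- s * L + `|a p| * `|L|)) ->
    bounded_by (s - 1) (fun p L => (r p ^+ 2)^-1 * f p L).
  move=> hf; exists 16 => // p L L0.
  have r2 : 0 < r p ^+ 2 by rewrite exprn_gt0.
  rewrite normrM (gtr0_norm (_ : 0 < (r p ^+ 2)^-1)) ?invr_gt0 //.
  rewrite ler_pdivrMl // (le_trans (hf p L)) // -mulrA ler_pM2l //.
  (* The square of L <= 4 exp (L / 4). Another exp (L / 2) is lost in [E_le], so that one full order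
     is spent. *)
  have h2 : L ^+ 2 <= 16 * expR (L / 2).
    have h := ler_pM (ltW L0) (ltW L0) (L_le L) (L_le L).
    rewrite expr2 (le_trans h) // mulrACA -expRD.
    rewrite (_ : L / 4 + L / 4 = L / 2); last by lra.
    by rewrite -natrM.
  apply: (le_trans (ler_pM (sqr_ge0 L) (expR_ge0 _) h2 (E_le p L0))).
  by rewrite -mulrA -expRD ler_wpM2l // ler_expR; lra.
apply: (@Wf_rotation R Par (s - 1) rem_c rem_s
  (fun p L => - (a p / r p) * quo_c p L + - (b p / r p) * quo_s p L)
  (fun p L => - (a p / r p) * quo_s p L + b p / r p * quo_c p L)
  (fun=> - s) (fun=> - t) (`|s| + `|t|)).
- by move=> _; rewrite normrN lerDl.
- by move=> _; rewrite normrN lerDr.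
- by apply: B => p L; exact: ec_Taylor2.
- by apply: B => p L; exact: es_Taylor2.
- move=> p L _.
  have dl := is_deriveM (is_derive_id L (1:R))
    (is_deriveD (is_deriveZ (a p) (is_derive_ec s t L)) (is_deriveZ (b p) (is_derive_es s t L))).
  apply: (is_derive_eq (is_deriveZ ((r p ^+ 2)^-1) (is_deriveD
    (is_deriveB (is_derive_ec (s + a p) (t + b p) L) (is_derive_ec s t L)) dl))).
  rewrite !fctE /= /GRing.scale /= /rem_c /rem_s /quo_c /quo_s.
  by move: (rn p); move: (r p) => x x0; field.
- move=> p L _.
  have dl := is_deriveM (is_derive_id L (1:R))
    (is_deriveB (is_deriveZ (a p) (is_derive_es s t L)) (is_deriveZ (b p) (is_derive_ec s t L))).
  apply: (is_derive_eq (is_deriveZ ((r p ^+ 2)^-1) (is_deriveD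
    (is_deriveB (is_derive_es (s + a p) (t + b p) L) (is_derive_es s t L)) dl))).
  rewrite !fctE /= /GRing.scale /= /rem_c /rem_s /quo_c /quo_s.
  by move: (rn p); move: (r p) => x x0; field.
- move=> M; apply: WfD; first exact: WfZ ar (Wf_k M).1.
  by apply: (WfZ (C := 1)) (Wf_k M).2 => p; rewrite normrN.
- by move=> M; apply: WfD; [exact: WfZ ar (Wf_k M).2|exact: WfZ br (Wf_k M).1].
Qed.

End Remainder.

End ExponentialFamilies.

Lemma Wf_param (R : realType) (P Q : Type) (h : Q -> P) N r (b : P -> R -> R) :
  Wf N r b -> Wf N r (fun a => b (h a)).
Proof.
elim: N b => [|N IH] b [[C C0 hC] hb]; first by split=> //; exists C => // a; exact: hC.
case: hb => b' db hb'; split; first by exists C => // a; exact: hC.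
by exists (fun a => b' (h a)) => [a|]; [exact: db|exact: IH].
Qed.

(** * Differences over the lattice cells *)

Section Integrand.
Variables (R : realType) (n : nat) (c : R).
Hypothesis c0 : 0 < c.
Local Notation V := 'rV[R]_n.
Variables (K : set V) (X : V -> V).
Hypotheses (bK : body K X) (K0 : K !=set0).
Local Notation dist := (dist bK K0).
Implicit Types (y : V) (N j : nat) (r : R).

(** The cut is sharp. Within a bounded distance of the body, a difference taken across it is merely
    bounded, which suffices there; farther out all points of the difference lie beyond the cut. *)
Definition outer (b : R -> R) y : R := if 1 < dist y then b (ln (dist y)) else 0.
Definition integrand N b y : R := diffn N (fun j => outer b (coordwise (tau c j) y)).
Definition dist1 y : R := Num.max 1 (dist y).

Local Notation base y := (coordwise (kap c) y).
Let B := n%:R * c.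

Let B0 : 0 <= B. Proof. by rewrite mulr_ge0 // ltW. Qed.

Lemma coordwise_tau j y : coordwise (tau c j) y = base y + j%:R *: (y - base y).
Proof. by apply/rowP => i; rewrite !mxE. Qed.

Lemma base_near y : enorm (y - base y) <= B.
Proof.
apply: le_trans (enorm_le_norm _) _; rewrite ler_wpM2l //.
apply: norm_le_coord => [|i]; first exact: ltW.
have /andP[h1 h2] := kap_le c0 (y 0 i).
by rewrite !mxE ger0_norm // ltW.
Qed.

Lemma dist1_ge1 y : 1 <= dist1 y. Proof. by rewrite le_max lexx. Qed.

Lemma dist_tau_le j y : `|dist (coordwise (tau c j) y) - dist (base y)| <= j%:R * B.
Proof.
apply: le_trans (dist_lip bK K0 _ _) _.
rewrite coordwise_tau addrC addKr enormZ ger0_norm //.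
by rewrite ler_wpM2l // base_near.
Qed.

Lemma dist_base_le y : `|dist y - dist (base y)| <= B.
Proof. exact: le_trans (dist_lip bK K0 _ _) (base_near y). Qed.

Let wgt_bound r x M : 1 <= x -> x <= M -> expR (- (`|r| * ln M)) <= wgt r x <= expR (`|r| * ln M).
Proof.
move=> x1 xM; have x0 : 0 < x by exact: lt_le_trans x1.
have M0 : 0 < M by exact: lt_le_trans xM.
have l0 : 0 <= ln x by exact: ln_ge0.
have lM : ln x <= ln M by rewrite ler_ln.
have : `|r * ln x| <= `|r| * ln M by rewrite normrM (ger0_norm l0) ler_wpM2l.
by rewrite ler_norml /wgt !ler_expR lerN2 => /andP[h1 h2]; rewrite h2 lerNl h1.
Qed.

Lemma integrand_bound (Par : Type) N r (b : Par -> R -> R) : Wf N r b ->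
  exists2 C : R, 0 <= C & forall a y, `|integrand N (b a) y| <= C * wgt (r + N%:R) (dist1 y).
Proof.
move=> hb; pose T := 2 * (N%:R * B + 2) + 2 * B.
have NB : 0 <= N%:R * B by rewrite mulr_ge0.
(* The direction y - base y varies with y, so y joins the parameters of the family. *)
have [C C0 hC] := @radial_diff R n K X bK K0 (Par * V)%type (fun a => a.2 - base a.2) N r
  (fun a => b a.1) B B0 (fun a => base_near a.2) (Wf_param fst hb).
have [D D0 hD] : bounded_by r b by case: N hb {NB T hC} => [|N] [].
pose C1 := C * expR (`|r + N%:R| * ln 2).
pose C2 := 2 ^+ N * (D * expR (`|r| * ln (T + N%:R * B))) * expR (`|r + N%:R| * ln (T + B)).
have C10 : 0 <= C1 by rewrite mulr_ge0 // expR_ge0.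
have C20 : 0 <= C2 by rewrite !mulr_ge0 ?expR_ge0.
exists (C1 + C2); first exact: addr_ge0.
move=> a y; have := dist_base_le y; rewrite ler_norml => /andP[y1 y2].
rewrite mulrDl; have [far|near] := leP T (dist (base y)).
  have Ty : dist1 y = dist y.
    by apply/max_idPr; move: far y1 y2 NB B0; rewrite /T; move: (dist y) (dist (base y)) (N%:R * B) B => u v w z; lra.
  apply: (@le_trans _ _ (C1 * wgt (r + N%:R) (dist1 y))); last by rewrite lerDl mulr_ge0 // wgt_ge0.
  rewrite /integrand (@eq_diffn _ _ _ (fun j => b a (ln (dist (base y + j%:R *: (y - base y)))))); last first.
    move=> j jN; rewrite /outer coordwise_tau -coordwise_tau; case: ifPn => // /negP[].
    have := dist_tau_le j y; rewrite ler_norml => /andP[h1 _].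
    have : j%:R * B <= N%:R * B by rewrite ler_wpM2r // ler_nat.
    by move: far NB B0 h1; rewrite /T; move: (dist _) (dist _) (N%:R * B) (j%:R * B) B => u v w z x; lra.
  apply: (le_trans (hC (a, y) (base y) _)); first by move: far B0; rewrite /T; move: (dist _) (N%:R * B) B => u v w; lra.
  rewrite -mulrA ler_wpM2l // Ty.
  have [z0 [z1 z2]] : 0 < dist y /\ dist y / 2 <= dist (base y) /\ dist (base y) <= 2 * dist y.
    by move: far y1 y2 NB B0; rewrite /T; move: (dist y) (dist (base y)) (N%:R * B) B => u v w z; split; [|split]; lra.
  exact: wgt_comparable.
apply: (@le_trans _ _ (C2 * wgt (r + N%:R) (dist1 y))); last by rewrite lerDr mulr_ge0 // wgt_ge0.
apply: (@le_trans _ _ (2 ^+ N * (D * expR (`|r| * ln (T + N%:R * B))))).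
  apply: diffn_bound => j jN; rewrite /outer; case: ifPn => d1; last first.
    by rewrite normr0 mulr_ge0 // expR_ge0.
  apply: (le_trans (hD a _ (_ : 0 < ln _))); first by rewrite ln_gt0.
  rewrite ler_wpM2l //.
  have dM : dist (coordwise (tau c j) y) <= T + N%:R * B.
    have := dist_tau_le j y; rewrite ler_norml lerBlDl => /andP[_ /le_trans]; apply.
    by apply: lerD; [exact: ltW|rewrite ler_wpM2r // ler_nat].
  by have /andP[_] := wgt_bound r (ltW d1) dM.
rewrite /C2 -mulrA ler_peMr ?mulr_ge0 ?expR_ge0 //.
have dM : dist1 y <= T + B by rewrite ge_max; apply/andP; move: near y1 y2 NB B0; rewrite /T;
  move: (dist y) (dist (base y)) (N%:R * B) B => u v w z; split; lra.
have /andP[h _] := wgt_bound (r + N%:R) (dist1_ge1 y) dM.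
rewrite (le_trans _ (ler_wpM2l (expR_ge0 _) h)) //.
by rewrite -expRD subrr expR0.
Qed.

Lemma measurable_outer (b : measurableTypeR R -> R) : measurable_fun setT b ->
  measurable_fun setT (outer b).
Proof.
move=> mb; apply: measurable_fun_ifT => //; last exact: measurable_comp_ln_dist.
apply: measurable_fun_ltr => //.
by apply: continuous_measurable_row; exact: dist_continuous.
Qed.

Lemma measurable_integrand N (b : measurableTypeR R -> R) : measurable_fun setT b ->
  measurable_fun setT (integrand N b).
Proof.
move=> mb; have mo j : measurable_fun setT (fun y : V => outer b (coordwise (tau c j) y)).
  apply: (measurableT_comp (measurable_outer mb)).
  by apply: measurable_coordwise; exact: measurable_tau.
suff H : forall N (g : nat -> V -> R), (forall j, measurable_fun setT (g j)) ->
  measurable_fun setT (fun y => diffn N (fun j => g j y)) by exact: (H N).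
elim=> [|M IH] g mg //=.
by apply: measurable_funB; apply: IH.
Qed.

End Integrand.

Section Functional.
Variables (R : realType) (n : nat) (c : R).
Hypothesis c0 : 0 < c.
Local Notation V := 'rV[R]_n.
Local Notation leb := (@lebesgue_measure R).
Variables (K : set V) (X : V -> V).
Hypotheses (bK : body K X) (K0 : K !=set0).
Local Notation dist := (dist bK K0).
Local Notation dist1 := (dist1 bK K0).
Local Notation outer := (outer bK K0).
Local Notation integrand := (integrand c bK K0).
Local Notation base y := (coordwise (kap c) y).
Implicit Types (y : V) (N j : nat) (r q : R) (b : measurableTypeR R -> R).

Lemma exp_tail_integrable q k : k < q ->
  leb.-integrable setT (fun L : measurableTypeR R => (\1_(`]0%R, +oo[%classic) L * expR (- q * L) * expR (k * L))%:E).
Proof.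
move=> kq; have h0 L : 0 <= \1_(`]0%R, +oo[%classic) L * expR (- q * L) * expR (k * L) :> R.
  by rewrite !mulr_ge0 ?expR_ge0.
have mE a : measurable_fun setT (fun L : measurableTypeR R => expR (a * L)).
  by apply: measurableT_comp => //.
have mf : measurable_fun setT (fun L : measurableTypeR R =>
    \1_(`]0%R, +oo[%classic) L * expR (- q * L) * expR (k * L)).
  by apply: measurable_funM => //; apply: measurable_funM => //.
have me : measurable_fun (`[0%R, +oo[%classic : set (measurableTypeR R)) (fun L : measurableTypeR R => (expR (- (q - k) * L))%:E).
  by apply: measurable_funTS; apply/measurable_EFinP; exact: mE.
apply/integrableP; split; first exact/measurable_EFinP.
under eq_integral do rewrite gee0_abs ?lee_fin //.
apply: (@le_lt_trans _ _ (\int[leb]_(x in `[0%R, +oo[) (expR (- (q - k) * x))%:E)%E); last first.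
  by rewrite integral_exp_tail ?subr_gt0 // ltry.
rewrite [leRHS]integral_mkcond; apply: ge0_le_integral => //.
- exact/measurable_EFinP.
- exact: ((measurable_restrictT _ (measurable_itv `[0%R, +oo[)).1 me).
- move=> x _; rewrite patchE indicE; case: ifPn => hx.
    rewrite lee_fin -[leRHS]mul1r -mulrA -expRD ler_pM ?expR_ge0 //; last first.
      by rewrite ler_expR; lra.
    by case: (_ \in _).
  rewrite memNset ?mul0r // => /= h; move/negP: hx; apply; rewrite inE /=.
  by move: h; rewrite !in_itv /= !andbT => /ltW.
Qed.

Lemma ball_finite : (lam R n [set y | (dist y <= 1)%R] < +oo)%E.
Proof.
have [d hd] := shell_formula bK K0.
by rewrite (tube_volume hd ltr01) ltry.
Qed.

(** By the shell formula ln dist has a density of growth at most exp (n L), which exp (- q L) beats;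
    the tube dist <= 1 has finite volume. *)
Lemma dist1_integrable q : n%:R < q -> (lam R n).-integrable setT (fun y => (wgt q (dist1 y))%:E).
Proof.
move=> nq; have [d hd] := shell_formula bK K0.
pose f (L : measurableTypeR R) : R := \1_(`]0%R, +oo[%classic) L * expR (- q * L).
have mf : measurable_fun setT f.
  by apply: measurable_funM => //; apply: measurableT_comp => //.
have [|i1 _] := hd f mf.
  move=> k kn; apply: exp_tail_integrable; apply: le_lt_trans nq.
  by rewrite ler_nat.
pose S := [set y | dist y <= 1].
have mS : measurable S.
  apply: measurable_closed; rewrite (_ : S = dist @^-1` [set z | z <= 1]) //.
  by apply: closed_comp; [move=> x _; exact: dist_continuous|exact: closed_le].
have i2 : (lam R n).-integrable setT (EFin \o \1_S).
  apply/integrableP; split; first by apply/measurable_EFinP; exact: measurable_indic.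
  under eq_integral do rewrite gee0_abs ?lee_fin //.
  by rewrite integral_indic // setIT ball_finite.
rewrite (_ : (fun y => _) = (fun y => (if 0 < dist y then f (ln (dist y)) else 0)%:E + (EFin \o \1_S) y)%E).
  exact: integrableD.
apply/funext => y; rewrite -EFinD; congr EFin; rewrite /dist1 /f !indicE.
have [y1|y1] := leP (dist y) 1.
  rewrite (mem_set (_ : S y)) // wgt1; case: ifPn => [y0|_]; last by rewrite add0r.
  by rewrite memNset ?mul0r ?add0r //= in_itv /= andbT ltNge ln_le0.
have y0 : 0 < dist y by exact: lt_trans y1.
rewrite y0 (memNset (_ : ~ S y)) ?addr0; last by rewrite /S /=; apply/negP; rewrite -ltNge.
by rewrite mem_set ?mul1r /= ?in_itv /= ?andbT ?ln_gt0 // /wgt mulNr.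
Qed.

Lemma integrand_integrable N r b : measurable_fun setT b -> Wf N r (fun _ : unit => b) -> n%:R < r + N%:R ->
  (lam R n).-integrable setT (EFin \o integrand N b).
Proof.
move=> mb hb nr; have [C C0 hC] := integrand_bound c0 bK K0 hb.
apply: (@le_integrable _ _ _ _ _ measurableT _ (fun y => C%:E * (wgt (r + N%:R) (dist1 y))%:E)%E).
- by apply/measurable_EFinP; exact: measurable_integrand.
- by move=> y _; rewrite -EFinM lee_fin (le_trans (hC tt y)) // ler_norm.
- by apply: integrableZl => //; exact: dist1_integrable.
Qed.

(* For summable b this is the sum of b (ln dist) over the lattice points with
   dist > 1 minus c^-n times its integral over dist > 1 (lfun_lattice); for
   large N it makes sense without summability. *)
Definition lfun N b : R := (-1) ^+ N / c ^+ n * fine (\int[lam R n]_y (integrand N b y)%:E)%E.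

Lemma fine_integral_le (f g : V -> R) : measurable_fun setT f -> (lam R n).-integrable setT (EFin \o g) ->
  (forall y, `|f y| <= g y) ->
  `|fine (\int[lam R n]_y (f y)%:E)%E| <= fine (\int[lam R n]_y (g y)%:E)%E.
Proof.
move=> mf ig fg; have i_f : (lam R n).-integrable setT (EFin \o f).
  apply: le_integrable ig => //; first exact/measurable_EFinP.
  by move=> y _; rewrite lee_fin (le_trans (fg y)) // ler_norm.
rewrite -fine_abse; last exact: integrable_fin_num.
apply: fine_le; [by rewrite abse_fin_num; exact: integrable_fin_num|exact: integrable_fin_num|].
apply: le_trans (le_abse_integral _ _ _) _ => //; first exact/measurable_EFinP.
apply: ge0_le_integral => //.
- by apply: measurableT_comp => //; exact/measurable_EFinP.
- exact: measurable_int ig.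
- by move=> y _; rewrite lee_fin.
Qed.

(** The constant serves the whole family. Applied to Taylor remainders in the exponent, this
    uniformity becomes complex differentiability. *)
Lemma lfun_bound (Par : Type) N r (b : Par -> measurableTypeR R -> R) :
  (forall a, measurable_fun setT (b a)) -> Wf N r b -> n%:R < r + N%:R ->
  exists C, forall a, `|lfun N (b a)| <= C.
Proof.
move=> mb hb nr; have [C C0 hC] := integrand_bound c0 bK K0 hb.
exists (`|(-1) ^+ N / c ^+ n| * fine (\int[lam R n]_y (C * wgt (r + N%:R) (dist1 y))%:E)%E) => a.
rewrite normrM ler_wpM2l // fine_integral_le //.
- exact: measurable_integrand.
- rewrite (_ : EFin \o _ = fun y => C%:E * (wgt (r + N%:R) (dist1 y))%:E)%E; last first.
    by apply/funext => y; rewrite /= EFinM.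
  by apply: integrableZl => //; exact: dist1_integrable.
Qed.

Lemma integrandD N b b' y : integrand N (fun L => b L + b' L) y = integrand N b y + integrand N b' y.
Proof.
rewrite /integrand -diffnD; apply: eq_diffn => j _.
by rewrite /outer; case: ifPn => _; rewrite ?addr0.
Qed.

Lemma integrandZ N (k : R) b y : integrand N (fun L => k * b L) y = k * integrand N b y.
Proof.
rewrite /integrand -diffnZ; apply: eq_diffn => j _.
by rewrite /outer; case: ifPn => _; rewrite ?mulr0.
Qed.

Lemma lfunD N r b b' : measurable_fun setT b -> Wf N r (fun _ : unit => b) ->
  measurable_fun setT b' -> Wf N r (fun _ : unit => b') -> n%:R < r + N%:R ->
  lfun N (fun L => b L + b' L) = lfun N b + lfun N b'.
Proof.
move=> mb hb mb' hb' nr.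
have i1 := integrand_integrable mb hb nr; have i2 := integrand_integrable mb' hb' nr.
rewrite /lfun -mulrDr; congr (_ * _).
under eq_integral do rewrite integrandD EFinD.
by rewrite integralD // fineD //; exact: integrable_fin_num.
Qed.

Lemma lfunZ N r (k : R) b : measurable_fun setT b -> Wf N r (fun _ : unit => b) -> n%:R < r + N%:R ->
  lfun N (fun L => k * b L) = k * lfun N b.
Proof.
move=> mb hb nr; have i1 := integrand_integrable mb hb nr.
rewrite /lfun mulrCA; congr (_ * _).
under eq_integral do rewrite integrandZ EFinM.
by rewrite integralZl // fineM //; exact: integrable_fin_num.
Qed.

Lemma lfun_cvg N r (b : nat -> measurableTypeR R -> R) b' :
  (forall k, measurable_fun setT (b k)) -> measurable_fun setT b' -> Wf N r b -> n%:R < r + N%:R ->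
  (forall L, b k L @[k --> \oo] --> b' L) -> lfun N (b k) @[k --> \oo] --> lfun N b'.
Proof.
move=> mb mb' hb nr bb; have [C C0 hC] := integrand_bound c0 bK K0 hb.
apply: cvgM; first exact: cvg_cst.
have cvI y : integrand N (b k) y @[k --> \oo] --> integrand N b' y.
  suff H : forall M (g : nat -> nat -> R) (h : nat -> R), (forall j, g k j @[k --> \oo] --> h j) ->
      diffn M (fun j => g k j) @[k --> \oo] --> diffn M h.
    apply: H => j; rewrite /outer; case: ifPn => _; [exact: bb|exact: cvg_cst].
  elim=> [|M IH] g h gh /=; first exact: gh.
  by apply: cvgB; [apply: (IH (fun k j => g k j.+1))|exact: IH].
have ig : (lam R n).-integrable setT (fun y => C%:E * (wgt (r + N%:R) (dist1 y))%:E)%E.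
  by apply: integrableZl => //; exact: dist1_integrable.
have mi k : measurable_fun setT (fun y => (integrand N (b k) y)%:E).
  by apply/measurable_EFinP; exact: measurable_integrand.
have mi' : measurable_fun setT (fun y => (integrand N b' y)%:E).
  by apply/measurable_EFinP; exact: measurable_integrand.
have [| |i' _ E] := dominated_convergence measurableT mi mi' _ ig.
- by apply: aeW => y _; apply: cvg_EFin; [exact: nearW|exact: cvI].
- by apply: aeW => y k _; rewrite -EFinM lee_fin; exact: hC.
by apply: fine_cvg; rewrite fineK //; exact: integrable_fin_num.
Qed.

End Functional.

Section Continuation.
Variables (R : realType) (n : nat) (c : R).
Hypothesis c0 : 0 < c.
Local Notation V := 'rV[R]_n.
Variables (K : set V) (X : V -> V).
Hypotheses (bK : body K X) (K0 : K !=set0).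
Local Notation dist1 := (dist1 bK K0).
Local Notation outer := (outer bK K0).
Local Notation integrand := (integrand c bK K0).
Local Notation lfun := (lfun c bK K0).
Local Notation base y := (coordwise (kap c) y).
Implicit Types (y : V) (N j : nat) (r q s t : R) (b : measurableTypeR R -> R).

Lemma outer_base_integrable r b : measurable_fun setT b -> Wf 0 r (fun _ : unit => b) -> n%:R < r ->
  (lam R n).-integrable setT (fun y => (outer b (base y))%:E).
Proof.
move=> mb hb nr; have nr0 : n%:R < r + 0%:R by rewrite addr0.
have E : (fun y => (outer b (base y))%:E) = EFin \o integrand 0 b.
  apply/funext => y; rewrite /= /integrand /=; congr (outer b _)%:E.
  by apply/rowP => i; rewrite !mxE /tau mul0r addr0.
by rewrite E; exact: (integrand_integrable c0 bK K0 mb hb nr0).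
Qed.

Lemma outer_integrable r b : measurable_fun setT b -> Wf 0 r (fun _ : unit => b) -> n%:R < r ->
  (lam R n).-integrable setT (fun y => (outer b y)%:E).
Proof.
move=> mb [[C C0 hC] _] nr.
apply: (@le_integrable _ _ _ _ _ measurableT _ (fun y => C%:E * (wgt r (dist1 y))%:E)%E).
- by apply/measurable_EFinP; exact: measurable_outer.
- move=> y _; rewrite -EFinM lee_fin; rewrite [leRHS]ger0_norm ?mulr_ge0 ?wgt_ge0 //.
  rewrite /outer; case: ifPn => y1; last by rewrite normr0 mulr_ge0 // wgt_ge0.
  by rewrite /dist1 (max_r (ltW y1)); apply: (hC tt); exact: ln_gt0.
- by apply: integrableZl => //; exact: dist1_integrable.
Qed.

Lemma integral_tau_signed j (f : V -> R) : (0 < j)%N -> measurable_fun setT f ->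
  (lam R n).-integrable setT (EFin \o f) ->
  (lam R n).-integrable setT (fun y => (f (coordwise (tau c j) y))%:E) /\
  (\int[lam R n]_y (f (coordwise (tau c j) y))%:E = \int[lam R n]_y (f y)%:E)%E.
Proof.
move=> j0 mf i_f; have mc : measurable_fun setT (@coordwise R n (tau c j)).
  by apply: measurable_coordwise; exact: measurable_tau.
split.
  apply/integrableP; split; first by apply/measurable_EFinP; exact: measurableT_comp mf mc.
  have := integral_coordwise_tau c0 (f := fun y => `|(f y)%:E|%E) j0 _ _ => ->.
  - by case/integrableP : i_f.
  - by apply: measurableT_comp => //; exact/measurable_EFinP.
  - by [].
rewrite integralE [RHS]integralE; congr (_ - _)%E.
- have := integral_coordwise_tau c0 (f := (EFin \o f)^\+%E) j0 _ _ => <- //.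
    by apply: eq_integral => y _; rewrite !funeposE.
  by apply: measurable_funepos; exact/measurable_EFinP.
- have := integral_coordwise_tau c0 (f := (EFin \o f)^\-%E) j0 _ _ => <- //.
    by apply: eq_integral => y _; rewrite !funenegE.
  by apply: measurable_funeneg; exact/measurable_EFinP.
Qed.

(** All points with j >= 1 give the same integral, so [diffn_step] evaluates the difference. The
    order is a successor because a difference of order 0 would keep the lattice term alone. *)
Lemma lfun_lattice N r b : measurable_fun setT b -> Wf 0 r (fun _ : unit => b) -> n%:R < r ->
  lfun N.+1 b = (c ^+ n)^-1 *
    (fine (\int[lam R n]_y (outer b (base y))%:E)%E - fine (\int[lam R n]_y (outer b y)%:E)%E).
Proof.
move=> mb hb nr.
have i0 := outer_base_integrable mb hb nr; have i1 := outer_integrable mb hb nr.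
pose s := fine (\int[lam R n]_y (outer b (base y))%:E)%E.
pose t := fine (\int[lam R n]_y (outer b y)%:E)%E.
suff main : lfun N.+1 b = (c ^+ n)^-1 * (s - t) by exact: main.
pose g j y := outer b (coordwise (tau c j) y).
have hg j : (lam R n).-integrable setT (EFin \o g j) /\
    fine (\int[lam R n]_y (g j y)%:E)%E = if j is 0%N then s else t.
  case: j => [|j].
    have E y : g 0%N y = outer b (base y).
      rewrite /g; congr outer; apply/rowP => i; rewrite !mxE /tau mul0r addr0 //.
    have Ef : g 0%N = (fun y => outer b (base y)) by apply/funext.
    by rewrite Ef; split; [exact: i0|].
  have [h1 h2] := integral_tau_signed (ltn0Sn j) (measurable_outer bK K0 mb) i1.
  by split; [exact: h1|exact: (congr1 fine h2)].
have H M (f : nat -> V -> R) : (forall j, (lam R n).-integrable setT (EFin \o f j)) ->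
    (lam R n).-integrable setT (fun y => (diffn M (fun j => f j y))%:E) /\
    fine (\int[lam R n]_y (diffn M (fun j => f j y))%:E)%E =
    diffn M (fun j => fine (\int[lam R n]_y (f j y)%:E)%E).
  elim: M f => [|M IH] f hf //=; first by split=> //; exact: hf.
  have [h1 h2] := IH (fun j => f j.+1) (fun j => hf j.+1); have [h3 h4] := IH f hf.
  split.
    rewrite (_ : (fun y => _) = (fun y => (diffn M (fun j => f j.+1 y))%:E - (diffn M (fun j => f j y))%:E)%E) //.
    exact: integrableB.
  under eq_integral do rewrite EFinB.
  rewrite integralB // fineB; [by rewrite h2 h4|exact: integrable_fin_num|exact: integrable_fin_num].
rewrite /lfun (H N.+1 g (fun j => (hg j).1)).2.
rewrite (@eq_diffn _ _ _ (fun j => if j is 0%N then s else t)); last by move=> j _; exact: (hg j).2.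
rewrite diffn_step; have := sqrr_sign R N.+1; rewrite expr2.
move: ((-1) ^+ N.+1) ((c ^+ n)^-1) => e k E.
by transitivity (e * e * (k * (s - t))); [ring|rewrite E mul1r].
Qed.

Lemma measurable_ec s t : measurable_fun setT (ec s t : measurableTypeR R -> R).
Proof.
apply: measurable_funM; apply: measurableT_comp => //.
by apply: continuous_measurable_fun; exact: continuous_cos.
Qed.

Lemma measurable_es s t : measurable_fun setT (es s t : measurableTypeR R -> R).
Proof.
apply: measurable_funM; apply: measurableT_comp => //.
by apply: continuous_measurable_fun; exact: continuous_sin.
Qed.

Let damp_cvg (q : nat) (f : R -> R) (L : R) :
  (f L * damp (fun k => k.+1%:R^-1) k L ^+ q) @[k --> \oo] --> f L.
Proof.
have h : damp (fun k => k.+1%:R^-1) k L @[k --> \oo] --> (1 : R).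
  rewrite -[X in _ --> X]invr1 /damp; apply: cvgV => //.
  rewrite -[X in _ --> X]addr0; apply: cvgD; first exact: cvg_cst.
  by rewrite -(mul0r (expR L)); apply: cvgM; [exact: cvg_harmonic|exact: cvg_cst].
elim: q => [|q IH]; first by under eq_fun do rewrite expr0 mulr1; exact: cvg_cst.
under eq_fun do rewrite exprSr mulrA.
by have H := cvgM IH h; rewrite mulr1 in H; exact: H.
Qed.

Let lfun_succ N s (f : R -> R) : measurable_fun setT (f : measurableTypeR R -> R) ->
  (forall M (q : nat), Wf M s (fun k L => f L * damp (fun k => k.+1%:R^-1) k L ^+ q)) ->
  (forall L, `|f L| <= expR (- s * L)) ->
  n%:R < s + N.+1%:R -> lfun N.+1 f = lfun N.+2 f.
Proof.
move=> mf wf hf ns.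
(* Each damping factor decays like exp (- L), with a constant depending on k; q of them make the
   profile summable. The bounds of order s are uniform in k, so [lfun_cvg] removes the damping. *)
pose q := (Num.truncn (n%:R - s)).+1; have nq : n%:R < s + q%:R by rewrite -ltrBlDl truncnS_gt.
have e0 (k : nat) : 0 < k.+1%:R^-1 :> R by rewrite invr_gt0.
pose b k (L : measurableTypeR R) : R := f L * damp (fun k => k.+1%:R^-1) k L ^+ q.
have mb k : measurable_fun setT (b k).
  apply: measurable_funM => //; apply: continuous_measurable_fun => L.
  apply: differentiable_continuous; apply/derivable1_diffP.
  by case: (is_derive_dampX e0 k q L).
have hb k : Wf 0 (s + q%:R) (fun _ : unit => b k).
  split=> //; exists (k.+1%:R ^+ q) => // _ L L0.
  have d0 := damp_gt0 e0 k L.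
  rewrite /b normrM normrX (gtr0_norm d0) mulrDl opprD expRD mulrCA -mulNr.
  rewrite ler_pM ?exprn_ge0 ?(ltW d0) //.
  rewrite -mulrN expRM_natl -exprMn lerXn2r ?nnegrE ?(ltW d0) ?mulr_ge0 ?expR_ge0 //.
  by have := damp_le e0 k L; rewrite invrK.
have E k : lfun N.+1 (b k) = lfun N.+2 (b k) by rewrite !(lfun_lattice _ (mb k) (hb k) nq).
have c1 := lfun_cvg (bK := bK) (K0 := K0) c0 mb mf (wf N.+1 q) ns (fun L => @damp_cvg q f L).
have ns' : n%:R < s + N.+2%:R by rewrite (lt_trans ns) // ltrD2l ltr_nat.
have c2 := lfun_cvg (bK := bK) (K0 := K0) c0 mb mf (wf N.+2 q) ns' (fun L => @damp_cvg q f L).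
apply: (cvg_unique _ c1); first exact: norm_hausdorff.
have EE : (fun k => lfun N.+1 (b k)) = (fun k => lfun N.+2 (b k)) by apply/funext.
by rewrite /= EE; exact: c2.
Qed.

Let eps_gt0 (k : nat) : 0 < k.+1%:R^-1 :> R. Proof. by rewrite invr_gt0. Qed.

Lemma lfun_ecs_succ N s t : n%:R < s + N.+1%:R ->
  lfun N.+1 (ec s t) = lfun N.+2 (ec s t) /\ lfun N.+1 (es s t) = lfun N.+2 (es s t).
Proof.
move=> ns; split.
- apply: (lfun_succ (measurable_ec s t) _ (ec_le s t) ns) => M q.
  by have [] := Wf_damped s t eps_gt0 M q.
- apply: (lfun_succ (measurable_es s t) _ (es_le s t) ns) => M q.
  by have [] := Wf_damped s t eps_gt0 M q.
Qed.

Lemma lfun_ecs_eq N M s t : n%:R < s + N.+1%:R -> (N <= M)%N ->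
  lfun N.+1 (ec s t) = lfun M.+1 (ec s t) /\ lfun N.+1 (es s t) = lfun M.+1 (es s t).
Proof.
move=> ns /subnKC <-; elim: (M - N)%N => [|k [IH1 IH2]]; first by rewrite addn0.
rewrite addnS IH1 IH2; apply: lfun_ecs_succ.
by rewrite (lt_le_trans ns) // lerD2l ler_nat ltnS leq_addr.
Qed.

Definition dec s t : measurableTypeR R -> R := fun L => L * ec s t L.
Definition des s t : measurableTypeR R -> R := fun L => L * es s t L.

(** [lfun_bound] is applied to the normalized remainders, parametrized by all nonzero increments of
    size at most 1 / 2, and linearity turns it into an estimate for the values of [lfun]. The loss
    of one order in [Wf_remainder] appears as s - 1. *)
Lemma lfun_Taylor N s t : n%:R < s - 1 + N%:R -> exists C, forall a b : R, `|a| + `|b| <= 1 / 2 ->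
  `|lfun N (ec (s + a) (t + b)) - lfun N (ec s t) + (a * lfun N (dec s t) + b * lfun N (des s t))|
     <= C * (`|a| + `|b|) ^+ 2 /\
  `|lfun N (es (s + a) (t + b)) - lfun N (es s t) + (a * lfun N (des s t) - b * lfun N (dec s t))|
     <= C * (`|a| + `|b|) ^+ 2.
Proof.
move=> ns; pose Par := {p : R * R | 0 < `|p.1| + `|p.2| <= 1 / 2}.
pose pa (p : Par) := (sval p).1; pose pb (p : Par) := (sval p).2.
have r0 p : 0 < `|pa p| + `|pb p| by have /andP[] := svalP p.
have r1 p : `|pa p| + `|pb p| <= 1 / 2 by have /andP[] := svalP p.
have md : measurable_fun setT (dec s t) by apply: measurable_funM => //; exact: measurable_ec.
have me : measurable_fun setT (des s t) by apply: measurable_funM => //; exact: measurable_es.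
have mc p : measurable_fun setT (rem_c s t pa pb p : measurableTypeR R -> R).
  apply: measurable_funM => //; apply: measurable_funD.
    by apply: measurable_funB; exact: measurable_ec.
  apply: measurable_funM => //; apply: measurable_funD; apply: measurable_funM => //.
    exact: measurable_ec.
  exact: measurable_es.
have ms p : measurable_fun setT (rem_s s t pa pb p : measurableTypeR R -> R).
  apply: measurable_funM => //; apply: measurable_funD.
    by apply: measurable_funB; exact: measurable_es.
  apply: measurable_funM => //; apply: measurable_funB; apply: measurable_funM => //.
    exact: measurable_es.
  exact: measurable_ec.
have [C1 h1] := lfun_bound c0 bK K0 mc (Wf_remainder s t r0 r1 N).1 ns.
have [C2 h2] := lfun_bound c0 bK K0 ms (Wf_remainder s t r0 r1 N).2 ns.
exists (`|C1| + `|C2|) => a b ab.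
have [z|nz] := eqVneq (`|a| + `|b|) 0.
  have [a0 b0] : a = 0 /\ b = 0.
    by move/eqP: z; rewrite paddr_eq0 // !normr_eq0 => /andP[/eqP -> /eqP ->].
  by split; rewrite a0 b0 !addr0 !subrr !mul0r ?subr0 ?addr0 !normr0 ?addr0 expr0n /= mulr0.
have ab' : 0 < `|(a, b).1| + `|(a, b).2| <= 1 / 2.
  by rewrite /= ab andbT lt_neqAle eq_sym nz /= addr_ge0.
pose p : Par := exist _ (a, b) ab'.
have rp : 0 < (`|a| + `|b|) ^+ 2 by rewrite exprn_gt0 // (r0 p).
have sw : s - 1 <= s by rewrite gerBl.
have sa : s - 1 <= s + a.
  rewrite lerD2l lerNl; apply: (le_trans (ler_norm _)); rewrite normrN.
  have := normr_ge0 b; move: ab; lra.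
have W s' t' : s - 1 <= s' -> Wf N (s - 1) (fun _ : unit => ec s' t') /\ Wf N (s - 1) (fun _ : unit => es s' t').
  by move=> ss; have [w1 w2] := Wf_ecs unit s' t' N; split; [exact: Wf_weaken ss w1|exact: Wf_weaken ss w2].
have [w1 w2] := W _ (t + b) sa; have [w3 w4] := W _ t sw; have [w5 w6] := Wf_Lecs unit s t N.
have L5 (f1 f2 f3 f4 : measurableTypeR R -> R) (k : R) :
    measurable_fun setT f1 -> measurable_fun setT f2 -> measurable_fun setT f3 -> measurable_fun setT f4 ->
    Wf N (s - 1) (fun _ : unit => f1) -> Wf N (s - 1) (fun _ : unit => f2) ->
    Wf N (s - 1) (fun _ : unit => f3) -> Wf N (s - 1) (fun _ : unit => f4) ->
    lfun N (fun L => k * (f1 L + -1 * f2 L + (a * f3 L + b * f4 L))) =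
    k * (lfun N f1 - lfun N f2 + (a * lfun N f3 + b * lfun N f4)).
  move=> m1 m2 m3 m4 v1 v2 v3 v4.
  have Z (f : measurableTypeR R -> R) k' : measurable_fun setT f -> Wf N (s - 1) (fun _ : unit => f) ->
      [/\ measurable_fun setT (fun L => k' * f L), Wf N (s - 1) (fun (_ : unit) L => k' * f L) &
          lfun N (fun L => k' * f L) = k' * lfun N f].
    by move=> mf wf; split; [exact: measurable_funM|exact: WfC|exact: (lfunZ c0 bK K0 k' mf wf ns)].
  have D (f f' : measurableTypeR R -> R) : measurable_fun setT f -> Wf N (s - 1) (fun _ : unit => f) ->
      measurable_fun setT f' -> Wf N (s - 1) (fun _ : unit => f') ->
      [/\ measurable_fun setT (fun L => f L + f' L), Wf N (s - 1) (fun (_ : unit) L => f L + f' L) &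
          lfun N (fun L => f L + f' L) = lfun N f + lfun N f'].
    by move=> mf wf mf' wf'; split; [exact: measurable_funD|exact: WfD|exact: (lfunD c0 bK K0 mf wf mf' wf' ns)].
  have [z2 z2' z2E] := Z f2 (-1) m2 v2; have [z3 z3' z3E] := Z f3 a m3 v3; have [z4 z4' z4E] := Z f4 b m4 v4.
  have [d1 d1' d1E] := D _ _ m1 v1 z2 z2'; have [d2 d2' d2E] := D _ _ z3 z3' z4 z4'.
  have [d3 d3' d3E] := D _ _ d1 d1' d2 d2'; have [_ _ ->] := Z _ k d3 d3'.
  by rewrite d3E d1E d2E z2E z3E z4E mulN1r.
split.
- have := h1 p; rewrite (_ : rem_c s t pa pb p = fun L => ((`|a| + `|b|) ^+ 2)^-1 *
    (ec (s + a) (t + b) L + -1 * ec s t L + (a * dec s t L + b * des s t L))); last first.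
    by apply/funext => L; rewrite /rem_c /dec /des /pa /pb /=; ring.
  rewrite L5 //; [|exact: measurable_ec|exact: measurable_ec].
  rewrite normrM gtr0_norm ?invr_gt0 // ler_pdivrMl // => /le_trans; apply.
  rewrite [leLHS]mulrC ler_wpM2r ?(ltW rp) // (le_trans (ler_norm _)) // lerDl.
  by [].
- have := h2 p; rewrite (_ : rem_s s t pa pb p = fun L => ((`|a| + `|b|) ^+ 2)^-1 *
    (es (s + a) (t + b) L + -1 * es s t L + (a * des s t L + b * (-1 * dec s t L)))); last first.
    by apply/funext => L; rewrite /rem_s /dec /des /pa /pb /=; ring.
  rewrite L5 //; [|exact: measurable_es|exact: measurable_es|exact: measurable_funM|exact: WfC].
  rewrite (lfunZ c0 bK K0 (-1) md w5 ns) mulN1r mulrN.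
  rewrite normrM gtr0_norm ?invr_gt0 // ler_pdivrMl // => /le_trans; apply.
  rewrite [leLHS]mulrC ler_wpM2r ?(ltW rp) // (le_trans (ler_norm _)) // lerDr.
  by [].
Qed.

End Continuation.

(** * Complex differentiability from a quadratic remainder *)

Section ComplexDerivative.
Variable R : realType.
Local Open Scope complex_scope.
Implicit Types z w : R[i].

(** Real and imaginary parts are estimated separately, so this equivalent norm replaces the
    modulus. *)
Definition csize z : R := `|complex.Re z| + `|complex.Im z|.

Lemma csize_ge0 z : 0 <= csize z. Proof. exact: addr_ge0. Qed.

Lemma norm_csize z : `|z| <= (csize z)%:C.
Proof.
rewrite normc_def lecR /csize -[leRHS]ger0_norm ?csize_ge0 // -sqrtr_sqr ler_wsqrtr //.
rewrite -(real_normK (num_real (complex.Re z))) -(real_normK (num_real (complex.Im z))).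
by rewrite sqrrD addrAC lerDl mulrn_wge0 // mulr_ge0.
Qed.

Lemma csize_norm z : (csize z)%:C <= 2%:C * `|z|.
Proof.
rewrite normc_def -rmorphM lecR /csize.
have h (a b : R) : `|a| <= Num.sqrt (a ^+ 2 + b ^+ 2).
  by rewrite -sqrtr_sqr ler_wsqrtr // lerDl sqr_ge0.
rewrite mulr_natl mulr2n lerD ?h //.
by rewrite addrC h.
Qed.

Lemma complex_derivable (F : R[i] -> R[i]) z (D : R[i]) (C r : R) : 0 < r ->
  (forall w, csize w <= r -> csize (F (z + w) - F z - D * w) <= C * csize w ^+ 2) ->
  derivable (F : R[i]^o -> R[i]^o) z 1.
Proof.
move=> r0 h; apply/cvg_ex; exists D.
apply/cvgrPdist_le => e e0.
pose C' : R := `|C| + 1.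
have C0 : 0 < C' by rewrite ltr_wpDl.
have [k k0 hk] : exists2 k : R, 0 < k & k%:C <= e /\ k <= r.
  case: e e0 => x y; rewrite ltcE /= => /andP[/eqP -> x0].
  exists (Num.min x r); first by rewrite lt_min x0.
  by split; [rewrite lecR ge_min lexx|rewrite ge_min lexx orbT].
have d0 : 0 < (k / (4 * C' + 4))%:C :> R[i].
  by rewrite ltcR divr_gt0 // addr_gt0 // mulr_gt0.
near=> w.
have w0 : w != 0 by near: w; exact: nbhs_dnbhs_neq.
have wd : `|w| <= (k / (4 * C' + 4))%:C by near: w; exact: dnbhs0_le.
rewrite /= -[w *: 1]/(w * 1) mulr1 addrC [w + z]addrC.
have -> : - (w^-1 *: (F (z + w) - F z)) + D = - (w^-1 * (F (z + w) - F z - D * w)).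
  by rewrite /GRing.scale /=; field.
rewrite normrN normrM normfV ler_pdivrMl ?normr_gt0 //.
have [v vE] : exists v : R, `|w| = v%:C by rewrite normc_def; eexists.
have v0 : 0 <= v by have := normr_ge0 w; rewrite vE lecR.
have vk : v <= k / (4 * C' + 4) by move: wd; rewrite vE lecR.
have P0 : 0 < 4 * C' + 4 by rewrite addr_gt0 // mulr_gt0.
have vk' : v * (4 * C' + 4) <= k by rewrite -ler_pdivlMr.
have sv : csize w <= 2 * v by have := csize_norm w; rewrite vE -rmorphM lecR.
case: hk => ke kr.
have C'v : 0 <= C' * v by rewrite mulr_ge0 // ltW.
have sr : csize w <= r by apply: le_trans sv _; apply: le_trans kr; lra.
rewrite (le_trans (norm_csize _)) // vE.
apply: (@le_trans _ _ (v%:C * k%:C)); last by rewrite ler_wpM2l // lecR.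
rewrite -rmorphM lecR (le_trans (h w sr)) //.
have s0 := csize_ge0 w.
apply: (@le_trans _ _ (C' * (2 * v) ^+ 2)).
  apply: (@le_trans _ _ (C' * csize w ^+ 2)).
    by rewrite ler_wpM2r ?sqr_ge0 // (le_trans (ler_norm _)) // lerDl.
  by rewrite ler_wpM2l ?(ltW C0) // lerXn2r ?nnegrE // mulr_ge0.
have -> : C' * (2 * v) ^+ 2 = v * (v * (4 * C')) by ring.
by rewrite ler_wpM2l // (le_trans _ vk') // ler_wpM2l // lerDl.
Unshelve. all: by end_near. Qed.

End ComplexDerivative.

Section Tails.
Variable R : realType.
Local Notation leb := (@lebesgue_measure R).
Implicit Types (a t L : R).

Let pindic L : R := \1_(`]0%R, +oo[%classic) L.

(** f may change sign: the majorant exp (- a x) is added to make the integrand nonnegative for the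
    fundamental theorem on a half-line, and subtracted afterwards. *)
Lemma integral_tail a C (f F : measurableTypeR R -> R) : 0 < a -> continuous (f : R -> R) ->
  (forall x : R, is_derive x (1 : R) F (f x)) ->
  (forall x, 0 <= x -> `|f x| <= expR (- a * x)) ->
  (forall x, 0 <= x -> `|F x| <= C * expR (- a * x)) ->
  (\int[leb]_L (pindic L * f L)%:E = (- F 0)%:E)%E.
Proof.
move=> a0 cf dF hf hF.
pose g (x : measurableTypeR R) : R := f x + expR (- a * x).
pose G (x : R) : R := F x + - a^-1 * expR (- a * x).
have dG x : is_derive x (1 : R) G (g x).
  apply: (is_derive_eq (is_deriveD (dF x) (is_deriveZ (- a^-1) (is_derive_expRM (- a) x)))).
  by rewrite /GRing.scale /= /g mulrA mulrNN mulVf ?mul1r // gt_eqF.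
have cg : continuous (g : R -> R).
  by move=> x; apply: cvgD; [exact: cf|exact: expRM_continuous].
have mg D : measurable D -> measurable_fun D (EFin \o g).
  by move=> mD; apply/measurable_EFinP; apply: measurable_funTS; exact: continuous_measurable_fun.
have me D : measurable D -> measurable_fun D (fun x : measurableTypeR R => (expR (- a * x))%:E).
  move=> mD; apply/measurable_EFinP; apply: measurable_funTS; apply: continuous_measurable_fun.
  exact: expRM_continuous.
have g0 x : 0 <= x -> 0 <= g x.
  by move=> /hf; rewrite ler_norml /g -lerBlDr sub0r => /andP[].
have e_lim : expR (- a * x) @[x --> +oo%R] --> 0.
  rewrite (_ : (fun x => expR (- a * x)) = (fun z => expR (- z)) \o (fun z => a * z)); last first.
    by apply: eq_fun => x; rewrite mulNr.
  apply: (@cvg_comp _ _ _ _ _ _ (pinfty_nbhs R)); last exact: cvgr_expR.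
  exact: gt0_cvgMry.
have F_lim : F x @[x --> +oo%R] --> 0.
  apply: norm_cvg0; apply: (@squeeze_cvgr _ _ _ _ (fun=> 0) (fun x => C * expR (- a * x))).
  - near=> x; rewrite normr_ge0 hF //; near: x; exact: nbhs_pinfty_ge.
  - exact: cvg_cst.
  - by rewrite -(mulr0 C); apply: cvgM => //; exact: cvg_cst.
have G_lim : G x @[x --> +oo%R] --> 0.
  rewrite -[X in _ --> X]addr0; apply: cvgD => //.
  by rewrite -(mulr0 (- a^-1)); apply: cvgM => //; exact: cvg_cst.
have Ig : (\int[leb]_(x in `[0%R, +oo[) (g x)%:E = (- G 0)%:E)%E.
  rewrite (@ge0_continuous_FTC2y _ _ G _ 0) //.
  - by rewrite -EFinB sub0r.
  - exact: continuous_subspaceT.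
  - apply: cvg_at_right_filter; apply: differentiable_continuous.
    by apply/derivable1_diffP; case: (dG 0).
  - by move=> x _; rewrite derive1E; case: (dG x).
have Ie := integral_exp_tail 0 a0; rewrite mulr0 expR0 in Ie.
have mI : measurable (`[0%R, +oo[%classic : set (measurableTypeR R)) by exact: measurable_itv.
have ig : leb.-integrable `[0%R, +oo[%classic (EFin \o g).
  apply/integrableP; split; first exact: mg.
  rewrite (eq_integral (EFin \o g)); first by rewrite Ig ltry.
  by move=> x; rewrite inE /= in_itv /= andbT => x0; rewrite /= ger0_norm ?g0.
have ie : leb.-integrable `[0%R, +oo[%classic (fun x : measurableTypeR R => (expR (- a * x))%:E).
  apply/integrableP; split; first exact: me.
  by under eq_integral do rewrite gee0_abs ?lee_fin ?expR_ge0 //; rewrite Ie ltry.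
transitivity (\int[leb]_(x in `[0%R, +oo[) (f x)%:E)%E.
  rewrite -integral_itv_obnd_cbnd; last first.
    by apply/measurable_EFinP; apply: measurable_funTS; exact: continuous_measurable_fun.
  rewrite [RHS]integral_mkcond; apply: eq_integral => x _.
  by rewrite /pindic patchE indicE; case: ifPn => _; rewrite ?mul1r ?mul0r.
rewrite (eq_integral (fun x => ((EFin \o g) x - (expR (- a * x))%:E)%E)); last first.
  by move=> x _; rewrite -EFinB /g addrK.
rewrite integralB // Ig Ie -EFinB; congr EFin; rewrite /G mulr0 expR0; ring.
Unshelve. all: by end_near. Qed.

(** The real part and minus the imaginary part of 1 / (a + i t). *)
Lemma integral_ecs_tail a t : 0 < a ->
  (\int[leb]_L (pindic L * ec a t L)%:E = (a / (a ^+ 2 + t ^+ 2))%:E)%E /\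
  (\int[leb]_L (pindic L * es a t L)%:E = (t / (a ^+ 2 + t ^+ 2))%:E)%E.
Proof.
move=> a0; pose q := a ^+ 2 + t ^+ 2.
have q0 : 0 < q by rewrite ltr_wpDr ?sqr_ge0 // exprn_gt0.
have qn : q != 0 by rewrite gt_eqF.
have cont (f : R -> R) f' : (forall x : R, is_derive x (1 : R) f (f' x)) -> continuous f.
  by move=> df x; apply: differentiable_continuous; apply/derivable1_diffP; case: (df x).
have comb (x y : R) L : `|q^-1 * (x * ec a t L + y * es a t L)| <= q^-1 * (`|x| + `|y|) * expR (- a * L).
  rewrite normrM gtr0_norm ?invr_gt0 // -mulrA ler_wpM2l ?invr_ge0 ?(ltW q0) //.
  rewrite (le_trans (ler_normD _ _)) // mulrDl lerD // normrM ler_wpM2l //.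
    exact: ec_le.
  exact: es_le.
have dF1 x : is_derive x (1 : R) (fun L => q^-1 * (- a * ec a t L + t * es a t L)) (ec a t x).
  apply: (is_derive_eq (is_deriveZ q^-1 (is_deriveD
    (is_deriveZ (- a) (is_derive_ec a t x)) (is_deriveZ t (is_derive_es a t x))))).
  rewrite /GRing.scale /=; move: (ec a t x) (es a t x) => u v; rewrite /q in qn *; field.
  exact: qn.
have dF2 x : is_derive x (1 : R) (fun L => q^-1 * (- t * ec a t L + - a * es a t L)) (es a t x).
  apply: (is_derive_eq (is_deriveZ q^-1 (is_deriveD
    (is_deriveZ (- t) (is_derive_ec a t x)) (is_deriveZ (- a) (is_derive_es a t x))))).
  rewrite /GRing.scale /=; move: (ec a t x) (es a t x) => u v; rewrite /q in qn *; field.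
  exact: qn.
split.
- have -> := @integral_tail a _ (ec a t) _ a0 (cont _ _ (is_derive_ec a t)) dF1
    (fun x _ => ec_le a t x) (fun x _ => comb (- a) t x).
  by congr EFin; rewrite /ec /es !mulr0 expR0 cos0 sin0 -/q; field; exact: qn.
- have -> := @integral_tail a _ (es a t) _ a0 (cont _ _ (is_derive_es a t)) dF2
    (fun x _ => es_le a t x) (fun x _ => comb (- t) (- a) x).
  by congr EFin; rewrite /ec /es !mulr0 expR0 cos0 sin0 -/q; field; exact: qn.
Qed.

End Tails.

Section OuterIntegral.
Variables (R : realType) (n : nat).
Local Notation V := 'rV[R]_n.
Local Notation leb := (@lebesgue_measure R).
Variables (K : set V) (X : V -> V).
Hypotheses (bK : body K X) (K0 : K !=set0).
Local Notation dist := (dist bK K0).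
Local Notation outer := (outer bK K0).
Variable d : nat -> R.
Hypothesis hd : shell_coefs bK K0 d.

Let outer_integral_gen (s : R) (f : measurableTypeR R -> R) (v : R -> R) : n%:R < s ->
  measurable_fun setT f -> (forall L, `|f L| <= expR (- s * L)) ->
  (forall k : R, k < s ->
    (\int[leb]_L (\1_(`]0%R, +oo[%classic) L * (f L * expR (k * L)))%:E = (v k)%:E)%E) ->
  (\int[lam R n]_y (outer f y)%:E = (\sum_(k < n) d k * v k.+1%:R)%:E)%E.
Proof.
move=> ns mf hf hv; pose g (L : measurableTypeR R) := \1_(`]0%R, +oo[%classic) L * f L.
have mg : measurable_fun setT g by apply: measurable_funM.
have [k kn|_ E] := hd mg.
  have ks : k.+1%:R < s by apply: le_lt_trans ns; rewrite ler_nat.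
  apply: le_integrable (exp_tail_integrable ks) => //.
    apply/measurable_EFinP; apply: measurable_funM => //; apply: measurableT_comp => //.
  move=> L _; rewrite /= lee_fin !normrM ler_wpM2r // ler_wpM2l //.
  by rewrite [leRHS]ger0_norm ?expR_ge0.
have -> : (fun y => (outer f y)%:E) = (fun y => (if 0 < dist y then g (ln (dist y)) else 0)%:E).
  apply/funext => y; congr EFin; rewrite /outer /g indicE.
  have [y1|y1] := leP (dist y) 1; last first.
    by rewrite (lt_trans ltr01 y1) mem_set ?mul1r //= in_itv /= andbT ln_gt0.
  case: ifPn => // _; rewrite memNset ?mul0r //= in_itv /= andbT.
  by apply/negP; rewrite -leNgt ln_le0.
rewrite E -sumEFin; apply: eq_bigr => k _; rewrite EFinM; congr (_ * _)%E.
rewrite -hv; last by apply: le_lt_trans ns; rewrite ler_nat.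
by apply: eq_integral => L _; rewrite /g mulrA.
Qed.

Lemma outer_integral_ecs (s t : R) : n%:R < s ->
  (\int[lam R n]_y (outer (ec s t) y)%:E =
    (\sum_(k < n) d k * ((s - k.+1%:R) / ((s - k.+1%:R) ^+ 2 + t ^+ 2)))%:E)%E /\
  (\int[lam R n]_y (outer (es s t) y)%:E =
    (\sum_(k < n) d k * (t / ((s - k.+1%:R) ^+ 2 + t ^+ 2)))%:E)%E.
Proof.
move=> ns; have E k L : expR (- s * L) * expR (k * L) = expR (- (s - k) * L).
  by rewrite -expRD; congr expR; ring.
split.
- apply: (outer_integral_gen (v := fun k => (s - k) / ((s - k) ^+ 2 + t ^+ 2)) ns).
  + exact: measurable_ec.
  + by move=> L; exact: ec_le.
  + move=> k ks; rewrite -(integral_ecs_tail t (_ : 0 < s - k)).1 ?subr_gt0 //.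
    by apply: eq_integral => L _; rewrite /ec mulrAC E.
- apply: (outer_integral_gen (v := fun k => t / ((s - k) ^+ 2 + t ^+ 2)) ns).
  + exact: measurable_es.
  + by move=> L; exact: es_le.
  + move=> k ks; rewrite -(integral_ecs_tail t (_ : 0 < s - k)).2 ?subr_gt0 //.
    by apply: eq_integral => L _; rewrite /es mulrAC E.
Qed.

End OuterIntegral.

#[local] Existing Instance summability.totally_filter.

(** * Sums over the lattice *)

Section NetSums.
Variables (R : realType) (I : choiceType).
Import finmap.
Implicit Types (u v : I -> R) (A B : {fset I}).

Lemma partial_sumE (W : zmodType) (x : I -> W) A :
  summability.partial_sum x A = \sum_(i <- A) x i.
Proof. by rewrite /summability.partial_sum big_seq_fsetE. Qed.

Definition abs_summable u := (\esum_(i in [set: I]) `|u i|%:E < +oo)%E.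

(** Positive and negative parts are summed separately, so that reindexing is inherited from [esum];
    [ssum_cvg] identifies the result with the limit over finite sets. *)
Definition ssum u : R := fine (\esum_(i in [set: I]) (Num.max (u i) 0)%:E)%E -
  fine (\esum_(i in [set: I]) (Num.max (- u i) 0)%:E)%E.

Let sum_le_esum u A : (forall i, 0 <= u i) ->
  ((\sum_(i <- A) u i)%:E <= \esum_(i in [set: I]) (u i)%:E)%E.
Proof.
move=> u0; apply: esum_ge; exists [set` A]; first by split.
by rewrite fsbig_finite //= set_fsetK sumEFin.
Qed.

Lemma net_esum u : (forall i, 0 <= u i) -> (\esum_(i in [set: I]) (u i)%:E < +oo)%E ->
  summability.partial_sum u A @[A --> summability.totally] -->
    fine (\esum_(i in [set: I]) (u i)%:E)%E.
Proof.
move=> u0 ufin; have S0 : (0 <= \esum_(i in [set: I]) (u i)%:E)%E.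
  by apply: esum_ge0 => i _; rewrite lee_fin.
have Sfin : (\esum_(i in [set: I]) (u i)%:E \is a fin_num)%E by rewrite ge0_fin_numE.
apply/cvgrPdist_le => e e0.
have [_ [X [finX _] <-] hX0] := ub_ereal_sup_adherent e0 Sfin.
have hX : (\esum_(i in [set: I]) (u i)%:E - e%:E < \sum_(x \in X) (u x)%:E)%E by exact: hX0.
exists (fset_set X) => // B /= XB; rewrite partial_sumE.
have hB := sum_le_esum B u0.
have hXB : (\sum_(i \in X) (u i)%:E <= \sum_(i \in [set` B]) (u i)%:E)%E.
  apply: lee_fsum_nneg_subset => //.
    by move=> i iX; apply/mem_set => /=; apply: (fsubsetP XB); rewrite in_fset_set.
  by move=> i _; rewrite lee_fin.
rewrite fsbig_finite // sumEFin fsbig_finite // set_fsetK sumEFin lee_fin in hXB.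
rewrite fsbig_finite //= sumEFin in hX.
rewrite -(fineK Sfin) -EFinB lte_fin in hX; rewrite -(fineK Sfin) lee_fin in hB.
rewrite ler_norml; move: (fine _) hX hB hXB => x; move: (\sum_(i <- B) _) (\sum_(i <- _) _) => y z; lra.
Qed.

Lemma ssum_cvg u : abs_summable u ->
  summability.partial_sum u A @[A --> summability.totally] --> ssum u.
Proof.
move=> su.
have h1 : summability.partial_sum (fun i => Num.max (u i) 0) A @[A --> summability.totally] -->
    fine (\esum_(i in [set: I]) (Num.max (u i) 0)%:E)%E.
  apply: net_esum => [i|]; first by rewrite le_max lexx orbT.
  apply: le_lt_trans su; apply: le_esum => i _; rewrite lee_fin ge_max normr_ge0 andbT.
  exact: ler_norm.
have h2 : summability.partial_sum (fun i => Num.max (- u i) 0) A @[A --> summability.totally] -->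
    fine (\esum_(i in [set: I]) (Num.max (- u i) 0)%:E)%E.
  apply: net_esum => [i|]; first by rewrite le_max lexx orbT.
  apply: le_lt_trans su; apply: le_esum => i _; rewrite lee_fin ge_max normr_ge0 andbT.
  by rewrite -normrN; exact: ler_norm.
have <- : (fun A => summability.partial_sum (fun i => Num.max (u i) 0) A -
    summability.partial_sum (fun i => Num.max (- u i) 0) A) = summability.partial_sum u.
  apply/funext => A; rewrite !partial_sumE -sumrB; apply: eq_bigr => i _.
  have [u0|u0] := leP (u i) 0; first by rewrite max_l ?oppr_ge0 // sub0r opprK.
  by rewrite max_r ?subr0 // oppr_le0 ltW.
exact: cvgB.
Qed.

Lemma abs_summableD u v : abs_summable u -> abs_summable v -> abs_summable (fun i => u i + v i).
Proof.
move=> su sv; apply: (@le_lt_trans _ _ (\esum_(i in [set: I]) (`|u i|%:E + `|v i|%:E))%E).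
  by apply: le_esum => i _; rewrite -EFinD lee_fin ler_normD.
rewrite esumD; first exact: lte_add_pinfty.
  by move=> i _; rewrite lee_fin.
by move=> i _; rewrite lee_fin.
Qed.

Lemma ssumD u v : abs_summable u -> abs_summable v -> ssum (fun i => u i + v i) = ssum u + ssum v.
Proof.
move=> su sv; have h' := ssum_cvg (abs_summableD su sv).
have E : summability.partial_sum (fun i => u i + v i) =
    (fun A => summability.partial_sum u A + summability.partial_sum v A).
  by apply/funext => A; rewrite !partial_sumE big_split.
have h : summability.partial_sum (fun i => u i + v i) A @[A --> summability.totally] --> ssum u + ssum v.
  by rewrite E; apply: cvgD; exact: ssum_cvg.
by apply: (cvg_unique _ h' h); exact: norm_hausdorff.
Qed.

Lemma esum_seq (s : seq I) (f : I -> R) : uniq s -> (forall i, 0 <= f i) ->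
  (forall i, i \notin s -> f i = 0) ->
  (\esum_(i in [set: I]) (f i)%:E = (\sum_(i <- s) f i)%:E)%E.
Proof.
move=> us f0 fs; transitivity (\esum_(i in [set` s]) (f i)%:E)%E.
  rewrite [RHS]esum_mkcond; apply: eq_esum => i _.
  by rewrite mem_setE; case: ifPn => // /fs ->.
rewrite esum_fset; [|exact: finite_seq|by move=> i _; rewrite lee_fin].
by rewrite -fsbig_seq // sumEFin.
Qed.

Lemma ssum_seq (s : seq I) u : uniq s -> (forall i, i \notin s -> u i = 0) ->
  abs_summable u /\ ssum u = \sum_(i <- s) u i.
Proof.
move=> us su; split.
  by rewrite /abs_summable (esum_seq us) ?ltry // => i /su ->; rewrite normr0.
rewrite /ssum !(esum_seq us); last first.
- by move=> i /su ->; rewrite maxxx.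
- by move=> i; rewrite le_max lexx orbT.
- by move=> i /su ->; rewrite oppr0 maxxx.
- by move=> i; rewrite le_max lexx orbT.
rewrite -sumrB; apply: eq_bigr => i _.
have [u0|u0] := leP (u i) 0; first by rewrite max_l ?oppr_ge0 // sub0r opprK.
by rewrite max_r ?subr0 // oppr_le0 ltW.
Qed.

End NetSums.

Section Reindex.
Variables (R : realType) (I J : choiceType) (P : set I) (Q : set J) (e : I -> J).
Hypothesis be : set_bij P Q e.

Lemma esum_reindex0 (f : J -> R) : (forall j, ~ Q j -> f j = 0) ->
  (\esum_(j in [set: J]) (f j)%:E =
   \esum_(i in [set: I]) (if i \in P then f (e i) else 0)%:E)%E.
Proof.
move=> fQ; transitivity (\esum_(j in Q) (f j)%:E)%E.
  rewrite [RHS]esum_mkcond; apply: eq_esum => j _; case: ifPn => //.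
  by rewrite notin_setE => /fQ ->.
rewrite (reindex_esum P Q e) // esum_mkcond; apply: eq_esum => i _.
by case: ifPn.
Qed.

Lemma ssum_reindex (u : J -> R) : (forall j, ~ Q j -> u j = 0) ->
  ssum u = ssum (fun i => if i \in P then u (e i) else 0).
Proof.
move=> uQ; rewrite /ssum !esum_reindex0; last first.
- by move=> j /uQ ->; rewrite maxxx.
- by move=> j /uQ ->; rewrite oppr0 maxxx.
congr (fine _ - fine _); apply: eq_esum => i _; case: ifPn => _ //; first by rewrite maxxx.
by rewrite oppr0 maxxx.
Qed.

Lemma abs_summable_reindex (u : J -> R) : (forall j, ~ Q j -> u j = 0) ->
  abs_summable (fun i => if i \in P then u (e i) else 0) -> abs_summable u.
Proof.
move=> uQ; rewrite /abs_summable esum_reindex0; last by move=> j /uQ ->; rewrite normr0.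
by congr (_ < _)%E; apply: eq_esum => i _; case: ifPn => _ //; rewrite normr0.
Qed.

End Reindex.

Section Lattice.
Variables (R : realType) (n : nat) (c : R).
Hypothesis c0 : 0 < c.
Local Notation V := 'rV[R]_n.
Local Notation Z := 'rV[int]_n.
Variables (K : set V) (X : V -> V).
Hypotheses (bK : body K X) (K0 : K !=set0).
Local Notation dist := (dist bK K0).
Local Notation outer := (outer bK K0).
Local Notation base y := (coordwise (kap c) y).
Implicit Types (y : V) (r a : R) (k : Z).

Definition latdist k : R := dist (latpt c k).

Let esum_lattice (g : V -> R) : measurable_fun setT g -> (forall y, 0 <= g y) ->
  (\esum_(k in [set: Z]) (g (latpt c k))%:E =
   (c ^+ n)^-1%:E * \int[lam R n]_y (g (base y))%:E)%E.
Proof.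
move=> mg g0; have cn : 0 < c ^+ n by rewrite exprn_gt0.
have mgb : measurable_fun setT (fun y => (g (base y))%:E).
  apply/measurable_EFinP; apply: measurableT_comp mg _.
  by apply: measurable_coordwise; exact: measurable_kap.
rewrite -ge0_integralZl //; last 2 first.
- by move=> y _; rewrite lee_fin.
- by rewrite lee_fin invr_ge0 ltW.
have := integral_kap c0 (f := fun y => ((c ^+ n)^-1%:E * (g y)%:E)%E) _ _ => ->.
- by apply: eq_esum => k _; rewrite -!EFinM mulrAC mulVf ?mul1r // gt_eqF.
- by apply: measurable_funeM; exact/measurable_EFinP.
- by move=> y; rewrite -EFinM lee_fin mulr_ge0 // invr_ge0 ltW.
Qed.

Lemma lattice_sum r (f : measurableTypeR R -> R) : measurable_fun setT f ->
  Wf 0 r (fun _ : unit => f) -> n%:R < r ->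
  abs_summable (fun k => outer f (latpt c k)) /\
  ssum (fun k => outer f (latpt c k)) = (c ^+ n)^-1 * fine (\int[lam R n]_y (outer f (base y))%:E)%E.
Proof.
move=> mf wf nr; have iob := outer_base_integrable c0 bK K0 mf wf nr.
have mo := measurable_outer bK K0 mf.
split.
  rewrite /abs_summable (esum_lattice (g := fun y => `|outer f y|)) //; last first.
    exact: measurableT_comp.
  by case/integrableP : iob => _ h; rewrite lte_mul_pinfty // lee_fin invr_ge0 exprn_ge0 // ltW.
rewrite /ssum (esum_lattice (g := fun y => Num.max (outer f y) 0)); last 2 first.
- exact: measurable_maxr.
- by move=> y; rewrite le_max lexx orbT.
rewrite (esum_lattice (g := fun y => Num.max (- outer f y) 0)); last 2 first.
- by apply: measurable_maxr => //; exact: measurableT_comp.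
- by move=> y; rewrite le_max lexx orbT.
have p1 : (\int[lam R n]_y (fun y => (outer f (base y))%:E)^\+ y \is a fin_num)%E.
  exact: integrable_pos_fin_num.
have p2 : (\int[lam R n]_y (fun y => (outer f (base y))%:E)^\- y \is a fin_num)%E.
  exact: integrable_neg_fin_num.
rewrite [in RHS]integralE fineB // mulrBr; congr (_ - _).
- rewrite (eq_integral (fun y => (Num.max (outer f (base y)) 0)%:E)) in p1 *; last first.
    by move=> y _; rewrite funeposE EFin_max.
  by rewrite fineM.
- rewrite (eq_integral (fun y => (Num.max (- outer f (base y)) 0)%:E)) in p2 *; last first.
    by move=> y _; rewrite funenegE EFin_max.
  by rewrite fineM.
Qed.

Lemma near_finite : finite_set [set k : Z | 0 < latdist k <= 1].
Proof.
have [B hB] := dist_far bK K0 1.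
pose M := (Num.truncn (`|B| / c)).+1.
pose f (g : 'rV['I_(M + M).+1]_n) : Z := \row_i ((g 0 i)%:Z - M%:Z).
apply: (@sub_finite_set _ _ (range f)); last exact: finite_image.
move=> k /= /andP[_ k1].
have kB : `|latpt c k| <= B by rewrite leNgt; apply/negP => /hB; rewrite ltNge k1.
have kM i : (`|k 0 i| <= M%:Z)%R.
  have : `|latpt c k 0 i| <= `|B|.
    by apply: (le_trans (norm_coord_le _ _)); apply: (le_trans kB); exact: ler_norm.
  rewrite mxE normrM (gtr0_norm c0) -ler_pdivlMl // mulrC => h.
  have := le_lt_trans h (truncnS_gt _); rewrite -/M -intr_norm -[M%:R]/(M%:~R : R) ltr_int.
  exact: ltW.
have kM' i : (`|(k 0 i + M%:Z)%R|%N < (M + M).+1)%N.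
  have := kM i; rewrite ler_norml => /andP[h1 h2]; rewrite ltnS -lez_nat gez0_abs; last by lia.
  by rewrite PoszD lerD2r.
exists (\row_i Ordinal (kM' i)) => //; apply/rowP => i; rewrite !mxE /=.
have := kM i; rewrite ler_norml => /andP[h1 h2]; rewrite gez0_abs ?addrK //; lia.
Qed.

(** The lattice points outside the body that the cut in [outer] leaves out. *)
Definition near_points : seq Z := finmap.enum_fset (fset_set [set k : Z | 0 < latdist k <= 1]).

Lemma near_pointsP k : (k \in near_points) = (0 < latdist k <= 1).
Proof. by rewrite in_fset_set ?mem_setE //; exact: near_finite. Qed.

Definition term (f : R -> R) k : R := if 0 < latdist k then f (ln (latdist k)) else 0.

Lemma term_sum r (f : measurableTypeR R -> R) : measurable_fun setT f ->
  Wf 0 r (fun _ : unit => f) -> n%:R < r ->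
  abs_summable (term f) /\
  ssum (term f) = \sum_(k <- near_points) f (ln (latdist k)) +
    (c ^+ n)^-1 * fine (\int[lam R n]_y (outer f (base y))%:E)%E.
Proof.
move=> mf wf nr; have [s1 E1] := lattice_sum mf wf nr.
pose u k : R := if k \in near_points then f (ln (latdist k)) else 0.
have us : uniq near_points by exact: finmap.fset_uniq.
have u0 k : k \notin near_points -> u k = 0 by rewrite /u => /negbTE ->.
have [s2 E2] := ssum_seq us u0.
have -> : term f = (fun k => u k + outer f (latpt c k)).
  apply/funext => k; rewrite /term /u near_pointsP /outer -/(latdist k).
  case: (ltP 1 (latdist k)) => k1; last by rewrite andbT addr0.
  by rewrite andbF add0r (lt_trans ltr01 k1).
split; first exact: abs_summableD.
rewrite ssumD // E1 E2; congr (_ + _); rewrite !big_seq; apply: eq_bigr => k kn.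
by rewrite /u kn.
Qed.

End Lattice.

(** * The entire continuation *)

Section Entire.
Variables (R : realType) (n : nat) (c : R).
Hypothesis c0 : 0 < c.
Local Notation V := 'rV[R]_n.
Local Notation Z := 'rV[int]_n.
Variables (K : set V) (X : V -> V).
Hypotheses (bK : body K X) (K0 : K !=set0).
Local Notation lfun := (lfun c bK K0).
Local Notation latdist := (latdist c bK K0).
Local Notation near_points := (near_points c bK K0).
Local Notation term := (term c bK K0).
Implicit Types (s t a b : R) (k : Z).

(** No fixed order serves all exponents, so it is adapted to s. The inequality n < s - 1 + N with N
    = order s + 1 leaves the spare unit that the Taylor remainders cost. *)
Definition order s : nat := Num.truncn (n%:R + 1 - s).

Lemma order_gt s : n%:R < s - 1 + (order s).+1%:R.
Proof. by have := truncnS_gt (n%:R + 1 - s); rewrite -/(order s); lra. Qed.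

Lemma lfun_order N s t : n%:R < s + N.+1%:R ->
  lfun N.+1 (ec s t) = lfun (order s).+1 (ec s t) /\ lfun N.+1 (es s t) = lfun (order s).+1 (es s t).
Proof.
move=> ns; have os : n%:R < s + (order s).+1%:R by have := order_gt s; lra.
have [h1 h2] := lfun_ecs_eq c0 bK K0 t ns (leq_maxl N (order s)).
have [h3 h4] := lfun_ecs_eq c0 bK K0 t os (leq_maxr N (order s)).
by rewrite h1 h2 h3 h4.
Qed.

Definition Gc s t := \sum_(k <- near_points) ec s t (ln (latdist k)) + lfun (order s).+1 (ec s t).
Definition Gs s t := \sum_(k <- near_points) es s t (ln (latdist k)) + lfun (order s).+1 (es s t).

Definition continuation (z : R[i]) : R[i] :=
  (Gc (complex.Re z) (complex.Im z) +i* (- Gs (complex.Re z) (complex.Im z)))%C.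

(** This says that f - i g has complex derivative - Dc + i Ds at s + i t; the same pair in both
    lines is the Cauchy-Riemann system. *)
Let taylor (f g : R -> R -> R) s t := exists Dc Ds C, forall a b, `|a| + `|b| <= 1 / 2 ->
  `|f (s + a) (t + b) - f s t + (a * Dc + b * Ds)| <= C * (`|a| + `|b|) ^+ 2 /\
  `|g (s + a) (t + b) - g s t + (a * Ds - b * Dc)| <= C * (`|a| + `|b|) ^+ 2.

Let taylorD f g f' g' s t : taylor f g s t -> taylor f' g' s t ->
  taylor (fun s t => f s t + f' s t) (fun s t => g s t + g' s t) s t.
Proof.
move=> [Dc [Ds [C h]]] [Dc' [Ds' [C' h']]]; exists (Dc + Dc'), (Ds + Ds'), (C + C') => a b ab.
have [h1 h2] := h a b ab; have [h3 h4] := h' a b ab; rewrite mulrDl; split.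
- rewrite (le_trans _ (lerD h1 h3)) //; apply: le_trans (ler_normD _ _).
  by rewrite le_eqVlt; apply/orP; left; apply/eqP; congr (`|_|); ring.
- rewrite (le_trans _ (lerD h2 h4)) //; apply: le_trans (ler_normD _ _).
  by rewrite le_eqVlt; apply/orP; left; apply/eqP; congr (`|_|); ring.
Qed.

Let taylor_point L s t : taylor (fun s t => ec s t L) (fun s t => es s t L) s t.
Proof.
exists (L * ec s t L), (L * es s t L), (L ^+ 2 * expR (- s * L + `|L|)) => a b ab.
have aE : expR (- s * L + `|a| * `|L|) <= expR (- s * L + `|L|).
  rewrite ler_expR lerD2l -[leRHS]mul1r ler_wpM2r //.
  by have := normr_ge0 b; move: ab; lra.
have B : (`|a| + `|b|) ^+ 2 * L ^+ 2 * expR (- s * L + `|a| * `|L|) <=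
    L ^+ 2 * expR (- s * L + `|L|) * (`|a| + `|b|) ^+ 2.
  have -> : L ^+ 2 * expR (- s * L + `|L|) * (`|a| + `|b|) ^+ 2 =
    (`|a| + `|b|) ^+ 2 * L ^+ 2 * expR (- s * L + `|L|) by ring.
  by rewrite ler_wpM2l // mulr_ge0 ?sqr_ge0.
split; apply: le_trans B.
- rewrite (_ : a * _ + b * _ = L * (a * ec s t L + b * es s t L)); first exact: ec_Taylor2.
  by ring.
- rewrite (_ : a * _ - b * _ = L * (a * es s t L - b * ec s t L)); first exact: es_Taylor2.
  by ring.
Qed.

Let taylor_sum (l : seq Z) s t : taylor (fun s t => \sum_(k <- l) ec s t (ln (latdist k)))
  (fun s t => \sum_(k <- l) es s t (ln (latdist k))) s t.
Proof.
elim: l => [|k l IH].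
  exists 0, 0, 0 => a b _; rewrite !big_nil !mulr0 !mul0r !(subr0, addr0) normr0.
  by split.
have := taylorD (taylor_point (ln (latdist k)) s t) IH.
congr taylor; apply/funext => s'; apply/funext => t'; by rewrite big_cons.
Qed.

(** [order] jumps, so at s + a the functional is taken with a different order; [lfun_order] replaces
    it by that of s, which is still admissible since |a| <= 1 / 2. *)
Let taylor_lfun s t : taylor (fun s t => lfun (order s).+1 (ec s t))
  (fun s t => lfun (order s).+1 (es s t)) s t.
Proof.
have [C h] := lfun_Taylor c0 bK K0 t (order_gt s).
exists (lfun (order s).+1 (dec s t)), (lfun (order s).+1 (des s t)), C => a b ab.
have ns : n%:R < s + a + (order s).+1%:R.
  have := order_gt s; have := ler_norm (- a); rewrite normrN; have := normr_ge0 b.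
  by move: ab; lra.
have [<- <-] := lfun_order (t + b) ns.
exact: h.
Qed.

Lemma continuation_entire : entire continuation.
Proof.
move=> z; have [Dc [Ds [C h]]] :=
  taylorD (taylor_sum near_points (complex.Re z) (complex.Im z)) (taylor_lfun (complex.Re z) (complex.Im z)).
apply: (@complex_derivable R continuation z (- Dc +i* Ds)%C (C + C) (1 / 2)) => // w wr.
have [h1 h2] := h _ _ wr; rewrite mulrDl; apply: lerD.
- apply: le_trans h1; rewrite le_eqVlt; apply/orP; left; apply/eqP; congr (`|_|).
  by case: z w {h wr h2} => [s t] [a b] /=; rewrite /Gc; ring.
- apply: le_trans h2; rewrite -normrN le_eqVlt; apply/orP; left; apply/eqP; congr (`|_|).
  by case: z w {h wr h1} => [s t] [a b] /=; rewrite /Gs; ring.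
Qed.

Variable d : nat -> R.
Hypothesis hd : shell_coefs bK K0 d.

Lemma continuation_value s t : n%:R < s ->
  [/\ abs_summable (term (ec s t)), abs_summable (term (es s t)),
  Gc s t = ssum (term (ec s t)) -
    (c ^+ n)^-1 * \sum_(k < n) d k * ((s - k.+1%:R) / ((s - k.+1%:R) ^+ 2 + t ^+ 2)) &
  Gs s t = ssum (term (es s t)) -
    (c ^+ n)^-1 * \sum_(k < n) d k * (t / ((s - k.+1%:R) ^+ 2 + t ^+ 2))].
Proof.
move=> ns; have [w1 w2] := Wf_ecs unit s t 0.
have [s1 E1] := term_sum c0 bK K0 (measurable_ec s t) w1 ns.
have [s2 E2] := term_sum c0 bK K0 (measurable_es s t) w2 ns.
have [q1 q2] := outer_integral_ecs hd t ns.
have l1 := lfun_lattice c0 bK K0 (order s) (measurable_ec s t) w1 ns.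
have l2 := lfun_lattice c0 bK K0 (order s) (measurable_es s t) w2 ns.
pose A (f : measurableTypeR R -> R) := fine (\int[lam R n]_y (outer bK K0 f (coordwise (kap c) y))%:E)%E.
have {}l1 := etrans l1 (congr1 (fun x => (c ^+ n)^-1 * (A (ec s t) - fine x)) q1).
have {}l2 := etrans l2 (congr1 (fun x => (c ^+ n)^-1 * (A (es s t) - fine x)) q2).
split; [exact: s1|exact: s2| |].
- by rewrite E1 -addrA -mulrBr; congr (_ + _); exact: l1.
- by rewrite E2 -addrA -mulrBr; congr (_ + _); exact: l2.
Qed.

End Entire.

(** * Orthogeodesics *)

Section Normals.
Variables (R : realType) (n : nat).
Local Notation V := 'rV[R]_n.
Implicit Types (K : set V) (X : V -> V) (x u : V).

Lemma unit_neq0 u : enorm u = 1 -> u != 0.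
Proof. by move=> u1; rewrite -enorm_eq0 u1 oner_eq0. Qed.

Lemma body_closed K X : body K X -> closed K.
Proof. by move=> bK; apply: compact_closed; [exact: norm_hausdorff|exact: body_compact bK]. Qed.

(** For a body with interior, [ld_outer] makes a point with outward normal u a maximizer of the
    product with u, hence X u by uniqueness; conversely [ld_maximizer] identifies the normal at X u.
    For a point every unit vector is a normal and X is constant on nonzero vectors. *)
Lemma outgoing_support K X x u : strictly_convex_smooth K -> body K X -> enorm u = 1 ->
  (boundary K x /\ outgoing_unit_normal K x u) <-> x = X u.
Proof.
move=> sK bK u1; have u0 := unit_neq0 u1; have cK := body_closed bK.
have sX := body_support bK.
split=> [[bx [_ [Kx|[U [f [ldK uE]]]]]]|->].
- by have := sm_in sX u0; rewrite Kx => ->.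
- have Kx : K x by case: bx => clx _; rewrite (closure_id K).1.
  have g0 : 0 < enorm (gradient f x).
    by rewrite enorm_gt0; case: ldK => _ Ux _ gf _; exact: gf.
  apply: (sm_uniq sX u0 Kx); apply/eqP; rewrite eq_le (sm_max sX u0 Kx) /=.
  have := ld_outer ldK cK (body_convex bK) bx (sm_in sX u0).
  move=> h; rewrite -subr_le0 -dotpBl [X in dotp _ X]uE /outer_normal dotpZr.
  by rewrite pmulr_rle0 // invr_gt0.
have bx : boundary K (X u).
  by apply: (maximizer_boundary u0 (sm_in sX u0)) => z Kz; exact: (sm_max sX u0 Kz).
split=> //; split=> //; case: sK => [[z Kz]|[_ _ _ sbK _]].
  by left; have Xz := sm_in sX u0; rewrite Kz /= in Xz; rewrite Xz.
right; have [U [f ldK]] := sbK _ bx; exists U, f; split=> //.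
have [l l0 uE] := ld_maximizer ldK cK bx u0 (fun z Kz => sm_max sX u0 Kz).
have g0 : gradient f (X u) != 0 by case: ldK => _ Ux _ gf _; exact: gf.
rewrite /outer_normal; move: (gradient f (X u)) uE g0 => g uE g0.
have gn0 : enorm g != 0 by rewrite enorm_eq0.
have E : l * enorm g = 1 by rewrite -u1 [in RHS]uE enormZ gtr0_norm.
by rewrite {1}uE; congr (_ *: _); apply: (mulIf gn0); rewrite E mulVf.
Qed.

End Normals.

Section Geodesics.
Variables (R : realType) (n : nat).
Local Notation V := 'rV[R]_n.
Implicit Types (x u : V) (k : 'rV[int]_n) (l : R).

Lemma torus_projP x y : torus_proj x = torus_proj y <-> exists k, x = y + latpt (2 * pi) k.
Proof.
have E k : latpt (2 * pi) k = (2 * pi) *: map_mx intr k :> V by apply/rowP => i; rewrite !mxE.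
split=> [/eqmodP/asboolP[k xy]|[k ->]]; first by exists k; rewrite E -xy addrC subrK.
by apply/eqmodP/asboolP; exists k; rewrite -E addrC addKr.
Qed.

Lemma geodesicE l x u t : 0 <= t <= l -> (geodesic l x u).2 t = torus_proj (x + t *: u).
Proof. by move=> tl; rewrite /geodesic /= patchE mem_set //= in_itv. Qed.

Lemma geodesic_eq l x y u : torus_proj x = torus_proj y -> geodesic l x u = geodesic l y u.
Proof.
move=> /torus_projP[k xy]; congr (_, _); apply/funext => t; rewrite !patchE; case: ifPn => // _.
by apply/torus_projP; exists k; rewrite xy addrAC.
Qed.

Lemma latpt_small k (r : R) i : r = latpt (2 * pi) k 0 i -> `|r| < 2 * pi -> r = 0.
Proof.
have p0 : 0 < 2 * pi :> R by rewrite mulr_gt0 // pi_gt0.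
move=> ->; rewrite mxE normrM (gtr0_norm p0) -[ltRHS]mulr1 ltr_pM2l // -intr_norm.
rewrite -[1]/(1%:~R) ltr_int => k1.
by rewrite (_ : k 0 i = 0) ?mulr0 //; move: k1; lia.
Qed.

Lemma latpt_inj : injective (@latpt R n (2 * pi)).
Proof.
have p0 : 2 * pi != 0 :> R by rewrite mulf_neq0 // gt_eqF // pi_gt0.
move=> k k' E; apply/rowP => i; have := congr1 (fun z : V => z 0 i) E.
by rewrite /latpt !mxE => /(mulfI p0) /eqP; rewrite eqr_int => /eqP.
Qed.

(** The lifts differ by lattice vectors at every time, so t (u - v) is a lattice vector for 0 <= t
    <= l; for t small enough it is shorter than a period in each coordinate and must vanish. *)
Lemma geodesic_inj l x y u v : 0 < l -> geodesic l x u = geodesic l y v -> u = v.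
Proof.
move=> l0 [] E.
have h t : 0 <= t <= l -> exists k, x + t *: u = y + t *: v + latpt (2 * pi) k.
  move=> tl; apply/torus_projP; have := congr1 (fun f => f t) E.
  by rewrite /= !patchE mem_set //= in_itv.
have [|k0 E0] := h 0; first by rewrite lexx ltW.
apply/rowP => i; apply/eqP; rewrite -subr_eq0; apply/eqP; set w := u 0 i - v 0 i.
have p0 : 0 < 2 * pi :> R by rewrite mulr_gt0 // pi_gt0.
pose t := Num.min l (pi / (`|w| + 1)).
have w1 : 0 < `|w| + 1 by rewrite ltr_wpDl.
have t0 : 0 < t by rewrite lt_min l0 divr_gt0 // pi_gt0.
have [|k Ek] := h t; first by rewrite (ltW t0) ge_min lexx.
have tw : t * w = latpt (2 * pi) (k - k0) 0 i.
  have := congr1 (fun z : V => z 0 i) Ek; have := congr1 (fun z : V => z 0 i) E0.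
  by rewrite !scale0r !mxE /w rmorphB /= mulrBr; lra.
have tw_small : `|t * w| < 2 * pi.
  rewrite normrM (gtr0_norm t0) (@le_lt_trans _ _ (pi / (`|w| + 1) * `|w|)) //.
    by rewrite ler_wpM2r // ge_min lexx orbT.
  rewrite mulrAC ltr_pdivrMr //; have := pi_gt0 R; have := normr_ge0 w.
  by move: (`|w|) (pi : R) => x' y' h1 h2; nra.
have /eqP := latpt_small tw tw_small; rewrite mulf_eq0 gt_eqF //= => /eqP.
by [].
Qed.

End Geodesics.

Section Bijection.
Variables (R : realType) (n : nat).
Local Notation V := 'rV[R]_n.
Variables (K1 K2 : set V) (X1 X2 : V -> V).
Hypotheses (sK1 : strictly_convex_smooth K1) (sK2 : strictly_convex_smooth K2).
Hypotheses (bK1 : body K1 X1) (bK2 : body K2 X2).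
Hypothesis K0 : minkowski_diff K1 K2 !=set0.
Implicit Types (x u : V) (k : 'rV[int]_n) (l : R).

Local Notation bK := (body_diff bK1 bK2).
Local Notation latdist := (latdist (2 * pi) bK K0).
Local Notation pvec := (pvec bK K0).

Definition direction k : V := (latdist k)^-1 *: pvec (latpt (2 * pi) k).
Definition lattice_geodesic k : curve R n := geodesic (latdist k) (X1 (direction k)) (direction k).

(** The normals determine the end points up to periods, and the lift can be translated to start
    exactly at X1 u; the lattice vector k collects the two translations. *)
Lemma orthogeodesicsP (g : curve R n) : orthogeodesics K1 K2 g <->
  exists l u k, [/\ 0 < l, enorm u = 1, g = geodesic l (X1 u) u &
    X1 u + l *: u = X2 (- u) + latpt (2 * pi) k].
Proof.
split=> [[l [x [u [l0 u1 gE]]]]|[l [u [k [l0 u1 gE kE]]]]].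
  have u1' : enorm (- u) = 1 by rewrite enormN.
  rewrite gE !geodesicE ?lexx ?(ltW l0) // scale0r addr0.
  move=> [x1 [/= bx1 px1 nx1]] [x2 [/= bx2 px2 nx2]].
  have x1E : x1 = X1 u by apply/(outgoing_support x1 sK1 bK1 u1).
  have x2E : x2 = X2 (- u) by apply/(outgoing_support x2 sK2 bK2 u1').
  rewrite x1E in px1; rewrite x2E in px2.
  have [k1 E1] := (torus_projP _ _).1 px1; have [k2 E2] := (torus_projP _ _).1 px2.
  exists l, u, (k2 - k1); split=> //; first exact: geodesic_eq.
  have -> : X1 u = x - latpt (2 * pi) k1 by rewrite E1 addrK.
  rewrite addrAC E2 -addrA; congr (_ + _); apply/rowP => i.
  by rewrite !mxE intrD [RHS]mulrDr rmorphN mulrN.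
exists l, (X1 u), u; split=> //.
- rewrite gE geodesicE ?lexx ?(ltW l0) // scale0r addr0; exists (X1 u).
  by have [bx nx] := (outgoing_support (X1 u) sK1 bK1 u1).2 erefl.
- rewrite gE geodesicE ?lexx ?(ltW l0) //; exists (X2 (- u)).
  have u1' : enorm (- u) = 1 by rewrite enormN.
  have [bx nx] := (outgoing_support (X2 (- u)) sK2 bK2 u1').2 erefl.
  by split=> //=; apply/torus_projP; exists k.
Qed.

Let X u := X1 u - X2 (- u).

Lemma lattice_point k : 0 < latdist k ->
  latpt (2 * pi) k = latdist k *: direction k + X (direction k).
Proof.
move=> k0; have nK : ~ minkowski_diff K1 K2 (latpt (2 * pi) k) by exact: (dist_gt0 bK K0 _).1.
rewrite -{1}(pvecE bK K0 nK) /direction scalerA mulfV ?gt_eqF // scale1r; congr (_ + _).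
rewrite -/(X _) -[LHS]/(X (pvec (latpt (2 * pi) k))).
by apply/esym; apply: (support_homog bK); rewrite ?invr_gt0 // -enorm_gt0.
Qed.

Lemma direction_unit k : 0 < latdist k -> enorm (direction k) = 1.
Proof.
move=> k0; rewrite enormZ gtr0_norm ?invr_gt0 // -[enorm _]/(latdist k) mulVf // gt_eqF //.
Qed.

(** Injectivity: the curve determines its length and velocity, and these the lattice point by
    [lattice_point]. Surjectivity: the end point equation reads 2 pi k = l u + X (l u), so [pvecK]
    recovers l u from k. *)
Lemma lattice_geodesic_bij :
  set_bij [set k | 0 < latdist k] (orthogeodesics K1 K2) lattice_geodesic.
Proof.
split=> [k /= k0|k k'|g /orthogeodesicsP[l [u [k [l0 u1 gE kE]]]]].
- apply/orthogeodesicsP; exists (latdist k), (direction k), k; split=> //.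
    exact: direction_unit.
  by rewrite (lattice_point k0) /X addrC addrCA; congr (_ + _); rewrite addrC subrK.
- move=> /set_mem k0 /set_mem k0' E.
  have Ed : latdist k = latdist k' by exact: (congr1 fst E).
  have Eu : direction k = direction k'.
    by move: E; rewrite /lattice_geodesic -Ed => /(geodesic_inj k0).
  have Ep : latpt (2 * pi) k = latpt (2 * pi) k' :> V.
    by rewrite (lattice_point k0) (lattice_point k0') Ed Eu.
  exact: latpt_inj Ep.
- have u0 := unit_neq0 u1.
  have lu0 : l *: u != 0 by rewrite scaler_eq0 negb_or gt_eqF.
  have kE' : latpt (2 * pi) k = l *: u + X (l *: u).
    have -> : X (l *: u) = X u by exact: (support_homog bK u0 l0).
    by rewrite /X addrA [l *: u + _]addrC kE addrAC subrr add0r.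
  have pE : pvec (latpt (2 * pi) k) = l *: u by rewrite kE'; exact: (pvecK bK K0 lu0).
  have dE : latdist k = l.
    by rewrite /latdist /dist pE enormZ u1 mulr1 gtr0_norm.
  have uE : direction k = u by rewrite /direction dE pE scalerA mulVf ?scale1r // gt_eqF.
  by exists k; rewrite /= ?dE // /lattice_geodesic dE uE gE.
Qed.

End Bijection.

Section ComplexSums.
Variable R : realType.
Local Open Scope complex_scope.

Lemma cvg_complex (T : Type) (F : set_system T) (FF : ProperFilter F) (u v : T -> R) (a b : R) :
  u x @[x --> F] --> a -> v x @[x --> F] --> b ->
  ((u x +i* v x : R[i]^o) @[x --> F] --> (a +i* b : R[i]^o)).
Proof.
move=> /cvgrPdist_le ua /cvgrPdist_le vb; apply/cvgrPdist_le => -[e e'] /=; rewrite ltcE /= => /andP[/eqP -> e0].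
have e2 : 0 < e / 2 by rewrite divr_gt0.
near=> x; apply: (le_trans (norm_csize _)); rewrite lecR /csize /=.
have h1 : `|a - u x| <= e / 2 by near: x; exact: (ua _ e2).
have h2 : `|b - v x| <= e / 2 by near: x; exact: (vb _ e2).
by rewrite [leRHS]splitr lerD.
Unshelve. all: by end_near. Qed.

Lemma sum_complex (I : Type) (r : seq I) (u v : I -> R) :
  \sum_(i <- r) (u i +i* v i) = (\sum_(i <- r) u i) +i* (\sum_(i <- r) v i).
Proof. by elim: r => [|i r IH]; rewrite ?big_nil // !big_cons IH. Qed.

Lemma invc_formula (a t : R) :
  (a +i* t)^-1 = (a / (a ^+ 2 + t ^+ 2)) +i* (- (t / (a ^+ 2 + t ^+ 2))).
Proof. by []. Qed.

Lemma inv_cpower (x : R) (s : R[i]) :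
  1 / cpower x s = ec (complex.Re s) (complex.Im s) (ln x) +i* - es (complex.Re s) (complex.Im s) (ln x).
Proof.
set E := (RHS); have h : cpower x s * E = 1.
  rewrite /cpower /E /ec /es mulNr expRN; set e := expR _; set p := _ * ln x.
  have e0 : e != 0 by rewrite gt_eqF // expR_gt0.
  have cs := cos2Dsin2 p.
  apply/eqP; rewrite eq_complex /=; apply/andP; split; apply/eqP.
    rewrite !mul0r !(subr0, addr0, add0r) -[RHS]cs; field; exact: e0.
  rewrite !mul0r !(subr0, addr0, add0r); field; exact: e0.
have c0 : cpower x s != 0.
  by apply/negP => /eqP c0; move: h; rewrite c0 mul0r => /esym/eqP; rewrite oner_eq0.
by rewrite div1r -[LHS]mulr1 -h mulrA mulVf // mul1r.
Qed.

End ComplexSums.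

Section Zeta.
Variables (R : realType) (n : nat).
Local Notation V := 'rV[R]_n.
Variables (K1 K2 : set V) (X1 X2 : V -> V).
Hypotheses (sK1 : strictly_convex_smooth K1) (sK2 : strictly_convex_smooth K2).
Hypotheses (bK1 : body K1 X1) (bK2 : body K2 X2).
Hypothesis K0 : minkowski_diff K1 K2 !=set0.
Local Notation bK := (body_diff bK1 bK2).
Local Notation latdist := (latdist (2 * pi) bK K0).
Local Notation term := (term (2 * pi) bK K0).
Local Notation phi := (lattice_geodesic bK1 bK2 K0).
Variable s : R[i].
Local Notation a := (complex.Re s).
Local Notation t := (complex.Im s).

Lemma zeta_term_lattice k : zeta_term s (phi k) =
  (ec a t (ln (latdist k)) +i* - es a t (ln (latdist k)))%C.
Proof. exact: inv_cpower. Qed.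

Hypotheses (sc : abs_summable (term (ec a t))) (ss : abs_summable (term (es a t))).

Lemma zeta_abs_convergent : zeta_Conv_abs_convergent K1 K2 s.
Proof.
rewrite /zeta_Conv_abs_convergent /summable.
rewrite (reindex_esum _ _ _ _ (lattice_geodesic_bij sK1 sK2 bK1 bK2 K0)).
apply: (@le_lt_trans _ _ (\esum_(k in [set: 'rV[int]_n]) (`|term (ec a t) k|%:E + `|term (es a t) k|%:E))%E).
  rewrite esum_mkcond; apply: le_esum => k _; case: ifPn => [|_]; last by rewrite -EFinD lee_fin addr_ge0.
  move=> /set_mem k0; rewrite -EFinD lee_fin /term (k0 : 0 < latdist k).
  have := norm_csize (ec a t (ln (latdist k)) +i* - es a t (ln (latdist k)))%C.
  rewrite /csize /= normrN => h; apply: (le_trans _ (_ : complex.Re `|zeta_term s (phi k)| <= _)).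
    by rewrite normc_def /= ger0_norm ?sqrtr_ge0.
  by rewrite zeta_term_lattice; move: h; rewrite normc_def lecR.
rewrite esumD; [exact: lte_add_pinfty| |]; by move=> k _; rewrite lee_fin.
Qed.

Lemma zeta_value : zeta_Conv K1 K2 s = (ssum (term (ec a t)) +i* - ssum (term (es a t)))%C.
Proof.
pose uc (g : curve R n) : R := if g \in orthogeodesics K1 K2 then complex.Re (zeta_term s g) else 0.
(* The sign matches [es], which is minus the imaginary part. *)
pose us (g : curve R n) : R := if g \in orthogeodesics K1 K2 then - complex.Im (zeta_term s g) else 0.
have bij := lattice_geodesic_bij sK1 sK2 bK1 bK2 K0.
have u0 f (g : curve R n) : ~ orthogeodesics K1 K2 g -> (if g \in orthogeodesics K1 K2 then f g else 0) = 0 :> R.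
  by move=> ng; rewrite memNset.
have inO k : 0 < latdist k -> phi k \in orthogeodesics K1 K2.
  by move=> k0; apply/mem_set; have [+ _ _] := bij; apply.
have Ec : (fun k => if k \in [set k | 0 < latdist k] then uc (phi k) else 0) = term (ec a t).
  apply/funext => k; rewrite /term; case: ifPn => [/set_mem|/negP nk]; last by case: ifPn => // k0; case: nk; exact/mem_set.
  move=> k0; rewrite (k0 : 0 < latdist k).
  by rewrite /uc inO // zeta_term_lattice.
have Es : (fun k => if k \in [set k | 0 < latdist k] then us (phi k) else 0) = term (es a t).
  apply/funext => k; rewrite /term; case: ifPn => [/set_mem|/negP nk]; last by case: ifPn => // k0; case: nk; exact/mem_set.
  move=> k0; rewrite (k0 : 0 < latdist k).
  by rewrite /us inO // zeta_term_lattice /= opprK.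
have sc' : abs_summable uc by apply: (abs_summable_reindex bij); [exact: u0|rewrite Ec].
have ss' : abs_summable us by apply: (abs_summable_reindex bij); [exact: u0|rewrite Es].
have Vc : ssum uc = ssum (term (ec a t)) by rewrite (ssum_reindex bij) ?Ec //; exact: u0.
have Vs : ssum us = ssum (term (es a t)) by rewrite (ssum_reindex bij) ?Es //; exact: u0.
have Fs := @summability.totally_filter (curve R n).
have h0 := cvg_complex Fs (ssum_cvg sc') (cvgN (ssum_cvg ss')).
move: h0; rewrite Vc Vs => h; rewrite /zeta_Conv /summability.sum.
apply: (@cvg_lim (R[i]^o) (@norm_hausdorff _ _)).
have E A : (summability.partial_sum uc A +i* - summability.partial_sum us A)%C =
    summability.partial_sum (fun g : curve R n =>
      (if g \in orthogeodesics K1 K2 then zeta_term s g else 0) : R[i]^o) A.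
  rewrite !partial_sumE -sumrN -sum_complex; apply: eq_bigr => g _.
  rewrite /uc /us; case: ifPn => _; last by rewrite oppr0.
  by rewrite opprK; case: (zeta_term s g).
apply: cvg_trans (h _); apply: near_eq_cvg; apply: nearW => A; exact: E.
Qed.

End Zeta.

Lemma real_complexM (R : realType) (a x y : R) :
  (a%:C * (x +i* y) = (a * x) +i* (a * y))%C.
Proof. by apply/eqP; rewrite eq_complex /= !mul0r subr0 addr0 !eqxx. Qed.

(** The factor l of the residue cancels the denominator left by integrating t^(l - 1) in the tube
    volume; the shift l = k + 1 is that of the shell coefficients. *)
Lemma polar_part (R : realType) (n : nat) (d : nat -> R) (V : nat -> R) (c : R) (s : R[i]) :
  (forall k, (k < n)%N -> V (n - k.+1)%N * ball_volume R k.+1 = d k / k.+1%:R) ->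
  1 / (c ^+ n)%:C%C * \sum_(1 <= l < n.+1) (pi `^ (l%:R / 2) * l%:R / Gamma (l%:R / 2 + 1))%:C%C *
      ((V (n - l)%N)%:C%C / (s - l%:R)) =
  ((c ^- n * \sum_(k < n) d k * ((complex.Re s - k.+1%:R) /
      ((complex.Re s - k.+1%:R) ^+ 2 + complex.Im s ^+ 2))) +i*
   - (c ^- n * \sum_(k < n) d k * (complex.Im s /
      ((complex.Re s - k.+1%:R) ^+ 2 + complex.Im s ^+ 2))))%C.
Proof.
move=> hV; rewrite div1r -fmorphV /= big_add1 /= big_mkord.
rewrite -[in RHS]mulrN -sumrN -real_complexM -sum_complex; congr (_ * _).
apply: eq_bigr => -[k kn] _ /=; rewrite -mulrN -real_complexM -invc_formula mulrA -rmorphM /=.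
congr (_%:C%C * _^-1).
  rewrite -[RHS](@divfK _ k.+1%:R) ?pnatr_eq0 // -hV // /ball_volume; ring.
by case: s => a t; rewrite -(rmorph_nat (@real_complex R)) /real_complex_def; simpc.
Qed.

Theorem theorem2p3 (R : realType) (d : nat) (K1 K2 : set 'rV[R]_d) :
  (2 <= d)%N ->
  strictly_convex_smooth K1 ->
  strictly_convex_smooth K2 ->
  (forall s : R[i], d%:R < complex.Re s -> zeta_Conv_abs_convergent K1 K2 s) /\
  exists F : R[i] -> R[i],
    entire F /\
    forall s : R[i], d%:R < complex.Re s ->
      F s = zeta_Conv K1 K2 s
        - 1 / ((2 * pi) ^+ d)%:C%C *
          \sum_(1 <= l < d.+1)
            (pi `^ (l%:R / 2) * l%:R / Gamma (l%:R / 2 + 1))%:C%C *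
            ((intrinsic_volume (minkowski_diff K1 K2) (d - l)%N)%:C%C
               / (s - l%:R)).
Proof.
move=> d2 sK1 sK2.
have [X1 bK1] := exists_body sK1; have [X2 bK2] := exists_body sK2.
(* In a nonzero direction the support maps provide points of K1 and K2, so that K1 - K2 is
   nonempty. *)
have [p p0] : exists p : 'rV[R]_d, p != 0.
  exists (const_mx 1); case: d d2 {K1 K2 sK1 sK2 X1 bK1 X2 bK2} => // d _.
  by apply/eqP => /rowP/(_ ord0)/eqP; rewrite !mxE oner_eq0.
have K0 : minkowski_diff K1 K2 !=set0.
  exists (X1 p - X2 p), (X1 p), (X2 p); split=> //.
    exact: (sm_in (body_support bK1)).
  exact: (sm_in (body_support bK2)).
have c0 : 0 < 2 * pi :> R by rewrite mulr_gt0 // pi_gt0.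
have [v hv] := shell_formula (body_diff bK1 bK2) K0.
split=> [s ds|].
  by have [sc ss _ _] := continuation_value c0 hv (complex.Im s) ds; exact: zeta_abs_convergent sc ss.
exists (continuation (2 * pi) (body_diff bK1 bK2) K0); split=> [|s ds].
  exact: continuation_entire.
have [sc ss Ec Es] := continuation_value c0 hv (complex.Im s) ds.
rewrite (zeta_value sK1 sK2 sc ss) (polar_part (2 * pi) s (steiner_coefficients (@tube_volume _ _ _ _ _ _ _ hv))).
rewrite /continuation Ec Es; apply/eqP; rewrite eq_complex /=.
by rewrite eqxx opprB opprK addrC eqxx.
Qed.
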